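(* Fix an integer $d>2$. Let $\begin{pmatrix} r_{-1}\\ r_0\end{pmatrix}\in\mathbb{Z}_{>0}^2$ and $\begin{pmatrix} d_{-1}\\ d_0\end{pmatrix}\in\mathbb{Z}^2$ be relatively prime vectors (i.e. $\gcd(r_{-1},d_{-1})=\gcd(r_0,d_0)=1$) such that $d\,r_{-1}r_0-r_{-1}^2-r_0^2=d-2$ and $d=\begin{vmatrix} r_{-1}&d_{-1}\\ r_0&d_0\end{vmatrix}$. Then $$\begin{pmatrix} r_{-1}\\ r_0\end{pmatrix}=\begin{pmatrix}0&1\\-1&d\end{pmatrix}^n\begin{pmatrix}1\\1\end{pmatrix}\quad\text{for some } n\in\mathbb{Z}.$$ In particular, all two-periodic elliptic helices over $X$ with $d$-dimensional consecutive Hom spaces and with negative limit slope $\theta\in\mathbb{Q}-\frac{d}{2(d-2)}\sqrt{d^2-4}$ are in the same numerical class.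
   Context: $k$ is an algebraically closed field of characteristic zero and $X$ a smooth elliptic curve over $k$. An object $\mathcal{E}$ of $\mathsf{Coh}\,X$ is elliptically exceptional if $\operatorname{Ext}^j(\mathcal{E},\mathcal{E})\cong k$ for $j=0,1$ and is zero otherwise, and for every $\mathcal{F}\in\mathsf{Coh}\,X$ the natural pairing $\operatorname{Hom}(\mathcal{E},\mathcal{F})\otimes\operatorname{Ext}^1(\mathcal{F},\mathcal{E})\to\operatorname{Ext}^1(\mathcal{E},\mathcal{E})=k$ is non-degenerate. $\mathcal{F}$ left mutates through $\mathcal{E}$ if $\operatorname{Ext}^j(\mathcal{E},\mathcal{F})=0$ for $j\neq0$ and the evaluation map $\operatorname{Hom}(\mathcal{E},\mathcal{F})\otimes_k\mathcal{E}\to\mathcal{F}$ is surjective; its kernel is the left mutation. A two-periodic elliptic helix is a sequence $\underline{\mathcal{E}}=(\mathcal{E}_i)_{i\in\mathbb{Z}}$ of elliptically exceptional objects of $\mathsf{Coh}\,X$ such that $\operatorname{Ext}^1(\mathcal{E}_i,\mathcal{E}_j)=0$ for all $i<j$, and for all $i$, $\mathcal{E}_i$ left mutates through $\mathcal{E}_{i-1}$ with left mutation isomorphic to $\mathcal{E}_{i-2}$. All terms are simple vector bundles, and $\dim\operatorname{Hom}(\mathcal{E}_i,\mathcal{E}_{i+1})$ is independent of $i$; ''$d$-dimensional consecutive Hom spaces'' means this dimension is $d$. The negative limit slope is $\lim_{n\to-\infty}\deg\mathcal{E}_n/\operatorname{rank}\mathcal{E}_n$. Numerical classes: the twist of $\underline{\mathcal{E}}$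 by a line bundle $\mathcal{L}$ on $X$ is $(\mathcal{L}\otimes\mathcal{E}_i)_i$; the shift by $m\in\mathbb{Z}$ is $(\mathcal{E}_{i+m})_i$. Helices $\underline{\mathcal{E}},\underline{\mathcal{F}}$ are numerically equal if $\operatorname{rank}\mathcal{E}_i=\operatorname{rank}\mathcal{F}_i$ and $\deg\mathcal{E}_i=\deg\mathcal{F}_i$ for all $i$, and are in the same numerical class if they are numerically equal after shifting and twisting. *)

(* Defs.v *)
From HB Require Import structures.
From mathcomp Require Import all_boot all_order all_algebra.
From mathcomp Require Import all_classical all_reals all_analysis.

Set Implicit Arguments.
Unset Strict Implicit.
Unset Printing Implicit Defensive.

Import Order.TTheory GRing.Theory Num.Theory.
Import numFieldNormedType.Exports.

Local Open Scope classical_set_scope.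
Local Open Scope ring_scope.

Definition mx2 (a b c e : int) : 'M[int]_2 :=
  \matrix_(i < 2, j < 2)
    if i == 0 then (if j == 0 then a else b) else (if j == 0 then c else e).

Definition col2 (a b : int) : 'cV[int]_2 :=
  \col_(i < 2) if i == 0 then a else b.

(* The elliptic curve X: the smooth plane cubic y^2 = x^3 + a x + b together   *)
(* with its point at infinity, given by its function field K = k(x, y).       *)
(* In characteristic zero every elliptic curve is isomorphic to such a cubic. *)

Record elliptic_curve (k : closedFieldType) := EllipticCurve {
  wa : k;
  wb : k;
  w_smooth : wa ^+ 3 *+ 4 + wb ^+ 2 *+ 27 != 0;
  ffield : fieldType;
  fconst : {rmorphism k -> ffield};
  fx : ffield;
  fy : ffield;
  w_eq : fy ^+ 2 = fx ^+ 3 + fconst wa * fx + fconst wb;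
  fx_transcendental : forall p : {poly k}, (map_poly fconst p).[fx] = 0 -> p = 0;
  ffield_gen : forall z : ffield, exists p q r : {poly k}, r != 0 /\
    z = ((map_poly fconst p).[fx] + (map_poly fconst q).[fx] * fy)
        / (map_poly fconst r).[fx]
}.

Inductive point (k : closedFieldType) (X : elliptic_curve k) :=
| Infinity
| Affine (x0 y0 : k) of y0 ^+ 2 = x0 ^+ 3 + wa X * x0 + wb X.

Arguments Infinity {k X}.

(* P(u, v), where P is a polynomial in the second variable v whose            *)
(* coefficients are polynomials in the first variable u.                      *)
Definition eval2 (R : comNzRingType) (P : {poly {poly R}}) (u v : R) : R :=
  P.[v%:P].[u].

Section LocalRings.
Variables (k : closedFieldType) (X : elliptic_curve k).
Notation K := (ffield X).

(* The rational functions regular at (u0, v0) in an affine chart with         *)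
(* coordinate functions u and v.                                              *)
Definition chart_regular (u v : K) (u0 v0 : k) (f : K) : Prop :=
  exists P Q : {poly {poly k}},
    [/\ eval2 Q u0 v0 != 0,
        eval2 (map_poly (map_poly (fconst X)) Q) u v != 0 &
        f = eval2 (map_poly (map_poly (fconst X)) P) u v
            / eval2 (map_poly (map_poly (fconst X)) Q) u v].

(* In the chart (x : 1 : z) of the projective plane the point at infinity     *)
(* (0 : 1 : 0) is the origin, and the coordinates are x / y and 1 / y.        *)
Definition regular_at (p : point X) (f : K) : Prop :=
  match p with
  | Infinity => chart_regular (fx X / fy X) (fy X)^-1 0 0 f
  | Affine x0 y0 _ => chart_regular (fx X) (fy X) x0 y0 f
  end.

(* For f regular at p: f does not vanish at p.                                *)
Definition unit_at (p : point X) (f : K) : Prop := f != 0 /\ regular_at p f^-1.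

Lemma chart_regular_const u v u0 v0 (c : k) :
  chart_regular u v u0 v0 (fconst X c).
Proof.
exists c%:P%:P, 1; rewrite /eval2 !map_polyC /= !map_polyC /= !rmorph1.
by rewrite !hornerC !oner_neq0 divr1.
Qed.

Lemma chart_regularB u v u0 v0 f g :
  chart_regular u v u0 v0 f -> chart_regular u v u0 v0 g ->
  chart_regular u v u0 v0 (f - g).
Proof.
move=> [P [Q [Q0 Qn ->]]] [P' [Q' [Q0' Qn' ->]]].
exists (P * Q' - P' * Q), (Q * Q').
move: Q0 Qn Q0' Qn'; rewrite /eval2 !rmorphB !rmorphM !(hornerM, hornerD, hornerN) => Q0 Qn Q0' Qn'.
split; [by rewrite mulf_neq0 | by rewrite mulf_neq0 |].
by rewrite -mulNr addf_div // mulNr.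
Qed.

Lemma chart_regularM u v u0 v0 f g :
  chart_regular u v u0 v0 f -> chart_regular u v u0 v0 g ->
  chart_regular u v u0 v0 (f * g).
Proof.
move=> [P [Q [Q0 Qn ->]]] [P' [Q' [Q0' Qn' ->]]].
exists (P * P'), (Q * Q').
move: Q0 Qn Q0' Qn'; rewrite /eval2 !rmorphM !hornerM => Q0 Qn Q0' Qn'.
split; [by rewrite mulf_neq0 | by rewrite mulf_neq0 |].
by rewrite mulf_div.
Qed.

Lemma regular_at_const p (c : k) : regular_at p (fconst X c).
Proof. by case: p => [|x0 y0 e]; exact: chart_regular_const. Qed.

Lemma regular_atB p f g :
  regular_at p f -> regular_at p g -> regular_at p (f - g).
Proof. by case: p => [|x0 y0 e]; exact: chart_regularB. Qed.

Lemma regular_atM p f g :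
  regular_at p f -> regular_at p g -> regular_at p (f * g).
Proof. by case: p => [|x0 y0 e]; exact: chart_regularM. Qed.

(* The nonempty open subsets of X are the complements of finite sets; those   *)
(* different from X are exactly the nonempty affine open subsets.             *)
Record aopen := AOpen {
  aset :> set (point X);
  asetP : finite_set (~` aset) /\ ~` aset !=set0
}.

Definition regular_on (U : aopen) : {pred K} :=
  fun f => `[< forall p, aset U p -> regular_at p f >].

Lemma regular_onP (U : aopen) (f : K) :
  reflect (forall p, aset U p -> regular_at p f) (f \in regular_on U).
Proof. exact: asboolP. Qed.

Lemma regular_on_subring (U : aopen) : subring_closed (regular_on U).
Proof.
split=> [|f g /regular_onP hf /regular_onP hg|f g /regular_onP hf /regular_onP hg].
- by apply/regular_onP => p _; rewrite -(rmorph1 (fconst X)); exact: regular_at_const.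
- by apply/regular_onP => p Up; apply: regular_atB; [exact: hf | exact: hg].
- by apply/regular_onP => p Up; apply: regular_atM; [exact: hf | exact: hg].
Qed.

HB.instance Definition _ (U : aopen) :=
  GRing.isSubringClosed.Build K (regular_on U) (regular_on_subring U).

(* O_X(U) *)
Record regfun (U : aopen) :=
  RegFun { regval :> K; regvalP : regval \in regular_on U }.

HB.instance Definition _ (U : aopen) := [isSub for @regval U].
HB.instance Definition _ (U : aopen) := [Choice of regfun U by <:].
HB.instance Definition _ (U : aopen) :=
  [SubChoice_isSubComNzRing of regfun U by <:].

Lemma regular_on_sub (U V : aopen) (sVU : V `<=` U) (f : regfun U) :
  regval f \in regular_on V.
Proof.
by apply/regular_onP => p Vp; move/regular_onP: (regvalP f); apply; exact: sVU.
Qed.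

Definition regres (U V : aopen) (sVU : V `<=` U) (f : regfun U) : regfun V :=
  RegFun (regular_on_sub sVU f).

Lemma regular_on_const (U : aopen) (c : k) : fconst X c \in regular_on U.
Proof. by apply/regular_onP => p _; exact: regular_at_const. Qed.

Definition regconst (U : aopen) (c : k) : regfun U :=
  RegFun (regular_on_const U c).

Definition distinguished (U V : aopen) (f : regfun U) : Prop :=
  forall p, aset V p <-> aset U p /\ unit_at p (regval f).

End LocalRings.

Section CoherentSheaves.
Variables (k : closedFieldType) (X : elliptic_curve k).

(* A coherent sheaf is given by its sections over the affine open subsets     *)
(* (a sheaf on the base of affine opens): finitely generated modules with     *)
(* restriction maps, such that the sections over D(f), for f in O_X(U), are   *)
(* the localization at f of the sections over U.                              *)
Record coh := Coh {
  sec :> forall U : aopen X, lmodType (regfun U);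
  res : forall U V : aopen X, V `<=` U -> sec U -> sec V;
  res_linear : forall (U V : aopen X) (sVU : V `<=` U) (a : regfun U)
      (s t : sec U),
    res sVU (a *: s + t) = regres sVU a *: res sVU s + res sVU t;
  res_id : forall (U : aopen X) (sUU : U `<=` U) (s : sec U), res sUU s = s;
  res_comp : forall (U V W : aopen X) (sVU : V `<=` U) (sWV : W `<=` V)
      (sWU : W `<=` U) (s : sec U),
    res sWV (res sVU s) = res sWU s;
  sec_fg : forall U : aopen X, exists (n : nat) (g : 'I_n -> sec U),
    forall s : sec U, exists c : 'I_n -> regfun U, s = \sum_(i < n) c i *: g i;
  sec_loc_ker : forall (U V : aopen X) (sVU : V `<=` U) (f : regfun U),
    distinguished V f -> forall s : sec U, res sVU s = 0 ->
    exists n : nat, f ^+ n *: s = 0;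
  sec_loc_im : forall (U V : aopen X) (sVU : V `<=` U) (f : regfun U),
    distinguished V f -> forall t : sec V,
    exists (n : nat) (s : sec U), regres sVU f ^+ n *: t = res sVU s
}.

Record coh_hom (E F : coh) := CohHom {
  hmap : forall U : aopen X, {linear E U -> F U};
  hmap_res : forall (U V : aopen X) (sVU : V `<=` U) (s : E U),
    hmap V (res sVU s) = res sVU (hmap U s)
}.

Definition hom_nz (E F : coh) (f : coh_hom E F) : Prop :=
  exists (U : aopen X) (s : E U), hmap f U s != 0.

Definition hom_basis (E F : coh) (n : nat) (f : 'I_n -> coh_hom E F) : Prop :=
  forall g : coh_hom E F, exists! c : 'rV[k]_n, forall (U : aopen X) (s : E U),
    hmap g U s = \sum_(i < n) regconst U (c 0 i) *: hmap (f i) U s.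

(* dim_k Hom(E, F) = n *)
Definition hom_dim (E F : coh) (n : nat) : Prop :=
  exists f : 'I_n -> coh_hom E F, hom_basis f.

(* Exactness of coherent sheaves is exactness of sections over affine opens.  *)
Definition short_exact (B M A : coh) (i : coh_hom B M) (p : coh_hom M A) : Prop :=
  forall U : aopen X,
    [/\ injective (hmap i U),
        forall s : A U, exists m : M U, hmap p U m = s &
        forall m : M U, hmap p U m = 0 <-> exists b : B U, hmap i U b = m].

(* 0 -> B -> mid -> A -> 0, representing a class of Ext^1(A, B) *)
Record extension (A B : coh) := Extension {
  emid : coh;
  einj : coh_hom B emid;
  eprj : coh_hom emid A;
  e_exact : short_exact einj eprj
}.

Definition ext_mor (A B A' B' : coh) (e : extension A B) (e' : extension A' B')
    (alpha : coh_hom A A') (beta : coh_hom B B') : Prop :=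
  exists m : coh_hom (emid e) (emid e'),
    (forall (U : aopen X) (b : B U),
       hmap m U (hmap (einj e) U b) = hmap (einj e') U (hmap beta U b)) /\
    (forall (U : aopen X) (s : emid e U),
       hmap (eprj e') U (hmap m U s) = hmap alpha U (hmap (eprj e) U s)).

Definition is_scal (E : coh) (c : k) (f : coh_hom E E) : Prop :=
  forall (U : aopen X) (s : E U), hmap f U s = regconst U c *: s.

Definition is_id (E : coh) (f : coh_hom E E) : Prop := is_scal 1 f.

Definition ext_equiv (A B : coh) (e e' : extension A B) : Prop :=
  exists (a : coh_hom A A) (b : coh_hom B B), [/\ is_id a, is_id b & ext_mor e e' a b].

Definition ext_split (A B : coh) (e : extension A B) : Prop :=
  exists s : coh_hom A (emid e), forall (U : aopen X) (a : A U),
    hmap (eprj e) U (hmap s U a) = a.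

(* The class of e' is c times that of e: e' is the pushout of e along c.      *)
Definition ext_scal (A B : coh) (c : k) (e e' : extension A B) : Prop :=
  exists (a : coh_hom A A) (b : coh_hom B B), [/\ is_id a, is_scal c b & ext_mor e e' a b].

(* The class of e is the Baer sum of those of e1 and e2: mu is a morphism     *)
(* from the extension of A by B + B with middle term the fibre product of     *)
(* the middle terms of e1 and e2 over A, to e, inducing the sum map B + B ->  *)
(* B and the identity of A.                                                   *)
Definition baer_sum (A B : coh) (e1 e2 e : extension A B) : Prop :=
  exists mu : forall U : aopen X, emid e1 U -> emid e2 U -> emid e U,
    [/\ forall (U : aopen X) (c : regfun U) (m1 n1 : emid e1 U)
          (m2 n2 : emid e2 U),
          hmap (eprj e1) U m1 = hmap (eprj e2) U m2 ->
          hmap (eprj e1) U n1 = hmap (eprj e2) U n2 ->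
          mu U (c *: m1 + n1) (c *: m2 + n2) = c *: mu U m1 m2 + mu U n1 n2,
        forall (U V : aopen X) (sVU : V `<=` U) (m1 : emid e1 U)
          (m2 : emid e2 U),
          hmap (eprj e1) U m1 = hmap (eprj e2) U m2 ->
          mu V (res sVU m1) (res sVU m2) = res sVU (mu U m1 m2),
        forall (U : aopen X) (b1 b2 : B U),
          mu U (hmap (einj e1) U b1) (hmap (einj e2) U b2)
          = hmap (einj e) U (b1 + b2) &
        forall (U : aopen X) (m1 : emid e1 U) (m2 : emid e2 U),
          hmap (eprj e1) U m1 = hmap (eprj e2) U m2 ->
          hmap (eprj e) U (mu U m1 m2) = hmap (eprj e1) U m1].

(* Ext^1(A, B) is isomorphic to k^n: cl induces an isomorphism to k^n from    *)
(* the k-vector space of equivalence classes of extensions.                   *)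
Definition ext1_dim (A B : coh) (n : nat) : Prop :=
  exists cl : extension A B -> 'rV[k]_n,
    [/\ forall v, exists e, cl e = v,
        forall e e', cl e = cl e' <-> ext_equiv e e',
        forall c e e', ext_scal c e e' -> cl e' = c *: cl e &
        forall e1 e2 e, baer_sum e1 e2 e -> cl e = cl e1 + cl e2].

(* Yoneda n-extensions of A by B, for n > 0, written as splices of short      *)
(* exact sequences.                                                           *)
Inductive yext : nat -> coh -> coh -> Type :=
| Yone A B of extension A B : yext 1 A B
| Ysplice n A C B of extension A C & yext n C B : yext n.+1 A B.

Inductive yext_mor : forall (n : nat) (A B A' B' : coh),
    yext n A B -> yext n A' B' -> coh_hom A A' -> coh_hom B B' -> Prop :=
| Ymor_one A B A' B' (e : extension A B) (e' : extension A' B') alpha beta :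
    ext_mor e e' alpha beta -> yext_mor (Yone e) (Yone e') alpha beta
| Ymor_splice n A C B A' C' B' (e : extension A C) (e' : extension A' C')
    (y : yext n C B) (y' : yext n C' B') alpha gamma beta :
    ext_mor e e' alpha gamma -> yext_mor y y' gamma beta ->
    yext_mor (Ysplice e y) (Ysplice e' y') alpha beta.

Inductive yext_equiv (n : nat) (A B : coh) : yext n A B -> yext n A B -> Prop :=
| Yequiv_mor y y' a b :
    is_id a -> is_id b -> yext_mor y y' a b -> yext_equiv y y'
| Yequiv_refl y : yext_equiv y y
| Yequiv_sym y y' : yext_equiv y y' -> yext_equiv y' y
| Yequiv_trans y y' y'' :
    yext_equiv y y' -> yext_equiv y' y'' -> yext_equiv y y''.

(* The short exact sequence ending in A splits; such n-extensions represent   *)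
(* the zero class, and zero has such a representative.                        *)
Definition yext_zero (n : nat) (A B : coh) (y : yext n A B) : Prop :=
  match y with
  | Yone _ _ e => ext_split e
  | Ysplice _ _ _ _ e _ => ext_split e
  end.

(* Ext^n(A, B) = 0, for n > 0 *)
Definition ext_vanish (n : nat) (A B : coh) : Prop :=
  forall y : yext n A B, exists y' : yext n A B, yext_equiv y y' /\ yext_zero y'.

(* e' represents the image of f in Hom(E, F) and e in Ext^1(F, E) under the   *)
(* composition pairing with values in Ext^1(E, E).                            *)
Definition ext_pullback (E F : coh) (f : coh_hom E F) (e : extension F E)
    (e' : extension E E) : Prop :=
  exists b : coh_hom E E, is_id b /\ ext_mor e' e f b.

Definition elliptically_exceptional (E : coh) : Prop :=
  [/\ hom_dim E E 1,
      ext1_dim E E 1,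
      forall n : nat, (2 <= n)%N -> ext_vanish n E E &
      forall F : coh,
        (forall f : coh_hom E F, hom_nz f ->
           exists (e : extension F E) (e' : extension E E),
             ext_pullback f e e' /\ ~ ext_split e') /\
        (forall e : extension F E, ~ ext_split e ->
           exists (f : coh_hom E F) (e' : extension E E),
             ext_pullback f e e' /\ ~ ext_split e')].

(* A basis f of Hom(E, F) identifies the tensor product of Hom(E, F) and E    *)
(* over k with E^n, and the evaluation map with the following one.            *)
Definition ev_map (E F : coh) (n : nat) (f : 'I_n -> coh_hom E F) (U : aopen X)
    (s : {ffun 'I_n -> E U}) : F U :=
  \sum_(i < n) hmap (f i) U (s i).

Definition ev_surjective (E F : coh) (n : nat) (f : 'I_n -> coh_hom E F) : Prop :=
  forall (U : aopen X) (t : F U), exists s : {ffun 'I_n -> E U}, ev_map f s = t.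

(* F left mutates through E *)
Definition left_mutates (E F : coh) : Prop :=
  (forall n : nat, (0 < n)%N -> ext_vanish n E F) /\
  (exists (n : nat) (f : 'I_n -> coh_hom E F), hom_basis f /\ ev_surjective f).

(* G is isomorphic to the kernel of the evaluation map *)
Definition is_left_mutation (E F G : coh) : Prop :=
  exists (n : nat) (f : 'I_n -> coh_hom E F)
    (j : forall U : aopen X, {linear G U -> {ffun 'I_n -> E U}}),
    [/\ hom_basis f,
        forall (U V : aopen X) (sVU : V `<=` U) (g : G U) (i : 'I_n),
          j V (res sVU g) i = res sVU (j U g i),
        forall U : aopen X, injective (j U) &
        forall (U : aopen X) (s : {ffun 'I_n -> E U}),
          ev_map f s = 0 <-> exists g : G U, j U g = s].

Definition two_periodic_elliptic_helix (E : int -> coh) : Prop :=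
  [/\ forall i, elliptically_exceptional (E i),
      forall i j, i < j -> ext_vanish 1 (E i) (E j) &
      forall i, left_mutates (E (i - 1)) (E i) /\
                is_left_mutation (E (i - 1)) (E i) (E (i - 2))].

(* dimension at the generic point *)
Definition is_rank (E : coh) (r : nat) : Prop :=
  exists (U : aopen X) (s : 'I_r -> E U),
    (forall c : 'I_r -> regfun U,
       \sum_(i < r) c i *: s i = 0 -> forall i, c i = 0) /\
    (forall t : E U, exists (a : regfun U) (c : 'I_r -> regfun U),
       a != 0 /\ a *: t = \sum_(i < r) c i *: s i).

Definition coh_rank (E : coh) : nat := xget 0%N [set r | is_rank E r].

(* E is isomorphic to O_X *)
Definition is_structure_sheaf (E : coh) : Prop :=
  exists e : forall U : aopen X, E U,
    (forall (U V : aopen X) (sVU : V `<=` U), res sVU (e U) = e V) /\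
    (forall (U : aopen X) (s : E U), exists! a : regfun U, s = a *: e U).

(* E is isomorphic to the skyscraper sheaf k(p) *)
Definition is_skyscraper (p : point X) (E : coh) : Prop :=
  forall U : aopen X,
    (~ aset U p -> forall s : E U, s = 0) /\
    (aset U p -> exists e : E U, forall s : E U,
       exists! c : k, s = regconst U c *: e).

(* The degree of coherent sheaves on a curve is the unique additive function  *)
(* with these two values; the sequences O(D) -> O(D + p) -> k(p) then give    *)
(* deg O(D) = deg D, and torsion sheaves have degree equal to their length.   *)
Definition is_degree (dg : coh -> int) : Prop :=
  [/\ forall E, is_structure_sheaf E -> dg E = 0,
      forall p E, is_skyscraper p E -> dg E = 1 &
      forall (B M A : coh) (i : coh_hom B M) (q : coh_hom M A),
        short_exact i q -> dg M = dg B + dg A].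

Definition coh_degree : coh -> int :=
  if pselect (exists dg, is_degree dg) is left h then projT1 (cid h)
  else fun=> 0.

Definition line_bundle (L : coh) : Prop :=
  forall p : point X, exists (U : aopen X) (e : L U),
    aset U p /\ forall s : L U, exists! a : regfun U, s = a *: e.

Definition bilinear_map (R : comNzRingType) (M N P : lmodType R)
    (b : M -> N -> P) : Prop :=
  (forall y, linear (fun x => b x y)) /\ (forall x, linear (b x)).

(* T is the tensor product of L and E over O_X *)
Definition is_tensor (L E T : coh) : Prop :=
  exists b : forall U : aopen X, L U -> E U -> T U,
    [/\ forall U, bilinear_map (b U),
        forall (U V : aopen X) (sVU : V `<=` U) (l : L U) (s : E U),
          b V (res sVU l) (res sVU s) = res sVU (b U l s) &
        forall (U : aopen X) (N : lmodType (regfun U)) (c : L U -> E U -> N),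
          bilinear_map c ->
          exists! phi : T U -> N,
            linear phi /\ forall l s, phi (b U l s) = c l s].

Definition numerically_equal (E F : int -> coh) : Prop :=
  forall i, coh_rank (E i) = coh_rank (F i) /\ coh_degree (E i) = coh_degree (F i).

Definition same_numerical_class (E F : int -> coh) : Prop :=
  exists (m : int) (L : coh) (T : int -> coh),
    [/\ line_bundle L,
        forall i, is_tensor L (E (i + m)) (T i) &
        numerically_equal T F].

Definition slope (R : realType) (E : coh) : R := (coh_degree E)%:~R / (coh_rank E)%:R.

(* theta is the limit of the slopes of E_n as n tends to -oo *)
Definition negative_limit_slope (R : realType) (E : int -> coh) (theta : R)
    : Prop :=
  (fun n : nat => slope R (E (- n%:Z))) @ \oo --> theta.

End CoherentSheaves.

(* Main.v *)
From HB Require Import structures.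
From mathcomp Require Import all_boot all_order all_algebra.
From mathcomp Require Import all_classical all_reals all_analysis.
From mathcomp Require Import ring lra zify.
Require Import Defs.

Set Implicit Arguments.
Unset Strict Implicit.
Unset Printing Implicit Defensive.

Import Order.TTheory GRing.Theory Num.Theory.

Local Open Scope classical_set_scope.
Local Open Scope ring_scope.

(** The equation d x y - x ^ 2 - y ^ 2 = d - 2 is quadratic in each unknown, so a
    solution can be changed by replacing x or y by the other root; this is the
    action of the matrix and of its inverse, and descent along it ends at (1, 1)
    (lemmas descent and orbit).

    For a helix, let r i and e i be the ranks and degrees of the terms. The terms
    are simple and not torsion, hence torsion free (end_torsion_free): a nonzero
    torsion section would give an endomorphism with image in a skyscraper sheaf.
    A torsion free sheaf is given by a lattice in K ^ n at each point, K being the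
    function field (coh_structure, torsion_free_iso), and homomorphisms are
    matrices over K that respect the lattices. Riemann-Roch then says that
      dim Hom(E, F) = rank E * deg F - rank F * deg E
    if Ext ^ 1(E, F) vanishes (riemann_roch_ext). To prove it, the vanishing of
    Ext ^ 1 is turned into the solvability of all problems with prescribed
    principal parts (split_glue); under this condition the dimension and the
    right hand side change by the same amount when one lattice is enlarged by a
    step of length one (step_target, step_source), and by such steps every pair
    of bundles is connected with O ^ n and O(infinity) ^ m, where the cohomology is
    computed directly (h0_infinity, h1_infinity). The functions needed come from
    strong approximation (approx), which in turn rests on translations of the
    curve: they provide coordinates with the pole at an arbitrary point.

    The exact sequences 0 -> E_(i - 2) -> E_(i - 1) ^ d -> E_i -> 0 of the mutations
    show that r and e satisfy u (i - 2) = d u (i - 1) - u i, and Riemann-Roch gives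
    r i * e (i + 1) - r (i + 1) * e i = d (helix_data). The slopes e / r converge to
    th as i tends to minus infinity, so the solution e - th r of the recurrence
    has no component along its growing exponential (dominant_vanish). Here th is
    a rational number minus a rational multiple of S, the irrational square root
    of d ^ 2 - 4; comparing coordinates over the basis 1, S one finds that
    d * (d x y - x ^ 2 - y ^ 2) = (d - 2) * d for x = r (- 1) and y = r 0
    (limit_relation). By the first part the ranks (1, 1) occur at two consecutive
    positions. Thus the ranks of two such helices agree after a shift. A twist by
    a multiple of the point at infinity (tensor_twist, dg_twist) makes the degrees
    agree at the first of the two positions; at the second they agree by the
    determinant relation, and everywhere by the recurrence.

    That a degree function exists follows from the irrationality of th: the
    degree is zero by convention otherwise (is_degree_slope). *)

(** * Charts and the function field *)

Section ChartValue.
Variables (k : closedFieldType) (X : elliptic_curve k).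
Notation K := (ffield X).
Notation cst := (fconst X).

Definition ceval (u v : K) (P : {poly {poly k}}) : K :=
  eval2 (map_poly (map_poly cst) P) u v.

Lemma eval2D (R : comNzRingType) (P Q : {poly {poly R}}) u v :
  eval2 (P + Q) u v = eval2 P u v + eval2 Q u v.
Proof. by rewrite /eval2 !hornerD. Qed.

Lemma eval2M (R : comNzRingType) (P Q : {poly {poly R}}) u v :
  eval2 (P * Q) u v = eval2 P u v * eval2 Q u v.
Proof. by rewrite /eval2 !hornerM. Qed.

Lemma eval2N (R : comNzRingType) (P : {poly {poly R}}) u v :
  eval2 (- P) u v = - eval2 P u v.
Proof. by rewrite /eval2 !hornerN. Qed.

Lemma eval2C (R : comNzRingType) (p : {poly R}) u v :
  eval2 p%:P u v = p.[u].
Proof. by rewrite /eval2 hornerC. Qed.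

Lemma eval2X (R : comNzRingType) (u v : R) : eval2 'X u v = v.
Proof. by rewrite /eval2 hornerX hornerC. Qed.

Lemma cevalD u v P Q : ceval u v (P + Q) = ceval u v P + ceval u v Q.
Proof. by rewrite /ceval rmorphD eval2D. Qed.

Lemma cevalM u v P Q : ceval u v (P * Q) = ceval u v P * ceval u v Q.
Proof. by rewrite /ceval rmorphM eval2M. Qed.

Lemma cevalN u v P : ceval u v (- P) = - ceval u v P.
Proof. by rewrite /ceval rmorphN eval2N. Qed.

Lemma cevalC u v p : ceval u v p%:P = (map_poly cst p).[u].
Proof. by rewrite /ceval map_polyC eval2C. Qed.

Lemma cevalX u v : ceval u v 'X = v.
Proof. by rewrite /ceval map_polyX eval2X. Qed.

Variables (u v : K) (u0 v0 : k).

(** Regularity in a chart, with the value of the function at the base point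
    remembered. *)
Definition chart_val (f : K) (c : k) : Prop :=
  exists P Q : {poly {poly k}},
    [/\ eval2 Q u0 v0 != 0, ceval u v Q != 0,
        f = ceval u v P / ceval u v Q & c = eval2 P u0 v0 / eval2 Q u0 v0].

(** Polynomial relations between the coordinate functions persist at the base
    point; this is what makes the value of a regular function well defined. *)
Definition good_chart := forall P, ceval u v P = 0 -> eval2 P u0 v0 = 0.

Lemma chart_val_regular f :
  chart_regular u v u0 v0 f <-> exists c, chart_val f c.
Proof.
split=> [[P [Q [h1 h2 h3]]]|[c [P [Q [h1 h2 h3 _]]]]].
  by exists (eval2 P u0 v0 / eval2 Q u0 v0), P, Q.
by exists P, Q.
Qed.

Lemma eval2_1 (R : comNzRingType) (a b : R) : eval2 1 a b = 1.
Proof. by rewrite /eval2 !hornerC. Qed.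

Lemma ceval1 : ceval u v 1 = 1.
Proof. by rewrite /ceval rmorph1 eval2_1. Qed.

Lemma chart_val_poly P : chart_val (ceval u v P) (eval2 P u0 v0).
Proof. by exists P, 1; rewrite !eval2_1 ceval1 !oner_neq0 !divr1. Qed.

Lemma chart_val_const c : chart_val (cst c) c.
Proof. by have := chart_val_poly c%:P%:P; rewrite cevalC eval2C map_polyC !hornerC. Qed.

Lemma chart_val_u : chart_val u u0.
Proof. by have := chart_val_poly 'X%:P; rewrite cevalC eval2C map_polyX !hornerX. Qed.

Lemma chart_val_v : chart_val v v0.
Proof. by have := chart_val_poly 'X; rewrite cevalX eval2X. Qed.

Lemma chart_valD f g c e : chart_val f c -> chart_val g e -> chart_val (f + g) (c + e).
Proof.
move=> [P [Q [h1 h2 -> ->]]] [P' [Q' [h1' h2' -> ->]]].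
exists (P * Q' + P' * Q), (Q * Q').
by rewrite !(eval2D, eval2M, cevalD, cevalM) !mulf_neq0 // !addf_div.
Qed.

Lemma chart_valM f g c e : chart_val f c -> chart_val g e -> chart_val (f * g) (c * e).
Proof.
move=> [P [Q [h1 h2 -> ->]]] [P' [Q' [h1' h2' -> ->]]].
exists (P * P'), (Q * Q').
by rewrite !(eval2M, cevalM) !mulf_neq0 // !mulf_div.
Qed.

Hypothesis good : good_chart.

Lemma chart_valV f c : c != 0 -> chart_val f c -> chart_val f^-1 c^-1.
Proof.
move=> c0 [P [Q [h1 h2 ef ec]]]; exists Q, P; split.
- by apply: contraNneq c0 => P0; rewrite ec P0 mul0r.
- by apply: contraNneq c0 => /good P0; rewrite ec P0 mul0r.
- by rewrite ef invf_div.
- by rewrite ec invf_div.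
Qed.

Lemma chart_val_uniq f c e : chart_val f c -> chart_val f e -> c = e.
Proof.
move=> [P [Q [h1 h2 -> ->]]] [P' [Q' [h1' h2' ef ->]]].
apply/eqP; rewrite eqr_div // -subr_eq0 -!eval2M -eval2N -eval2D; apply/eqP.
apply: good; rewrite cevalD cevalN !cevalM; apply/eqP; rewrite subr_eq0 -eqr_div //.
exact/eqP.
Qed.
End ChartValue.

Section Weierstrass.
Variables (k : closedFieldType) (X : elliptic_curve k).
Notation K := (ffield X).
Notation cst := (fconst X).
Notation x := (fx X).
Notation y := (fy X).

Definition px (p : {poly k}) : K := (map_poly cst p).[x].
Fact wf_key : unit. Proof. exact: tt. Qed.
(** The cubic polynomial of the Weierstrass equation. *)
Definition wf : {poly k} := locked_with wf_key ('X^3 + wa X *: 'X + (wb X)%:P).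
Lemma wfE : wf = 'X^3 + wa X *: 'X + (wb X)%:P.
Proof. by rewrite /wf unlock. Qed.

Lemma sgt0 (p : {poly k}) : (p != 0) = (0 < size p)%N.
Proof. by rewrite size_poly_gt0. Qed.

Lemma szM (p q : {poly k}) : p != 0 -> q != 0 ->
  size (p * q) = (size p + size q).-1.
Proof. exact: size_mul. Qed.

Lemma pxD p q : px (p + q) = px p + px q.
Proof. by rewrite /px rmorphD hornerD. Qed.
Lemma pxN p : px (- p) = - px p.
Proof. by rewrite /px rmorphN hornerN. Qed.
Lemma pxM p q : px (p * q) = px p * px q.
Proof. by rewrite /px rmorphM hornerM. Qed.
Lemma pxC c : px c%:P = cst c.
Proof. by rewrite /px map_polyC hornerC. Qed.
Lemma pxX : px 'X = x.
Proof. by rewrite /px map_polyX hornerX. Qed.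
Lemma px0 : px 0 = 0. Proof. by rewrite /px rmorph0 horner0. Qed.
Lemma px1 : px 1 = 1. Proof. by rewrite -(rmorph1 polyC) pxC rmorph1. Qed.
Lemma pxXn p n : px (p ^+ n) = px p ^+ n.
Proof. by rewrite /px rmorphXn horner_exp. Qed.
Lemma pxZ c p : px (c *: p) = cst c * px p.
Proof. by rewrite -mul_polyC pxM pxC. Qed.

Lemma px_wf : px wf = y ^+ 2.
Proof. by rewrite wfE !pxD pxZ pxC pxXn pxX w_eq. Qed.

Lemma px_eq0 p : (px p == 0) = (p == 0).
Proof.
apply/eqP/eqP => [|->]; last by rewrite px0.
exact: fx_transcendental.
Qed.

Lemma wf_horner a : wf.[a] = a ^+ 3 + wa X * a + wb X.
Proof. by rewrite wfE !hornerE. Qed.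

Lemma size_wf : size wf = 4%N.
Proof.
rewrite wfE -addrA size_polyDl size_polyXn //.
apply: leq_ltn_trans (size_polyD _ _) _; rewrite gtn_max.
apply/andP; split.
  by apply: leq_ltn_trans (size_scale_leq _ _) _; rewrite size_polyX.
by apply: leq_ltn_trans (size_polyC_leq1 _) _.
Qed.

Lemma wf_neq0 : wf != 0. Proof. by rewrite !sgt0 size_wf. Qed.

Lemma y_neq0 : y != 0.
Proof. by have := wf_neq0; rewrite -px_eq0 px_wf expf_eq0. Qed.

Lemma x_neq_cst c : x - cst c != 0.
Proof.
have := px_eq0 ('X - c%:P); rewrite pxD pxN pxX pxC => ->.
by rewrite polyXsubC_eq0.
Qed.

(** The cubic has odd degree, so it is not a square in k(x); hence 1 and y are
    linearly independent over k(x). *)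
Lemma sq_wf_eq0 (p q : {poly k}) : p ^+ 2 = q ^+ 2 * wf -> p = 0 /\ q = 0.
Proof.
move=> e; have [q0|q0] := eqVneq q 0.
  by move/eqP: e; rewrite q0 expr0n mul0r expf_eq0 /= => /eqP.
exfalso; have p0 : p != 0.
  apply: contraTneq (wf_neq0) => p0; move: e; rewrite p0 expr0n /= => /esym/eqP.
  by rewrite mulf_eq0 expf_eq0 /= (negbTE q0) /= => /eqP ->; rewrite eqxx.
have : size (p ^+ 2) = size (q ^+ 2 * wf) by rewrite e.
rewrite !expr2 !szM ?mulf_neq0 ?wf_neq0 // size_wf.
by move: p0 q0; rewrite !sgt0 => ? ? ?; lia.
Qed.

Lemma pq_eq0 p q : px p + px q * y = 0 -> p = 0 /\ q = 0.
Proof.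
move=> h; apply: sq_wf_eq0.
apply/eqP; rewrite -subr_eq0 -px_eq0 pxD pxN [px (_ * wf)]pxM !pxXn px_wf -exprMn subr_eq0.
by move/eqP: h; rewrite addr_eq0 => /eqP ->; rewrite sqrrN.
Qed.

Lemma field_pq (z : K) : exists p q r : {poly k}, r != 0 /\ z = (px p + px q * y) / px r.
Proof. exact: ffield_gen. Qed.

Lemma affine_reduce (G : {poly {poly k}}) : exists H (p q : {poly k}),
  G = H * ('X * 'X - wf%:P) + (p%:P + q%:P * 'X).
Proof.
elim/poly_ind: G => [|G c [H [p [q ->]]]].
  by exists 0, 0, 0; rewrite !mul0r !addr0.
exists (H * 'X + q%:P), (q * wf + c), p; rewrite polyCD polyCM; ring.
Qed.

(** Modulo the equation of the curve a polynomial in x and y is p + q y, which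
    vanishes in K only if p = q = 0. *)
Lemma good_affine x0 y0 : y0 ^+ 2 = x0 ^+ 3 + wa X * x0 + wb X ->
  good_chart x y x0 y0.
Proof.
move=> e G; have [H [p [q ->]]] := affine_reduce G.
rewrite !(cevalD, cevalM, cevalN, cevalC, cevalX, eval2D, eval2M, eval2N, eval2C, eval2X).
rewrite -!/(px _) px_wf wf_horner -e !expr2 !subrr !mulr0 !add0r.
by move/pq_eq0 => [-> ->]; rewrite !horner0 mul0r addr0.
Qed.

(** A degree bound that stands in for the order at infinity, where x and y have
    poles of orders 2 and 3: the conditions say that (p + q y) / r is bounded at
    infinity, and for b = true that it vanishes there. *)
Definition inf_small (b : bool) (f : K) := exists p q r : {poly k}, [/\ r != 0,
  f = (px p + px q * y) / px r, (size p + b <= size r)%N & (size (q * 'X^2)%R <= size r)%N].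

Lemma sz_mul (p r r' : {poly k}) b : r != 0 -> r' != 0 ->
  (size p + b <= size r)%N -> (size (p * r')%R + b <= size (r * r')%R)%N.
Proof.
move=> r0 r0'; have [->|p0] := eqVneq p 0.
  rewrite mul0r !size_poly0 szM //; move: r0'; rewrite !sgt0; lia.
rewrite !szM //; move: r0 r0' p0; rewrite !sgt0; lia.
Qed.

Lemma sz_add (p q : {poly k}) b n : (size p + b <= n -> size q + b <= n ->
  size (p + q)%R + b <= n)%N.
Proof. have := size_polyD p q; lia. Qed.

Lemma inf_smallD b f g : inf_small b f -> inf_small b g -> inf_small b (f + g).
Proof.
move=> [p [q [r [r0 -> h1 h2]]]] [p' [q' [r' [r0' -> h1' h2']]]].
exists (p * r' + p' * r), (q * r' + q' * r), (r * r'); split.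
- by rewrite mulf_neq0.
- rewrite addf_div ?px_eq0 // !pxD !pxM; congr (_ / _); ring.
- by apply: sz_add; [|rewrite (mulrC r)]; exact: sz_mul.
- rewrite mulrDl !(mulrAC _ _ 'X^2) -[leqLHS]addn0.
  by apply: sz_add; [|rewrite (mulrC r)]; apply: sz_mul; rewrite // addn0.
Qed.

Lemma inf_smallM b f g : inf_small false f -> inf_small b g -> inf_small b (f * g).
Proof.
move=> [p [q [r [r0 -> h1 h2]]]] [p' [q' [r' [r0' -> h1' h2']]]].
have szX (s : {poly k}) n : (size (s * 'X^2)%R <= n)%N = (s == 0) || (size s + 2 <= n)%N.
  by have [->|s0] := eqVneq s 0; rewrite ?mul0r ?size_poly0 // size_mulXn // addnC.
exists (p * p' + q * q' * wf), (p * q' + q * p'), (r * r'); split.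
- by rewrite mulf_neq0.
- rewrite mulf_div !pxD !pxM px_wf; congr (_ / _); ring.
- apply: sz_add.
    have [->|p0] := eqVneq p 0; last have [->|p0'] := eqVneq p' 0.
    + by rewrite mul0r size_poly0 szM //; move: h1' r0; rewrite !sgt0; lia.
    + by rewrite mulr0 size_poly0 szM //; move: h1' r0; rewrite !sgt0; lia.
    by rewrite !szM //; move: p0 p0' h1 h1'; rewrite !sgt0; lia.
  move: h2 h2'; rewrite !szX.
  have [->|q0] := eqVneq q 0; last have [->|q0'] := eqVneq q' 0.
  + by rewrite !mul0r size_poly0 szM //; move: h1' r0; rewrite !sgt0; lia.
  + by rewrite mulr0 mul0r size_poly0 szM //; move: h1' r0; rewrite !sgt0; lia.
  rewrite !szM ?mulf_neq0 ?wf_neq0 // size_wf.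
  by move: q0 q0'; rewrite !sgt0; case: (b); lia.
- rewrite /= addn0 in h1; rewrite mulrDl -[leqLHS]addn0.
  have {}h1' : (size p' <= size r')%N by lia.
  apply: sz_add; rewrite addn0; move: h2 h2'; rewrite !szX.
    have [->|p0] := eqVneq p 0; first by rewrite !(mulr0, mul0r) !eqxx.
    have [->|q0'] := eqVneq q' 0; first by rewrite !(mulr0, mul0r) !eqxx.
    rewrite mulf_eq0 (negbTE p0) (negbTE q0') /= !szM //.
    move: p0 q0' r0 r0' h1; rewrite !sgt0; clear.
    by move: (size p) (size q) (size r) (size q') (size r'); lia.
  have [->|p0] := eqVneq p' 0; first by rewrite !(mulr0, mul0r) !eqxx.
  have [->|q0'] := eqVneq q 0; first by rewrite !(mulr0, mul0r) !eqxx.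
  rewrite mulf_eq0 (negbTE p0) (negbTE q0') /= !szM //.
  move: p0 q0' r0 r0' h1'; rewrite !sgt0; clear.
  by move: (size p') (size q) (size r) (size q') (size r'); lia.
Qed.

Lemma inf_small0 b : inf_small b 0.
Proof.
exists 0, 0, 1; rewrite oner_neq0 px1 px0 !(mul0r, addr0) size_poly1 size_poly0.
by split; rewrite // add0n leq_b1.
Qed.

Lemma inf_small_cst c : inf_small false (cst c).
Proof.
exists c%:P, 0, 1; rewrite oner_neq0 px1 divr1 px0 pxC !mul0r !addr0 addn0 size_poly0.
by split; rewrite // size_poly1 size_polyC leq_b1.
Qed.

Lemma inf_small_weak f : inf_small true f -> inf_small false f.
Proof. by move=> [p [q [r [r0 -> h1 h2]]]]; exists p, q, r; split=> //; lia. Qed.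

Lemma inf_small_u : inf_small true (x / y).
Proof.
exists 0, 'X, wf; split; rewrite ?wf_neq0 ?size_wf ?size_poly0 //.
  rewrite px0 pxX px_wf add0r; field; exact: y_neq0.
by rewrite -exprS size_polyXn.
Qed.

Lemma inf_small_w : inf_small true y^-1.
Proof.
exists 0, 1, wf; split; rewrite ?wf_neq0 ?size_wf ?size_poly0 //.
  rewrite px0 px1 px_wf add0r; field; exact: y_neq0.
by rewrite mul1r size_polyXn.
Qed.

Lemma inf_small_1 : ~ inf_small true 1.
Proof.
move=> [p [q [r [r0 /eqP]]]]; rewrite eq_sym -subr_eq0 -[X in _ - X](@divff _ (px r)) ?px_eq0 //.
rewrite -mulrBl mulf_eq0 invr_eq0 px_eq0 (negbTE r0) orbF addrAC -pxN -pxD.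
move=> /eqP /pq_eq0 [/eqP]; rewrite subr_eq0 => /eqP -> _; lia.
Qed.

Lemma inf_smallN b f : inf_small b f -> inf_small b (- f).
Proof.
move=> h; rewrite -mulN1r; apply: inf_smallM => //.
by rewrite -(rmorph1 cst) -rmorphN; exact: inf_small_cst.
Qed.

(** Since x / y and 1 / y vanish at infinity, a polynomial in them differs from
    its constant term by a function vanishing there. *)
Lemma inf_small_sub (G : {poly {poly k}}) :
  inf_small true (ceval (x / y) y^-1 G - cst (eval2 G 0 0)).
Proof.
have pol (p : {poly k}) : inf_small true ((map_poly cst p).[x / y] - cst p.[0]).
  elim/poly_ind: p => [|p c hp].
    by rewrite rmorph0 !horner0 rmorph0 subr0; exact: inf_small0.
  rewrite rmorphD rmorphM /= map_polyX map_polyC !(hornerD, hornerMX, hornerC) mulr0 add0r addrK.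
  apply: inf_smallM inf_small_u; rewrite -(subrK (cst p.[0]) (_.[_])).
  by apply: inf_smallD (inf_small_cst _); exact: inf_small_weak.
elim/poly_ind: G => [|G c IH].
  by have := pol 0; rewrite !(rmorph0, horner0) /ceval /eval2 rmorph0 !horner0 rmorph0.
rewrite cevalD cevalM eval2D eval2M cevalX eval2X cevalC eval2C mulr0 add0r -addrA.
apply: inf_smallD (pol c); apply: inf_smallM inf_small_w.
rewrite -(subrK (cst (eval2 G 0 0)) (ceval _ _ _)).
by apply: inf_smallD (inf_small_cst _); exact: inf_small_weak.
Qed.

(** The constant term of a relation between x / y and 1 / y would be a constant
    that vanishes at infinity, hence it is zero. *)
Lemma good_infinity : good_chart (x / y) y^-1 0 0 (X := X).
Proof.
move=> G h; have := inf_small_sub G; rewrite h sub0r.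
apply: contraPeq => c0 /inf_smallN; rewrite opprK => /(inf_smallM (inf_small_cst (eval2 G 0 0)^-1)).
by rewrite -rmorphM mulVf // rmorph1; exact: inf_small_1.
Qed.

End Weierstrass.

(** * Values at points and uniformizers *)

(** Characteristic zero as a class: it is needed almost everywhere below, and
    instance search supplies it. *)
Class char0 (k : closedFieldType) := char0P : [pchar k] =i pred0.

Section Values.
Variables (k : closedFieldType) (X : elliptic_curve k).
Notation K := (ffield X).
Notation cst := (fconst X).
Notation x := (fx X).
Notation y := (fy X).
Notation px := (@px k X).
Notation wf := (wf X).
Implicit Types (p : point X) (f g : K) (c e : k).

(** Regularity at p together with the value c at p. *)
Definition rv p f c : Prop :=
  match p with
  | Infinity => chart_val (x / y) y^-1 0 0 f c
  | Affine x0 y0 _ => chart_val x y x0 y0 f c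
  end.

Lemma rv_const p c : rv p (cst c) c.
Proof. by case: p => [|x0 y0 h]; exact: chart_val_const. Qed.

Lemma rvD p f g c e : rv p f c -> rv p g e -> rv p (f + g) (c + e).
Proof. by case: p => [|x0 y0 h]; exact: chart_valD. Qed.

Lemma rvM p f g c e : rv p f c -> rv p g e -> rv p (f * g) (c * e).
Proof. by case: p => [|x0 y0 h]; exact: chart_valM. Qed.

Lemma rvV p f c : c != 0 -> rv p f c -> rv p f^-1 c^-1.
Proof.
case: p => [|x0 y0 h]; apply: chart_valV; [exact: good_infinity|exact: good_affine].
Qed.

Lemma rv_uniq p f c e : rv p f c -> rv p f e -> c = e.
Proof.
case: p => [|x0 y0 h]; apply: chart_val_uniq; [exact: good_infinity|exact: good_affine].
Qed.

Lemma rv_reg p f : regular_at p f <-> exists c, rv p f c.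
Proof. by case: p => [|x0 y0 h]; exact: chart_val_regular. Qed.

Lemma rvN p f c : rv p f c -> rv p (- f) (- c).
Proof.
move=> h; rewrite -mulN1r -[- c]mulN1r; apply: rvM h.
by rewrite -(rmorph1 cst) -rmorphN; exact: rv_const.
Qed.

Lemma rvB p f g c e : rv p f c -> rv p g e -> rv p (f - g) (c - e).
Proof. by move=> h1 h2; apply: rvD => //; exact: rvN. Qed.

Lemma rv1 p : rv p 1 1.
Proof. by rewrite -[X in rv _ X](rmorph1 cst); exact: rv_const. Qed.

Lemma rv0 p : rv p 0 0.
Proof. by rewrite -[X in rv _ X](rmorph0 cst); exact: rv_const. Qed.

Lemma rvX p f c n : rv p f c -> rv p (f ^+ n) (c ^+ n).
Proof.
by move=> h; elim: n => [|n IH]; rewrite ?expr0 ?exprS; [exact: rv1|exact: rvM].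
Qed.

Lemma rv_neq0 p f c : c != 0 -> rv p f c -> f != 0.
Proof. by move=> c0 h; apply: contraNneq c0 => f0; apply/eqP/(rv_uniq h); rewrite f0;
  exact: rv0. Qed.

Lemma rv_px x0 y0 h (q : {poly k}) : rv (@Affine k X x0 y0 h) (px q) q.[x0].
Proof.
by have := chart_val_poly x y x0 y0 q%:P; rewrite cevalC eval2C.
Qed.

Lemma rv_x x0 y0 h : rv (@Affine k X x0 y0 h) x x0.
Proof. exact: chart_val_u. Qed.

Lemma rv_y x0 y0 h : rv (@Affine k X x0 y0 h) y y0.
Proof. exact: chart_val_v. Qed.

(** f is t ^ m times a unit at p. Once every nonzero f has this form for one t,
    the exponent m is the valuation of f at p. *)
Definition monoat p (t f : K) (m : int) := exists2 c, c != 0 & rv p (f / t ^ m) c.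

Section Mono.
Variables (p : point X) (t : K).
Hypothesis (t0 : t != 0) (rt : rv p t 0).

Let tm m : t ^ m != 0 := expfz_neq0 m t0.

Lemma monoat_neq0 f m : monoat p t f m -> f != 0.
Proof.
move=> [c c0 /(rv_neq0 c0)]; by rewrite mulf_eq0 negb_or => /andP[].
Qed.

Lemma monoatM f g m n : monoat p t f m -> monoat p t g n -> monoat p t (f * g) (m + n).
Proof.
move=> [c c0 hf] [e e0 hg]; exists (c * e); first by rewrite mulf_neq0.
by rewrite expfzDr // -mulf_div; exact: rvM.
Qed.

Lemma monoatV f m : monoat p t f m -> monoat p t f^-1 (- m).
Proof.
move=> [c c0 hf]; exists c^-1; first by rewrite invr_eq0.
by rewrite -invr_expz invrK mulrC -invf_div; exact: rvV.
Qed.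

Lemma monoat_unit f c : c != 0 -> rv p f c -> monoat p t f 0.
Proof. by move=> c0 h; exists c => //; rewrite expr0z divr1. Qed.

Lemma monoat_t : monoat p t t 1.
Proof. by exists 1; rewrite ?oner_neq0 // expr1z divff //; exact: rv1. Qed.

Lemma monoatXz f m n : monoat p t f m -> monoat p t (f ^ n) (m * n).
Proof.
move=> [c c0 h]; exists (c ^ n); first exact: expfz_neq0.
rewrite -exprz_exp invr_expz -exprz_inv -expfzMl.
case: n => n; first exact: rvX.
by rewrite !NegzE -!exprnN -!exprVn; apply: rvX; exact: rvV.
Qed.

Lemma rv_tpos m : (0 < m)%R -> rv p (t ^ m) 0.
Proof.
case: m => // -[|m] // _; by have := rvX m.+1 rt; rewrite expr0n.
Qed.

Lemma monoatD f g m n : (m < n)%R -> monoat p t f m -> monoat p t g n ->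
  monoat p t (f + g) m.
Proof.
move=> mn [c c0 hf] [e e0 hg]; exists c => //.
rewrite mulrDl -[c]addr0; apply: rvD => //; rewrite -(mulr0 e).
have -> : g / t ^ m = g / t ^ n * t ^ (n - m).
  by rewrite expfzDr // mulrA mulfVK // -invr_expz.
by apply: rvM => //; apply: rv_tpos; rewrite subr_gt0.
Qed.

Lemma monoat_inj f m n : monoat p t f m -> monoat p t f n -> m = n.
Proof.
suff H m' n' : (m' < n')%R -> monoat p t f m' -> ~ monoat p t f n'.
  by move=> h1 h2; case: (ltgtP m n) => // /H; [move=> /(_ h1)|move=> /(_ h2)].
move=> mn [c c0 hf] [e e0 hg].
suff: rv p (f / t ^ m') (e * 0) by move/(rv_uniq hf)/eqP; rewrite mulr0 (negbTE c0).
have -> : f / t ^ m' = f / t ^ n' * t ^ (n' - m').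
  by rewrite expfzDr // mulrA mulfVK // -invr_expz.
by apply: rvM => //; apply: rv_tpos; rewrite subr_gt0.
Qed.

End Mono.

Context {ch : char0 k}.

Lemma two_neq0 : 2 != 0 :> k.
Proof. by have := ch 2; rewrite !inE /= => /negbT. Qed.

Definition uniformizer p t := [/\ t != 0, rv p t 0 &
  forall f, f != 0 -> exists m, monoat p t f m].

(** Every element of K is a quotient of elements p + q y. *)
Lemma uniformizer_pq p t : t != 0 -> rv p t 0 ->
  (forall q1 q2, px q1 + px q2 * y != 0 -> exists m, monoat p t (px q1 + px q2 * y) m) ->
  uniformizer p t.
Proof.
move=> t0 rt H; split=> // f f0; have [q1 [q2 [r [r0 ef]]]] := field_pq f.
have [m hm] : exists m, monoat p t (px q1 + px q2 * y) m.
  by apply: H; apply: contraNneq f0 => h; rewrite ef h mul0r.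
have [n hn] : exists n, monoat p t (px r) n.
  by have := H r 0; rewrite px0 mul0r addr0; apply; rewrite px_eq0.
exists (m - n); rewrite ef; apply: monoatM => //; exact: monoatV.
Qed.

Lemma horner_neq0_poly (q : {poly k}) a : q != 0 ->
  exists n q1, q1.[a] != 0 /\ q = q1 * ('X - a%:P) ^+ n.
Proof.
move=> q0; have [n [q1 h e]] := multiplicity_XsubC q a.
by exists n, q1; split => //; move: h; rewrite q0.
Qed.

(** At a double root the discriminant would vanish, against smoothness. *)
Lemma wf_simple_root a : wf.[a] = 0 -> exists g : {poly k}, wf = g * ('X - a%:P) /\ g.[a] != 0.
Proof.
rewrite wf_horner => h; exists ('X^2 + a *: 'X + (a ^+ 2 + wa X)%:P); split.
  have -> : wf = 'X^3 + (wa X)%:P * 'X - (a ^+ 3 + wa X * a)%:P.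
    by rewrite wfE -mul_polyC; congr (_ + _); rewrite -polyCN; congr polyC; apply/eqP;
      rewrite -addr_eq0 addrC h.
  rewrite -mul_polyC !(polyCD, polyC_exp, polyCM); ring.
rewrite !(hornerD, hornerXn, hornerZ, hornerX, hornerC); apply/eqP => h2; have := w_smooth X.
have ea : wa X = - (3 * a ^+ 2) by apply/eqP; rewrite -addr_eq0; apply/eqP; rewrite -[RHS]h2; ring.
have eb : wb X = 2 * a ^+ 3.
  by apply/eqP; rewrite -subr_eq0; apply/eqP; rewrite -[RHS]h ea; ring.
by rewrite ea eb; apply/negP; rewrite negbK; apply/eqP; ring.
Qed.

(** Where y does not vanish, x - x0 is a uniformizer: the norm
    (a + b y) (a - b y) = a ^ 2 - b ^ 2 wf is a polynomial in x, and one of the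
    two factors is a unit once the common powers of x - x0 are removed. Where y
    vanishes, y is a uniformizer, since y ^ 2 is a unit times x - x0; there a and
    b y have orders of different parity, so nothing cancels in a + b y. *)
Lemma uniformizer_affine x0 y0 h : exists q1 q2 : {poly k},
  uniformizer (@Affine k X x0 y0 h) (px q1 + px q2 * y).
Proof.
set p := Affine h; have [y00|y00] := eqVneq y0 0; last first.
  exists ('X - x0%:P), 0; rewrite px0 mul0r addr0 pxD pxN pxX pxC.
  have t0 := x_neq_cst X x0; set t := x - _ in t0 *.
  have rt : rv p t 0 by rewrite -(subrr x0); apply: rvB; [exact: rv_x|exact: rv_const].
  have pt n (q : {poly k}) : px (q * ('X - x0%:P) ^+ n) = px q * t ^+ n.
    by rewrite pxM pxXn pxD pxN pxX pxC.
  have mt n : monoat p t (t ^+ n) n by have := monoatXz n (monoat_t p t0); rewrite mul1r.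
  have mpx q : q != 0 -> exists m, monoat p t (px q) m.
    move=> /(horner_neq0_poly x0) [n [q1 [h1 ->]]]; exists (0 + n%:Z); rewrite pt.
    by apply: monoatM => //; apply: monoat_unit h1 _; exact: rv_px.
  apply: uniformizer_pq => // q1 q2.
  have [->|q10] := eqVneq q1 0; last have [->|q20] := eqVneq q2 0.
  - rewrite px0 add0r mulf_eq0 negb_or px_eq0 => /andP[q20 _].
    have [m hm] := mpx _ q20; exists (m + 0); apply: monoatM => //.
    by apply: monoat_unit y00 _; exact: rv_y.
  - by rewrite px0 mul0r addr0 px_eq0 => /mpx.
  have [n1 [a1 [h1 ->]]] := horner_neq0_poly x0 q10.
  have [n2 [a2 [h2 ->]]] := horner_neq0_poly x0 q20.
  rewrite !pt => nz.
  have m1 : monoat p t (px a1 * t ^+ n1) n1.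
    by rewrite -[n1%:Z]add0r; apply: monoatM => //; apply: monoat_unit h1 _; exact: rv_px.
  have r2 : rv p (px a2 * y) (a2.[x0] * y0) by apply: rvM; [exact: rv_px|exact: rv_y].
  have m2 : monoat p t (px a2 * t ^+ n2 * y) n2.
    rewrite mulrAC -[n2%:Z]add0r; apply: monoatM => //.
    by apply: monoat_unit r2; rewrite mulf_neq0.
  have [lt12|lt21|e12] := ltngtP n1 n2.
  - by exists n1%:Z; apply: monoatD m1 m2.
  - by exists n2%:Z; rewrite addrC; apply: monoatD m2 m1.
  rewrite e12 mulrAC -mulrDl in nz *.
  have r12 : rv p (px a1 + px a2 * y) (a1.[x0] + a2.[x0] * y0).
    by apply: rvD => //; exact: rv_px.
  have [e0|ne0] := eqVneq (a1.[x0] + a2.[x0] * y0) 0; last first.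
    by exists (0 + n2%:Z); apply: monoatM => //; apply: monoat_unit r12.
  have nz' : px a1 + px a2 * y != 0 by apply: contraNneq nz => ->; rewrite mul0r.
  (* the conjugate does not vanish at p, since 2 and a1.[x0] are nonzero *)
  have rc : rv p (px a1 - px a2 * y) (a1.[x0] - a2.[x0] * y0).
    by apply: rvB => //; exact: rv_px.
  have mc : monoat p t (px a1 - px a2 * y) 0.
    apply: monoat_unit rc; move/eqP: e0; rewrite addr_eq0 => /eqP e0.
    apply: contraNneq h1; rewrite -[a2.[x0] * y0]opprK -e0 opprK -mulr2n -mulr_natl => /eqP.
    by rewrite mulf_eq0 (negbTE two_neq0).
  have eN : px (a1 ^+ 2 - a2 ^+ 2 * wf) = (px a1 + px a2 * y) * (px a1 - px a2 * y).
    rewrite pxD pxN [px (_ * wf)]pxM !pxXn px_wf; ring.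
  have [m hm] : exists m, monoat p t (px (a1 ^+ 2 - a2 ^+ 2 * wf)) m.
    apply: mpx; rewrite -(px_eq0 X) eN mulf_neq0 //; exact: monoat_neq0 mc.
  exists (m - 0 + n2%:Z); apply: monoatM => //.
  have -> : px a1 + px a2 * y = px (a1 ^+ 2 - a2 ^+ 2 * wf) / (px a1 - px a2 * y).
    by rewrite eN mulfK //; exact: monoat_neq0 mc.
  by apply: monoatM => //; exact: monoatV.
have [g [eg g0]] : exists g : {poly k}, wf = g * ('X - x0%:P) /\ g.[x0] != 0.
  by apply: wf_simple_root; rewrite wf_horner -h y00 expr0n.
exists 0, 1; rewrite px0 px1 mul1r add0r.
have t0 := y_neq0 X.
have rt : rv p y 0 by rewrite -y00; exact: rv_y.
have mg : monoat p y (px g) 0 by apply: monoat_unit g0 _; exact: rv_px.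
have mt := monoat_t p t0.
have mx : monoat p y (x - cst x0) 2.
  have -> : x - cst x0 = y ^ 2 / px g.
    rewrite -exprnP -px_wf eg pxM pxD pxN pxX pxC mulrC mulKf //; exact: monoat_neq0 mg.
  rewrite -[2]subr0; apply: monoatM => //; last exact: monoatV.
  by have := monoatXz 2 mt; rewrite mul1r.
have mpx q : q != 0 -> exists n : nat, monoat p y (px q) (2 * n%:Z).
  move=> /(horner_neq0_poly x0) [n [q1 [h1 ->]]]; exists n; rewrite -[2 * _]add0r.
  rewrite pxM pxXn pxD pxN pxX pxC; apply: monoatM => //; last exact: (monoatXz n mx).
  by apply: monoat_unit h1 _; exact: rv_px.
apply: uniformizer_pq => // q1 q2.
have [->|q10] := eqVneq q1 0; last have [->|q20] := eqVneq q2 0.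
- rewrite px0 add0r mulf_eq0 negb_or px_eq0 => /andP[q20 _].
  by have [m hm] := mpx _ q20; exists (2 * m%:Z + 1); exact: monoatM.
- by rewrite px0 mul0r addr0 px_eq0 => /mpx [m hm]; exists (2 * m%:Z).
move=> _; have [n1 m1] := mpx _ q10; have [n2 m2] := mpx _ q20.
have {}m2 := monoatM t0 m2 mt.
case: (ltgtP (2 * n1%:Z) (2 * n2%:Z + 1)) => lt12.
- by exists (2 * n1%:Z); exact: (monoatD t0 rt lt12) m1 m2.
- by exists (2 * n2%:Z + 1); rewrite addrC; exact: (monoatD t0 rt lt12) m2 m1.
by exfalso; lia.
Qed.

End Values.

(** * The valuations of the function field *)

HB.instance Definition _ (k : closedFieldType) (X : elliptic_curve k) :=
  gen_eqMixin (point X).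
HB.instance Definition _ (k : closedFieldType) (X : elliptic_curve k) :=
  gen_choiceMixin (point X).

Section Orders.
Variables (k : closedFieldType) (X : elliptic_curve k).
Context {ch : char0 k}.
Notation K := (ffield X).
Notation cst := (fconst X).
Notation x := (fx X).
Notation y := (fy X).
Notation px := (@px k X).
Notation wf := (wf X).
Implicit Types (p : point X) (f g : K) (c e : k).

(** x ^ 3 and y ^ 2 have the same leading term at infinity. *)
Lemma rv_inf_eps : rv (@Infinity k X) (x ^+ 3 / y ^+ 2) 1.
Proof.
have y0 := y_neq0 X; set u := x / y.
have ru : rv Infinity u 0 by exact: chart_val_u.
have rw : rv (@Infinity k X) y^-1 0 by exact: chart_val_v.
have -> : x ^+ 3 / y ^+ 2 = 1 - cst (wa X) * (u * y^-1) - cst (wb X) * (y^-1 * y^-1).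
  by rewrite /u; have -> : x ^+ 3 = y ^+ 2 - cst (wa X) * x - cst (wb X); [rewrite w_eq;
    ring|field].
have -> : 1 = 1 - wa X * (0 * 0) - wb X * (0 * 0) :> k by ring.
by do ![apply: rvB|apply: rvM|exact: rv1|exact: rv_const|exact: ru|exact: rw].
Qed.

Lemma x_neq0 : x != 0.
Proof. by have := x_neq_cst X 0; rewrite rmorph0 subr0. Qed.

(** The poles of a(x) at infinity have even order and those of b(x) y odd order,
    so nothing cancels in a + b y. *)
Lemma uniformizer_infinity : uniformizer (@Infinity k X) (x / y).
Proof.
set p := @Infinity k X; set u := x / y; have y0 := y_neq0 X.
have x0 := x_neq0.
have u0 : u != 0 by rewrite mulf_neq0 ?invr_eq0.
have ru : rv p u 0 by exact: chart_val_u.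
pose ep := x ^+ 3 / y ^+ 2; have rep : rv p ep 1 := rv_inf_eps.
have mep : monoat p u ep 0 by apply: monoat_unit rep; exact: oner_neq0.
have mt := monoat_t p u0.
have mx : monoat p u x (-2).
  have -> : x = ep * (u ^ 2)^-1 by rewrite -exprnP /ep /u; field; rewrite x0 y0.
  rewrite -[-2]add0r; apply: monoatM => //; apply: monoatV.
  by have := monoatXz 2 mt; rewrite mul1r.
have my : monoat p u y (-3).
  have -> : y = ep * (u ^ 3)^-1 by rewrite -exprnP /ep /u; field; rewrite x0 y0.
  rewrite -[-3]add0r; apply: monoatM => //; apply: monoatV.
  by have := monoatXz 3 mt; rewrite mul1r.
have mc c : c != 0 -> monoat p u (cst c) 0.
  by move=> c0; apply: monoat_unit c0 _; exact: rv_const.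
have mpx (q : {poly k}) : q != 0 -> exists n : nat, monoat p u (px q) (- (2 * n%:Z)).
  elim/poly_ind: q => [|q c IH]; first by rewrite eqxx.
  have [->|q0] := eqVneq q 0.
    by rewrite mul0r add0r polyC_eq0 pxC => /mc ?; exists 0%N.
  move=> _; have [n mn] := IH q0; exists n.+1; rewrite pxD pxM pxX pxC.
  have -> : - (2 * n.+1%:Z) = - (2 * n%:Z) + -2 by lia.
  have [->|c0] := eqVneq c 0; first by rewrite rmorph0 addr0; exact: monoatM.
  by apply: (@monoatD _ _ _ _ u0 ru _ _ _ 0); [lia|exact: monoatM|exact: mc].
apply: uniformizer_pq => // q1 q2.
have [->|q10] := eqVneq q1 0; last have [->|q20] := eqVneq q2 0.
- rewrite px0 add0r mulf_eq0 negb_or px_eq0 => /andP[q20 _].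
  by have [m hm] := mpx _ q20; exists (- (2 * m%:Z) - 3); exact: monoatM.
- by rewrite px0 mul0r addr0 px_eq0 => /mpx [m hm]; exists (- (2 * m%:Z)).
move=> _; have [n1 m1] := mpx _ q10; have [n2 m2] := mpx _ q20.
have {}m2 := monoatM u0 m2 my.
case: (ltgtP (- (2 * n1%:Z)) (- (2 * n2%:Z) - 3)) => lt12.
- by exists (- (2 * n1%:Z)); exact: (monoatD u0 ru lt12 m1 m2).
- by exists (- (2 * n2%:Z) - 3); rewrite addrC; exact: (monoatD u0 ru lt12 m2 m1).
by exfalso; lia.
Qed.

Lemma uniformizer_ex p : exists t, uniformizer p t.
Proof.
case: p => [|x0 y0 h]; first by exists (x / y); exact: uniformizer_infinity.
by have [q1 [q2 hq]] := uniformizer_affine h; exists (px q1 + px q2 * y).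
Qed.

Definition unif p : K := xget 0 [set t | uniformizer p t].

Lemma unifP p : uniformizer p (unif p).
Proof. by have [t ht] := uniformizer_ex p; exact: (xgetPex 0 (ex_intro _ t ht)). Qed.

Lemma unif_neq0 p : unif p != 0. Proof. by case: (unifP p). Qed.
Lemma rv_unif p : rv p (unif p) 0. Proof. by case: (unifP p). Qed.

(** The order of vanishing; for f = 0 it is an arbitrary integer, and ordge is
    the notion to use for functions that may be zero. *)
Definition val p f : int := xget 0 [set m | monoat p (unif p) f m].

Arguments val : simpl never.

Lemma val_mono p f : f != 0 -> monoat p (unif p) f (val p f).
Proof.
move=> f0; have [_ _ /(_ f f0) [m hm]] := unifP p.
exact: (@xgetPex _ 0 [set m | monoat p (unif p) f m] (ex_intro _ m hm)).
Qed.

Lemma val_eq p f m : monoat p (unif p) f m -> val p f = m.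
Proof.
move=> h; apply: (monoat_inj (unif_neq0 p) (rv_unif p) _ h).
exact/val_mono/(monoat_neq0 h).
Qed.

Lemma valM p f g : f != 0 -> g != 0 -> val p (f * g) = val p f + val p g.
Proof.
move=> f0 g0; apply: val_eq; apply: monoatM; rewrite ?unif_neq0 //; exact: val_mono.
Qed.

Lemma valV p f : f != 0 -> val p f^-1 = - val p f.
Proof. by move=> f0; apply: val_eq; apply: monoatV; exact: val_mono. Qed.

Lemma val_rv p f c : c != 0 -> rv p f c -> val p f = 0.
Proof. by move=> c0 h; apply: val_eq; exact: monoat_unit h. Qed.

Lemma val_cst p c : c != 0 -> val p (cst c) = 0.
Proof. by move=> c0; apply: val_rv c0 _; exact: rv_const. Qed.

Lemma val1 p : val p 1 = 0.
Proof. by apply: val_rv (rv1 _); exact: oner_neq0. Qed.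

Lemma val_unif p : val p (unif p) = 1.
Proof. by apply: val_eq; apply: monoat_t; exact: unif_neq0. Qed.

Lemma valXz p f n : f != 0 -> val p (f ^ n) = val p f * n.
Proof. by move=> f0; apply: val_eq; apply: monoatXz; exact: val_mono. Qed.

Lemma valX p f n : f != 0 -> val p (f ^+ n) = val p f *+ n.
Proof. by move=> f0; rewrite exprnP valXz // -mulrzz pmulrn. Qed.

Definition ordge p (n : int) f := (f == 0) || (n <= val p f).

Lemma ordge_0 p n : ordge p n 0. Proof. by rewrite /ordge eqxx. Qed.

Lemma ordgeE p n f : f != 0 -> ordge p n f = (n <= val p f).
Proof. by rewrite /ordge => /negbTE ->. Qed.

Lemma val_ordge p f : ordge p (val p f) f.
Proof. by rewrite /ordge lexx orbT. Qed.

Lemma ordge_le p m n f : n <= m -> ordge p m f -> ordge p n f.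
Proof. by rewrite /ordge => h /orP[->//|/(le_trans h) ->]; rewrite orbT. Qed.

Lemma ordgeM p m n f g : ordge p m f -> ordge p n g -> ordge p (m + n) (f * g).
Proof.
have [->|f0] := eqVneq f 0; first by rewrite mul0r !ordge_0.
have [->|g0] := eqVneq g 0; first by rewrite mulr0 !ordge_0.
by rewrite !ordgeE ?mulf_neq0 // valM //; exact: lerD.
Qed.

(** A function with a value at p and a pole at p would, multiplied by a positive
    power of the uniformizer, have both a nonzero value and the value zero. *)
Lemma ordge_regP p f : ordge p 0 f <-> regular_at p f.
Proof.
rewrite rv_reg; have [->|f0] := eqVneq f 0.
  by rewrite ordge_0; split => // _; exists 0; exact: rv0.
rewrite ordgeE //; have [c c0 h] := val_mono p f0; split => [v0|[e he]].
  have -> : f = f / unif p ^ val p f * unif p ^ val p f.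
    by rewrite divfK // expfz_neq0 // unif_neq0.
  have [n vn] : exists n : nat, val p f = n by exists `|val p f|%N; rewrite gez0_abs.
  rewrite vn in h *; exists (c * 0 ^+ n); apply: rvM => //.
  by apply: rvX; exact: rv_unif.
rewrite leNgt; apply/negP => v0.
have := rvM he (rv_tpos (rv_unif p) (m := - val p f) _).
rewrite oppr_gt0 => /(_ v0); rewrite mulr0 -invr_expz => /(rv_uniq h)/eqP.
by rewrite (negbTE c0).
Qed.

Lemma ordge1P p f : ordge p 1 f <-> rv p f 0.
Proof.
have [->|f0] := eqVneq f 0; first by rewrite ordge_0; split => // _; exact: rv0.
rewrite ordgeE //; split => [h|h].
  have /ordge_regP/rv_reg [c hc] : ordge p 0 f by rewrite ordgeE //; lia.
  have [c0|c0] := eqVneq c 0; first by rewrite -c0.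
  by have := val_rv c0 hc; lia.
have : ordge p 0 f by apply/ordge_regP/rv_reg; exists 0.
rewrite ordgeE // le_eqVlt => /orP[/eqP e|//].
have [c c0] := val_mono p f0; rewrite -e expr0z divr1 => /(rv_uniq h)/eqP.
by rewrite eq_sym (negbTE c0).
Qed.

Lemma rv_ordge1 p f c : rv p f c <-> ordge p 1 (f - cst c).
Proof.
rewrite ordge1P; split=> h; first by rewrite -(subrr c); apply: rvB => //; exact: rv_const.
by rewrite -(subrK (cst c) f) -[c in rv _ _ c]add0r; apply: rvD => //; exact: rv_const.
Qed.

Lemma ordge_shift p n m f g : g != 0 -> val p g = m ->
  ordge p n (f * g) = ordge p (n - m) f.
Proof.
move=> g0 <-; have [->|f0] := eqVneq f 0; first by rewrite mul0r !ordge_0.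
by rewrite !ordgeE ?mulf_neq0 // valM // lerBlDr.
Qed.

Lemma ordge_unif p n f : ordge p n f = ordge p 0 (f * unif p ^ (- n)).
Proof.
by rewrite (@ordge_shift _ _ (- n)) ?expfz_neq0 ?unif_neq0 ?valXz ?unif_neq0 // ?val_unif ?mul1r
  // opprK add0r.
Qed.

Lemma ordgeD p n f g : ordge p n f -> ordge p n g -> ordge p n (f + g).
Proof.
rewrite !(ordge_unif _ n) mulrDl => /ordge_regP/rv_reg [c h] /ordge_regP/rv_reg [e h'].
by apply/ordge_regP/rv_reg; exists (c + e); exact: rvD.
Qed.

Lemma ordgeN p n f : ordge p n (- f) = ordge p n f.
Proof.
have [->|f0] := eqVneq f 0; first by rewrite oppr0.
rewrite !ordgeE ?oppr_eq0 // -mulN1r valM ?oppr_eq0 ?oner_eq0 //.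
have -> : val p (-1) = 0; last by rewrite add0r.
by rewrite -(rmorph1 cst) -rmorphN val_cst // oppr_eq0 oner_eq0.
Qed.

Lemma ordgeB p n f g : ordge p n f -> ordge p n g -> ordge p n (f - g).
Proof. by move=> h1 h2; apply: ordgeD => //; rewrite ordgeN. Qed.

Lemma ordge_sum p n (I : Type) (r : seq I) (P : pred I) (F : I -> K) :
  (forall i, P i -> ordge p n (F i)) -> ordge p n (\sum_(i <- r | P i) F i).
Proof.
move=> h; elim/big_ind: _ => //; [exact: ordge_0|exact: ordgeD].
Qed.

Lemma ordge_cst p c : ordge p 0 (cst c).
Proof. by apply/ordge_regP; exact: regular_at_const. Qed.

Lemma ordge_1 p : ordge p 0 1.
Proof. by rewrite -(rmorph1 cst) ordge_cst. Qed.

Lemma ordgeM0 p f g : ordge p 0 f -> ordge p 0 g -> ordge p 0 (f * g).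
Proof. by move=> h1 h2; rewrite -[0](addr0 0); exact: ordgeM. Qed.

Lemma ordgeX p f n : ordge p 0 f -> ordge p 0 (f ^+ n).
Proof. by move=> h; elim: n => [|n IH]; rewrite ?expr0 ?ordge_1 // exprS ordgeM0. Qed.

Lemma ordgeX1 p f n : ordge p 1 f -> ordge p n%:Z (f ^+ n).
Proof.
move=> h; elim: n => [|n IH]; first by rewrite expr0 ordge_1.
by rewrite exprS -[n.+1%:Z]/(1 + n)%:Z PoszD; apply: ordgeM.
Qed.

(** The residue field is k, so a constant multiple of any function of the same
    order removes the leading term. *)
Lemma ordge_lead p f g n : g != 0 -> val p g = n -> ordge p n f ->
  exists c, ordge p (n + 1) (f - cst c * g).
Proof.
move=> g0 vg hf.
have : ordge p 0 (f / g) by rewrite (@ordge_shift _ _ (- n)) ?invr_eq0 // ?valV ?vg // opprK add0r.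
move=> /ordge_regP/rv_reg [c /rv_ordge1 hc]; exists c.
have -> : f - cst c * g = (f / g - cst c) * g by rewrite mulrBl divfK.
by rewrite addrC; apply: ordgeM => //; rewrite -vg val_ordge.
Qed.

Lemma unit_atP p f : unit_at p f -> regular_at p f -> f != 0 /\ val p f = 0.
Proof.
move=> [f0 /ordge_regP h1] /ordge_regP h2; split => //.
by move: h1 h2; rewrite !ordgeE ?invr_eq0 // valV //; lia.
Qed.

Lemma unit_at_val p f : f != 0 -> val p f = 0 -> unit_at p f.
Proof.
move=> f0 v0; split => //; apply/ordge_regP; rewrite ordgeE ?invr_eq0 // valV //; lia.
Qed.

(** If unif p is a unit times t ^ m then m * val p t = 1 with val p t positive. *)
Lemma val_uniformizer p t : uniformizer p t -> val p t = 1.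
Proof.
move=> [t0 rt H]; have [m [c c0 hm]] := H _ (unif_neq0 p).
have : ordge p 1 t by apply/ordge1P.
have := val_unif p; rewrite -(divfK (expfz_neq0 m t0) (unif p)) valM ?mulf_neq0 ?invr_eq0
  ?expfz_neq0 ?unif_neq0 //.
rewrite (val_rv c0 hm) valXz // add0r ordgeE // => e v1.
move: (val p t) v1 e => v v1 e; have m1 : (1 <= m)%R by move: e v1; clear; nia.
by move: e v1 m1; clear; nia.
Qed.

Lemma val_inf_y : val Infinity y = -3.
Proof.
have x0 := x_neq0; have y0 := y_neq0 X.
have := val_uniformizer uniformizer_infinity; rewrite valM ?invr_eq0 // valV //.
have := val_rv (oner_neq0 _) rv_inf_eps.
by rewrite valM ?invr_eq0 ?expf_neq0 // valV ?expf_neq0 // !valX //; lia.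
Qed.

Lemma val_inf_x : val Infinity x = -2.
Proof.
have x0 := x_neq0; have y0 := y_neq0 X; have := val_inf_y.
have := val_uniformizer uniformizer_infinity; rewrite valM ?invr_eq0 // valV //; lia.
Qed.

Lemma finite_val_xc c : finite_set [set p | val p (x - cst c) != 0].
Proof.
have [b hb] : exists b, b ^+ 2 = wf.[c].
  have /closed_rootP [b /rootP hb] : size ('X^2 - (wf.[c])%:P) != 1%N.
    by rewrite size_XnsubC.
  by exists b; apply/eqP; rewrite -subr_eq0; move: hb; rewrite !(hornerD, hornerN, hornerXn,
    hornerC) => ->.
rewrite wf_horner in hb.
have hb' : (- b) ^+ 2 = c ^+ 3 + wa X * c + wb X by rewrite sqrrN.
apply: (@sub_finite_set _ _ [set Infinity; Affine hb; Affine hb']); last first.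
  by rewrite !finite_setU; do !split; apply: finite_set1.
move=> [|x0 y0 h] /=; first by left; left.
have [e|ne] := eqVneq x0 c; last first.
  have h0 : rv (Affine h) (x - cst c) (x0 - c) by apply: rvB; [exact: rv_x|exact: rv_const].
  by rewrite (val_rv _ h0) ?eqxx // subr_eq0.
subst x0 => _.
have : (y0 - b) * (y0 + b) == 0 by rewrite -subr_sqr h hb subrr.
rewrite mulf_eq0 subr_eq0 addr_eq0 => /orP[] /eqP e; subst y0.
  by left; right; congr Affine; exact: eq_irrelevance.
by right; congr Affine; exact: eq_irrelevance.
Qed.

Lemma finite_val_px (q : {poly k}) : q != 0 -> finite_set [set p | val p (px q) != 0].
Proof.
move=> q0; have [r ->] := closed_field_poly_normal q.
have l0 : lead_coef q != 0 by rewrite lead_coef_eq0.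
elim: r => [|c r IH].
  rewrite big_nil (_ : [set _ | _] = set0) ?finite_set0 //.
  by apply/seteqP; split => // p /=; rewrite pxZ px1 mulr1 val_cst ?eqxx.
rewrite big_cons; apply: sub_finite_set (_ : finite_set ([set p | val p (x - cst c) != 0] `|` _)).
  2: by rewrite finite_setU; split; [exact: finite_val_xc|exact: IH].
move=> p /=; rewrite scalerAr pxM pxD pxN pxX pxC valM ?x_neq_cst //.
  by have [->|] := eqVneq (val p (x - cst c)) 0; [rewrite add0r; right|left].
rewrite px_eq0 scaler_eq0 (negbTE l0) /= -size_poly_gt0.
by rewrite size_prod_XsubC.
Qed.

(** At an affine point, a zero or a pole of f is a zero of the denominator or of
    the norm of the numerator; both are polynomials in x. *)
Lemma finite_val f : f != 0 -> finite_set [set p | val p f != 0].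
Proof.
move=> f0; have [q1 [q2 [r [r0 ef]]]] := field_pq f.
have nz : px q1 + px q2 * y != 0 by apply: contraNneq f0 => h; rewrite ef h mul0r.
pose N := q1 ^+ 2 - q2 ^+ 2 * wf.
have eN : px N = (px q1 + px q2 * y) * (px q1 - px q2 * y).
  rewrite /N pxD pxN [px (_ * wf)]pxM !pxXn px_wf; ring.
have N0 : N != 0.
  apply: contraNneq nz => /eqP; rewrite subr_eq0 => /eqP /sq_wf_eq0 [-> ->].
  by rewrite !px0 mul0r addr0.
have nz' : px q1 - px q2 * y != 0.
  by move: N0; rewrite -(px_eq0 X) eN mulf_eq0 negb_or => /andP[].
apply: (@sub_finite_set _ _ ([set Infinity] `|` ([set p | val p (px N) != 0] `|` [set p | val p
  (px r) != 0]))); last first.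
  by rewrite !finite_setU; do !split;
    [exact: finite_set1|exact: finite_val_px|exact: finite_val_px].
move=> [|x0 y0 h]; first by left.
set p := Affine h => hv; right.
have vf : val p f = val p (px q1 + px q2 * y) - val p (px r).
  by rewrite ef valM ?invr_eq0 ?px_eq0 // valV ?px_eq0.
have vN : val p (px N) = val p (px q1 + px q2 * y) + val p (px q1 - px q2 * y).
  by rewrite eN valM.
have reg q q' : ordge p 0 (px q + px q' * y).
  by apply/ordge_regP/rv_reg; exists (q.[x0] + q'.[x0] * y0); apply: rvD;
    [exact: rv_px|apply: rvM; [exact: rv_px|exact: rv_y]].
have := reg q1 q2; have := reg q1 (- q2); rewrite pxN mulNr !ordgeE // => g1 g2.
apply: contrapT => /not_orP [/negP/negPn/eqP hN /negP/negPn/eqP hr].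
move: hv => /eqP; apply; rewrite vf hr; move: hN; rewrite vN.
by move: (val _ _) (val _ _) g1 g2; clear; lia.
Qed.

(** The points above x = 0, 1, 2, ... are pairwise distinct in characteristic
    zero. *)
Lemma point_neq_ex (A : set (point X)) : finite_set A -> exists p, ~ A p.
Proof.
move=> fA; apply: contrapT => /forallNP h.
have {}h p : A p by apply: contrapT; exact: h.
have px0 (c : k) : exists y0, y0 ^+ 2 = c ^+ 3 + wa X * c + wb X.
  have /closed_rootP [b /rootP hb] : size ('X^2 - (wf.[c])%:P) != 1%N.
    by rewrite size_XnsubC.
  exists b; apply/eqP; rewrite -wf_horner -subr_eq0; move: hb.
  by rewrite !(hornerD, hornerN, hornerXn, hornerC) => ->.
pose pt (n : nat) := Affine (projT2 (cid (px0 n%:R))).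
have ipt : injective pt.
  have /pcharf0P n0 := ch; move=> m n [e _].
  suff H a b : (a <= b)%N -> a%:R = b%:R :> k -> a = b.
    by case: (leqP m n) => [mn|/ltnW nm]; [exact: H|apply/esym/H].
  move=> ab /eqP; rewrite eq_sym -subr_eq0 -natrB // n0 subn_eq0 => ba.
  by apply/eqP; rewrite eqn_leq ab.
have : finite_set (pt @^-1` A).
  by apply: finite_preimage => // m n _ _ /ipt.
rewrite (_ : _ @^-1` _ = setT); first by exact: infinite_nat.
by apply/seteqP; split => // n _ /=.
Qed.

Lemma aopen_neq0 (U : aopen X) : exists p, aset U p.
Proof.
have [p /contrapT hp] := point_neq_ex (proj1 (asetP U)); by exists p.
Qed.

End Orders.

(** * Translations of the curve *)

(** (xi, eta) is the difference of the points (x, y) and (x0, y0) in the group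
    law of the cubic: l is the slope of the line through (x, y) and (x0, - y0). *)
Lemma chord_law (F : fieldType) (a b x y x0 y0 : F) :
  y ^+ 2 = x ^+ 3 + a * x + b -> y0 ^+ 2 = x0 ^+ 3 + a * x0 + b ->
  x - x0 != 0 ->
  let l := (y + y0) / (x - x0) in let xi := l ^+ 2 - x - x0 in
  (y0 - l * (xi - x0)) ^+ 2 = xi ^+ 3 + a * xi + b.
Proof.
move=> e e0 d0 l xi.
have ea : a = ((y ^+ 2 - y0 ^+ 2) - (x ^+ 3 - x0 ^+ 3)) / (x - x0).
  rewrite e e0; field; exact: d0.
have eb : b = y0 ^+ 2 - x0 ^+ 3 - a * x0 by rewrite e0; ring.
rewrite eb ea /xi /l; field; exact: d0.
Qed.

(** The form of xi from which its order at infinity can be read off. *)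
Lemma chord_xi (F : fieldType) (a b x y x0 y0 : F) :
  y ^+ 2 = x ^+ 3 + a * x + b -> x - x0 != 0 ->
  ((y + y0) / (x - x0)) ^+ 2 - x - x0
  = (x0 * x ^+ 2 + (a + x0 ^+ 2) * x + (b + y0 ^+ 2 - x0 ^+ 3) + 2 * y0 * y)
    / (x - x0) ^+ 2.
Proof.
move=> e d0; have -> : b = y ^+ 2 - x ^+ 3 - a * x by rewrite e; ring.
field; exact: d0.
Qed.

Section Translation.
Variables (k : closedFieldType) (X : elliptic_curve k).
Context {ch : char0 k}.
Notation K := (ffield X).
Notation cst := (fconst X).
Notation x := (fx X).
Notation y := (fy X).
Notation px := (@px k X).
Notation wf := (wf X).
Implicit Types (p q : point X) (f g : K) (c e : k).

Lemma ordgeMe p l (m n : int) f g : l = m + n -> ordge p m f -> ordge p n g ->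
  ordge p l (f * g).
Proof. by move=> ->; exact: ordgeM. Qed.

Lemma ordge_nat p n m : (m <= 0)%R -> ordge p m (n%:R : K).
Proof. by move=> m0; apply: ordge_le m0 _; rewrite -(rmorph_nat cst) ordge_cst. Qed.

(** Affine points differ in a coordinate x or y, and x has a pole at infinity. *)
Lemma reg_sep p q : p <> q -> exists2 f, regular_at p f & ~ regular_at q f.
Proof.
have sep f c e : rv p f c -> rv q f e -> c != e -> exists2 f, regular_at p f & ~ regular_at q f.
  move=> hp hq ce; exists (f - cst e)^-1.
    apply/rv_reg; exists (c - e)^-1; apply: rvV; first by rewrite subr_eq0.
    by apply: rvB => //; exact: rv_const.
  move=> /rv_reg [b hb].
  have h0 : rv q (f - cst e) 0 by rewrite -(subrr e); apply: rvB => //; exact: rv_const.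
  have f0 : f - cst e != 0.
    apply: contraNneq ce => f0; rewrite -subr_eq0; apply/eqP.
    have : rv p (f - cst e) (c - e) by apply: rvB => //; exact: rv_const.
    by rewrite f0 => /rv_uniq; apply; exact: rv0.
  generalize (rvM hb h0); rewrite mulVf // mulr0 => /rv_uniq /(_ (rv1 _)) /eqP.
  by rewrite eq_sym oner_eq0.
case: p q sep => [|x1 y1 h1] [|x2 y2 h2] // sep ne.
- exists (x - cst x2)^-1.
    apply/ordge_regP; rewrite ordgeE ?invr_eq0 ?x_neq_cst // valV ?x_neq_cst //.
    have : ~~ ordge Infinity 0 (x - cst x2).
      apply/negP => h; have : ordge Infinity 0 x by rewrite -(subrK (cst x2) x) ordgeD // ordge_cst.
      by rewrite ordgeE ?x_neq0 // val_inf_x.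
    rewrite ordgeE ?x_neq_cst //; lia.
  move=> /rv_reg [b hb].
  have h0 : rv (Affine h2) (x - cst x2) 0.
    by rewrite -(subrr x2); apply: rvB; [exact: rv_x|exact: rv_const].
  generalize (rvM hb h0); rewrite mulVf ?x_neq_cst // mulr0 => /rv_uniq /(_ (rv1 _)) /eqP.
  by rewrite eq_sym oner_eq0.
- exists x; first by apply/rv_reg; exists x1; exact: rv_x.
  by move=> /ordge_regP; rewrite ordgeE ?x_neq0 // val_inf_x.
have [e|n1] := eqVneq x1 x2; last by apply: sep n1; [exact: rv_x|exact: rv_x].
have [e'|n2] := eqVneq y1 y2; last by apply: sep n2; [exact: rv_y|exact: rv_y].
by exfalso; apply: ne; subst x2 y2; congr Affine; exact: eq_irrelevance.
Qed.

(** What is needed of two functions for K to be, with these functions as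
    coordinates, again the function field of the curve. *)
Definition wpair (xi eta : K) :=
  [/\ eta ^+ 2 = xi ^+ 3 + cst (wa X) * xi + cst (wb X),
      forall p : {poly k}, (map_poly cst p).[xi] = 0 -> p = 0 &
      forall z : K, exists p q r : {poly k}, r != 0 /\
        z = ((map_poly cst p).[xi] + (map_poly cst q).[xi] * eta) / (map_poly cst r).[xi]].

Section Chord.
Variables (x0 y0 : k) (h0 : y0 ^+ 2 = x0 ^+ 3 + wa X * x0 + wb X).
Let q := @Affine k X x0 y0 h0.
Let lam := (y + cst y0) / (x - cst x0).
Let xi := lam ^+ 2 - x - cst x0.
Let eta := cst y0 - lam * (xi - cst x0).
Let d0 := x_neq_cst X x0.

Let h0' : cst y0 ^+ 2 = cst x0 ^+ 3 + cst (wa X) * cst x0 + cst (wb X).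
Proof. by rewrite -!rmorphXn -rmorphM -!rmorphD h0. Qed.

Let eqn : eta ^+ 2 = xi ^+ 3 + cst (wa X) * xi + cst (wb X).
Proof. by apply: chord_law => //; exact: w_eq. Qed.

Let reg_aff p : ordge p 0 lam -> ordge p 0 x -> ordge p 0 xi /\ ordge p 0 eta.
Proof.
move=> hl hx; have hxi : ordge p 0 xi.
  by apply: ordgeB; [apply: ordgeB => //; exact: ordgeX|exact: ordge_cst].
by split => //; apply: ordgeB; rewrite ?ordge_cst // ordgeM0 // ordgeB // ordge_cst.
Qed.

(** At the other point above x0 the equation of the curve gives the slope as a
    quotient with a nonvanishing denominator. *)
Let reg_lam p : p <> q -> p <> Infinity -> ordge p 0 lam.
Proof.
case: p => // x1 y1 h1 ne _; apply/ordge_regP/rv_reg.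
have [e|ne1] := eqVneq x1 x0; last first.
  exists ((y1 + y0) / (x1 - x0)); apply: rvM.
    by apply: rvD; [exact: rv_y|exact: rv_const].
  by apply: rvV; [rewrite subr_eq0|apply: rvB; [exact: rv_x|exact: rv_const]].
subst x1.
have ney : y1 - y0 != 0.
  rewrite subr_eq0; apply/eqP => e; apply: ne; subst y1; congr Affine; exact: eq_irrelevance.
have rd : rv (Affine h1) (y - cst y0) (y1 - y0) by apply: rvB; [exact: rv_y|exact: rv_const].
have nd : _ := rv_neq0 ney rd.
have -> : lam = (x ^+ 2 + x * cst x0 + cst x0 ^+ 2 + cst (wa X)) / (y - cst y0).
  apply/eqP; rewrite /lam eqr_div //; apply/eqP.
  have -> : (y + cst y0) * (y - cst y0) = y ^+ 2 - cst y0 ^+ 2 by ring.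
  rewrite w_eq h0'; ring.
eexists; apply: rvM; last exact: rvV rd.
do ![apply: rvD|apply: rvM|apply: rvX|exact: rv_x|exact: rv_const].
Qed.

(** The poles of lam ^ 2 and x at infinity cancel in xi, whose value there is x0;
    so xi - x0 has a zero, which compensates the pole of lam in eta. *)
Let reg_inf : ordge Infinity 0 xi /\ ordge Infinity 0 eta.
Proof.
set p := @Infinity k X.
have vx : val p (x - cst x0) = -2.
  have rx : rv p x^-1 0 by apply/ordge1P;
    rewrite ordgeE ?invr_eq0 ?x_neq0 // valV ?x_neq0 // val_inf_x.
  have -> : x - cst x0 = (1 - cst x0 * x^-1) * x.
    by field; exact: x_neq0.
  have rq : rv p (1 - cst x0 * x^-1) 1.
    rewrite -[X in rv _ _ X](subr0 1) -(mulr0 x0); apply: rvB; first exact: rv1.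
    by apply: rvM => //; exact: rv_const.
  rewrite valM ?x_neq0 // ?(rv_neq0 _ rq) ?oner_eq0 // (val_rv _ rq) ?oner_eq0 // val_inf_x.
  by [].
have ox : ordge p (-2) x by rewrite ordgeE ?x_neq0 // val_inf_x.
have oy : ordge p (-3) y by rewrite ordgeE ?y_neq0 // val_inf_y.
have oc n c : (n <= 0)%R -> ordge p n (cst c) by move=> n0; apply: ordge_le n0 _; exact: ordge_cst.
have od : ordge p 2 (x - cst x0)^-1 by rewrite ordgeE ?invr_eq0 // valV // vx.
have od2 : ordge p 4 ((x - cst x0) ^+ 2)^-1.
  by rewrite ordgeE ?invr_eq0 ?expf_neq0 // valV ?expf_neq0 // valX // vx.
have exi : _ := chord_xi (cst y0) (w_eq X) d0; rewrite -/lam -/xi in exi.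
have oxi : ordge p 0 xi.
  rewrite exi; apply: (ordgeMe (m := -4) (n := 4)) => //.
  apply: ordgeD; last first.
    apply: (ordgeMe (m := 0) (n := -4)) => //; last by apply: ordge_le oy.
    by apply: ordgeM0; [exact: ordge_nat|exact: ordge_cst].
  apply: ordgeD; last first.
    by apply: (ordge_le (m := 0)) => //; apply: ordgeB; [apply: ordgeD|];
      rewrite ?ordgeX ?ordge_cst.
  apply: ordgeD.
    by apply: (ordgeMe (m := 0) (n := -4)) => //; [exact: ordge_cst|rewrite expr2;
      exact: (ordgeMe (m := -2) (n := -2))].
  apply: (ordgeMe (m := -2) (n := -2)) => //.
  by rewrite -rmorphXn -rmorphD oc.
split => //; apply: ordgeB; first exact: ordge_cst.
apply: (ordgeMe (m := -1) (n := 1)) => //.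
  apply: (ordgeMe (m := -3) (n := 2)) => //; apply: ordgeD => //; exact: oc.
have -> : xi - cst x0 = ((cst (wa X) + 3 * cst x0 ^+ 2) * x
      + (cst (wb X) + cst y0 ^+ 2 - 2 * cst x0 ^+ 3) + 2 * cst y0 * y) / (x - cst x0) ^+ 2.
  by rewrite exi; field; exact: d0.
apply: (ordgeMe (m := -3) (n := 4)) => //.
have o2 (m : nat) : ordge p 0 (m%:R : K) by exact: ordge_nat.
have oo c : ordge p 0 (cst c) by exact: ordge_cst.
apply: ordgeD; last first.
  by apply: (ordgeMe (m := 0) (n := -3)) => //; apply: ordgeM0.
apply: (ordge_le (m := -2)) => //; apply: ordgeD.
  by apply: (ordgeMe (m := 0) (n := -2)) => //; apply: ordgeD => //; apply: ordgeM0 => //;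
    exact: ordgeX.
apply: (ordge_le (m := 0)) => //; apply: ordgeB; first by apply: ordgeD => //; exact: ordgeX.
by apply: ordgeM0 => //; exact: ordgeX.
Qed.

Let reg_pair p : p <> q -> ordge p 0 xi /\ ordge p 0 eta.
Proof.
move=> ne; have [->|ni] := pselect (p = Infinity); first exact: reg_inf.
apply: reg_aff; first exact: reg_lam.
case: p ni {ne} => // x1 y1 h1 _; apply/ordge_regP/rv_reg; exists x1; exact: rv_x.
Qed.

(** Otherwise lam is regular at q, so y + y0 = lam (x - x0) vanishes at q, which
    means y0 = 0; then lam ^ 2 (x - x0) = wf(x) / (x - x0) vanishes at q, against
    the simplicity of the roots of the cubic. *)
Let xi_q : ~ ordge q 0 xi.
Proof.
move=> hxi.
have hx : ordge q 0 x by apply/ordge_regP/rv_reg; exists x0; exact: rv_x.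
have : ordge q 0 (lam ^+ 2).
  have -> : lam ^+ 2 = xi + x + cst x0 by rewrite /xi; ring.
  by apply: ordgeD; rewrite ?ordge_cst // ordgeD.
have [l0|l0] := eqVneq lam 0.
  have e : y = - cst y0.
    apply/eqP; rewrite -addr_eq0; move/eqP: l0; rewrite mulf_eq0 invr_eq0 (negbTE d0) orbF.
    by [].
  generalize (pq_eq0 (X := X) (p := y0%:P) (q := 1)); rewrite pxC px1 mul1r e subrr.
  by move=> /(_ erefl) [_ /eqP]; rewrite oner_eq0.
rewrite ordgeE ?expf_neq0 // valX // => v2.
have {v2} : ordge q 0 lam by rewrite ordgeE //; lia.
move=> /ordge_regP/rv_reg [c hc].
have ry : rv q (y + cst y0) 0.
  rewrite -(mulr0 c); have -> : y + cst y0 = lam * (x - cst x0) by rewrite divfK.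
  by apply: rvM hc _; rewrite -(subrr x0); apply: rvB; [exact: rv_x|exact: rv_const].
have y00 : y0 = 0.
  have /(rv_uniq ry)/esym : rv q (y + cst y0) (y0 + y0) by apply: rvD;
    [exact: rv_y|exact: rv_const].
  by rewrite -mulr2n -mulr_natl => /eqP; rewrite mulf_eq0 (negbTE (two_neq0 (k := k))) => /eqP.
have [g [eg g0]] : exists g : {poly k}, wf = g * ('X - x0%:P) /\ g.[x0] != 0.
  by apply: wf_simple_root; rewrite wf_horner -h0 y00 expr0n.
have eg' : px g = lam ^+ 2 * (x - cst x0).
  apply: (mulIf d0); generalize (px_wf X); rewrite eg pxM pxD pxN pxX pxC => ->.
  by rewrite -mulrA -expr2 -exprMn divfK // y00 rmorph0 addr0.
have : rv q (px g) (c ^+ 2 * (x0 - x0)).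
  rewrite eg'; apply: rvM; first exact: rvX.
  by apply: rvB; [exact: rv_x|exact: rv_const].
by rewrite subrr mulr0 => /(rv_uniq (rv_px _ _))/eqP; rewrite (negbTE g0).
Qed.

Let pxi (p : {poly k}) : K := (map_poly cst p).[xi].

Let pxiM (p1 p2 : {poly k}) : pxi (p1 * p2) = pxi p1 * pxi p2.
Proof. by rewrite /pxi rmorphM hornerM. Qed.
Let pxiD (p1 p2 : {poly k}) : pxi (p1 + p2) = pxi p1 + pxi p2.
Proof. by rewrite /pxi rmorphD hornerD. Qed.
Let pxiN (p1 : {poly k}) : pxi (- p1) = - pxi p1.
Proof. by rewrite /pxi rmorphN hornerN. Qed.
Let pxiC c : pxi c%:P = cst c.
Proof. by rewrite /pxi map_polyC hornerC. Qed.
Let pxi1 : pxi 1 = 1.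
Proof. by rewrite -(rmorph1 polyC) pxiC rmorph1. Qed.
Let pxi0 : pxi 0 = 0.
Proof. by rewrite -(rmorph0 polyC) pxiC rmorph0. Qed.
Let pxiX : pxi 'X = xi.
Proof. by rewrite /pxi map_polyX hornerX. Qed.

(** xi has a pole at q, so it is not a root of a polynomial over k. *)
Let xi_trans (p : {poly k}) : pxi p = 0 -> p = 0.
Proof.
have [r ->] : _ := closed_field_poly_normal p; rewrite -mul_polyC pxiM pxiC => /eqP.
rewrite mulf_eq0 fmorph_eq0 => /orP[/eqP->|]; first by rewrite mul0r.
elim: r => [|c r IH]; first by rewrite big_nil pxi1 oner_eq0.
rewrite big_cons pxiM pxiD pxiN pxiC pxiX mulf_eq0 subr_eq0 => /orP[/eqP e|/IH /eqP].
  by exfalso; apply: xi_q; rewrite e ordge_cst.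
by rewrite mulf_eq0 => /orP[/eqP-> | /eqP ->]; rewrite ?mulr0 ?mul0r.
Qed.

Let pxi_eq0 (p : {poly k}) : (pxi p == 0) = (p == 0).
Proof.
by apply/eqP/eqP => [/xi_trans//|->]; rewrite -(rmorph0 polyC) pxiC rmorph0.
Qed.

Let inF (z : K) := exists p q r : {poly k}, r != 0 /\ z = (pxi p + pxi q * eta) / pxi r.

Let inFD a b : inF a -> inF b -> inF (a + b).
Proof.
move=> [p1 [q1 [r1 [n1 ->]]]] [p2 [q2 [r2 [n2 ->]]]].
exists (p1 * r2 + p2 * r1), (q1 * r2 + q2 * r1), (r1 * r2); split; first by rewrite mulf_neq0.
rewrite addf_div ?pxi_eq0 // !pxiD !pxiM; congr (_ / _); ring.
Qed.

Let pxi_wf : pxi wf = eta ^+ 2.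
Proof.
by rewrite eqn wfE /pxi !rmorphD /= map_polyXn map_polyZ map_polyX map_polyC !(hornerD,
  hornerXn, hornerZ, hornerX, hornerC).
Qed.

Let inFM a b : inF a -> inF b -> inF (a * b).
Proof.
move=> [p1 [q1 [r1 [n1 ->]]]] [p2 [q2 [r2 [n2 ->]]]].
exists (p1 * p2 + q1 * q2 * wf), (p1 * q2 + q1 * p2), (r1 * r2); split; first by rewrite mulf_neq0.
rewrite mulf_div !pxiD !pxiM pxi_wf; congr (_ / _); ring.
Qed.

Let inFV a : inF a -> inF a^-1.
Proof.
move=> [p1 [q1 [r1 [n1 ->]]]]; have [z0|z0] := eqVneq (pxi p1 + pxi q1 * eta) 0.
  rewrite z0 mul0r invr0; exists 0, 0, 1; rewrite oner_neq0; split => //.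
  by rewrite pxi0 mul0r addr0 mul0r.
have eN : pxi (p1 ^+ 2 - q1 ^+ 2 * wf) = (pxi p1 + pxi q1 * eta) * (pxi p1 - pxi q1 * eta).
  rewrite !expr2 pxiD pxiN !pxiM pxi_wf; ring.
have N0 : p1 ^+ 2 - q1 ^+ 2 * wf != 0.
  apply: contraNneq z0 => /eqP; rewrite subr_eq0 => /eqP /sq_wf_eq0 [-> ->].
  by rewrite pxi0 mul0r addr0.
exists (r1 * p1), (- (r1 * q1)), (p1 ^+ 2 - q1 ^+ 2 * wf); split => //.
generalize (N0); rewrite -pxi_eq0 eN mulf_eq0 negb_or => /andP[_ z1].
rewrite pxiN !pxiM invf_div; field; by rewrite z0 z1.
Qed.

Let inF_cst c : inF (cst c).
Proof.
exists c%:P, 0, 1; rewrite oner_neq0; split => //.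
by rewrite pxi0 pxi1 pxiC mul0r addr0 divr1.
Qed.

Let inF_all z : inF z.
Proof.
have hN a : inF a -> inF (- a).
  by move=> h; rewrite -mulN1r -(rmorph1 cst) -rmorphN; apply: inFM.
have hxi : inF xi.
  exists 'X, 0, 1; rewrite oner_neq0; split => //.
  by rewrite pxi0 pxi1 pxiX mul0r addr0 divr1.
have heta : inF eta.
  exists 0, 1, 1; rewrite oner_neq0; split => //.
  by rewrite pxi0 pxi1 mul1r add0r divr1.
have hlam : inF lam.
  have n0 : xi - cst x0 != 0 by rewrite subr_eq0; apply/eqP => e; apply: xi_q; rewrite e ordge_cst.
  have -> : lam = (cst y0 - eta) / (xi - cst x0) by rewrite /eta opprB addrC subrK mulfK.
  by apply: inFM; [apply: inFD => //; exact: hN|apply: inFV; apply: inFD => //; exact: hN].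
have hx : inF x.
  have -> : x = lam * lam - xi - cst x0 by rewrite /xi expr2; ring.
  by apply: inFD; [apply: inFD; [exact: inFM|exact: hN]|exact: hN].
have hy : inF y.
  have -> : y = lam * (x - cst x0) - cst y0 by rewrite divfK // addrK.
  by apply: inFD; [apply: inFM => //; apply: inFD => //; exact: hN|exact: hN].
have hpx (p : {poly k}) : inF (px p).
  elim/poly_ind: p => [|p c IH]; first by rewrite px0 -(rmorph0 cst).
  by rewrite pxD pxM pxX pxC; apply: inFD => //; exact: inFM.
have [p [q' [r [_ ->]]]] : _ := field_pq z.
by apply: inFM; [apply: inFD => //; exact: inFM|exact: inFV].
Qed.

(** Translating by the point q moves the pole of the coordinates from infinity to
    q. The translated coordinates generate K because lam, then x and y, are
    rational functions of them. *)
Lemma wpair_affine : exists xi eta, wpair xi eta /\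
  forall p, p <> @Affine k X x0 y0 h0 -> ordge p 0 xi /\ ordge p 0 eta.
Proof. by exists xi, eta; split => //; split => //; exact: inF_all. Qed.

End Chord.

Lemma wpair_ex q : exists xi eta, wpair xi eta /\
  forall p, p <> q -> ordge p 0 xi /\ ordge p 0 eta.
Proof.
case: q => [|x0 y0 h0]; last exact: wpair_affine.
exists x, y; split; first by split; [exact: w_eq|exact: fx_transcendental|exact: ffield_gen].
move=> [//|x0 y0 h] _; split; apply/ordge_regP/rv_reg.
  by exists x0; exact: rv_x.
by exists y0; exact: rv_y.
Qed.

End Translation.

(** * Strong approximation *)

Section Approximation.
Variables (k : closedFieldType) (X : elliptic_curve k).
Context {ch : char0 k}.
Notation K := (ffield X).
Notation cst := (fconst X).
Notation x := (fx X).
Notation y := (fy X).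
Notation px := (@px k X).
Implicit Types (p q : point X) (f g : K) (c e : k).

Lemma rv_ceval p u v u0 v0 P : rv p u u0 -> rv p v v0 ->
  rv p (ceval u v P) (eval2 P u0 v0).
Proof.
move=> hu hv.
have pol (a : {poly k}) : rv p (map_poly cst a).[u] a.[u0].
  elim/poly_ind: a => [|a c IH]; first by rewrite rmorph0 !horner0; exact: rv0.
  rewrite rmorphD rmorphM /= map_polyX map_polyC !(hornerD, hornerMX, hornerC).
  by apply: rvD (rv_const _ _); exact: rvM.
elim/poly_ind: P => [|P a IH].
  by rewrite -(rmorph0 polyC) cevalC eval2C; exact: pol.
rewrite cevalD cevalM eval2D eval2M cevalX eval2X cevalC eval2C.
by apply: rvD (pol _); exact: rvM.
Qed.

Section Pair.
Variables (xi eta : K) (q : point X).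
Hypothesis hw : wpair xi eta.
Hypothesis reg : forall p, p <> q -> ordge p 0 xi /\ ordge p 0 eta.

Let e1 := let: And3 a _ _ := hw in a.
Let e2 := let: And3 _ a _ := hw in a.
Let e3 := let: And3 _ _ a := hw in a.

Let X' : elliptic_curve k :=
  @EllipticCurve k (wa X) (wb X) (w_smooth X) K cst xi eta e1 e2 e3.

(** With xi and eta as coordinates, the points other than q are affine points of
    the curve X', with the same local rings: the local ring of X' lies in that of
    X, and a valuation ring has no proper overring in which its nonunits stay
    nonunits. *)
Let transfer p : p <> q -> exists c1 c2 (h : c2 ^+ 2 = c1 ^+ 3 + wa X' * c1 + wb X'),
  [/\ rv p xi c1, rv p eta c2 & forall f c, @rv k X' (Affine h) f c <-> rv p f c].
Proof.
move=> /reg [/ordge_regP/rv_reg [c1 h1] /ordge_regP/rv_reg [c2 h2]].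
have h : c2 ^+ 2 = c1 ^+ 3 + wa X' * c1 + wb X'.
  apply: rv_uniq (rvX 2 h2) _; rewrite e1.
  by apply: rvD (rv_const _ _); apply: rvD; [exact: rvX|apply: rvM => //; exact: rv_const].
exists c1, c2, h; split => //.
have one f c : @rv k X' (Affine h) f c -> rv p f c.
  move=> [P [Q [n1 n2 -> ->]]]; apply: rvM; first exact: rv_ceval.
  by apply: rvV => //; exact: rv_ceval.
move=> f c; split; first exact: one.
move=> hf; have [reg'|nreg] := pselect (@ordge k X' (Affine h) 0 f).
  move/ordge_regP/rv_reg: reg' => [e he].
  by rewrite (rv_uniq hf (one _ _ he)).
have f0 : f != 0 by apply: contra_notN nreg => /eqP ->; exact: ordge_0.
have : @rv k X' (Affine h) f^-1 0.
  apply/ordge1P; rewrite ordgeE ?invr_eq0 // valV //.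
  by move/negP: nreg; rewrite ordgeE //; lia.
move=> /one /(rvM hf); rewrite mulr0 divff // => /(rv_uniq (rv1 _)) /eqP.
by rewrite oner_eq0.
Qed.

(** A uniformizer at an affine point of X' can be taken polynomial in xi and eta,
    so that it has no pole outside q. *)
Lemma pair_param p : p <> q -> exists u, [/\ forall p', p' <> q -> ordge p' 0 u,
  u != 0 & val p u = 1].
Proof.
move=> pq; have [c1 [c2 [h [h1 h2 H]]]] : _ := transfer pq.
have [q1 [q2 hu]] : _ := @uniformizer_affine k X' ch c1 c2 h.
pose u : K := (map_poly cst q1).[xi] + (map_poly cst q2).[xi] * eta.
rewrite -[_ + _]/u in hu.
have hpx p' (a : {poly k}) : p' <> q -> ordge p' 0 ((map_poly cst a).[xi]).
  move=> /reg [r1 _]; elim/poly_ind: a => [|a c IH].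
    by rewrite rmorph0 horner0 ordge_0.
  rewrite rmorphD rmorphM /= map_polyX map_polyC !(hornerD, hornerMX, hornerC).
  by rewrite ordgeD ?ordge_cst // ordgeM0.
have [u0' ru hm] : _ := hu; have u0 : u != 0 := u0'; exists u; split => //.
  by move=> p' pq'; rewrite ordgeD ?ordgeM0 ?hpx //; case: (reg pq').
have ou : ordge p 1 u by apply/ordge1P/H.
have [m [c c0 hc]] : _ := hm _ (unif_neq0 p).
have v0 : _ := val_rv c0 (proj1 (H _ _) hc).
generalize (val_unif p); rewrite -(divfK (expfz_neq0 m u0) (unif p)).
rewrite (@valM _ _ _ _ _ (u ^ m)) ?mulf_neq0 ?invr_eq0 ?expfz_neq0 ?unif_neq0 //.
rewrite v0 valXz // add0r; move: ou; rewrite ordgeE //.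
move: (val p u) => v v1 e; have m1 : (1 <= m)%R by move: e v1; clear; nia.
by move: e v1 m1; clear; nia.
Qed.

(** Points at which xi and eta both agree have the same local ring, hence are
    equal. *)
Lemma pair_sep p1 p2 : p1 <> p2 -> p1 <> q -> p2 <> q ->
  exists h, [/\ forall p', p' <> q -> ordge p' 0 h, rv p1 h 1 & rv p2 h 0].
Proof.
move=> ne n1 n2; have [c1 [c2 [h [h1 h2 H]]]] : _ := transfer n1.
have [d1 [d2 [h' [h1' h2' H']]]] : _ := transfer n2.
suff [z [a [b [rz za zb ab]]]] : exists z a b, [/\ forall p', p' <> q -> ordge p' 0 z,
    rv p1 z a, rv p2 z b & a != b].
  exists (cst (a - b)^-1 * (z - cst b)); split.
  - move=> p' hp; rewrite ordgeM0 ?ordge_cst // ordgeB ?ordge_cst //; exact: rz.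
  - rewrite -[X in rv _ _ X](mulVf (_ : a - b != 0)) ?subr_eq0 //.
    by apply: rvM (rv_const _ _) _; apply: rvB => //; exact: rv_const.
  - rewrite -[X in rv _ _ X](mulr0 (a - b)^-1) -(subrr b).
    by apply: rvM (rv_const _ _) _; apply: rvB => //; exact: rv_const.
have [e|d] := eqVneq c1 d1; last by exists xi, c1, d1; split=> // p' /reg [].
have [e'|d'] := eqVneq c2 d2; last by exists eta, c2, d2; split=> // p' /reg [].
exfalso; subst d1 d2.
have eh : h' = h by exact: eq_irrelevance.
have [f hf] : _ := reg_sep ne; apply; move/rv_reg: hf => [c hc].
by apply/rv_reg; exists c; apply/H'; rewrite eh; apply/H.
Qed.

End Pair.

Lemma param q p : p <> q ->
  exists u, [/\ forall p', p' <> q -> ordge p' 0 u, u != 0 & val p u = 1].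
Proof. by have [xi [eta [hw hr]]] : _ := wpair_ex q; exact: (pair_param hw hr). Qed.

Lemma separator q p1 p2 : p1 <> p2 -> p1 <> q -> p2 <> q ->
  exists h, [/\ forall p', p' <> q -> ordge p' 0 h, rv p1 h 1 & rv p2 h 0].
Proof. by have [xi [eta [hw hr]]] : _ := wpair_ex q; exact: (pair_sep hw hr). Qed.

(** Apply 1 - (1 - h ^ N) ^ N to a function h with value 1 at p0 and zeros on S;
    the result is close to 1 at p0 and to 0 on S. *)
Lemma idem q p0 (S : seq (point X)) (N : nat) : p0 <> q -> q \notin S -> p0 \notin S ->
  exists e : K, [/\ forall p', p' <> q -> ordge p' 0 e, ordge p0 N (1 - e) &
    forall p, p \in S -> ordge p N e].
Proof.
move=> n0 qS pS.
have [h [hr h1 hS]] : exists h, [/\ forall p', p' <> q -> ordge p' 0 h, rv p0 h 1 &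
    forall p, p \in S -> ordge p 1 h].
  elim: S qS pS => [|p S IH]; first by exists 1; split => // *; [exact: ordge_1|exact: rv1].
  rewrite in_cons negb_or => /andP[qp qS]; rewrite in_cons negb_or => /andP[pp pS].
  have [h [hr h1 hS]] := IH qS pS.
  have [|||h' [hr' h1' h0']] := @separator q p0 p.
  - exact/eqP.
  - exact: n0.
  - by apply/eqP; rewrite eq_sym.
  exists (h * h'); split.
  - by move=> p' hp; rewrite ordgeM0 ?hr ?hr'.
  - by rewrite -(mulr1 1); exact: rvM.
  - have pq : p <> q by apply/eqP; rewrite eq_sym.
    move=> p'; rewrite in_cons => /orP[/eqP->|pS'].
      by apply: (ordgeMe (m := 0) (n := 1)); rewrite ?hr //; apply/ordge1P.
    apply: (ordgeMe (m := 1) (n := 0)); rewrite ?hS // hr' //.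
    by move=> e; move: qS; rewrite -e pS'.
exists (1 - (1 - h ^+ N) ^+ N); split.
- by move=> p' hp; rewrite ordgeB ?ordge_1 // ordgeX // ordgeB ?ordge_1 // ordgeX // hr.
- rewrite subKr; apply: ordgeX1; apply/ordge1P; rewrite -(subrr 1); apply: rvB (rv1 _) _.
  by rewrite -(expr1n k N); exact: rvX.
move=> p pS'; have pq : p <> q by move=> e; move: qS; rewrite -e pS'.
rewrite -[X in X - _](expr1n K N) subrXX subKr.
apply: (ordgeMe (m := N) (n := 0)); rewrite ?addr0 //; first by apply: ordgeX1; exact: hS.
apply: ordge_sum => i _; rewrite ordgeM0 ?ordgeX ?ordge_1 // ordgeB ?ordge_1 // ordgeX // hr //.
Qed.

Lemma val_bound (S : seq (point X)) f : exists N : nat, forall p, p \in S -> val p f <= N.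
Proof.
elim: S => [|p S [N hN]]; first by exists 0%N.
exists (N + `|val p f|)%N => p'; rewrite in_cons => /orP[/eqP->|/hN]; lia.
Qed.

(** For negative orders, a local parameter u at p0 is inverted after its other
    zeros have been cancelled by a function equal to 1 at p0. *)
Lemma mono_ex q p0 (j : int) : p0 <> q ->
  exists w, [/\ w != 0, val p0 w = j & forall p, p <> q -> p <> p0 -> ordge p 0 w].
Proof.
move=> n0; have [u [ru u0 v1]] : _ := param n0.
suff [w [w0 vw rw]] : exists w, [/\ w != 0, val p0 w = -1 & forall p, p <> q -> p <> p0 ->
  ordge p 0 w].
  case: j => j.
    exists (u ^+ j); rewrite expf_neq0 // valX // v1; split => //; first by rewrite natz.
    by move=> p hp _; rewrite ordgeX // ru.
  exists (w ^+ j.+1); rewrite expf_neq0 // valX // vw NegzE; split => //.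
    by rewrite mulNrn natz.
  by move=> p hp hp'; rewrite ordgeX // rw.
have /finite_seqP [S eS] : finite_set [set p | val p u != 0] by exact: finite_val.
pose S' := [seq p <- S | (p != q) && (p != p0)].
have [N hN] : _ := val_bound S' u.
have [|||e [re e1 eS']] := @idem q p0 S' N.+1 => //.
- by rewrite mem_filter eqxx.
- by rewrite mem_filter eqxx andbF.
have re1 : rv p0 e 1.
  rewrite -(subKr 1 e) -[X in rv _ _ X](subr0 1); apply: rvB (rv1 _) _.
  by apply/ordge1P; apply: ordge_le e1.
have e0 : e != 0 by apply: rv_neq0 re1; exact: oner_neq0.
exists (e / u); split.
- by rewrite mulf_neq0 ?invr_eq0.
- by rewrite valM ?invr_eq0 // valV // v1 (val_rv _ re1) // oner_eq0.
move=> p pq pp; have [pS|pS] := boolP (p \in S').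
  generalize (eS' p pS); generalize (hN p pS).
  rewrite !ordgeE ?mulf_neq0 ?invr_eq0 // valM ?invr_eq0 // valV //; lia.
have vu : val p u = 0.
  apply/eqP; apply: contraNT pS => h; rewrite mem_filter; apply/andP; split.
    by apply/andP; split; apply/eqP.
  by have : [set p | val p u != 0] p by []; rewrite eS.
rewrite ordgeM0 ?re // ordgeE ?invr_eq0 // valV // vu //.
Qed.

(** The Laurent expansion at p0 is matched term by term. *)
Lemma approx_one q p0 (A : K) (N : int) : p0 <> q ->
  exists f, ordge p0 N (f - A) /\ forall p, p <> q -> p <> p0 -> ordge p 0 f.
Proof.
move=> n0; have [n hn] : exists n : nat, ordge p0 (N - n%:Z) A.
  by exists `|N - val p0 A|%N; apply: ordge_le (val_ordge _ _); lia.
elim: n A hn => [|n IH] A hn.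
  exists 0; rewrite sub0r ordgeN; split; last by move=> *; exact: ordge_0.
  by apply: ordge_le hn; lia.
have [w [w0 vw rw]] : _ := mono_ex (N - n.+1%:Z) n0.
have [c hc] : _ := ordge_lead w0 vw hn.
have [|f [hf rf]] := IH (A - cst c * w); first by apply: ordge_le hc; lia.
exists (f + cst c * w); split; first by rewrite (_ : _ - A = f - (A - cst c * w)) //; ring.
by move=> p h1 h2; rewrite ordgeD ?rf // ordgeM0 ?ordge_cst ?rw.
Qed.

(** Strong approximation: with poles allowed at the one point q only, a function
    can be prescribed at finitely many other points up to any order. *)
Lemma approx q (S : seq (point X)) (A : point X -> K) (N : nat) : q \notin S ->
  exists f, (forall p, p \in S -> ordge p N (f - A p)) /\
            (forall p, p \notin S -> p <> q -> ordge p 0 f).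
Proof.
elim: S => [|p0 S IH].
  by move=> _; exists 0; split => // p _ _; exact: ordge_0.
rewrite in_cons negb_or => /andP[qp qS]; have [f' [hf' rf']] := IH qS.
have [p0S|p0S] := boolP (p0 \in S).
  exists f'; split => p; rewrite in_cons.
    by case/orP => [/eqP->|]; apply: hf'.
  by rewrite negb_or => /andP[_]; exact: rf'.
have n0 : p0 <> q by apply/eqP; rewrite eq_sym.
have [f0 [hf0 rf0]] : _ := approx_one (A p0 - f') N n0.
have [e [re e1 eS]] : _ := idem (N + `|val p0 f0|) n0 qS p0S.
have neq p : p \in S -> p <> q by move=> h e'; move: qS; rewrite -e' h.
have neq0 p : p \in S -> p <> p0 by move=> h e'; move: p0S; rewrite -e' h.
exists (f' + e * f0); split => p.
  rewrite in_cons => /orP[/eqP->|pS].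
    rewrite (_ : _ - A p0 = (f0 - (A p0 - f')) - (1 - e) * f0); last by ring.
    apply: ordgeB => //.
    by apply: (ordge_le _ (ordgeM e1 (val_ordge p0 f0))); lia.
  rewrite addrAC ordgeD ?hf' //.
  apply: (ordge_le _ (ordgeM (eS p pS) (rf0 p (neq p pS) (neq0 p pS)))); lia.
rewrite in_cons negb_or => /andP[pp pS] pq.
rewrite ordgeD ?rf' // ordgeM0 ?re // rf0 //; exact/eqP.
Qed.

(** The cohomology of O(infinity) is computed by hand; it is the one case from
    which that of all vector bundles is derived. *)

Lemma valDl p f g : f != 0 -> ordge p (val p f + 1) g -> f + g != 0 /\ val p (f + g) = val p f.
Proof.
move=> f0; have [->|g0] := eqVneq g 0; first by rewrite addr0.
rewrite ordgeE // => h.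
have hm : monoat p (unif p) (f + g) (val p f).
  apply: (@monoatD _ _ _ _ _ _ f g _ (val p g));
    [exact: unif_neq0|exact: rv_unif|lia|exact: val_mono|exact: val_mono].
by split; [exact: monoat_neq0 hm|exact: val_eq].
Qed.

Lemma val_inf_px (a : {poly k}) : a != 0 -> val Infinity (px a) = - (2 * (size a).-1%:Z).
Proof.
elim/poly_ind: a => [|a c IH]; first by rewrite eqxx.
have [->|a0] := eqVneq a 0.
  rewrite mul0r add0r polyC_eq0 pxC => c0.
  by rewrite val_cst // size_polyC c0.
move=> _; rewrite size_MXaddC (negbTE a0) /= pxD pxM pxX pxC.
have v : val Infinity (px a * x) = - (2 * (size a)%:Z).
  rewrite valM ?px_eq0 ?x_neq0 // IH // val_inf_x.
  by move: a0; rewrite -size_poly_gt0; move: (size _) => n; lia.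
have oc : ordge Infinity (val Infinity (px a * x) + 1) (cst c).
  rewrite v; apply: ordge_le (ordge_cst _ _).
  by move: a0; rewrite -size_poly_gt0; move: (size _) => n; lia.
have nz : px a * x != 0 by rewrite mulf_neq0 ?px_eq0 ?x_neq0.
by have [_ ->] := valDl nz oc.
Qed.

(** The order allowed at p for a section of O(infinity). *)
Definition inf_pole p : int := if p == Infinity then -1 else 0.

(** k[x, y] is integrally closed. A root x0 of the denominator r is a common root
    of a and b: both a + b y and a - b y vanish at the points above x0, and if
    these points coincide, orders are compared at the single point. *)
Lemma affine_regular f : (forall p, p <> Infinity -> ordge p 0 f) ->
  exists a b : {poly k}, f = px a + px b * y.
Proof.
move=> hf; have [a [b [r [r0 ef]]]] : _ := field_pq f.
have [n] := ubnP (size r); elim: n => // n IH in a b r r0 ef * => szr.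
have [s1|s1] := eqVneq (size r) 1%N.
  have /size_poly1P [c c0 er] : size r == 1%N by apply/eqP.
  exists (c^-1 *: a), (c^-1 *: b); rewrite ef er pxC !pxZ fmorphV; field.
  by rewrite fmorph_eq0.
have /closed_rootP [x0 hx0] : _ := s1.
have [r1 er] : _ := factor_theorem r x0 hx0.
have r10 : r1 != 0 by apply: contraNneq r0; rewrite er => ->; rewrite mul0r.
have szr1 : (size r1 < size r)%N by rewrite er szM ?polyXsubC_eq0 // size_XsubC addn2.
suff [/rootP/factor_theorem [a1 ea] /rootP/factor_theorem [b1 eb]] : a.[x0] = 0 /\ b.[x0] = 0.
  apply: (IH a1 b1 r1) => //; last exact: leq_trans szr1 _.
  rewrite ef er ea eb !pxM pxD pxN pxX pxC; field.
  by rewrite px_eq0 r10 x_neq_cst.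
have [y0 hy0] : exists y0, y0 ^+ 2 = x0 ^+ 3 + wa X * x0 + wb X.
  have /closed_rootP [y0 /rootP hb] : size ('X^2 - ((wf X).[x0])%:P) != 1%N.
    by rewrite size_XnsubC.
  exists y0; apply/eqP; rewrite -wf_horner -subr_eq0; move: hb.
  by rewrite !(hornerD, hornerN, hornerXn, hornerC) => ->.
have key y1 (h : y1 ^+ 2 = x0 ^+ 3 + wa X * x0 + wb X) : a.[x0] + b.[x0] * y1 = 0.
  have /ordge_regP/rv_reg [c hc] : _ := hf (Affine h) ltac:(done).
  have h1 : rv (Affine h) (f * px r) (c * r.[x0]) by apply: rvM => //; exact: rv_px.
  have h2 : rv (Affine h) (f * px r) (a.[x0] + b.[x0] * y1).
    by rewrite ef divfK ?px_eq0 //; apply: rvD; [|apply: rvM];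
      [exact: rv_px|exact: rv_px|exact: rv_y].
  by rewrite (rv_uniq h2 h1) (rootP hx0) mulr0.
have hy0' : (- y0) ^+ 2 = x0 ^+ 3 + wa X * x0 + wb X by rewrite sqrrN.
have k1 : _ := key _ hy0; have k2 : _ := key _ hy0'.
have a0 : a.[x0] = 0.
  have : 2 * a.[x0] = 0 by rewrite -[RHS](addr0 0) -{1}k1 -k2; ring.
  by move/eqP; rewrite mulf_eq0 (negbTE (two_neq0 (k := k))) => /eqP.
split => //; move: k1; rewrite a0 add0r => /eqP; rewrite mulf_eq0 => /orP[/eqP//|/eqP y00].
set p := Affine hy0.
have ry : rv p y 0 by rewrite -y00; exact: rv_y.
have [g [eg g0]] : exists g : {poly k}, wf X = g * ('X - x0%:P) /\ g.[x0] != 0.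
  by apply: wf_simple_root; rewrite wf_horner -hy0 y00 expr0n.
have rg : rv p (px g) g.[x0] by exact: rv_px.
have vx : val p (x - cst x0) = 2 * val p y.
  generalize (px_wf X); rewrite eg pxM pxD pxN pxX pxC => /(congr1 (val p)).
  by rewrite valM ?x_neq_cst ?(rv_neq0 g0 rg) // (val_rv g0 rg) add0r valX ?y_neq0 // => ->; lia.
have vy : 1 <= val p y by rewrite -ordgeE ?y_neq0 //; apply/ordge1P.
have ox (d : {poly k}) : d.[x0] = 0 -> ordge p (2 * val p y) (px d).
  move=> /rootP/factor_theorem [d1 ->]; rewrite pxM pxD pxN pxX pxC -vx.
  apply: (ordgeMe (m := 0) (n := val p (x - cst x0))); rewrite ?add0r ?val_ordge //.
  by apply/ordge_regP/rv_reg; exists d1.[x0]; exact: rv_px.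
have of' : ordge p 0 f by exact: hf.
have oby : ordge p (2 * val p y) (px b * y).
  have -> : px b * y = f * px r - px a by rewrite ef divfK ?px_eq0 // addrAC subrr add0r.
  apply: ordgeB; last exact: ox.
  by apply: (ordgeMe (m := 0) (n := 2 * val p y)); rewrite ?add0r // ox //; exact/rootP.
have [->|b0] := eqVneq b 0; first by rewrite horner0.
have /ordge1P : ordge p 1 (px b).
  by move: oby; rewrite !ordgeE ?mulf_neq0 ?px_eq0 ?y_neq0 // valM ?px_eq0 ?y_neq0 //; lia.
by move/(rv_uniq (rv_px _ _)).
Qed.

(** The pole orders at infinity of the functions a(x) + b(x) y are 0, 2, 3, ...,
    never 1: the sections of O(infinity) are constant. *)
Lemma h0_infinity f : (forall p, ordge p (inf_pole p) f) -> exists c, f = cst c.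
Proof.
move=> hf.
have [|a [b ef]] := @affine_regular f.
  by move=> p /eqP/negbTE hp; generalize (hf p); rewrite /inf_pole hp.
generalize (hf Infinity); rewrite /inf_pole eqxx.
have vb : b != 0 -> val Infinity (px b * y) = - (2 * (size b).-1%:Z) - 3.
  by move=> b0; rewrite valM ?px_eq0 ?y_neq0 // val_inf_px // val_inf_y.
have [eb|b0] := eqVneq b 0.
  move: ef; rewrite eb px0 mul0r addr0 => ef.
  have [ea|a0] := eqVneq a 0; first by exists 0; rewrite ef ea px0 rmorph0.
  rewrite ef ordgeE ?px_eq0 // val_inf_px // => sz.
  have /size1_polyC -> : (size a <= 1)%N by move: sz; move: (size _) => n; lia.
  by exists a`_0; rewrite pxC.
have nb : px b * y != 0 by rewrite mulf_neq0 ?px_eq0 ?y_neq0.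
have [ea|a0] := eqVneq a 0.
  by rewrite ef ea px0 add0r ordgeE // vb //; lia.
have na : px a != 0 by rewrite px_eq0.
have va : _ := val_inf_px a0.
case: (ltgtP (val Infinity (px a)) (val Infinity (px b * y))) => lt.
- have [|n0 v0] := @valDl Infinity (px a) (px b * y) na; first by rewrite ordgeE //; lia.
  by rewrite ef ordgeE // v0; move: lt; rewrite va vb //; lia.
- have [|n0 v0] := @valDl Infinity (px b * y) (px a) nb; first by rewrite ordgeE //; lia.
  by rewrite ef addrC ordgeE // v0; rewrite vb //; lia.
by move: lt; rewrite va vb //; lia.
Qed.

(** The vanishing of H ^ 1(O(infinity)), in terms of principal parts: those at
    affine points are interpolated, and poles of order 2, 3, ... at infinity are
    removed by the monomials x ^ i and x ^ i y. *)
Lemma h1_infinity (S : seq (point X)) (A : point X -> K) : exists f, forall p,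
  ordge p (inf_pole p) (f - (if p \in S then A p else 0)).
Proof.
pose S' := [seq p <- S | p != Infinity].
have [|f0 [hf0 rf0]] := @approx Infinity S' A 0; first by rewrite mem_filter eqxx.
pose a := (if Infinity \in S then A Infinity else 0) - f0.
suff [g [rg hg]] : exists g, (forall p, p <> Infinity ->
  ordge p 0 g) /\ ordge Infinity (-1) (a - g).
  exists (f0 + g) => p; rewrite /inf_pole; have [->|/eqP np] := eqVneq p Infinity.
    by rewrite -ordgeN (_ : - _ = a - g) // /a; ring.
  have mS : (p \in S') = (p \in S) by rewrite mem_filter; move/eqP: np => ->.
  rewrite -mS addrAC ordgeD ?rg //; case: ifPn => pS; first exact: hf0.
  by rewrite subr0 rf0.
have [n hn] : exists n : nat, ordge Infinity (-1 - n%:Z) a.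
  by exists `|val Infinity a|%N; apply: ordge_le (val_ordge _ _); lia.
have regx p : p <> Infinity -> ordge p 0 x.
  by case: p => // x0 y0 h _; apply/ordge_regP/rv_reg; exists x0; exact: rv_x.
have regy p : p <> Infinity -> ordge p 0 y.
  by case: p => // x0 y0 h _; apply/ordge_regP/rv_reg; exists y0; exact: rv_y.
elim: n a hn => [|n IH] a hn.
  exists 0; rewrite subr0; split; first by move=> *; exact: ordge_0.
  by apply: ordge_le hn; lia.
have [w [w0 vw rw]] : exists w, [/\ w != 0, val Infinity w = -1 - n.+1%:Z & forall p,
  p <> Infinity -> ordge p 0 w].
  have [on|on] := boolP (odd n).
    exists (x ^+ (n./2) * y); split.
    - by rewrite mulf_neq0 ?expf_neq0 ?x_neq0 ?y_neq0.
    - rewrite valM ?expf_neq0 ?x_neq0 ?y_neq0 // valX ?x_neq0 // val_inf_x val_inf_y.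
      rewrite -mulr_natr natz; have := odd_double_half n; rewrite on -muln2; lia.
    - by move=> p hp; rewrite ordgeM0 ?ordgeX ?regx ?regy.
  exists (x ^+ (n./2).+1); split.
  - by rewrite expf_neq0 ?x_neq0.
  - rewrite valX ?x_neq0 // val_inf_x.
    rewrite -mulr_natr natz; have := odd_double_half n; rewrite (negbTE on) -muln2; lia.
  - by move=> p hp; rewrite ordgeX ?regx.
have [c hc] : _ := ordge_lead w0 vw hn.
have [|g [rg hg]] := IH (a - cst c * w); first by apply: ordge_le hc; lia.
exists (g + cst c * w); split; last by rewrite (_ : a - _ = a - cst c * w - g) //; ring.
by move=> p hp; rewrite ordgeD ?rg // ordgeM0 ?ordge_cst ?rw.
Qed.

End Approximation.

(** * Lattices over the local rings *)

Lemma invmx_mul (F : fieldType) n (A B : 'M[F]_n) : A \in unitmx -> B \in unitmx ->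
  invmx (A *m B) = invmx B *m invmx A.
Proof.
move=> uA uB; have uAB : A *m B \in unitmx by rewrite unitmx_mul uA.
rewrite -[RHS](mulmxK uAB) -!mulmxA (mulmxA (invmx A)) mulVmx // mul1mx.
by rewrite mulmxA mulVmx // mul1mx.
Qed.

Section LocalLattices.
Variables (k : closedFieldType) (X : elliptic_curve k).
Context {ch : char0 k}.
Notation K := (ffield X).
Notation cst := (fconst X).
Implicit Types (p q : point X) (f g : K) (c : k).

Definition mge p (e : int) m n (A : 'M[K]_(m, n)) := forall i j, ordge p e (A i j).

Lemma mge_0 p e m n : mge p e (0 : 'M[K]_(m, n)).
Proof. by move=> i j; rewrite mxE ordge_0. Qed.

Lemma mgeD p e m n (A B : 'M[K]_(m, n)) : mge p e A -> mge p e B -> mge p e (A + B).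
Proof. by move=> hA hB i j; rewrite mxE ordgeD. Qed.

Lemma mgeN p e m n (A : 'M[K]_(m, n)) : mge p e A -> mge p e (- A).
Proof. by move=> hA i j; rewrite mxE ordgeN. Qed.

Lemma mgeB p e m n (A B : 'M[K]_(m, n)) : mge p e A -> mge p e B -> mge p e (A - B).
Proof. by move=> hA hB; apply: mgeD => //; exact: mgeN. Qed.

Lemma mgeM p e1 e2 e m n l (A : 'M[K]_(m, n)) (B : 'M[K]_(n, l)) : e = e1 + e2 ->
  mge p e1 A -> mge p e2 B -> mge p e (A *m B).
Proof. by move=> -> hA hB i j; rewrite mxE ordge_sum // => h _; exact: ordgeM. Qed.

Lemma mgeM0 p m n l (A : 'M[K]_(m, n)) (B : 'M[K]_(n, l)) :
  mge p 0 A -> mge p 0 B -> mge p 0 (A *m B).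
Proof. exact: mgeM. Qed.

Lemma mgeZ p e1 e2 e m n (A : 'M[K]_(m, n)) a : e = e1 + e2 ->
  ordge p e1 a -> mge p e2 A -> mge p e (a *: A).
Proof. by move=> -> ha hA i j; rewrite mxE ordgeM. Qed.

Lemma mge_sum p e m n (I : Type) (r : seq I) (P : pred I) (F : I -> 'M[K]_(m, n)) :
  (forall i, P i -> mge p e (F i)) -> mge p e (\sum_(i <- r | P i) F i).
Proof. by move=> h; elim/big_ind: _ => //; [exact: mge_0|exact: mgeD]. Qed.

Lemma mge_le p e1 e2 m n (A : 'M[K]_(m, n)) : e2 <= e1 -> mge p e1 A -> mge p e2 A.
Proof. by move=> h hA i j; apply: ordge_le (hA i j). Qed.

Lemma mge_cst p m n (A : 'M[k]_(m, n)) : mge p 0 (map_mx cst A).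
Proof. by move=> i j; rewrite mxE ordge_cst. Qed.

Lemma mge_1 p n : mge p 0 (1%:M : 'M[K]_n).
Proof. by move=> i j; rewrite mxE; case: (_ == _); [exact: ordge_1|exact: ordge_0]. Qed.

Lemma mge_bound p m n (A : 'M[K]_(m, n)) : exists N : nat, mge p (- N%:Z) A.
Proof.
exists (\sum_i \sum_j `|val p (A i j)|)%N => i j; apply: ordge_le (val_ordge _ _).
rewrite (bigD1 i) //= (bigD1 j) //=; lia.
Qed.

Lemma ordge_prodn p (e : int) n (F : 'I_n -> K) : (forall i, ordge p e (F i)) ->
  ordge p (e *+ n) (\prod_i F i).
Proof.
elim: n F => [|n IH] F h; first by rewrite big_ord0 mulr0n ordge_1.
by rewrite big_ord_recl mulrS; apply: ordgeM => //; apply: IH.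
Qed.

Lemma mge_det p e n (A : 'M[K]_n) : mge p e A -> ordge p (e *+ n) (\det A).
Proof.
move=> h; apply: ordge_sum => s _; apply: (ordgeMe (m := 0) (n := e *+ n)); rewrite ?add0r //.
  by rewrite ordgeX // ordgeN ordge_1.
exact: ordge_prodn.
Qed.

Lemma mge_inv p n (A : 'M[K]_n) : mge p 0 A -> A \in unitmx -> val p (\det A) = 0 ->
  mge p 0 (invmx A).
Proof.
move=> hA uA v0; rewrite /invmx uA; apply: (@mgeZ _ 0 0) => //.
  have d0 : \det A != 0 by rewrite -unitfE -unitmxE.
  by rewrite ordgeE ?invr_eq0 // valV // v0.
move=> i j; rewrite mxE ordgeM0 ?ordgeX ?ordgeN ?ordge_1 //.
rewrite -(mul0rn _ n.-1); apply: mge_det => a b; rewrite !mxE; exact: hA.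
Qed.

Lemma rv_prod p (I : finType) (F : I -> K) (c : I -> k) :
  (forall i, rv p (F i) (c i)) -> rv p (\prod_i F i) (\prod_i c i).
Proof. by move=> h; elim/big_ind2: _ => //; [exact: rv1|move=> *; exact: rvM]. Qed.

Lemma rv_sum p (I : finType) (F : I -> K) (c : I -> k) :
  (forall i, rv p (F i) (c i)) -> rv p (\sum_i F i) (\sum_i c i).
Proof. by move=> h; elim/big_ind2: _ => //; [exact: rv0|move=> *; exact: rvD]. Qed.

Lemma rv_det p n (A : 'M[K]_n) (C : 'M[k]_n) : (forall i j, rv p (A i j) (C i j)) ->
  rv p (\det A) (\det C).
Proof.
move=> h; apply: rv_sum => s; apply: rvM; last by apply: rv_prod => i.
by apply: rvX; apply: rvN; exact: rv1.
Qed.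

Lemma mge_rv p m n (A : 'M[K]_(m, n)) : mge p 0 A ->
  exists C : 'M[k]_(m, n), mge p 1 (A - map_mx cst C).
Proof.
move=> hA; have h i j : exists c, rv p (A i j) c by apply/rv_reg/ordge_regP; exact: hA.
exists (\matrix_(i, j) projT1 (cid (h i j))) => i j.
by rewrite !mxE; case: cid => c /= /rv_ordge1.
Qed.

Lemma rv_mx p m n (A : 'M[K]_(m, n)) C : mge p 1 (A - map_mx cst C) ->
  forall i j, rv p (A i j) (C i j).
Proof. by move=> h i j; apply/rv_ordge1; have := h i j; rewrite !mxE. Qed.

(** A matrix D stands for the lattice of the row vectors v such that v D is
    integral at p. *)
Definition lat p m n (D : 'M[K]_n) (v : 'M[K]_(m, n)) := mge p 0 (v *m D).

Lemma latD p m n (D : 'M[K]_n) (v w : 'M[K]_(m, n)) : lat p D v -> lat p D w -> lat p D (v + w).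
Proof. by move=> h1 h2; rewrite /lat mulmxDl; exact: mgeD. Qed.

Lemma latB p m n (D : 'M[K]_n) (v w : 'M[K]_(m, n)) : lat p D v -> lat p D w -> lat p D (v - w).
Proof. by move=> h1 h2; rewrite /lat mulmxBl; exact: mgeB. Qed.

Lemma latZ p m n (D : 'M[K]_n) a (v : 'M[K]_(m, n)) : ordge p 0 a -> lat p D v -> lat p D (a *: v).
Proof. by move=> h1 h2; rewrite /lat -scalemxAl; apply: (@mgeZ _ 0 0). Qed.

Lemma lat_0 p m n (D : 'M[K]_n) : lat p D (0 : 'M[K]_(m, n)).
Proof. by rewrite /lat mul0mx; exact: mge_0. Qed.

Lemma lat_mul p m n l (D : 'M[K]_n) (v : 'M[K]_(m, n)) (A : 'M[K]_(l, m)) :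
  mge p 0 A -> lat p D v -> lat p D (A *m v).
Proof. by move=> h1 h2; rewrite /lat -mulmxA; exact: mgeM0. Qed.

Lemma lat_rows p m n (D : 'M[K]_n) (v : 'M[K]_(m, n)) :
  (forall i, lat p D (row i v)) -> lat p D v.
Proof. by move=> h i j; have := h i 0 j; rewrite -row_mul mxE. Qed.

Lemma lat_row p m n (D : 'M[K]_n) (v : 'M[K]_(m, n)) i :
  lat p D v -> lat p D (row i v).
Proof. by move=> h a j; rewrite -row_mul mxE; exact: h. Qed.

(** D1 contains D with a quotient of length one, generated by e. *)
Definition up p n (D D1 : 'M[K]_n) := D1 \in unitmx /\ exists e : 'rV[K]_n,
  [/\ ~ lat p D e, lat p D (unif p *: e) &
      forall v : 'rV[K]_n, lat p D1 v <-> exists2 a, ordge p 0 a & lat p D (v - a *: e)].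

Lemma ordge_unif1 p : ordge p 1 (unif p).
Proof. by rewrite ordgeE ?unif_neq0 // val_unif. Qed.

(** Modulo the uniformizer t, the row t e D is a nonzero row over k; a constant
    change of basis makes it a multiple of the first unit row, and then the
    larger lattice is obtained by scaling the first coordinate. *)
Lemma grow p n (D : 'M[K]_n) (e : 'rV[K]_n) : D \in unitmx -> ~ lat p D e ->
  lat p D (unif p *: e) -> exists D1, [/\ D1 \in unitmx,
    forall v : 'rV[K]_n, lat p D1 v <-> (exists2 a, ordge p 0 a & lat p D (v - a *: e)) &
    val p (\det D1) = val p (\det D) + 1].
Proof.
move=> uD ne le; set t := unif p in le *; have t0 : t != 0 by exact: unif_neq0.
have [w0 hw0] := mge_rv le; rewrite -scalemxAl in hw0.
have w00 : w0 != 0.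
  apply: contra_notN ne => /eqP w00; rewrite w00 map_mx0 subr0 in hw0.
  rewrite /lat -[X in mge _ _ X]scale1r -(mulVf t0) -scalerA; apply: (@mgeZ _ (-1) 1) hw0 => //.
  by rewrite ordgeE ?invr_eq0 // valV // val_unif.
case: n => [|n] in D e uD ne le w0 hw0 w00 *.
  by exfalso; move/eqP: w00; apply; apply/rowP => -[].
pose Q := invmx (row_ebase w0); pose c := col_ebase w0 0 0.
have rk : \rank w0 = 1%N by rewrite rank_rV w00.
have uQ : Q \in unitmx by rewrite unitmx_inv row_ebase_unit.
have eQ : w0 *m Q = c *: delta_mx 0 0.
  rewrite -{1}(mulmx_ebase w0) /Q mulmxK ?row_ebase_unit // rk.
  rewrite [col_ebase w0]mx11_scalar mul_scalar_mx -/c; congr (_ *: _).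
  by apply/rowP => j; rewrite !mxE /= andbT eq_sym; case: j => [[|j] hj].
have c0 : c != 0.
  by have := col_ebase_unit w0; rewrite [col_ebase w0]mx11_scalar unitmxE det_scalar expr1 unitfE.
pose Qc := map_mx cst Q.
have uQc : Qc \in unitmx by rewrite map_unitmx.
have gQ : mge p 0 Qc by exact: mge_cst.
have gQi : mge p 0 (invmx Qc) by rewrite -map_invmx; exact: mge_cst.
pose dl : 'rV[K]_n.+1 := \row_j (if j == 0 then t else 1).
pose dg := diag_mx dl; have gdg : mge p 0 dg.
  move=> i j; rewrite !mxE; case: (i == j); last by rewrite mulr0n ordge_0.
  by rewrite mulr1n; case: (_ == _); rewrite ?ordge_1 // (ordge_le _ (ordge_unif1 _)).
have ddg : \det dg = t.
  rewrite det_diag (bigD1 0) //= mxE eqxx big1 ?mulr1 // => i /negbTE i0.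
  by rewrite mxE i0.
have udg : dg \in unitmx by rewrite unitmxE ddg unitfE.
(* e D Q is t ^ -1 (c, 0, ..., 0) up to the integral row z *)
pose z := t^-1 *: ((t *: (e *m D) - map_mx cst w0) *m Qc).
have gz : mge p 0 z.
  apply: (@mgeZ _ (-1) 1) => //; first by rewrite ordgeE ?invr_eq0 // valV // val_unif.
  by apply: (@mgeM _ 1 0).
have ez : e *m D *m Qc = t^-1 *: (cst c *: delta_mx 0 0) + z.
  rewrite /z mulmxBl scalerBr -map_mxM eQ -scalemxAl [t^-1 *: (t *: _)]scalerA mulVf // scale1r.
  by rewrite map_mxZ map_delta_mx addrC subrK.
have dE (u : 'rV[K]_n.+1) : u *m dg = \row_j (u 0 j * (if j == 0 then t else 1)).
  by apply/rowP => j; rewrite mul_mx_diag !mxE.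
exists (D *m Qc *m dg); split.
- by rewrite !unitmx_mul uD uQc udg.
- move=> v; split.
    rewrite /lat !mulmxA; set u := v *m D *m Qc; rewrite dE => hu.
    have hu0 : ordge p 0 (u 0 0 * t) by have := hu 0 0; rewrite mxE eqxx.
    have huj j : j != 0 -> ordge p 0 (u 0 j).
      by move=> /negbTE j0; have := hu 0 j; rewrite mxE j0 mulr1.
    have ga : ordge p 0 (t * u 0 0 / cst c).
      rewrite (mulrC t) ordgeM0 // -fmorphV ordge_cst //.
    exists (t * u 0 0 / cst c) => //.
    rewrite -[mge _ _ _]/(lat p D _).
    suff : mge p 0 ((v - (t * u 0 0 / cst c) *: e) *m D *m Qc).
      by move=> h; rewrite /lat -[X in mge _ _ X](mulmxK uQc); exact: mgeM0.
    rewrite -mulmxA mulmxBl mulmxA -/u -scalemxAl mulmxA ez scalerDr opprD addrA.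
    apply: mgeB; last by apply: (@mgeZ _ 0 0).
    move=> i j; rewrite ord1 !mxE eqxx /=; have [->|j0] := eqVneq j 0.
      rewrite mulr1 (_ : _ - _ = 0) ?ordge_0 //; field.
      by rewrite fmorph_eq0 c0 t0.
    by rewrite !mulr0 subr0; move: (huj j j0); rewrite [u 0 j]mxE.
  move=> [a ga la].
  have gDQ (w : 'rV[K]_n.+1) : lat p D w -> lat p (D *m Qc *m dg) w.
    by move=> h; rewrite /lat !mulmxA; apply: mgeM0 => //; exact: mgeM0.
  rewrite -(subrK (a *: e) v); apply: latD; first exact: gDQ.
  apply: latZ => //; rewrite /lat !mulmxA ez mulmxDl; apply: mgeD; last exact: mgeM0.
  rewrite dE => i j; rewrite !mxE eqxx /=; have [_|_] := eqVneq j 0.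
    by rewrite mulr1 mulrAC mulVf // mul1r ordge_cst.
  by rewrite !mulr0 mul0r ordge_0.
rewrite !det_mulmx ddg det_map_mx.
have d0 : \det D != 0 by rewrite -unitfE -unitmxE.
have q0 : \det Q != 0 by rewrite -unitfE -unitmxE.
rewrite valM ?mulf_neq0 ?fmorph_eq0 // val_unif valM ?fmorph_eq0 // val_cst // addr0 //.
Qed.

(** Chains of lattices with successive quotients of length one. *)
Inductive ups p n : 'M[K]_n -> nat -> 'M[K]_n -> Prop :=
| Ups0 D : ups p D 0 D
| UpsS D D1 D2 m : up p D D1 -> ups p D1 m D2 -> ups p D m.+1 D2.

(** A submodule between the lattice D and a bounded set is itself a lattice,
    reached from D by such a chain: each step raises the order of the determinant
    by one, and the bound on L bounds this order. *)
Lemma ups_fill p n (D : 'M[K]_n) (L : 'rV[K]_n -> Prop) (N : nat) : D \in unitmx ->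
  (forall v w, L v -> L w -> L (v + w)) ->
  (forall a v, ordge p 0 a -> L v -> L (a *: v)) ->
  (forall v, lat p D v -> L v) ->
  (forall v, L v -> mge p (- N%:Z) v) ->
  exists m D1, [/\ D1 \in unitmx, ups p D m D1 & forall v, lat p D1 v <-> L v].
Proof.
move=> uD LD LZ; have [M] := ubnP (`|(N * n)%:Z - val p (\det D)|%N).
elim: M => // M IH in D uD *; rewrite ltnS => hM hL hN.
have bnd D' : D' \in unitmx -> (forall v, lat p D' v -> L v) -> val p (\det D') <= (N * n)%:Z.
  move=> uD' hL'; have gi : mge p (- N%:Z) (invmx D').
    move=> i j; have : lat p D' (row i (invmx D')).
      by apply: lat_row; rewrite /lat mulVmx //; exact: mge_1.
    by move=> /hL' /hN /(_ 0 j); rewrite mxE.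
  have := mge_det gi; rewrite det_inv.
  have d0 : \det D' != 0 by rewrite -unitfE -unitmxE.
  by rewrite ordgeE ?invr_eq0 // valV // -mulr_natr natz; lia.
have [full|nfull] := pselect (forall v, L v -> lat p D v).
  by exists 0%N, D; split => //; [exact: Ups0|move=> v; split; [exact: hL|exact: full]].
have {nfull} [v [Lv nv]] : exists v, L v /\ ~ lat p D v.
  by move/existsNP: nfull => [v /not_implyP]; exists v.
have ot m : ordge p 0 (unif p ^+ m) by rewrite ordgeX // (ordge_le _ (ordge_unif1 _)).
have [m hm] : exists m, lat p D (unif p ^+ m *: v).
  have [m hm] := mge_bound p (v *m D); exists m; rewrite /lat -scalemxAl.
  apply: (@mgeZ _ m%:Z (- m%:Z)) hm; rewrite ?subrr //; apply: ordgeX1; exact: ordge_unif1.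
elim: m hm => [|m IHm] hm; first by rewrite expr0 scale1r in hm.
have [/IHm //|ne] := pselect (lat p D (unif p ^+ m *: v)).
have le : lat p D (unif p *: (unif p ^+ m *: v)) by rewrite scalerA -exprS.
have [D1 [uD1 h1 v1]] := grow uD ne le.
have hL1 w : lat p D1 w -> L w.
  move=> /h1 [a ga la]; rewrite -(subrK (a *: (unif p ^+ m *: v)) w).
  by apply: (LD _ _ (hL _ la)); apply: (LZ _ _ ga); exact: (LZ _ _ (ot m) Lv).
have [|m' [D2 [uD2 ups2 h2]]] := IH D1 uD1 _ hL1 hN.
  have := bnd D1 uD1 hL1; have := bnd D uD hL; rewrite v1; move: hM; clear.
  by move: (val _ _) => z; lia.
exists m'.+1, D2; split => //; apply: UpsS ups2; split => //.
by exists (unif p ^+ m *: v).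
Qed.

End LocalLattices.

(** * Matrix divisors and their coherent sheaves *)

Section MatrixDivisors.
Variables (k : closedFieldType) (X : elliptic_curve k).
Context {ch : char0 k}.
Notation K := (ffield X).
Notation cst := (fconst X).
Implicit Types (p q : point X) (f g : K) (c : k).

(** A lattice at each point, standard at almost all points: the adelic
    description of a vector bundle of rank n with a trivialization at the generic
    point. *)
Record mdiv n := Mdiv {
  mfun :> point X -> 'M[K]_n;
  mdiv_unit : forall p, mfun p \in unitmx;
  mdiv_fin : finite_set [set p | mfun p <> 1%:M]
}.

Lemma mdiv_supp n (D : mdiv n) : exists S : seq (point X), forall p, p \notin S -> D p = 1%:M.
Proof.
have /finite_seqP [S eS] := mdiv_fin D; exists S => p pS; apply: contrapT => h.
by have : [set p | D p <> 1%:M] p by []; rewrite eS /= (negbTE pS).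
Qed.

Lemma mat_approx q (S : seq (point X)) m n (A : point X -> 'M[K]_(m, n)) (N : nat) :
  q \notin S -> exists F : 'M[K]_(m, n), (forall p, p \in S -> mge p N (F - A p)) /\
     (forall p, p \notin S -> p <> q -> mge p 0 F).
Proof.
move=> qS; have H i j : exists f, (forall p, p \in S -> ordge p N (f - A p i j)) /\
     (forall p, p \notin S -> p <> q -> ordge p 0 f).
  exact: (approx (fun p => A p i j) N qS).
exists (\matrix_(i, j) projT1 (cid (H i j))); split => p h.
  by move=> i j; rewrite !mxE; case: cid => f /= [h1 _]; exact: h1.
by move=> h' i j; rewrite !mxE; case: cid => f /= [_ h2]; exact: h2.
Qed.

Lemma mge_bounds (S : seq (point X)) m n (A : point X -> 'M[K]_(m, n)) :
  exists N : nat, forall p, p \in S -> mge p (- N%:Z) (A p).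
Proof.
elim: S => [|p S [N hN]]; first by exists 0%N.
have [M hM] := mge_bound p (A p); exists (N + M)%N => p'.
by rewrite in_cons => /orP[/eqP->|/hN h]; [apply: mge_le hM|apply: mge_le h]; lia.
Qed.

Lemma lat_approx n (D : mdiv n) q (S : seq (point X)) m (W : point X -> 'M[K]_(m, n)) (M : nat) :
  exists V : 'M[K]_(m, n), (forall p, p \in S -> p <> q -> mge p M ((V - W p) *m D p)) /\
     (forall p, p \notin S -> p <> q -> lat p (D p) V).
Proof.
have [SD hD] := mdiv_supp D.
pose S' := [seq p <- S ++ SD | p != q].
have [N hN] := mge_bounds S' D.
have [|V [hV rV]] := @mat_approx q S' m n (fun p => if p \in S then W p else 0) (N + M).
  by rewrite mem_filter eqxx.
exists V; split => p pS /eqP pq.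
  have pS' : p \in S' by rewrite mem_filter pq mem_cat pS.
  have := hV p pS'; rewrite pS => h; by apply: (mgeM _ h (hN p pS')); lia.
have [pS'|pS'] := boolP (p \in S').
  have := hV p pS'; rewrite (negbTE pS) subr0 => h.
  by apply: (@mge_le _ _ p M) => //; apply: (mgeM _ h (hN p pS')); lia.
have -> : D p = 1%:M.
  by apply: hD; apply: contraNN pS'; rewrite mem_filter pq mem_cat => ->; rewrite orbT.
by rewrite /lat mulmx1; apply: rV => //; exact/eqP.
Qed.

(** By approximation there is a basis of K ^ n that consists of sections away
    from q and is a local basis of the bundle at the points of T. *)
Lemma lat_frame n (D : mdiv n) q (T : seq (point X)) : exists V : 'M[K]_n,
  [/\ V \in unitmx, forall p, p <> q -> lat p (D p) V &
      forall p, p \in T -> p <> q -> mge p 0 (invmx (V *m D p))].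
Proof.
have [p0 hp0] : exists p0, ~ [set q] p0 by apply: point_neq_ex; exact: finite_set1.
have [V [hV rV]] := lat_approx D q (p0 :: T) (fun p => invmx (D p)) 1.
have one p : p \in p0 :: T -> p <> q -> rv p (\det (V *m D p)) 1.
  move=> pS pq; rewrite -[X in rv _ _ X](det1 k n); apply: rv_det; apply: rv_mx.
  by rewrite map_mx1 -(mulVmx (mdiv_unit D p)) -mulmxBl; exact: hV.
have uV : V \in unitmx.
  have r0 : rv p0 (\det (V *m D p0)) 1 by apply: one => //; rewrite in_cons eqxx.
  have := rv_neq0 (oner_neq0 _) r0; rewrite det_mulmx mulf_eq0 negb_or => /andP[h _].
  by rewrite unitmxE unitfE.
have latV p : p <> q -> lat p (D p) V.
  move=> pq; have [pS|pS] := boolP (p \in p0 :: T); last exact: rV.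
  rewrite -(subrK (invmx (D p)) V); apply: latD; first by apply: mge_le (hV p pS pq).
  by rewrite /lat mulVmx ?mdiv_unit //; exact: mge_1.
exists V; split => // p pT pq; apply: mge_inv; first exact: latV.
  by rewrite unitmx_mul uV mdiv_unit.
have r0 : rv p (\det (V *m D p)) 1 by apply: one => //; rewrite in_cons pT orbT.
by apply: val_rv r0; exact: oner_neq0.
Qed.

Lemma frame_fin n (D : mdiv n) q (V : 'M[K]_n) : V \in unitmx ->
  (forall p, p <> q -> lat p (D p) V) ->
  exists S : seq (point X), forall p, p <> q -> (p \in S) <-> ~ mge p 0 (invmx (V *m D p)).
Proof.
move=> uV latV; have d0 : \det V != 0 by rewrite -unitfE -unitmxE.
have fS : finite_set [set p | p <> q /\ ~ mge p 0 (invmx (V *m D p))].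
  apply: (@sub_finite_set _ _ ([set p | D p <> 1%:M] `|` [set p | val p (\det V) != 0])).
    move=> p [pq h]; have [e|] := pselect (D p = 1%:M); last by left.
    right; apply: contra_notN h => /eqP v0; rewrite e mulmx1; apply: mge_inv => //.
    by have := latV p pq; rewrite /lat e mulmx1.
  rewrite finite_setU; split; first exact: mdiv_fin.
  exact: finite_val.
have /finite_seqP [S eS] := fS; exists S => p pq.
have : [set p | p <> q /\ ~ mge p 0 (invmx (V *m D p))] p <-> p \in S by rewrite eS.
move=> /= h; split; first by move=> /h [].
by move=> h'; apply/h; split.
Qed.

Definition lat_on n (D : mdiv n) (U : aopen X) : {pred 'rV[K]_n} :=
  fun v => `[< forall p, aset U p -> lat p (D p) v >].

Lemma lat_onP n (D : mdiv n) (U : aopen X) (v : 'rV[K]_n) :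
  reflect (forall p, aset U p -> lat p (D p) v) (v \in lat_on D U).
Proof. exact: asboolP. Qed.

Lemma lat_on_zmod n (D : mdiv n) (U : aopen X) : zmod_closed (lat_on D U).
Proof.
split=> [|v w /lat_onP hv /lat_onP hw]; apply/lat_onP => p Up; first exact: lat_0.
by apply: latB; [exact: hv|exact: hw].
Qed.

HB.instance Definition _ n (D : mdiv n) (U : aopen X) :=
  GRing.isZmodClosed.Build 'rV[K]_n (lat_on D U) (lat_on_zmod D U).

Record lsec n (D : mdiv n) (U : aopen X) :=
  LSec { lval :> 'rV[K]_n; lvalP : lval \in lat_on D U }.

HB.instance Definition _ n (D : mdiv n) (U : aopen X) := [isSub for @lval n D U].
HB.instance Definition _ n (D : mdiv n) (U : aopen X) := [Choice of lsec D U by <:].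
HB.instance Definition _ n (D : mdiv n) (U : aopen X) :=
  [SubChoice_isSubZmodule of lsec D U by <:].

Lemma lval_inj n (D : mdiv n) (U : aopen X) (s t : lsec D U) : lval s = lval t -> s = t.
Proof. exact: val_inj. Qed.

Lemma lvalD n (D : mdiv n) (U : aopen X) (s t : lsec D U) : lval (s + t) = lval s + lval t.
Proof. by []. Qed.

Lemma lval0 n (D : mdiv n) (U : aopen X) : lval (0 : lsec D U) = 0.
Proof. by []. Qed.

Lemma regvalD (U : aopen X) (a b : regfun U) : regval (a + b) = regval a + regval b.
Proof. by []. Qed.
Lemma regvalM (U : aopen X) (a b : regfun U) : regval (a * b) = regval a * regval b.
Proof. by []. Qed.
Lemma regval1 (U : aopen X) : regval (1 : regfun U) = 1.
Proof. by []. Qed.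
Lemma regval0 (U : aopen X) : regval (0 : regfun U) = 0.
Proof. by []. Qed.
Lemma regvalX (U : aopen X) (a : regfun U) m : regval (a ^+ m) = regval a ^+ m.
Proof. by elim: m => [|m IH] //; rewrite !exprS regvalM IH. Qed.
Lemma regval_inj (U : aopen X) (a b : regfun U) : regval a = regval b -> a = b.
Proof. exact: val_inj. Qed.
Lemma regfun_ord (U : aopen X) (a : regfun U) p : aset U p -> ordge p 0 (regval a).
Proof. by move=> Up; apply/ordge_regP; move/regular_onP: (regvalP a); apply. Qed.

Lemma regfun_ex (U : aopen X) f : (forall p, aset U p -> ordge p 0 f) ->
  exists a : regfun U, regval a = f.
Proof.
move=> h; have hf : f \in regular_on U by apply/regular_onP => p /h /ordge_regP.
by exists (RegFun hf).
Qed.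

Lemma lscale_subproof n (D : mdiv n) (U : aopen X) (a : regfun U) (s : lsec D U) :
  regval a *: lval s \in lat_on D U.
Proof.
apply/lat_onP => p Up; apply: latZ; first exact: regfun_ord.
by move/lat_onP: (lvalP s); apply.
Qed.

Definition lscale n (D : mdiv n) (U : aopen X) (a : regfun U) (s : lsec D U) : lsec D U :=
  LSec (lscale_subproof a s).

Fact lscaleA n (D : mdiv n) (U : aopen X) (a b : regfun U) (s : lsec D U) :
  lscale a (lscale b s) = lscale (a * b) s.
Proof. by apply: lval_inj; rewrite /= scalerA. Qed.
Fact lscale1 n (D : mdiv n) (U : aopen X) : left_id 1 (@lscale n D U).
Proof. by move=> s; apply: lval_inj; rewrite /= scale1r. Qed.
Fact lscaleDr n (D : mdiv n) (U : aopen X) : right_distributive (@lscale n D U) +%R.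
Proof. by move=> a s t; apply: lval_inj; rewrite /= scalerDr. Qed.
Fact lscaleDl n (D : mdiv n) (U : aopen X) (s : lsec D U) :
  {morph (@lscale n D U)^~ s : a b / a + b}.
Proof. by move=> a b; apply: lval_inj; rewrite /= scalerDl. Qed.

HB.instance Definition _ n (D : mdiv n) (U : aopen X) :=
  GRing.Zmodule_isLmodule.Build (regfun U) (lsec D U)
    (@lscaleA n D U) (@lscale1 n D U) (@lscaleDr n D U) (@lscaleDl n D U).

Lemma lvalZ n (D : mdiv n) (U : aopen X) (a : regfun U) (s : lsec D U) :
  lval (a *: s) = regval a *: lval s.
Proof. by []. Qed.

Lemma lval_sum n (D : mdiv n) (U : aopen X) (I : finType) (F : I -> lsec D U) :
  lval (\sum_i F i) = \sum_i lval (F i).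
Proof. by elim/big_rec2: _ => // i y1 y2 _ <-. Qed.

Lemma lsec_ex n (D : mdiv n) (U : aopen X) v : (forall p, aset U p -> lat p (D p) v) ->
  exists s : lsec D U, lval s = v.
Proof. by move=> /lat_onP h; exists (LSec h). Qed.

Lemma lsec_lat n (D : mdiv n) (U : aopen X) (s : lsec D U) p : aset U p -> lat p (D p) (lval s).
Proof. by move: p; apply/lat_onP; exact: lvalP. Qed.

Lemma lres_subproof n (D : mdiv n) (U V : aopen X) (sVU : V `<=` U) (s : lsec D U) :
  lval s \in lat_on D V.
Proof. by apply/lat_onP => p /sVU Up; exact: lsec_lat. Qed.

Definition lres n (D : mdiv n) (U V : aopen X) (sVU : V `<=` U) (s : lsec D U) : lsec D V :=
  LSec (lres_subproof sVU s).

(** Two frames V and W are chosen such that W is a local basis wherever V is not;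
    a function h vanishing where V fails, with 1 - h vanishing where W fails,
    cuts a section into h s and (1 - h) s, which have regular coordinates in V
    and in W. *)
Lemma lsec_fg n (D : mdiv n) (U : aopen X) : exists (m : nat) (g : 'I_m -> lsec D U),
    forall s : lsec D U, exists c : 'I_m -> regfun U, s = \sum_(i < m) c i *: g i.
Proof.
have [_ [q nUq]] := asetP U.
have Uq p : aset U p -> p <> q by move=> Up e; apply: nUq; rewrite -e.
have [V [uV lV _]] := lat_frame D q [::].
have [S1 hS1] := frame_fin uV lV.
have [W [uW lW iW]] := lat_frame D q S1.
have [S2 hS2] := frame_fin uW lW.
have [N1 hN1] := mge_bounds S1 (fun p => invmx (V *m D p)).
have [N2 hN2] := mge_bounds S2 (fun p => invmx (W *m D p)).
have [|h [hh rh]] := @approx _ X ch q [seq p <- S1 ++ S2 | p != q]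
    (fun p => if p \in S1 then 0 else 1) (N1 + N2); first by rewrite mem_filter eqxx.
have h1 p : p \in S1 -> p <> q -> ordge p (N1 + N2)%N h.
  move=> pS /eqP pq; have := hh p; rewrite mem_filter mem_cat pS pq subr0; exact.
have h2 p : p \in S2 -> p <> q -> ordge p (N1 + N2)%N (1 - h).
  move=> pS pq; have nS : p \notin S1.
    by apply/negP => pS1; move/(hS2 p pq): pS; apply; exact: iW.
  have := hh p; rewrite mem_filter mem_cat pS orbT (negbTE nS) -ordgeN opprB; apply.
  by rewrite andbT; exact/eqP.
have rh' p : p <> q -> ordge p 0 h.
  move=> pq; have [|pS] := boolP (p \in [seq p <- S1 ++ S2 | p != q]); last exact: rh.
  rewrite mem_filter mem_cat => /andP[_ /orP[]] pS; first exact: (ordge_le _ (h1 p pS pq)).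
  rewrite -(subKr 1 h) ordgeB ?ordge_1 //; exact: (ordge_le _ (h2 p pS pq)).
have good f Z (S : seq (point X)) N : Z \in unitmx -> (forall p, p <> q -> ordge p 0 f) ->
    (forall p, p <> q -> p \in S <-> ~ mge p 0 (invmx (Z *m D p))) ->
    (forall p, p \in S -> mge p (- N%:Z) (invmx (Z *m D p))) ->
    (forall p, p \in S -> p <> q -> ordge p N f) ->
    forall (s : lsec D U) p, aset U p -> mge p 0 (f *: (lval s *m invmx Z)).
  move=> uZ rf hS hN hf s p Up; have pq := Uq p Up.
  have -> : lval s *m invmx Z = (lval s *m D p) *m invmx (Z *m D p).
    by rewrite invmx_mul ?mdiv_unit // mulmxA (mulmxK (mdiv_unit D p)).
  rewrite scalemxAr; apply: mgeM0; first exact: lsec_lat.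
  have [pS|pS] := boolP (p \in S); first by apply: (mgeZ _ (hf p pS pq) (hN p pS)); rewrite subrr.
  apply: (mgeZ (e1 := 0) (e2 := 0)) => //; first exact: rf.
  by apply: contrapT => h'; move/negP: pS; apply; apply/hS.
have lVW i p : aset U p -> lat p (D p) (row i (col_mx V W)).
  move=> /Uq pq; apply: lat_row; rewrite /lat mul_col_mx => a b; rewrite mxE.
  by case: (fintype.split a) => j; [exact: lV|exact: lW].
exists (n + n)%N, (fun i => projT1 (cid (lsec_ex (lVW i)))) => s.
pose c := row_mx (h *: (lval s *m invmx V)) ((1 - h) *: (lval s *m invmx W)).
have rc i p : aset U p -> ordge p 0 (c 0 i).
  move=> Up; rewrite mxE; case: (fintype.split i) => j.
    apply: (good h V S1 N1 uV rh' hS1 hN1 _ s p Up 0 j) => p' pS pq.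
    by apply: ordge_le (h1 p' pS pq); lia.
  apply: (good (1 - h) W S2 N2 uW _ hS2 hN2 _ s p Up 0 j) => p' pS.
    by rewrite ordgeB ?ordge_1 ?rh'.
  by move=> pq; apply: ordge_le (h2 p' pS pq); lia.
exists (fun i => projT1 (cid (regfun_ex (rc i)))).
apply: lval_inj; rewrite lval_sum.
transitivity (c *m col_mx V W).
  rewrite mul_row_col -!scalemxAl !mulmxKV // -scalerDl addrC subrK scale1r //.
rewrite mulmx_sum_row; apply: eq_bigr => i _; rewrite lvalZ.
by case: cid => a /= ->; case: cid => b /= ->.
Qed.

Lemma unit_atE p f : unit_at p f -> ordge p 0 f -> f != 0 /\ val p f = 0.
Proof. by move=> h /ordge_regP; exact: unit_atP. Qed.

Lemma finite_list_zeros f : f != 0 -> exists S : seq (point X), forall p, p \notin S -> val p f = 0.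
Proof.
move=> f0; have /finite_seqP [S eS] : finite_set [set p | val p f != 0] by exact: finite_val.
exists S => p pS; apply/eqP; apply: contraNT pS => h.
by have : [set p | val p f != 0] p by []; rewrite eS.
Qed.

(** A power of f clears the finitely many poles at the zeros of f. *)
Lemma lsec_loc_im n (D : mdiv n) (U V : aopen X) (sVU : V `<=` U) (f : regfun U) :
  distinguished V f -> forall t : lsec D V,
  exists (m : nat) (s : lsec D U), regres sVU f ^+ m *: t = lres sVU s.
Proof.
move=> dV t; have [f0|f0] := eqVneq (regval f) 0.
  exists 1%N, 0; apply: lval_inj; rewrite expr1 lvalZ /= f0 scale0r //.
have [S hS] := finite_list_zeros f0.
have [N hN] := mge_bounds S (fun p => lval t *m D p).
have hs p : aset U p -> lat p (D p) (regval f ^+ N *: lval t).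
  move=> Up; rewrite /lat -scalemxAl; have ro := regfun_ord f Up.
  have [Vp|nVp] := pselect (aset V p).
    by apply: (mgeZ (e1 := 0) (e2 := 0)) => //; [exact: ordgeX|exact: lsec_lat].
  have v1 : ordge p 1 (regval f).
    have vn : val p (regval f) <> 0.
      by move=> v0; apply: nVp; apply/dV; split => //; exact: unit_at_val.
    by move: ro; rewrite !ordgeE //; move: vn; move: (val p _) => z; clear; lia.
  have pS : p \in S.
    apply: contraT => /hS v0; move: v1; rewrite ordgeE // v0 //.
  by apply: (mgeZ (e1 := N) (e2 := - N%:Z) _ _ (hN p pS)); [rewrite subrr|exact: ordgeX1].
have [s es] := lsec_ex hs; exists N, s; apply: lval_inj.
by rewrite lvalZ regvalX /= es.
Qed.

(** The vector bundle of a matrix divisor: over U the rows that belong to the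
    lattice at each point of U. *)
Definition LL n (D : mdiv n) : coh X.
Proof.
refine (@Coh k X (fun U => lsec D U : lmodType (regfun U)) (@lres n D) _ _ _ _ _ _).
- by move=> U V sVU a s t; exact: lval_inj.
- by move=> U sUU s; exact: lval_inj.
- by move=> U V W sVU sWV sWU s; exact: lval_inj.
- exact: lsec_fg.
- move=> U V sVU f _ s /(congr1 (@lval n D V)) /= h; exists 0%N; rewrite expr0 scale1r.
  exact: lval_inj.
- exact: lsec_loc_im.
Defined.

End MatrixDivisors.

(** * Open sets and ideals of regular functions *)

Section MkLin.
Variables (R : pzRingType) (V W : lmodType R) (f : V -> W).
Hypothesis hf : linear f.
Definition mklin : {linear V -> W} :=
  HB.pack f (GRing.isLinear.Build R V W *:%R f hf).
Lemma mklinE x : mklin x = f x. Proof. by []. Qed.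
End MkLin.

Section Structure.
Variables (k : closedFieldType) (X : elliptic_curve k).
Context {ch : char0 k}.
Notation K := (ffield X).
Notation cst := (fconst X).
Implicit Types (p q : point X) (f g : K) (c : k).

Lemma openI_subproof (U V : aopen X) : finite_set (~` (aset U `&` aset V)) /\
  ~` (aset U `&` aset V) !=set0.
Proof.
rewrite setCI; have [fU [q nUq]] := asetP U; have [fV _] := asetP V.
by split; [rewrite finite_setU; split|exists q; left].
Qed.

Definition openI (U V : aopen X) : aopen X := AOpen (openI_subproof U V).

Lemma openIl U V : aset (openI U V) `<=` aset U. Proof. by move=> p []. Qed.
Lemma openIr U V : aset (openI U V) `<=` aset V. Proof. by move=> p []. Qed.

Lemma off_subproof q : finite_set (~` (~` [set q])) /\ ~` (~` [set q]) !=set0.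
Proof. by rewrite setCK; split; [exact: finite_set1|exists q]. Qed.
Definition off q : aopen X := AOpen (off_subproof q).

Lemma openD_subproof (U : aopen X) (S : seq (point X)) :
  finite_set (~` (aset U `&` ~` [set` S])) /\ ~` (aset U `&` ~` [set` S]) !=set0.
Proof.
rewrite setCI setCK; have [fU [q nUq]] := asetP U.
by split; [rewrite finite_setU; split|exists q; left].
Qed.
Definition openD (U : aopen X) (S : seq (point X)) : aopen X := AOpen (openD_subproof U S).

Lemma open_ex p : exists U : aopen X, aset U p.
Proof.
have [q hq] : exists q, ~ [set p] q by apply: point_neq_ex; exact: finite_set1.
by exists (off q) => /= e; apply: hq.
Qed.

Lemma open_miss (U : aopen X) : exists q, forall p, aset U p -> p <> q.
Proof. by have [_ [q nUq]] := asetP U; exists q => p Up e; apply: nUq; rewrite -e. Qed.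

Lemma open_seq (U : aopen X) : exists S : seq (point X), forall p, ~ aset U p <-> p \in S.
Proof.
have [/finite_seqP [S eS] _] := asetP U; exists S => p.
by have -> : (~ aset U p) = (~` aset U) p by []; rewrite eS.
Qed.

Lemma cutoff (U : aopen X) p (S : seq (point X)) : aset U p -> p \notin S ->
  exists f : regfun U, rv p (regval f) 1 /\
    forall p', aset U p' -> p' \in S -> rv p' (regval f) 0.
Proof.
move=> Up pS; have [q hq] := open_miss U.
pose S' := p :: [seq p' <- S | p' != q].
have qS' : q \notin S'.
  rewrite in_cons negb_or mem_filter eqxx /= andbT; apply/eqP => e; exact: (hq _ Up).
have [f [hf rf]] : exists f, (forall p', p' \in S' ->
  ordge p' 1 (f - (if p' == p then 1 else 0))) /\
   (forall p', p' \notin S' -> p' <> q -> ordge p' 0 f).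
  exact: (approx _ 1 qS').
have [a ea] : exists a : regfun U, regval a = f.
  apply: regfun_ex => p' Up'; have [pS'|pS'] := boolP (p' \in S'); last by apply: rf;
    last exact: hq.
  rewrite -(subrK (if p' == p then 1 else 0) f) ordgeD //.
    by apply: ordge_le (hf p' pS').
  by case: ifP => _; rewrite ?ordge_1 ?ordge_0.
exists a; rewrite ea; split.
  by apply/rv_ordge1; rewrite rmorph1; have := hf p; rewrite in_cons eqxx /=; apply.
move=> p' Up' pS'; apply/ordge1P; have := hf p'.
have -> : (p' == p) = false by apply/negbTE; apply: contraNneq pS => <-.
rewrite subr0; apply; rewrite in_cons mem_filter pS' andbT; apply/orP; right.
by apply/eqP; exact: hq.
Qed.

Lemma zero_list (U : aopen X) (f : regfun U) : regval f != 0 ->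
  exists W : aopen X, aset W `<=` aset U /\ distinguished W f.
Proof.
move=> f0; have [S hS] : exists S : seq (point X), forall p, p \in S <-> val p (regval f) != 0.
  have /finite_seqP [S eS] : finite_set [set p | val p (regval f) != 0] by exact: finite_val.
  exists S => p; have -> : (val p (regval f) != 0 : Prop) = [set p | val p (regval f) != 0] p by [].
  by rewrite eS.
exists (openD U S); split; first by move=> p [].
move=> p; split=> [[Up pS]|[Up hu]]; split => //.
  apply: unit_at_val => //; apply/eqP; apply: contrapT => /negP h.
  by apply: pS; apply/hS.
move=> /hS /eqP; apply.
by have [_ ->] : regval f != 0 /\ val p (regval f) = 0 by apply: unit_atE => //; exact: regfun_ord.
Qed.

Lemma rv_unit_at p f c : c != 0 -> rv p f c -> unit_at p f.
Proof. move=> c0 h; apply: unit_at_val; [exact: rv_neq0 h|exact: val_rv h]. Qed.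

Lemma nbhd (U O : aopen X) p : aset U p -> aset O p ->
  exists (f : regfun U) (W : aopen X), [/\ aset W `<=` aset U, aset W `<=` aset O,
    distinguished W f, aset W p & rv p (regval f) 1].
Proof.
move=> Up Op; have [S hS] := open_seq O.
have [|f [f1 f0]] := @cutoff U p S Up; first by apply/negP => /hS; apply.
have nz : regval f != 0 by apply: rv_neq0 f1; exact: oner_neq0.
have [W [WU dW]] := zero_list nz.
exists f, W; split => //.
  move=> p' Wp'; apply: contrapT => /hS pS.
  have [Up' [n0 /rv_reg [c hc]]] := (dW p').1 Wp'.
  have := rvM (f0 p' Up' pS) hc; rewrite divff // mul0r => /(rv_uniq (rv1 _)) /eqP.
  by rewrite oner_eq0.
by apply/dW; split => //; apply: rv_unit_at f1; exact: oner_neq0.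
Qed.

Lemma openI_ex (U V : aopen X) : exists p, aset U p /\ aset V p.
Proof.
have [p hp] : exists p, ~ (~` (aset U `&` aset V)) p.
  apply: point_neq_ex; exact: (asetP (openI U V)).1.
by exists p; apply: contrapT.
Qed.

(** Multiplication with a high power of f clears the poles at the zeros of f. *)
Lemma extend (U W : aopen X) (f : regfun U) : regval f != 0 -> distinguished W f ->
  forall gam : regfun W, exists N : nat, forall M, (N <= M)%N -> exists del : regfun U,
    regval del = regval f ^+ M * regval gam.
Proof.
move=> f0 dW gam; have [S hS] := finite_list_zeros f0.
have [g0|g0] := eqVneq (regval gam) 0.
  by exists 0%N => M _; exists 0; rewrite g0 mulr0.
have [N hN] : exists N : nat, forall p, p \in S -> - val p (regval gam) <= N.
  have [N hN] := val_bound S (regval gam)^-1; exists N => p /hN; rewrite valV //.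
exists N => M NM; apply: regfun_ex => p Up; have ro : ordge p 0 (regval f) by exact: regfun_ord.
have [Wp|nWp] := pselect (aset W p).
  by rewrite ordgeM0 ?ordgeX //; exact: regfun_ord.
have vn : val p (regval f) <> 0.
  by move=> v0; apply: nWp; apply/dW; split => //; exact: unit_at_val.
have v1 : 1 <= val p (regval f).
  move: ro vn; rewrite ordgeE //; by move: (val _ _) => z; clear; lia.
have pS : p \in S by apply: contraT => /hS /vn.
have := hN p pS; rewrite ordgeE ?mulf_neq0 ?expf_neq0 // valM ?expf_neq0 // valX // -mulr_natr natz.
by move: v1 NM; move: (val _ _) (val _ _) => a b; clear; nia.
Qed.

(** A function g of the ideal with value 1 at all zeros of a nonzero function f of
    the ideal is built with cutoff functions. Then f divides a power of 1 - g, so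
    1 is congruent modulo the ideal to (1 - g) ^ N, a multiple of f. *)
Lemma nullstellensatz (U : aopen X) (I : regfun U -> Prop) :
  (forall a b, I a -> I b -> I (a + b)) -> (forall a b, I b -> I (a * b)) ->
  (forall p, aset U p -> exists a c, [/\ I a, c != 0 & rv p (regval a) c]) -> I 1.
Proof.
move=> ID IM Ip.
have [p0 Up0] := aopen_neq0 U.
have [f [c [If c0 rf]]] := Ip p0 Up0.
have f0 : regval f != 0 by exact: rv_neq0 rf.
have [S hS] := finite_list_zeros f0.
have [g Ig hg] : exists2 g, I g & forall p, aset U p -> p \in S -> rv p (regval g) 1.
  elim: S {hS} => [|p S [g Ig hg]]; first by exists f.
  have [pS|pS] := boolP (p \in S).
    by exists g => // p' Up'; rewrite in_cons => /orP[/eqP e|]; apply: hg => //; rewrite e.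
  have [Up|nUp] := pselect (aset U p); last first.
    by exists g => // p' Up'; rewrite in_cons => /orP[/eqP e|]; [case: nUp; rewrite -e|apply: hg].
  have [a [e [Ia e0 ra]]] := Ip p Up.
  have [chi [ch1 ch0]] := cutoff Up pS.
  have [b rb] : exists b, rv p (regval g) b.
    by apply/rv_reg/ordge_regP; exact: regfun_ord.
  exists (g + regconst U ((1 - b) / e) * chi * a); first by apply: ID => //; exact: IM.
  move=> p' Up'; rewrite in_cons => /orP[/eqP->|pS'].
    have E : b + (1 - b) / e * 1 * e = 1 by rewrite mulr1 divfK // addrC subrK.
    rewrite -[X in rv _ _ X]E regvalD !regvalM; apply: rvD => //; apply: rvM => //;
      apply: rvM => //.
    exact: rv_const.
  have [a' ra'] : exists a', rv p' (regval a) a'.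
    by apply/rv_reg/ordge_regP; exact: regfun_ord.
  have E : 1 + (1 - b) / e * 0 * a' = 1 by rewrite mulr0 mul0r addr0.
  rewrite -[X in rv _ _ X]E regvalD !regvalM; apply: rvD; first exact: hg.
  by apply: rvM => //; apply: rvM; [exact: rv_const|exact: ch0].
have [N hN] := val_bound S (regval f).
have [u hu] : exists u : regfun U, regval u = (1 - regval g) ^+ N / regval f.
  apply: regfun_ex => p Up; have rg : ordge p 0 (regval g) by exact: regfun_ord.
  have r1 : ordge p 0 ((1 - regval g) ^+ N) by rewrite ordgeX // ordgeB ?ordge_1.
  have [pS|pS] := boolP (p \in S); last first.
    by rewrite ordgeM0 // ordgeE ?invr_eq0 // valV // hS.
  have o1 : ordge p 1 (1 - regval g).
    by apply/ordge1P; rewrite -(subrr 1); apply: rvB; [exact: rv1|exact: hg].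
  apply: (@ordge_le _ _ p (N%:Z - val p (regval f))); first by have := hN p pS; lia.
  apply: ordgeM; first exact: ordgeX1.
  by rewrite ordgeE ?invr_eq0 // valV.
have -> : 1 = (1 - (1 - g) ^+ N) + u * f.
  have -> : u * f = (1 - g) ^+ N; last by rewrite subrK.
  apply: regval_inj; rewrite regvalM hu divfK // regvalX //.
apply: ID; last exact: IM.
rewrite -[X in X - _](expr1n _ N) subrXX subKr mulrC; exact: IM.
Qed.

End Structure.

(** * The structure of coherent sheaves *)

(** A maximal independent family among generators, with one common denominator. *)
Lemma torsion_basis (R : comNzRingType) (M : lmodType R) :
  (forall a b : R, a * b = 0 -> a = 0 \/ b = 0) ->
  forall m (g : 'I_m -> M), exists r (s : 'I_r -> M) (a : R), [/\ a != 0,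
    forall c : 'I_r -> R, \sum_(i < r) c i *: s i = 0 -> forall i, c i = 0 &
    forall i, exists c : 'I_r -> R, a *: g i = \sum_(j < r) c j *: s j].
Proof.
move=> R0; elim=> [|m IH] g.
  by exists 0%N, (fun _ => 0), 1; split; [exact: oner_neq0|move=> c _ []|move=> []].
have [r [s [a [a0 indep span]]]] := IH (fun i => g (lift ord_max i)).
have wid n (i : 'I_n) : widen_ord (leqnSn n) i = lift ord_max i.
  by apply: val_inj; rewrite /= /bump leqNgt ltn_ord.
have [[b [b0 [c hc]]]|nb] := pselect (exists b : R, b != 0 /\ exists c : 'I_r -> R,
    b *: g ord_max = \sum_(j < r) c j *: s j).
  exists r, s, (a * b); split => //.
    by apply/eqP => /R0 [] /eqP; [rewrite (negbTE a0)|rewrite (negbTE b0)].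
  move=> i; have [j ->|->] := unliftP ord_max i.
    have [e he] := span j; exists (fun l => b * e l).
    rewrite mulrC -scalerA he scaler_sumr; apply: eq_bigr => l _; by rewrite scalerA.
  exists (fun l => a * c l); rewrite -scalerA hc scaler_sumr.
  by apply: eq_bigr => l _; rewrite scalerA.
pose s' (i : 'I_r.+1) := oapp s (g ord_max) (unlift ord_max i).
have sumE (c : 'I_r.+1 -> R) :
    \sum_i c i *: s' i = \sum_(i < r) c (lift ord_max i) *: s i + c ord_max *: g ord_max.
  rewrite big_ord_recr /= /s' unlift_none /=; congr (_ + _).
  by apply: eq_bigr => i _; rewrite wid liftK.
exists r.+1, s', a; split => //.
  move=> c; rewrite sumE => h.
  have cm : c ord_max = 0.
    apply: contrapT => /eqP c0; apply: nb; exists (- c ord_max); split; first by rewrite oppr_eq0.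
    by exists (fun i => c (lift ord_max i)); rewrite scaleNr; apply/esym/eqP; rewrite -addr_eq0 h.
  rewrite cm scale0r addr0 in h => i.
  by have [j ->|->] := unliftP ord_max i => //; exact: (indep (fun j => c (lift ord_max j))).
move=> i; have [j ->|->] := unliftP ord_max i.
  have [e he] := span j; exists (fun l => oapp e 0 (unlift ord_max l)).
  rewrite sumE unlift_none /= scale0r addr0 he.
  by apply: eq_bigr => l _; rewrite liftK.
exists (fun l => oapp (fun=> 0) a (unlift ord_max l)).
rewrite sumE unlift_none /= big1 ?add0r // => l _; by rewrite liftK /= scale0r.
Qed.

Section Structure.
Variables (k : closedFieldType) (X : elliptic_curve k).
Context {ch : char0 k}.
Notation K := (ffield X).
Notation cst := (fconst X).
Implicit Types (p q : point X) (f g : K) (c : k).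

Lemma regfun_dom (U : aopen X) (a b : regfun U) : a * b = 0 -> a = 0 \/ b = 0.
Proof.
move=> /(congr1 (@regval k X U)); rewrite regvalM regval0 => /eqP.
rewrite mulf_eq0 => /orP[] /eqP h; [left|right]; exact: regval_inj.
Qed.

Lemma regval_neq0 (U : aopen X) (a : regfun U) : (a != 0) = (regval a != 0).
Proof.
apply/negP/negP => h; apply: contra_not h => /eqP e; apply/eqP; last by rewrite e.
by apply: regval_inj.
Qed.

Lemma resD (E : coh X) (U V : aopen X) (h : V `<=` U) (s t : E U) :
  res h (s + t) = res h s + res h t.
Proof.
have := res_linear h 1 s t; rewrite !scale1r => ->; congr (_ + _).
by rewrite (_ : regres h 1 = 1) ?scale1r //; exact: regval_inj.
Qed.

Lemma res0 (E : coh X) (U V : aopen X) (h : V `<=` U) : res h (0 : E U) = 0.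
Proof. by apply: (addrI (res h 0)); rewrite -resD !addr0. Qed.

Lemma resZ (E : coh X) (U V : aopen X) (h : V `<=` U) a (s : E U) :
  res h (a *: s) = regres h a *: res h s.
Proof. by have := res_linear h a s 0; rewrite res0 !addr0. Qed.

Lemma resN (E : coh X) (U V : aopen X) (h : V `<=` U) (s : E U) : res h (- s) = - res h s.
Proof. by apply/eqP; rewrite -addr_eq0 -resD addNr res0. Qed.

Lemma res_sum (E : coh X) (U V : aopen X) (h : V `<=` U) (I : finType) (F : I -> E U) :
  res h (\sum_i F i) = \sum_i res h (F i).
Proof.
by elim/big_rec2: _ => [|i y1 y2 _ <-]; [exact: res0|rewrite resD].
Qed.

Variable E : coh X.
Let U0 := off (@Infinity k X).

Section Basis.
Variables (r : nat) (s : 'I_r -> E U0) (a0 : regfun U0).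
Hypothesis a0_neq0 : a0 != 0.
Hypothesis indep : forall c : 'I_r -> regfun U0,
  \sum_(i < r) c i *: s i = 0 -> forall i, c i = 0.
Hypothesis span : forall e : E U0, exists c : 'I_r -> regfun U0, a0 *: e = \sum_(j < r) c j *: s j.

(** Coefficients over W become, after multiplication with a power of a function
    f vanishing outside W, coefficients over the open set on which the s i are
    independent. *)
Lemma indep_res (W : aopen X) (h : W `<=` U0) (c : 'I_r -> regfun W) :
  \sum_i c i *: res h (s i) = 0 -> forall i, c i = 0.
Proof.
move=> e i0; have [p Wp] := aopen_neq0 W.
have [f [W1 [W1U W1W dW1 W1p rf]]] := nbhd (h _ Wp) Wp.
have f0 : regval f != 0 by apply: rv_neq0 rf; exact: oner_neq0.
have H i : exists N : nat, forall M, (N <= M)%N -> exists del : regfun U0,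
    regval del = regval f ^+ M * regval (regres W1W (c i)) by exact: extend.
pose N := (\sum_i projT1 (cid (H i)))%N.
have H' i : exists del : regfun U0, regval del = regval f ^+ N * regval (c i).
  by apply: (projT2 (cid (H i))); rewrite /N (bigD1 i) //= leq_addr.
pose del i := projT1 (cid (H' i)); have hd i : regval (del i) = regval f ^+ N * regval (c i).
  by rewrite /del; case: cid.
have z : res W1U (\sum_i del i *: s i) = 0.
  rewrite res_sum (eq_bigr (fun i => regres W1U f ^+ N *: res W1W (c i *: res h (s i)))).
    by rewrite -scaler_sumr -res_sum e res0 scaler0.
  move=> i _; rewrite !resZ (res_comp _ _ W1U) scalerA; congr (_ *: _).
  by apply: regval_inj; rewrite regvalM regvalX /= hd.
have [m hm] := sec_loc_ker dW1 z.
have /indep /(_ i0) : \sum_i (f ^+ m * del i) *: s i = 0.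
  by rewrite -[RHS]hm scaler_sumr; apply: eq_bigr => i _; rewrite scalerA.
move=> /(congr1 (@regval k X U0)); rewrite regvalM regvalX hd regval0 => /eqP.
rewrite !mulf_eq0 !expf_eq0 (negbTE f0) !andbF /= => /eqP h0.
exact: regval_inj.
Qed.

(** The row v of the coordinates of the section e at the generic point, with
    respect to the independent family s, tested on some open set W. *)
Definition coords (Om : aopen X) (e : E Om) (v : 'rV[K]_r) := exists (W : aopen X)
  (hO : W `<=` Om) (h0 : W `<=` U0) (b : regfun W) (c : 'I_r -> regfun W),
  [/\ b != 0, b *: res hO e = \sum_i c i *: res h0 (s i) &
      forall i, regval (c i) = regval b * v 0 i].

Lemma coords_near (Om : aopen X) (e : E Om) p : aset Om p -> aset U0 p ->
  exists (f : regfun U0) (N : nat) (e' : E U0) (W : aopen X) (hO : W `<=` Om) (h0 : W `<=` U0),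
   [/\ rv p (regval f) 1, distinguished W f & regres h0 f ^+ N *: res hO e = res h0 e'].
Proof.
move=> Op Up; have [f [W [WU WO dW Wp rf]]] := nbhd Up Op.
have [N [e' he']] := sec_loc_im WU dW (res WO e).
by exists f, N, e', W, WO, WU.
Qed.

Lemma coords_exS (e' : E U0) : exists v, coords e' v /\ forall p, aset U0 p ->
  val p (regval a0) = 0 -> mge p 0 v.
Proof.
have [c hc] := span e'; exists (\row_i (regval (c i) / regval a0)); split.
  exists U0, (@subset_refl _ _), (@subset_refl _ _), a0, c; split => //.
    by rewrite !res_id hc; apply: eq_bigr => i _; rewrite res_id.
  by move=> i; rewrite mxE mulrC divfK // -regval_neq0.
move=> p Up v0 i j; rewrite mxE ordgeM0 //; first exact: regfun_ord.
by rewrite ordgeE ?invr_eq0 -?regval_neq0 // valV -?regval_neq0 // v0.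
Qed.

Lemma coords_ext (Om Om' W : aopen X) (hO : W `<=` Om) (hO' : W `<=` Om') (e : E Om) (e' : E Om')
   (f : K) (b : regfun W) v : regval b = f -> f != 0 -> b *: res hO e = res hO' e' ->
   coords e' v -> coords e (f^-1 *: v).
Proof.
move=> bf f0 he [W' [h1 [h2 [b' [c [b0 hb hc]]]]]].
pose V := openI W W'; have VW : V `<=` W := @openIl _ _ W W'.
have VW' : V `<=` W' := @openIr _ _ W W'.
exists V, (fun p h => hO p (VW p h)), (fun p h => h2 p (VW' p h)),
  (regres VW b * regres VW' b'), (fun i => regres VW' (c i)); split.
- rewrite regval_neq0 regvalM mulf_neq0 //= ?bf //; by rewrite regval_neq0 in b0.
- rewrite mulrC -scalerA -(res_comp hO VW) -resZ he.
  rewrite (res_comp hO' VW (fun p h => h1 p (VW' p h))) -(res_comp h1 VW') -resZ hb res_sum.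
  by apply: eq_bigr => i _; rewrite resZ; congr (_ *: _); exact: res_comp.
- move=> i; rewrite regvalM /= hc mxE bf; field.
  exact: f0.
Qed.

Lemma coords_res (Om V : aopen X) (h : V `<=` Om) (e : E Om) v : coords e v -> coords (res h e) v.
Proof.
move=> hv; rewrite -(scale1r v) -(invr1 K).
apply: (@coords_ext V Om V (@subset_refl _ _) h _ _ 1 1) hv; rewrite ?oner_neq0 //.
by rewrite scale1r res_id.
Qed.

Lemma coords_ex (Om : aopen X) (e : E Om) : exists v, coords e v.
Proof.
have [p [Op Up]] := openI_ex Om U0.
have [f [N [e' [W [hO [h0 [rf dW he]]]]]]] := coords_near e Op Up.
have [v [hv _]] := coords_exS e'.
exists ((regval f ^+ N)^-1 *: v); apply: coords_ext he hv; first by rewrite regvalX.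
by rewrite expf_neq0 //; apply: rv_neq0 rf; exact: oner_neq0.
Qed.

Lemma coords_lin (Om : aopen X) (a : regfun Om) (e e' : E Om) v v' : coords e v -> coords e' v' ->
  coords (a *: e + e') (regval a *: v + v').
Proof.
move=> [W [h1 [h2 [b [c [b0 hb hc]]]]]] [W' [h1' [h2' [b' [c' [b0' hb' hc']]]]]].
pose V := openI W W'; have VW : V `<=` W := @openIl _ _ W W'.
have VW' : V `<=` W' := @openIr _ _ W W'.
pose VO : V `<=` Om := fun p h => h1 p (VW p h).
pose VU : V `<=` U0 := fun p h => h2 p (VW p h).
exists V, VO, VU, (regres VW b * regres VW' b'),
  (fun i => regres VO a * regres VW' b' * regres VW (c i) + regres VW b * regres VW' (c' i)); split.
- by rewrite regval_neq0 regvalM mulf_neq0 //= -?regval_neq0.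
- have E1 : regres VW b *: res VO e = \sum_i regres VW (c i) *: res VU (s i).
    rewrite -(res_comp h1 VW) -resZ hb res_sum; apply: eq_bigr => i _.
    by rewrite resZ; congr (_ *: _); exact: res_comp.
  have E2 : regres VW' b' *: res VO e' = \sum_i regres VW' (c' i) *: res VU (s i).
    rewrite -(res_comp h1' VW') -resZ hb' res_sum; apply: eq_bigr => i _.
    by rewrite resZ; congr (_ *: _); exact: res_comp.
  rewrite resD resZ scalerDr scalerA.
  have -> : regres VW b * regres VW' b' * regres VO a = regres VO a * regres VW' b' * regres VW b.
    by rewrite mulrC (mulrC (regres VW b)) mulrA.
  rewrite -[X in X + _]scalerA -[X in _ + X]scalerA E1 E2 ?scalerA !scaler_sumr -big_split;
    apply: eq_bigr => i _ /=.
  by rewrite scalerDl !scalerA.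
- move=> i; rewrite regvalD !regvalM /= hc hc' !mxE; ring.
Qed.

(** The kernel of the map to the generic fibre is the torsion. *)
Lemma coords0 (Om : aopen X) (e : E Om) : coords e 0 -> exists2 b : regfun Om, b != 0 & b *: e = 0.
Proof.
move=> [W [h1 [h2 [b [c [b0 hb hc]]]]]].
have {}hb : b *: res h1 e = 0.
  rewrite hb big1 // => i _; rewrite (_ : c i = 0) ?scale0r //.
  by apply: regval_inj; rewrite hc mxE mulr0.
have [p Wp] := aopen_neq0 W.
have [f [W1 [W1O W1W dW1 W1p rf]]] := nbhd (h1 _ Wp) Wp.
have f0 : regval f != 0 by apply: rv_neq0 rf; exact: oner_neq0.
have [N hN] : exists N : nat, forall M, (N <= M)%N -> exists del : regfun Om,
    regval del = regval f ^+ M * regval (regres W1W b) by exact: extend.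
have [del hd] := hN N (leqnn N).
have d0 : del != 0 by rewrite regval_neq0 hd mulf_neq0 ?expf_neq0 //= -regval_neq0.
have z : res W1O (del *: e) = 0.
  rewrite resZ (_ : regres W1O del = regres W1O f ^+ N * regres W1W b).
    by rewrite -scalerA -(res_comp h1 W1W) -resZ hb res0 scaler0.
  by apply: regval_inj; rewrite regvalM regvalX /= hd.
have [m hm] := sec_loc_ker dW1 z.
exists (f ^+ m * del); last by rewrite -scalerA.
by rewrite regval_neq0 regvalM regvalX mulf_neq0 ?expf_neq0 // -regval_neq0.
Qed.

Lemma coords_tors (Om : aopen X) (e : E Om) v (b : regfun Om) : b != 0 -> b *: e = 0 ->
  coords e v -> v = 0.
Proof.
move=> b0 be [W [h1 [h2 [b' [c [b0' hb hc]]]]]].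
have z : \sum_i (regres h1 b * c i) *: res h2 (s i) = 0.
  under eq_bigr do rewrite -scalerA.
  by rewrite -scaler_sumr -hb scalerA mulrC -scalerA -resZ be res0 scaler0.
apply/rowP => i; have /(congr1 (@regval k X W)) := indep_res z i.
rewrite regvalM regval0 hc mxE => /eqP; rewrite !mulf_eq0.
move: b0 b0'; rewrite !regval_neq0 => /negbTE n1 /negbTE n2.
by move=> /orP[|/orP[|/eqP//]]; rewrite ?n2 //= n1.
Qed.

Lemma coords_uniq (Om : aopen X) (e : E Om) v w : coords e v -> coords e w -> v = w.
Proof.
move=> hv hw; have := coords_lin (- 1) hw hv; rewrite scaleN1r addNr => h.
have : regval (-1 : regfun Om) *: w + v = 0 by apply: coords_tors h;
  [exact: oner_neq0|rewrite scaler0].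
have -> : regval (-1 : regfun Om) = -1 by [].
by rewrite scaleN1r addrC => /eqP; rewrite subr_eq0 => /eqP.
Qed.

(** The map from the sections of E to its generic fibre K ^ r. *)
Definition iota (Om : aopen X) (e : E Om) : 'rV[K]_r := projT1 (cid (coords_ex e)).

Lemma iotaP (Om : aopen X) (e : E Om) : coords e (iota e).
Proof. by rewrite /iota; case: cid. Qed.

Lemma iotaE (Om : aopen X) (e : E Om) v : coords e v -> iota e = v.
Proof. exact/coords_uniq/iotaP. Qed.

Lemma iota_lin (Om : aopen X) a (e e' : E Om) : iota (a *: e + e') = regval a *: iota e + iota e'.
Proof. by apply: iotaE; apply: coords_lin; exact: iotaP. Qed.

Lemma iotaD (Om : aopen X) (e e' : E Om) : iota (e + e') = iota e + iota e'.
Proof. by rewrite -[e]scale1r iota_lin scale1r regval1 scale1r. Qed.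

Lemma iota0 (Om : aopen X) : iota (0 : E Om) = 0.
Proof. by apply: (addrI (iota (0 : E Om))); rewrite -iotaD !addr0. Qed.

Lemma iotaZ (Om : aopen X) a (e : E Om) : iota (a *: e) = regval a *: iota e.
Proof. by rewrite -[_ *: e]addr0 iota_lin iota0 addr0. Qed.

Lemma iota_res (Om V : aopen X) (h : V `<=` Om) (e : E Om) : iota (res h e) = iota e.
Proof. by apply/iotaE/coords_res/iotaP. Qed.

Lemma iota_sum (Om : aopen X) (I : finType) (F : I -> E Om) : iota (\sum_i F i) = \sum_i iota (F i).
Proof. by elim/big_rec2: _ => [|i y1 y2 _ <-]; [exact: iota0|rewrite iotaD]. Qed.

Lemma iota_s i : iota (s i) = delta_mx 0 i.
Proof.
apply: iotaE; exists U0, (@subset_refl _ _), (@subset_refl _ _), 1, (fun j => (j == i)%:R).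
split; first exact: oner_neq0.
  rewrite scale1r (bigD1 i) //= eqxx scale1r big1 ?addr0 // => j /negbTE ->.
  by rewrite scale0r.
by move=> j; rewrite mxE regval1 mul1r eqxx /=; case: (_ == _).
Qed.

(** The image in the generic fibre of the stalk of E at p. *)
Definition stalk p (v : 'rV[K]_r) := exists (Om : aopen X) (e : E Om), aset Om p /\ iota e = v.

Lemma stalkD p v w : stalk p v -> stalk p w -> stalk p (v + w).
Proof.
move=> [Om [e [Op <-]]] [Om' [e' [Op' <-]]].
exists (openI Om Om'), (res (@openIl _ _ Om Om') e + res (@openIr _ _ Om Om') e'); split => //.
by rewrite iotaD !iota_res.
Qed.

Lemma stalkZ p a v : ordge p 0 a -> stalk p v -> stalk p (a *: v).
Proof.
move=> ha [Om [e [Op <-]]].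
have [->|a0'] := eqVneq a 0.
  by exists Om, 0; rewrite iota0 scale0r.
have [S hS] := finite_list_zeros a0'.
pose Om' := openD Om [seq q <- S | q != p].
have [b hb] : exists b : regfun Om', regval b = a.
  apply: regfun_ex => q [Oq] /=; rewrite mem_filter => nS.
  have [->|qp] := eqVneq q p; first exact: ha.
  rewrite ordgeE // hS //; apply/negP => qS; apply: nS; by rewrite qS andbT.
have OO : Om' `<=` Om by move=> q [].
exists Om', (b *: res OO e); split; last by rewrite iotaZ hb iota_res.
by split => //=; rewrite mem_filter eqxx.
Qed.

(** Up to a power of a function equal to 1 at p, an element of the stalk comes
    from a section over any given neighbourhood of p. *)
Lemma stalk_from (Om : aopen X) p v : aset Om p -> stalk p v ->
  exists (f : regfun Om) (N : nat) (e : E Om), rv p (regval f) 1 /\ iota e = regval f ^+ N *: v.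
Proof.
move=> Op [Om' [e' [Op' <-]]].
have [f [W [WO WO' dW Wp rf]]] := nbhd Op Op'.
have [N [e he]] := sec_loc_im WO dW (res WO' e').
exists f, N, e; split => //.
by rewrite -(iota_res WO) -he iotaZ iota_res regvalX.
Qed.

(** Finitely many generators over a neighbourhood bound the poles. *)
Lemma stalk_upper p : exists N : nat, forall v, stalk p v -> mge p (- N%:Z) v.
Proof.
have [Om Op] := open_ex p.
have [m [g hg]] := sec_fg E Om.
have H i : exists N : nat, mge p (- N%:Z) (iota (g i)) by exact: mge_bound.
pose N := (\sum_i projT1 (cid (H i)))%N.
have H' i : mge p (- N%:Z) (iota (g i)).
  apply: mge_le (projT2 (cid (H i))); rewrite /N (bigD1 i) //=; lia.
exists N => v /(stalk_from Op) [f [n [e [rf he]]]].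
have f0 : regval f != 0 by apply: rv_neq0 rf; exact: oner_neq0.
have -> : v = (regval f ^+ n)^-1 *: iota e.
  by rewrite he scalerA mulVf ?expf_neq0 // scale1r.
apply: (mgeZ (e1 := 0) (e2 := - N%:Z)); rewrite ?add0r //.
  rewrite ordgeE ?invr_eq0 ?expf_neq0 // valV ?expf_neq0 // valX //.
  by rewrite (val_rv _ rf) ?mul0rn ?oppr0 // oner_neq0.
have [c ->] := hg e; rewrite iota_sum; apply: mge_sum => i _; rewrite iotaZ.
by apply: (mgeZ (e1 := 0) (e2 := - N%:Z)); rewrite ?add0r //; exact: regfun_ord.
Qed.

(** Some multiples of the generic basis extend to sections near p. *)
Lemma stalk_lower p : exists2 D : 'M[K]_r, D \in unitmx & forall v, lat p D v -> stalk p v.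
Proof.
have [Om Op] := open_ex p; have [p' [Op' Up']] := openI_ex Om U0.
have [f [W [WO WU dW Wp rf]]] := nbhd Op' Up'.
have f0 : regval f != 0 by apply: rv_neq0 rf; exact: oner_neq0.
have H i : exists N, exists e : E Om, regres WO f ^+ N *: res WU (s i) = res WO e.
  exact: sec_loc_im.
pose N := (\sum_i projT1 (cid (H i)))%N.
have H' i : exists e : E Om, iota e = regval f ^+ N *: delta_mx 0 i.
  have [e he] := projT2 (cid (H i)); set n := projT1 _ in he.
  have /subnK <- : (n <= N)%N by rewrite /N (bigD1 i) //= leq_addr.
  exists (f ^+ (N - n) *: e); rewrite iotaZ regvalX exprD -scalerA; congr (_ *: _).
  by rewrite -(iota_res WO) -he iotaZ iota_res iota_s regvalX.
exists ((regval f ^+ N)^-1%:M).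
  by rewrite unitmxE det_scalar unitrX // unitfE invr_eq0 expf_neq0.
move=> v hv; rewrite /lat mul_mx_scalar in hv.
have -> : v = \sum_i ((regval f ^+ N)^-1 * v 0 i) *: (regval f ^+ N *: delta_mx 0 i).
  rewrite {1}[v]row_sum_delta; apply: eq_bigr => i _; rewrite scalerA; congr (_ *: _).
  by rewrite mulrAC mulVf ?mul1r // expf_neq0.
have st0 : stalk p 0 by exists Om, 0; rewrite iota0.
elim/big_ind: _ => [//|v1 v2|i _]; first exact: stalkD.
apply: stalkZ; first by have := hv 0 i; rewrite mxE.
by have [e he] := H' i; exists Om, e.
Qed.

Lemma stalk_generic p : aset U0 p -> val p (regval a0) = 0 ->
  forall v, lat p 1%:M v <-> stalk p v.
Proof.
move=> Up v0 v; rewrite /lat mulmx1; split.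
  move=> hv; rewrite [v]row_sum_delta.
  have st0 : stalk p 0 by exists U0, 0; rewrite iota0.
  elim/big_ind: _ => [//|v1 v2|i _]; first exact: stalkD.
  apply: stalkZ; first exact: hv.
  by exists U0, (s i); rewrite iota_s.
move=> /(stalk_from Up) [f [n [e [rf he]]]].
have f0 : regval f != 0 by apply: rv_neq0 rf; exact: oner_neq0.
have -> : v = (regval f ^+ n)^-1 *: iota e.
  by rewrite he scalerA mulVf ?expf_neq0 // scale1r.
apply: (mgeZ (e1 := 0) (e2 := 0)) => //.
  rewrite ordgeE ?invr_eq0 ?expf_neq0 // valV ?expf_neq0 // valX //.
  by rewrite (val_rv _ rf) ?mul0rn ?oppr0 // oner_neq0.
have [w [hw /(_ p Up v0) gw]] := coords_exS e.
by rewrite (iotaE hw).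
Qed.

(** Between the two bounds the stalk is a lattice, and it is the standard one
    wherever the basis s generates. *)
Lemma stalk_mdiv : exists D : mdiv X r, forall p v, lat p (D p) v <-> stalk p v.
Proof.
have H p : exists D : 'M[K]_r, [/\ D \in unitmx, forall v, lat p D v <-> stalk p v &
    aset U0 p -> val p (regval a0) = 0 -> D = 1%:M].
  have [[Up v0]|ng] := pselect (aset U0 p /\ val p (regval a0) = 0).
    by exists 1%:M; split; rewrite ?unitmx1 //; exact: stalk_generic.
  have [D uD lD] := stalk_lower p; have [N hN] := stalk_upper p.
  have [m [D1 [uD1 _ h1]]] := ups_fill uD (@stalkD p) (@stalkZ p) lD hN.
  by exists D1; split => // Up v0; case: ng.
pose D p := projT1 (cid (H p)).
have hD p := projT2 (cid (H p)).
have uD p : D p \in unitmx by case: (hD p).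
have fD : finite_set [set p | D p <> 1%:M].
  apply: (@sub_finite_set _ _ (~` aset U0 `|` [set p | val p (regval a0) != 0])).
    move=> p /= nD; have [Up|nU] := pselect (aset U0 p); last by left.
    right; apply: contra_notN nD => /eqP v0; by case: (hD p) => _ _; apply.
  rewrite finite_setU; split; first by case: (asetP U0).
  by apply: finite_val; rewrite -regval_neq0.
exists (Mdiv uD fD) => p v /=; by case: (hD p).
Qed.

(** A section of the lattices lifts locally; the functions f such that f v lifts
    form an ideal that vanishes nowhere. *)
Lemma iota_surj (D : mdiv X r) : (forall p v, lat p (D p) v <-> stalk p v) ->
  forall (Om : aopen X) v, (forall p, aset Om p -> lat p (D p) v) -> exists e : E Om, iota e = v.
Proof.
move=> hD Om v hv.
pose I (f : regfun Om) := exists e : E Om, iota e = regval f *: v.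
suff : I 1 by move=> [e]; rewrite regval1 scale1r; exists e.
apply: nullstellensatz.
  - by move=> a b [e he] [e' he']; exists (e + e'); rewrite iotaD he he' regvalD scalerDl.
  - by move=> a b [e he]; exists (a *: e); rewrite iotaZ he regvalM scalerA.
  - move=> p Op; have /hD /(stalk_from Op) [f [N [e [rf he]]]] := hv p Op.
    exists (f ^+ N), 1; split; [by exists e; rewrite regvalX|exact: oner_neq0|].
    by rewrite regvalX -(expr1n k N); exact: rvX.
Qed.

End Basis.

(** A coherent sheaf modulo its torsion is the bundle of a matrix divisor: the
    stalks, mapped to the generic fibre, are lattices. *)
Theorem coh_structure : exists n (D : mdiv X n) (i : coh_hom E (LL D)),
  (forall (U : aopen X) (v : LL D U), exists e : E U, hmap i U e = v) /\
  (forall (U : aopen X) (e : E U), hmap i U e = 0 <-> exists2 b : regfun U, b != 0 & b *: e = 0).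
Proof.
have [m [g hg]] := sec_fg E U0.
have [r [s [a [a0 indep span']]]] := torsion_basis (@regfun_dom U0) g.
have span (e : E U0) : exists c : 'I_r -> regfun U0, a *: e = \sum_(j < r) c j *: s j.
  have [c ->] := hg e; pose d i := projT1 (cid (span' i)).
  have hd i : a *: g i = \sum_j d i j *: s j by exact: (projT2 (cid (span' i))).
  exists (fun j => \sum_i c i * d i j); rewrite scaler_sumr.
  rewrite (eq_bigr (fun i => \sum_j (c i * d i j) *: s j)).
    by rewrite exchange_big; apply: eq_bigr => j _; rewrite scaler_suml.
  move=> i _; rewrite scalerA mulrC -scalerA hd scaler_sumr.
  by apply: eq_bigr => j _; rewrite scalerA.
have [D hD] := stalk_mdiv a0 indep span.
pose io := @iota r s a a0 span.
have hlat (U : aopen X) (e : E U) : io U e \in lat_on D U.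
  by apply/lat_onP => p Up; apply/hD; exists U, e.
pose f (U : aopen X) (e : E U) : lsec D U := LSec (hlat U e).
have lf U : linear (f U : E U -> LL D U) by move=> b e e'; apply: lval_inj; exact: iota_lin.
have hr (U V : aopen X) (sVU : V `<=` U) (e : E U) : f V (res sVU e) = lres sVU (f U e).
  by apply: lval_inj; exact: (iota_res a0 indep span).
pose i : coh_hom E (@LL k X ch r D) := @CohHom k X E (LL D) (fun U => mklin (lf U))
  hr.
exists r, D, i; split.
  move=> U v; have [e he] := iota_surj indep hD (fun p Up => lsec_lat v Up).
  by exists e; apply: lval_inj.
move=> U e; split.
  move=> /(congr1 (@lval k X r D U)) /= h; apply: (coords0 (s := s)).
  by have := iotaP a0 span e; rewrite -/(io U e) h.
move=> [b b0 be]; apply: lval_inj; rewrite /= ; apply: (coords_tors indep b0 be).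
exact: iotaP.
Qed.

End Structure.

(** * Homomorphisms of bundles as matrices *)

Section KDim.
Variables (k K : fieldType) (cst : {rmorphism k -> K}) (V : lmodType K).

(** Bases over k of subsets of a space over K, and the resulting dimension; the
    subsets are spaces of homomorphisms between bundles. *)
Definition kbasis (S : set V) a (f : 'I_a -> V) := (forall i, S (f i)) /\
  forall v, S v -> exists! c : 'rV[k]_a, v = \sum_i cst (c 0 i) *: f i.

Definition kdim (S : set V) a := exists f : 'I_a -> V, kbasis S f.

Lemma kbasis_mx (S : set V) a b (f : 'I_a -> V) (g : 'I_b -> V) : kbasis S f -> kbasis S g ->
  exists C : 'M[k]_(a, b), forall i, f i = \sum_j cst (C i j) *: g j.
Proof.
move=> [Sf _] [_ hg]; have H i : exists c : 'rV[k]_b, f i = \sum_j cst (c 0 j) *: g j.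
  by have [c [hc _]] := hg _ (Sf i); exists c.
exists (\matrix_(i, j) projT1 (cid (H i)) 0 j) => i.
by under eq_bigr do rewrite mxE; case: cid.
Qed.

Lemma kbasis_mul a b (f : 'I_a -> V) (g : 'I_b -> V) (C : 'M[k]_(a, b)) (c : 'rV[k]_a) :
  (forall i, f i = \sum_j cst (C i j) *: g j) ->
  \sum_i cst (c 0 i) *: f i = \sum_j cst ((c *m C) 0 j) *: g j.
Proof.
move=> hC; under eq_bigr do rewrite hC scaler_sumr.
rewrite exchange_big; apply: eq_bigr => j _ /=.
rewrite mxE rmorph_sum scaler_suml; apply: eq_bigr => i _.
by rewrite scalerA rmorphM.
Qed.

Lemma kbasis_one (S : set V) a (f : 'I_a -> V) (C : 'M[k]_a) : kbasis S f ->
  (forall i, f i = \sum_j cst (C i j) *: f j) -> C = 1%:M.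
Proof.
move=> [Sf hf] hC; apply/row_matrixP => i.
have [c [_ uc]] := hf _ (Sf i).
have <- : c = row i C.
  by apply: uc; rewrite [LHS]hC; apply: eq_bigr => j _; rewrite mxE.
apply: uc; rewrite (bigD1 i) //= big1 ?addr0.
  by rewrite !mxE eqxx rmorph1 scale1r.
by move=> j /negbTE ji; rewrite !mxE eq_sym ji rmorph0 scale0r.
Qed.

Lemma kdim_uniq (S : set V) a b : kdim S a -> kdim S b -> a = b.
Proof.
have mul (f : 'I_a -> V) (g : 'I_b -> V) : kbasis S f -> kbasis S g -> (a <= b)%N.
  move=> hf hg; have [C hC] := kbasis_mx hf hg; have [C' hC'] := kbasis_mx hg hf.
  have E : C *m C' = 1%:M.
    apply: (kbasis_one hf) => i; rewrite [LHS]hC.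
    have := kbasis_mul (row i C) hC'; under eq_bigr do rewrite mxE.
    by move=> ->; apply: eq_bigr => j _; rewrite -row_mul mxE.
  by have := mulmx1_min E.
have mul' (f : 'I_b -> V) (g : 'I_a -> V) : kbasis S f -> kbasis S g -> (b <= a)%N.
  move=> hf hg; have [C hC] := kbasis_mx hf hg; have [C' hC'] := kbasis_mx hg hf.
  have E : C *m C' = 1%:M.
    apply: (kbasis_one hf) => i; rewrite [LHS]hC.
    have := kbasis_mul (row i C) hC'; under eq_bigr do rewrite mxE.
    by move=> ->; apply: eq_bigr => j _; rewrite -row_mul mxE.
  by have := mulmx1_min E.
move=> [f hf] [g hg]; apply/eqP; rewrite eqn_leq; apply/andP; split.
  exact: mul hf hg.
exact: mul' hg hf.
Qed.

(** S is the kernel of a linear map from S' onto k ^ n, where R is the graph of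
    this map. A relation is used since the maps below take the value of a
    function at a point, which is itself given by a relation. *)
Lemma kdim_ext (S S' : set V) a n (R : V -> 'rV[k]_n -> Prop) :
  (forall u v, S' u -> S' v -> S' (u + v)) -> (forall c u, S' u -> S' (cst c *: u)) ->
  (forall c u v w z, R u w -> R v z -> R (cst c *: u + v) (c *: w + z)) ->
  (forall v w z, R v w -> R v z -> w = z) ->
  (forall v, S v -> S' v /\ R v 0) ->
  (forall v, S' v -> R v 0 -> S v) ->
  (forall v, S' v -> exists w, R v w) ->
  (forall w, exists2 v, S' v & R v w) ->
  kdim S a -> kdim S' (a + n).
Proof.
move=> SD SZ Rlin Runiq SS' RS Rtot Rsurj [f [Sf hf]].
have H j : exists v, S' v /\ R v (delta_mx 0 j).
  by have [v h1 h2] := Rsurj (delta_mx 0 j); exists v.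
pose g j := projT1 (cid (H j)).
have S'g j : S' (g j) by rewrite /g; case: cid => v [].
have Rg j : R (g j) (delta_mx 0 j) by rewrite /g; case: cid => v [].
pose F (i : 'I_(a + n)) := match fintype.split i with inl i => f i | inr j => g j end.
have Fl i : F (lshift n i) = f i by rewrite /F; case: splitP => j // e; [congr f;
  apply/ord_inj|exfalso; move: e (ltn_ord i) => /= ->; lia].
have Fr j : F (rshift a j) = g j by rewrite /F; case: splitP => i // e; [exfalso;
  move: e (ltn_ord i) => /= <-; lia|congr g; apply/ord_inj; move: e => /= /addnI].
have sumF (c : 'rV[k]_(a + n)) : \sum_i cst (c 0 i) *: F i =
    \sum_i cst (lsubmx c 0 i) *: f i + \sum_j cst (rsubmx c 0 j) *: g j.
  rewrite big_split_ord; congr (_ + _); apply: eq_bigr => i _ /=; rewrite mxE.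
    by rewrite Fl.
  by rewrite Fr.
have S'0 : S' 0 by have [v h _] := Rsurj 0; have := SZ 0 v h; rewrite rmorph0 scale0r.
have R00 : R 0 0.
  by have [v h h'] := Rsurj 0; have := Rlin (-1) v v 0 0 h' h';
    rewrite rmorphN1 scaleN1r addNr scaler0 addr0.
have combg (w : 'rV[k]_n) : S' (\sum_j cst (w 0 j) *: g j) /\ R (\sum_j cst (w 0 j) *: g j) w.
  suff : S' (\sum_j cst (w 0 j) *: g j) /\
      R (\sum_j cst (w 0 j) *: g j) (\sum_j w 0 j *: delta_mx 0 j).
    by rewrite -row_sum_delta.
  elim/big_ind2: _ => //; last by move=> j _; split;
    [exact: SZ|rewrite -[_ *: g j]addr0 -[w 0 j *: _]addr0; exact: Rlin].
  move=> u w1 v w2 [h1 h2] [h3 h4]; split; first exact: SD.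
  by have := Rlin 1 _ _ _ _ h2 h4; rewrite rmorph1 !scale1r.
have combf (c : 'rV[k]_a) : S (\sum_i cst (c 0 i) *: f i).
  have [h1 h2] : S' (\sum_i cst (c 0 i) *: f i) /\ R (\sum_i cst (c 0 i) *: f i) 0.
    elim/big_ind: _ => //.
      move=> u v [h1 h2] [h3 h4]; split; first exact: SD.
      by have := Rlin 1 _ _ _ _ h2 h4; rewrite rmorph1 !scale1r addr0.
    move=> i _; have [h1 h2] := SS' _ (Sf i); split; first exact: SZ.
    by have := Rlin (c 0 i) _ _ _ _ h2 R00; rewrite scaler0 !addr0.
  exact: RS.
exists F; split.
  by move=> i; rewrite /F; case: fintype.split => j; [case: (SS' _ (Sf j))|exact: S'g].
move=> v S'v; have [w Rvw] := Rtot v S'v.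
have [c [hc uc]] : exists! c : 'rV[k]_a, v - \sum_j cst (w 0 j) *: g j = \sum_i cst (c 0 i) *: f i.
  apply: hf; have [h1 h2] := combg w; apply: RS.
    by apply: SD => //; rewrite -scaleN1r -(rmorphN1 cst); exact: SZ.
  by have := Rlin (-1) _ _ _ _ h2 Rvw; rewrite rmorphN1 !scaleN1r addrC addNr.
exists (row_mx c w); split.
  by rewrite sumF row_mxKl row_mxKr -hc subrK.
move=> c'; rewrite sumF => ev.
have ew : w = rsubmx c'.
  have [h1 h2] := combg (rsubmx c').
  have [_ h3] := SS' _ (combf (lsubmx c')).
  apply: (Runiq v) => //; rewrite ev.
  by have := Rlin 1 _ _ _ _ h3 h2; rewrite rmorph1 !scale1r add0r.
rewrite -[c']hsubmxK -ew; congr (row_mx _ _); apply: uc.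
by rewrite ev -ew addrK.
Qed.

End KDim.

Section LatticeHoms.
Variables (k : closedFieldType) (X : elliptic_curve k).
Context {ch : char0 k}.
Notation K := (ffield X).
Notation cst := (fconst X).
Implicit Types (p q : point X) (f g : K) (c : k).

(** A function vanishing to a high order at the poles of c in U, with its own
    poles outside U. *)
Lemma denominator (U : aopen X) n (c : 'rV[K]_n) : exists b : regfun U, b != 0 /\
  forall i, exists a : regfun U, regval a = regval b * c 0 i.
Proof.
have [q hq] := open_miss U.
have [S hS] : exists S : seq (point X), forall p, p \notin S -> mge p 0 c.
  elim: n c => [|n IH] c; first by exists [::] => p _ i [].
  have [S hS] := IH (\row_i c 0 (lift ord0 i)).
  have [S' hS'] : exists S' : seq (point X), forall p, p \notin S' -> ordge p 0 (c 0 ord0).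
    have [->|c0] := eqVneq (c 0 ord0) 0; first by exists [::] => p _; exact: ordge_0.
    by have [S' hS'] := finite_list_zeros c0; exists S' => p /hS' v0; rewrite ordgeE // v0.
  exists (S ++ S') => p; rewrite mem_cat negb_or => /andP[/hS h1 /hS' h2] i j.
  rewrite (ord1 i); have [j' ->|->//] := unliftP ord0 j.
  by have := h1 0 j'; rewrite mxE.
have [N hN] := mge_bounds S (fun _ => c).
have [p0 hp0] : exists p0, ~ [set` q :: S] p0.
  by apply: point_neq_ex; exact: finite_seq.
have /negP := hp0; rewrite in_cons negb_or => /andP[pq pS].
have [f [hf rf]] : exists f, (forall p, p \in p0 :: [seq p <- S | p != q] ->
      ordge p N.+1 (f - (if p == p0 then 1 else 0))) /\
   (forall p, p \notin p0 :: [seq p <- S | p != q] -> p <> q -> ordge p 0 f).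
  apply: (approx (fun p => if p == p0 then 1 else 0)).
  by rewrite in_cons negb_or eq_sym pq mem_filter eqxx.
have f1 : rv p0 f 1.
  apply/rv_ordge1; rewrite rmorph1; have := hf p0; rewrite in_cons eqxx => /(_ isT).
  by apply: ordge_le.
have f0 : f != 0 by apply: rv_neq0 f1; exact: oner_neq0.
have fS p : p \in S -> p <> q -> ordge p N.+1 f.
  move=> h /eqP hq'; have := hf p; rewrite in_cons mem_filter h hq' orbT => /(_ isT).
  have -> : (p == p0) = false by apply/negbTE; apply: contraNneq pS => <-.
  by rewrite subr0.
have rf' p : p <> q -> ordge p 0 f.
  move=> hq'; have [e|np] := eqVneq p p0.
    by rewrite e; apply/ordge_regP/rv_reg; exists 1.
  have [/fS h|pS'] := boolP (p \in S); first by apply: ordge_le (h hq').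
  by apply: rf => //; rewrite in_cons negb_or np mem_filter negb_and pS' orbT.
have [b hb] : exists b : regfun U, regval b = f by apply: regfun_ex => p /hq; exact: rf'.
exists b; split; first by rewrite regval_neq0 hb.
move=> i; apply: regfun_ex => p Up; rewrite hb.
have [pS'|pS'] := boolP (p \in S).
  apply: (@ordge_le _ _ p (N.+1%:Z - N%:Z)); first by lia.
  by apply: ordgeM; [exact: fS (hq _ Up)|exact: hN].
by rewrite ordgeM0 //; [exact: rf' (hq _ Up)|exact: hS].
Qed.

Lemma frame_sec n (D : mdiv X n) (U : aopen X) (T : seq (point X)) : exists (V : 'M[K]_n)
  (v : 'I_n -> lsec D U), [/\ V \in unitmx, forall i, lval (v i) = row i V &
   forall p, p \in T -> aset U p -> mge p 0 (invmx (V *m D p))].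
Proof.
have [q hq] := open_miss U.
have [V [uV lV hV]] := lat_frame D q T.
have H i p : aset U p -> lat p (D p) (row i V) by move=> /hq pq; apply: lat_row; exact: lV.
exists V, (fun i => projT1 (cid (lsec_ex (H i)))); split => //.
  by move=> i; case: cid.
by move=> p pT /hq; exact: hV.
Qed.

(** A linear map on the sections over U extends to the generic fibre: it is the
    matrix of its values on a frame, as sections have regular coordinates in the
    frame up to a denominator. *)
Lemma lin_matrix n m (D : mdiv X n) (U : aopen X) (phi : LL D U -> 'rV[K]_m) :
  (forall a s t, phi (a *: s + t) = regval a *: phi s + phi t) ->
  exists A : 'M[K]_(n, m), forall s : LL D U, phi s = lval s *m A.
Proof.
move=> lin; have [V [v [uV hv _]]] := frame_sec D U [::].
have phi0 : phi 0 = 0.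
  by have := lin 1 0 0; rewrite regval1 !scale1r addr0 => /eqP;
    rewrite -subr_eq subrr eq_sym => /eqP.
have phiZ a s : phi (a *: s) = regval a *: phi s by rewrite -[a *: s]addr0 lin phi0 addr0.
have phiD s t : phi (s + t) = phi s + phi t by have := lin 1 s t; rewrite regval1 !scale1r.
have phi_sum (I : finType) (F : I -> LL D U) : phi (\sum_i F i) = \sum_i phi (F i).
  by elim/big_rec2: _ => // i y1 y2 _ <-; rewrite phiD.
pose H : 'M[K]_(n, m) := \matrix_i phi (v i).
exists (invmx V *m H) => s.
have [b [b0 hb]] := denominator U (lval s *m invmx V).
pose a i := projT1 (cid (hb i)).
have ha i : regval (a i) = regval b * (lval s *m invmx V) 0 i by rewrite /a; case: cid.
have e : b *: s = \sum_i a i *: v i :> LL D U.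
  apply: lval_inj; rewrite lval_sum lvalZ -{1}(mulmxKV uV (lval s)) mulmx_sum_row scaler_sumr.
  by apply: eq_bigr => i _; rewrite lvalZ ha hv scalerA.
have b0' : regval b != 0 by rewrite -regval_neq0.
apply: (scalerI b0'); rewrite -phiZ e phi_sum mulmxA (mulmx_sum_row _ H) scaler_sumr.
by apply: eq_bigr => i _; rewrite phiZ ha scalerA rowK.
Qed.

Lemma matrix_uniq n m (D : mdiv X n) (U : aopen X) (A B : 'M[K]_(n, m)) :
  (forall s : lsec D U, lval s *m A = lval s *m B) -> A = B.
Proof.
move=> h; have [V [v [uV hv _]]] := frame_sec D U [::].
have e : V *m A = V *m B by apply/row_matrixP => i; rewrite !row_mul -hv.
by rewrite -(mulKmx uV A) e mulKmx.
Qed.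

(** The matrix A maps the lattice D p into the lattice M p. *)
Definition hlat p n m (D : mdiv X n) (M : mdiv X m) (A : 'M[K]_(n, m)) :=
  mge p 0 (invmx (D p) *m A *m M p).

Lemma hlatP p n m (D : mdiv X n) (M : mdiv X m) (A : 'M[K]_(n, m)) :
  hlat p D M A <-> forall v : 'rV[K]_n, lat p (D p) v -> lat p (M p) (v *m A).
Proof.
split=> [h v hv|h].
  have -> : v *m A = (v *m D p) *m (invmx (D p) *m A).
    by rewrite mulmxA mulmxK ?mdiv_unit.
  by rewrite /lat -mulmxA; apply: mgeM0.
apply: lat_rows => i; rewrite row_mul; apply: h; apply: lat_row.
by rewrite /lat mulVmx ?mdiv_unit //; exact: mge_1.
Qed.

(** The matrices over two open sets agree because they agree on the
    intersection. *)
Lemma hom_matrix n m (D : mdiv X n) (M : mdiv X m) (h : coh_hom (LL D) (LL M)) :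
  exists A : 'M[K]_(n, m), (forall (U : aopen X) (s : LL D U), lval (hmap h U s) = lval s *m A) /\
    forall p, hlat p D M A.
Proof.
have H U : exists A : 'M[K]_(n, m), forall s : LL D U, lval (hmap h U s) = lval s *m A.
  by apply: (@lin_matrix n m D U (fun s => lval (hmap h U s))) => a s t; rewrite linearP.
have sub (U V : aopen X) (hVU : V `<=` U) A B :
    (forall s : LL D U, lval (hmap h U s) = lval s *m A) ->
    (forall s : LL D V, lval (hmap h V s) = lval s *m B) -> A = B.
  move=> hA hB; apply: (@matrix_uniq _ _ D U) => s; rewrite -hA.
  have <- : lval (hmap h V (@res _ _ (LL D) U V hVU s)) = lval s *m B by rewrite hB.
  by rewrite hmap_res.
have [A hA] := H (off Infinity).
have hAU U (s : LL D U) : lval (hmap h U s) = lval s *m A.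
  have [B hB] := H U; have [C hC] := H (openI U (off Infinity)).
  have <- : B = A; last exact: hB.
  rewrite (sub U _ (@openIl k X U (off Infinity)) B C hB hC).
  by rewrite (sub _ _ (@openIr k X U (off Infinity)) A C hA hC).
exists A; split => // p; apply/hlatP => v hv.
have [U Up] := open_ex p.
have [V [w [uV hw hV]]] := frame_sec D U [:: p].
have lV : lat p (M p) (V *m A).
  apply: lat_rows => i; rewrite row_mul -hw -hAU; exact: lsec_lat.
have -> : v *m A = ((v *m D p) *m invmx (V *m D p)) *m (V *m A).
  by rewrite invmx_mul ?mdiv_unit // !mulmxA mulmxK ?mdiv_unit // mulmxKV.
apply: lat_mul lV; apply: mgeM0; first exact: hv.
by apply: hV; rewrite ?in_cons ?eqxx.
Qed.

Lemma matrix_hom n m (D : mdiv X n) (M : mdiv X m) (A : 'M[K]_(n, m)) :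
  (forall p, hlat p D M A) ->
  exists h : coh_hom (LL D) (LL M), forall (U : aopen X) (s : LL D U),
    lval (hmap h U s) = lval s *m A.
Proof.
move=> hA; have H U (s : LL D U) : lval s *m A \in lat_on M U.
  by apply/lat_onP => p Up; move/hlatP: (hA p); apply; exact: lsec_lat.
pose f U (s : lsec D U) : lsec M U := LSec (H U s).
have lf U : linear (f U : LL D U -> LL M U).
  by move=> a s t; apply: lval_inj; rewrite /= mulmxDl -scalemxAl.
have hr (U V : aopen X) (sVU : V `<=` U) (e : LL D U) :
    mklin (lf V) (res sVU e) = res sVU (mklin (lf U) e) by exact: lval_inj.
by exists (@CohHom k X (LL D) (LL M) (fun U => mklin (lf U)) hr).
Qed.

End LatticeHoms.

(** * Riemann-Roch for bundles *)

Section RiemannRoch.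
Variables (k : closedFieldType) (X : elliptic_curve k).
Context {ch : char0 k}.
Notation K := (ffield X).
Notation cst := (fconst X).
Implicit Types (p q : point X) (f g : K) (c : k).

Lemma mdiv_of_subproof n (S : seq (point X)) (F : point X -> 'M[K]_n)
  (uF : forall p, F p \in unitmx) :
  (forall p, (if p \in S then F p else 1%:M) \in unitmx) /\
  finite_set [set p | (if p \in S then F p else 1%:M) <> 1%:M].
Proof.
split; first by move=> p; case: ifP => // _; rewrite unitmx1.
apply: (@sub_finite_set _ _ [set` S]); last exact: finite_seq.
by move=> p /=; case: ifP.
Qed.

Definition mdiv_of n (S : seq (point X)) (F : point X -> 'M[K]_n)
  (uF : forall p, F p \in unitmx) : mdiv X n :=
  Mdiv (mdiv_of_subproof S uF).1 (mdiv_of_subproof S uF).2.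

(** Different matrices may define the same lattice. *)
Definition latsame p n (M M' : 'M[K]_n) := forall v : 'rV[K]_n, lat p M v <-> lat p M' v.

Lemma latsame_val p n (M M' : 'M[K]_n) : M \in unitmx -> M' \in unitmx ->
  latsame p M M' -> val p (\det M) = val p (\det M').
Proof.
have half (A B : 'M[K]_n) : A \in unitmx -> B \in unitmx -> (forall v : 'rV[K]_n, lat p A v ->
  lat p B v) ->
    val p (\det A) <= val p (\det B).
  move=> uA uB h; have hg : mge p 0 (invmx A *m B).
    apply: lat_rows => i; apply: h; apply: lat_row.
    by rewrite /lat mulVmx //; exact: mge_1.
  have : ordge p (0 *+ n) (\det (invmx A *m B)) by exact: mge_det.
  rewrite det_mulmx det_inv mul0rn.
  have d0 : \det A != 0 by rewrite -unitfE -unitmxE.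
  have d1 : \det B != 0 by rewrite -unitfE -unitmxE.
  by rewrite ordgeE ?mulf_neq0 ?invr_eq0 // valM ?invr_eq0 // valV // addrC subr_ge0.
move=> uM uM' h; apply/eqP; rewrite eq_le; apply/andP; split.
  by apply: half => // v /h.
by apply: half => // v /h.
Qed.

Lemma up_val p n (D D1 : 'M[K]_n) : D \in unitmx -> up p D D1 ->
  val p (\det D1) = val p (\det D) + 1.
Proof.
move=> uD [uD1 [e [ne te he]]]; have [D2 [uD2 h2 <-]] := grow uD ne te.
by apply: latsame_val => // v; rewrite he h2.
Qed.

Lemma ups_val p n (D D1 : 'M[K]_n) m : D \in unitmx -> ups p D m D1 ->
  D1 \in unitmx /\ val p (\det D1) = val p (\det D) + m%:Z.
Proof.
move=> uD h; elim: h uD => {D D1 m} [D|D D1 D2 m hup _ IH] uD; first by rewrite addr0.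
have [uD1 _] := hup; have [uD2 ->] := IH uD1; split => //.
rewrite (up_val uD hup); lia.
Qed.

Lemma up_latsame p n (D D' D1 D1' : 'M[K]_n) : D1' \in unitmx -> latsame p D D' ->
  latsame p D1 D1' ->
  up p D D1 -> up p D' D1'.
Proof.
move=> u h h1 [_ [e [ne te he]]]; split => //; exists e; split.
- by move=> /h.
- exact/h.
- by move=> v; rewrite -h1 he; split => -[a ga la]; exists a => //; apply/h.
Qed.

Inductive gups n : mdiv X n -> nat -> mdiv X n -> Prop :=
| Gups0 (M M' : mdiv X n) : (forall p, latsame p (M p) (M' p)) -> gups M 0 M'
| GupsS (M M1 M' : mdiv X n) p N : up p (M p) (M1 p) -> (forall q, q <> p ->
  latsame q (M q) (M1 q)) ->
    gups M1 N M' -> gups M N.+1 M'.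

Lemma gups_same n (M0 M M' : mdiv X n) N : (forall p, latsame p (M0 p) (M p)) ->
  gups M N M' -> gups M0 N M'.
Proof.
move=> h0 h; case: h h0 => {M M' N} [M M' h h0|M M1 M' p N hup hq hg h0].
  by apply: Gups0 => p v; rewrite h0 h.
apply: (GupsS (p := p) (M1 := M1)) hg.
  apply: up_latsame hup; [exact: mdiv_unit|by move=> v; rewrite h0|by []].
by move=> q qp v; rewrite h0; exact: hq.
Qed.

Lemma gups_trans n (M M1 M2 : mdiv X n) a b : gups M a M1 -> gups M1 b M2 -> gups M (a + b) M2.
Proof.
move=> h; elim: h b => {M M1 a} [M M1 h|M M1' M1 p a hup hq _ IH] b h2.
  exact: gups_same h h2.
by rewrite addSn; apply: GupsS hup hq _; exact: IH.
Qed.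

Definition mset_fun n (M : mdiv X n) p (D : 'M[K]_n) : point X -> 'M[K]_n :=
  fun q => if q == p then D else M q.

Lemma mset_subproof n (M : mdiv X n) p (D : 'M[K]_n) : D \in unitmx ->
  (forall q, mset_fun M p D q \in unitmx) /\ finite_set [set q | mset_fun M p D q <> 1%:M].
Proof.
move=> uD; rewrite /mset_fun; split; first by move=> q; case: ifP => // _; exact: mdiv_unit.
apply: (@sub_finite_set _ _ ([set p] `|` [set q | M q <> 1%:M])).
  by move=> q /=; case: eqP => [->|_]; [left|right].
by rewrite finite_setU; split; [exact: finite_set1|exact: mdiv_fin].
Qed.

Definition mset n (M : mdiv X n) p (D : 'M[K]_n) (uD : D \in unitmx) : mdiv X n :=
  Mdiv (mset_subproof M p uD).1 (mset_subproof M p uD).2.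

Lemma mset_eq n (M : mdiv X n) p (D : 'M[K]_n) (uD : D \in unitmx) : mset M p uD p = D.
Proof. by rewrite /= /mset_fun eqxx. Qed.

Lemma mset_neq n (M : mdiv X n) p q (D : 'M[K]_n) (uD : D \in unitmx) : q <> p ->
  mset M p uD q = M q.
Proof. by move=> /eqP/negbTE h; rewrite /= /mset_fun h. Qed.

Lemma ups_gups n p (M M' : mdiv X n) a D1 : (forall q, q <> p -> latsame q (M q) (M' q)) ->
  ups p (M p) a D1 -> latsame p D1 (M' p) -> gups M a M'.
Proof.
move=> hq h; move e : (M p) h => D h.
elim: h M e hq => {D D1 a} [D|D D1 D2 a hup _ IH] M e hq h1.
  apply: Gups0 => q; have [->|qp] := eqVneq q p; first by rewrite e.
  by apply: hq; exact/eqP.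
have [uD1 _] := hup.
apply: (GupsS (p := p) (M1 := mset M p uD1)).
- by rewrite mset_eq e.
- by move=> q qp; rewrite mset_neq.
- apply: IH h1; first exact: mset_eq.
  by move=> q qp; rewrite mset_neq //; exact: hq.
Qed.

(** The length of the chain is the difference of the orders of the determinants:
    this is the contribution of p to the difference of the degrees. *)
Lemma gups_point n p (M M' : mdiv X n) : (forall q, q <> p -> latsame q (M q) (M' q)) ->
  (forall v : 'rV[K]_n, lat p (M p) v -> lat p (M' p) v) ->
  exists a, gups M a M' /\ val p (\det (M' p)) = val p (\det (M p)) + a%:Z.
Proof.
move=> hq hp; have [N hN] := mge_bound p (invmx (M' p)).
have [||||a [D1 [uD1 hups h1]]] := @ups_fill k X ch p n (M p) (lat p (M' p)) N (mdiv_unit M p).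
- by move=> v w; exact: latD.
- by move=> b v; exact: latZ.
- exact: hp.
- move=> v hv; rewrite -(mulmxK (mdiv_unit M' p) v).
  by apply: (mgeM _ hv hN); rewrite add0r.
exists a; split; first exact: ups_gups hups h1.
have [_ <-] := ups_val (mdiv_unit M p) hups.
by apply: latsame_val; rewrite ?mdiv_unit // => v; rewrite h1.
Qed.

(** The two divisors differ at finitely many points only, which are treated one
    after the other. *)
Lemma gups_ex n (M M' : mdiv X n) : (forall p (v : 'rV[K]_n), lat p (M p) v -> lat p (M' p) v) ->
  exists a, gups M a M'.
Proof.
have [S hS] := mdiv_supp M; have [S' hS'] := mdiv_supp M'.
have : forall p, p \notin S ++ S' -> M p = M' p.
  by move=> p; rewrite mem_cat negb_or => /andP[/hS -> /hS' ->].
move: (S ++ S') => T {S S' hS hS'}; elim: T M => [|p T IH] M hT h.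
  by exists 0%N; apply: Gups0 => p; rewrite hT.
pose M1 := mset M p (mdiv_unit M' p).
have [q|q|a [ga _]] := @gups_point n p M M1.
- by move=> qp; rewrite mset_neq.
- by rewrite mset_eq; exact: h.
have [q qT|q|b gb] := IH M1; last by exists (a + b)%N; exact: gups_trans ga gb.
  have [->|qp] := eqVneq q p; first by rewrite mset_eq.
  rewrite mset_neq; last exact/eqP.
  by apply: hT; rewrite in_cons negb_or qp.
have [->|qp] := eqVneq q p; first by rewrite mset_eq.
by rewrite mset_neq; [exact: h|exact/eqP].
Qed.

Definition hglob n m (D : mdiv X n) (M : mdiv X m) : set 'M[K]_(n, m) :=
  [set A | forall p, hlat p D M A].

Definition h0 n m (D : mdiv X n) (M : mdiv X m) := kdim cst (hglob D M).

(** The vanishing of Ext ^ 1(LL D, LL M) in adelic terms: every system of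
    principal parts of homomorphisms is that of one global matrix. *)
Definition h1zero n m (D : mdiv X n) (M : mdiv X m) :=
  forall (S : seq (point X)) (A : point X -> 'M[K]_(n, m)),
  exists B, forall p, hlat p D M (B - (if p \in S then A p else 0)).

Lemma hlat_latsame p n m (D : mdiv X n) (M M' : mdiv X m) A :
  latsame p (M p) (M' p) -> hlat p D M A -> hlat p D M' A.
Proof. by move=> h /hlatP hA; apply/hlatP => v /hA /h. Qed.

Lemma hlat_latsamel p n m (D D' : mdiv X n) (M : mdiv X m) A :
  latsame p (D p) (D' p) -> hlat p D M A -> hlat p D' M A.
Proof. by move=> h /hlatP hA; apply/hlatP => v /h /hA. Qed.

Lemma hlatD p n m (D : mdiv X n) (M : mdiv X m) A B :
  hlat p D M A -> hlat p D M B -> hlat p D M (A + B).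
Proof. by move=> hA hB; rewrite /hlat mulmxDr mulmxDl; exact: mgeD. Qed.

Lemma hlatZ p n m (D : mdiv X n) (M : mdiv X m) a A :
  ordge p 0 a -> hlat p D M A -> hlat p D M (a *: A).
Proof.
by move=> ha hA; rewrite /hlat -scalemxAr -scalemxAl; apply: (mgeZ (e1 := 0) (e2 := 0)).
Qed.

Lemma hlat_up p n m (D : mdiv X n) (M M' : mdiv X m) A :
  up p (M p) (M' p) -> hlat p D M A -> hlat p D M' A.
Proof.
move=> [_ [e [_ _ he]]] /hlatP hA; apply/hlatP => v /hA hv; apply/he.
by exists 0; rewrite ?ordge_0 // scale0r subr0.
Qed.

Lemma hlat_upl p n m (D D' : mdiv X n) (M : mdiv X m) A :
  up p (D' p) (D p) -> hlat p D M A -> hlat p D' M A.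
Proof.
move=> [_ [e [_ _ he]]] /hlatP hA; apply/hlatP => v hv; apply/hA/he.
by exists 0; rewrite ?ordge_0 // scale0r subr0.
Qed.

(** A homomorphism into the larger bundle maps the fibre of D at p, which has
    dimension n, to the line k e. This gives a linear map to k ^ n with kernel
    the homomorphisms into M, and h1zero makes it surjective. *)
Lemma step_target n m (D : mdiv X n) (M M' : mdiv X m) p a :
  up p (M p) (M' p) -> (forall q, q <> p -> latsame q (M q) (M' q)) ->
  h0 D M a -> h1zero D M -> h0 D M' (a + n) /\ h1zero D M'.
Proof.
move=> hup hq hd h1; have mon q A : hlat q D M A -> hlat q D M' A.
  have [->|/eqP qp] := eqVneq q p; first exact: hlat_up.
  exact/hlat_latsame/hq.
split; last by move=> S A; have [B hB] := h1 S A; exists B => q; exact: mon.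
have [_ [e [ne te he]]] := hup.
pose R (A : 'M[K]_(n, m)) (w : 'rV[k]_n) := lat p (M p) (invmx (D p) *m A - map_mx cst w^T *m e).
apply: (kdim_ext (R := R)) hd.
- by move=> u v hu hv q; apply: hlatD.
- by move=> c u hu q; apply: hlatZ => //; exact: ordge_cst.
- move=> c u v w z hu hv; rewrite /R mulmxDr -scalemxAr linearD linearZ map_mxD map_mxZ.
  rewrite mulmxDl -scalemxAl opprD addrACA -scalerBr.
  exact: (latD (latZ (ordge_cst _ _) hu) hv).
- move=> v w z hw hz; have h : lat p (M p) (map_mx cst (z^T - w^T) *m e).
    have -> : map_mx cst (z^T - w^T) *m e = (invmx (D p) *m v - map_mx cst w^T *m e)
        - (invmx (D p) *m v - map_mx cst z^T *m e).
      by rewrite map_mxB mulmxBl opprB [RHS]addrC addrA subrK.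
    exact: (latB hw hz).
  apply/rowP => i; apply/eqP; rewrite -subr_eq0; apply: contra_notT ne => c0.
  have := lat_row i h; rewrite row_mul => hi.
  have {}hi : lat p (M p) (cst (z 0 i - w 0 i) *: e).
    suff -> : cst (z 0 i - w 0 i) *: e = row i (map_mx cst (z^T - w^T)) *m e by [].
    rewrite [row i _]mx11_scalar mul_scalar_mx; congr (_ *: _).
    by rewrite !mxE.
  rewrite -opprB oppr_eq0 in c0.
  rewrite -[e]scale1r -(mulVf (_ : cst (z 0 i - w 0 i) != 0)) ?fmorph_eq0 // -scalerA.
  by apply: latZ => //; rewrite -fmorphV ordge_cst.
- move=> A hA; split; first by move=> q; exact: mon.
  by rewrite /R trmx0 map_mx0 mul0mx subr0; have := hA p; rewrite /hlat /lat.
- move=> A hA hR q; have [->|/eqP qp] := eqVneq q p.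
    by move: hR; rewrite /R trmx0 map_mx0 mul0mx subr0.
  by apply: hlat_latsame (hA q) => v; rewrite hq.
- move=> A hA; have H i : exists c, lat p (M p) (row i (invmx (D p) *m A) - cst c *: e).
    have /he [b gb lb] : lat p (M' p) (row i (invmx (D p) *m A)).
      by apply: lat_row; exact: hA.
    have [c hc] : exists c, rv p b c by apply/rv_reg/ordge_regP.
    exists c; have -> : row i (invmx (D p) *m A) - cst c *: e =
      (row i (invmx (D p) *m A) - b *: e) + ((b - cst c) / unif p) *: (unif p *: e).
      by rewrite scalerA divfK ?unif_neq0 // scalerBl addrA subrK.
    apply: latD => //; apply: latZ => //; move/rv_ordge1: hc => hc.
    by rewrite (ordge_shift _ _ (m := -1)) ?invr_eq0 ?unif_neq0 // valV ?unif_neq0 // val_unif.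
  exists (\row_i projT1 (cid (H i))); apply: lat_rows => i.
  rewrite linearB /= [row i (map_mx _ _ *m e)]row_mul [row i (map_mx _ _)]mx11_scalar
    mul_scalar_mx !mxE.
  by case: cid.
- move=> w; have [B hB] := h1 [:: p] (fun _ => D p *m (map_mx cst w^T *m e)).
  have hBp := hB p; rewrite in_cons eqxx /= in hBp.
  have RB : R B w.
    move: hBp; rewrite /hlat mulmxBr mulKmx ?mdiv_unit //.
  exists B => // q; have [->|/eqP qp] := eqVneq q p; last first.
    apply: mon; have := hB q; rewrite in_cons (negbTE (introN eqP qp)) /= subr0 //.
  apply: (lat_rows (D := M' p)) => i; apply/he; exists (cst (w 0 i)); first exact: ordge_cst.
  have := lat_row i RB; rewrite linearB /= [row i (map_mx _ _ *m e)]row_mul [row i (map_mx _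
    _)]mx11_scalar mul_scalar_mx.
  by rewrite !mxE.
Qed.

(** Dually, a homomorphism A on the smaller bundle extends to the larger one if
    and only if unif p *: e *m A vanishes in the fibre of M at p, which has
    dimension m. *)
Lemma step_source n m (D D' : mdiv X n) (M : mdiv X m) p a :
  up p (D' p) (D p) -> (forall q, q <> p -> latsame q (D' q) (D q)) ->
  h0 D M a -> h1zero D M -> h0 D' M (a + m) /\ h1zero D' M.
Proof.
move=> hup hq hd h1; have mon q A : hlat q D M A -> hlat q D' M A.
  have [->|/eqP qp] := eqVneq q p; first exact: hlat_upl.
  by apply/hlat_latsamel => v; rewrite hq.
split; last by move=> S A; have [B hB] := h1 S A; exists B => q; exact: mon.
have [_ [e [ne te he]]] := hup; set t := unif p in te.
have t0 : t != 0 by exact: unif_neq0.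
pose R (A : 'M[K]_(n, m)) (w : 'rV[k]_m) := mge p 1 (t *: e *m A *m M p - map_mx cst w).
apply: (kdim_ext (R := R)) hd.
- by move=> u v hu hv q; apply: hlatD.
- by move=> c u hu q; apply: hlatZ => //; exact: ordge_cst.
- move=> c u v w z; rewrite /R; set e1 := t *: e => hu hv.
  rewrite mulmxDr -scalemxAr mulmxDl -scalemxAl map_mxD map_mxZ.
  rewrite opprD addrACA -scalerBr; apply: mgeD => //.
  by apply: (mgeZ (e1 := 0) (e2 := 1)) => //; exact: ordge_cst.
- move=> v w z hw hz; apply/rowP => i.
  have hi : rv p ((t *: e *m v *m M p) 0 i) (w 0 i) by exact: rv_mx.
  by apply: (rv_uniq hi); exact: rv_mx.
- move=> A hA; split; first by move=> q; exact: mon.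
  have /hlatP /(_ e) hAe := hA p.
  rewrite /R map_mx0 subr0 -!scalemxAl; apply: (mgeZ (e1 := 1) (e2 := 0)) => //.
    exact: ordge_unif1.
  by apply: hAe; apply/he; exists 1; rewrite ?ordge_1 // scale1r subrr; exact: lat_0.
- move=> A hA; rewrite /R map_mx0 subr0 => hR q; have [->|/eqP qp] := eqVneq q p; last first.
    by apply: hlat_latsamel (hA q); exact: hq.
  apply/hlatP => v /he [b gb lb]; rewrite -(subrK (b *: e) v) mulmxDl; apply: latD.
    by move/hlatP: (hA p); apply.
  rewrite -scalemxAl; apply: latZ => //; rewrite /lat.
  have -> : e *m A *m M p = t^-1 *: (t *: e *m A *m M p).
    by rewrite -!scalemxAl scalerA mulVf // scale1r.
  apply: (mgeZ (e1 := -1) (e2 := 1)) => //.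
  by rewrite ordgeE ?invr_eq0 // valV // val_unif.
- move=> A hA; have /hlatP /(_ _ te) := hA p => /mge_rv [w hw].
  by exists w.
- move=> w.
  have [u0 hu0] := mge_rv te.
  have [j u0j] : exists j, u0 0 j != 0.
    apply: contrapT => /forallNP h; apply: ne.
    have u00 : u0 = 0 by apply/rowP => j; rewrite mxE; apply/eqP; apply: contrapT => /negP;
      exact: h.
    rewrite u00 map_mx0 subr0 -scalemxAl in hu0.
    rewrite /lat -[_ *m _]scale1r -(mulVf t0) -scalerA;
      apply: (mgeZ (e1 := -1) (e2 := 1)) hu0 => //.
    by rewrite ordgeE ?invr_eq0 // valV // val_unif.
  pose Z0 : 'M[k]_(n, m) := \matrix_(i, l) ((i == j)%:R / u0 0 j * w 0 l).
  have eZ0 : u0 *m Z0 = w.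
    apply/rowP => l; rewrite !mxE (bigD1 j) //= mxE eqxx big1 ?addr0.
      by rewrite mul1r mulrA divff // mul1r.
    by move=> i /negbTE ij; rewrite mxE ij !mul0r mulr0.
  pose A0 := D' p *m map_mx cst Z0 *m invmx (M p).
  have hA0 : hlat p D' M A0.
    rewrite /hlat /A0 -!mulmxA mulVmx ?mdiv_unit // mulmx1 mulKmx ?mdiv_unit //.
    exact: mge_cst.
  have RA0 : R A0 w.
    rewrite /R /A0 !mulmxA mulmxKV ?mdiv_unit // -eZ0 map_mxM -mulmxBl.
    by apply: (mgeM _ hu0 (mge_cst _ _)).
  have [B hB] := h1 [:: p] (fun _ => A0).
  have hBp : hlat p D M (B - A0) by have := hB p; rewrite in_cons eqxx.
  exists B.
    move=> q; have [->|/eqP qp] := eqVneq q p; last first.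
      by apply: mon; have := hB q; rewrite in_cons (negbTE (introN eqP qp)) /= subr0.
    by rewrite -(subrK A0 B); exact: (hlatD (mon _ _ hBp) hA0).
  have hBe : mge p 1 (t *: e *m (B - A0) *m M p).
    have /hlatP /(_ e) hAe := hBp.
    rewrite -!scalemxAl; apply: (mgeZ (e1 := 1) (e2 := 0)) => //; first exact: ordge_unif1.
    by apply: hAe; apply/he; exists 1; rewrite ?ordge_1 // scale1r subrr; exact: lat_0.
  rewrite /R -(subrK A0 B) mulmxDr mulmxDl -addrA; exact: mgeD.
Qed.

Lemma gups_target n m (D : mdiv X n) (M M' : mdiv X m) N a : gups M N M' ->
  h0 D M a -> h1zero D M -> h0 D M' (a + n * N) /\ h1zero D M'.
Proof.
move=> h; elim: h a => {M M' N} [M M' h|M M1 M' p N hup hq _ IH] a ha h1.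
  rewrite muln0 addn0; split; last first.
    move=> S A; have [B hB] := h1 S A; exists B => q; exact: hlat_latsame (hB q).
  rewrite /h0; suff <- : hglob D M = hglob D M' by [].
  apply/seteqP; split => A hA q; first exact: hlat_latsame (hA q).
  by apply: hlat_latsame (hA q) => v; rewrite h.
have [ha1 h11] := step_target hup hq ha h1.
by rewrite mulnS addnA; exact: IH.
Qed.

Lemma gups_source n m (D D' : mdiv X n) (M : mdiv X m) N a : gups D' N D ->
  h0 D M a -> h1zero D M -> h0 D' M (a + m * N) /\ h1zero D' M.
Proof.
move=> h; elim: h a => {D D' N} [D' D h|D' D1 D p N hup hq _ IH] a ha h1.
  rewrite muln0 addn0; split; last first.
    move=> S A; have [B hB] := h1 S A; exists B => q; apply: hlat_latsamel (hB q).
    by move=> v; rewrite h.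
  rewrite /h0; suff <- : hglob D M = hglob D' M by [].
  apply/seteqP; split => A hA q; last exact: hlat_latsamel (hA q).
  by apply: hlat_latsamel (hA q) => v; rewrite h.
have [ha1 h11] := IH a ha h1.
have [ha2 h12] := step_source hup hq ha1 h11.
by split => //; rewrite mulnS [(m + _)%N]addnC addnA.
Qed.

Lemma scalar_unit n (a : K) : a != 0 -> (a%:M : 'M[K]_n) \in unitmx.
Proof. by move=> a0; rewrite unitmxE det_scalar unitrX // unitfE. Qed.

Definition mone n : mdiv X n := mdiv_of [::] (fun _ => @unitmx1 _ n).
Definition minf n : mdiv X n :=
  mdiv_of [:: Infinity] (fun _ => scalar_unit n (unif_neq0 (@Infinity k X))).

Lemma mone_eq n p : mone n p = 1%:M. Proof. by []. Qed.
Lemma minf_eq n p : minf n p = if p == Infinity then (unif Infinity)%:M else 1%:M.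
Proof. by rewrite -mem_seq1. Qed.

Lemma hlat_base p n m (A : 'M[K]_(n, m)) : hlat p (mone n) (minf m) A <->
  mge p (inf_pole p) A.
Proof.
rewrite /hlat mone_eq minf_eq invmx1 mul1mx /inf_pole; case: eqP => [->|_]; last by rewrite mulmx1.
set t := unif _; have t0 : t != 0 by exact: unif_neq0.
rewrite mul_mx_scalar; split=> h i j.
  have := h i j; rewrite mxE mulrC (@ordge_shift _ _ _ _ _ 1) ?val_unif //.
by have := h i j; rewrite mxE mulrC (@ordge_shift _ _ _ _ _ 1) ?val_unif.
Qed.

Lemma h0_base n m : h0 (mone n) (minf m) (n * m).
Proof.
exists (fun i => map_mx cst (vec_mx (delta_mx 0 i))); split.
  move=> i p; apply/hlat_base; apply: mge_le (mge_cst _ _).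
  by rewrite /inf_pole; case: ifP.
move=> A hA; have H i j : exists c, A i j = cst c.
  by apply: h0_infinity => p; have /hlat_base := hA p; apply.
pose C := \matrix_(i, j) projT1 (cid (H i j)).
have eA : A = map_mx cst C by apply/matrixP => i j; rewrite !mxE; case: cid.
have comb (c : 'rV[k]_(n * m)) :
    \sum_i cst (c 0 i) *: map_mx cst (vec_mx (delta_mx 0 i)) = map_mx cst (vec_mx c) :>
      'M[K]_(n, m).
  rewrite [in RHS](row_sum_delta c) linear_sum raddf_sum; apply: eq_bigr => i _.
  by rewrite linearZ /= map_mxZ.
exists (mxvec C); split; first by rewrite comb mxvecK.
move=> c; rewrite comb eA => /map_mx_inj h.
by rewrite h vec_mxK.
Qed.

Lemma h1zero_base n m : h1zero (mone n) (minf m).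
Proof.
move=> S A; have H i j : exists f, forall p,
  ordge p (inf_pole p) (f - (if p \in S then A p i j else 0)).
  exact: (h1_infinity S (fun p => A p i j)).
exists (\matrix_(i, j) projT1 (cid (H i j))) => p; apply/hlat_base => i j.
by rewrite !mxE; case: cid => f /= /(_ p); case: ifP => // _; rewrite mxE.
Qed.

(** A sufficiently large scalar lattice at the points where M or M' is not
    standard. *)
Lemma mdiv_above n (M M' : mdiv X n) : exists S : mdiv X n,
  forall p (v : 'rV[K]_n), (lat p (M p) v -> lat p (S p) v) /\ (lat p (M' p) v -> lat p (S p) v).
Proof.
have [T hT] := mdiv_supp M; have [T' hT'] := mdiv_supp M'.
have [N hN] := mge_bounds (T ++ T') (fun p => invmx (M p)).
have [N' hN'] := mge_bounds (T ++ T') (fun p => invmx (M' p)).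
have t0 p : unif p ^+ (N + N') != 0 by rewrite expf_neq0 // unif_neq0.
exists (mdiv_of (T ++ T') (fun p => scalar_unit n (t0 p))) => p v /=; case: ifP => pT.
  have go (Q : mdiv X n) N0 : (N0 <= N + N')%N -> mge p (- N0%:Z) (invmx (Q p)) ->
      lat p (Q p) v -> lat p (unif p ^+ (N + N'))%:M v.
    move=> hle hQ hv; rewrite /lat mul_mx_scalar -(mulmxK (mdiv_unit Q p) v).
    apply: (mgeZ (e1 := (N + N')%N) (e2 := - (N + N')%N%:Z)); first by rewrite subrr.
      by apply: ordgeX1; exact: ordge_unif1.
    apply: mge_le (mgeM (erefl (0 + _)) hv hQ); lia.
  by split; [apply: (go M N); rewrite ?leq_addr //; exact: hN|apply: (go M' N');
    rewrite ?leq_addl //; exact: hN'].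
move/negbT: pT; rewrite mem_cat negb_or => /andP[/hT -> /hT' ->]; by split.
Qed.

Lemma mdiv_below n (M M' : mdiv X n) : exists S : mdiv X n,
  forall p (v : 'rV[K]_n), lat p (S p) v -> lat p (M p) v /\ lat p (M' p) v.
Proof.
have [T hT] := mdiv_supp M; have [T' hT'] := mdiv_supp M'.
have [N hN] := mge_bounds (T ++ T') M.
have [N' hN'] := mge_bounds (T ++ T') M'.
have t0 p : (unif p ^+ (N + N'))^-1 != 0 by rewrite invr_eq0 expf_neq0 // unif_neq0.
exists (mdiv_of (T ++ T') (fun p => scalar_unit n (t0 p))) => p v /=; case: ifP => pT; last first.
  by move/negbT: pT; rewrite mem_cat negb_or => /andP[/hT -> /hT' ->].
rewrite /lat mul_mx_scalar => hv.
have gv : mge p (N + N')%N v.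
  have -> : v = unif p ^+ (N + N') *: ((unif p ^+ (N + N'))^-1 *: v).
    by rewrite scalerA divff ?scale1r // expf_neq0 // unif_neq0.
  apply: (mgeZ (e1 := (N + N')%N) (e2 := 0)) => //; first by rewrite addr0.
  by apply: ordgeX1; exact: ordge_unif1.
by split; [apply: mge_le (mgeM (erefl _) gv (hN p pT))|apply: mge_le (mgeM (erefl _) gv (hN' p
  pT))]; lia.
Qed.

Section Degree.
Variable dl : forall n, mdiv X n -> int.
Hypothesis dl_gups : forall n (M M' : mdiv X n) N, gups M N M' -> dl M' = dl M + N%:Z.
Hypothesis dl_one : forall n, dl (mone n) = 0.

Lemma dl_inf n : dl (minf n) = n%:Z.
Proof.
have [||a [ga va]] := @gups_point n Infinity (mone n) (minf n).
- by move=> q /eqP/negbTE hq v; rewrite mone_eq minf_eq hq.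
- move=> v; rewrite /lat mone_eq minf_eq mulmx1 eqxx mul_mx_scalar => hv.
  by apply: (mgeZ (e1 := 0) (e2 := 0)) => //; apply: ordge_le (ordge_unif1 _).
rewrite (dl_gups ga) dl_one add0r; move: va.
rewrite mone_eq minf_eq eqxx det_scalar det1 val1 add0r valX ?unif_neq0 // val_unif.
by rewrite natz => ->.
Qed.

(** Both (D, M) and the pair of trivial bundle and O(infinity) ^ m can be changed,
    by enlarging the target and shrinking the source, into one and the same pair;
    for the latter pair the dimension is known by hand, and each step changes
    both sides in the same way. The degree enters only through its behaviour on
    such steps. *)
Theorem riemann_roch n m (D : mdiv X n) (M : mdiv X m) a : h0 D M a -> h1zero D M ->
  a%:Z = n%:Z * dl M - m%:Z * dl D.
Proof.
move=> ha h1.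
have [S hS] := mdiv_above M (minf m); have [R hR] := mdiv_below D (mone n).
have [n1 g1] := gups_ex (fun p v => (hS p v).1); have [n3 g3] := gups_ex (fun p v => (hS p v).2).
have [n2 g2] := gups_ex (fun p v h => (hR p v h).1).
have [n4 g4] := gups_ex (fun p v h => (hR p v h).2).
have [ha1 h11] := gups_target g1 ha h1.
have [ha2 _] := gups_source g2 ha1 h11.
have [hb1 h12] := gups_target g3 (h0_base n m) (@h1zero_base n m).
have [hb2 _] := gups_source g4 hb1 h12.
have e : (a + n * n1 + m * n2 = n * m + n * n3 + m * n4)%N by exact: (kdim_uniq ha2 hb2).
have := dl_gups g1; have := dl_gups g3; have := dl_gups g2; have := dl_gups g4.
by rewrite dl_inf dl_one; move: e (dl _) (dl _) (dl _) (dl _); clear; nia.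
Qed.

End Degree.

End RiemannRoch.

(** * Skyscraper sheaves and degrees *)

Section Skyscraper.
Variables (k : closedFieldType) (X : elliptic_curve k).
Context {ch : char0 k}.
Notation K := (ffield X).
Notation cst := (fconst X).
Implicit Types (p q : point X) (f g : K) (c : k).

(** The value at p as a function; it is meaningful if f is regular at p. *)
Definition rval p f : k := xget 0 [set c | rv p f c].

Lemma rval_eq p f c : rv p f c -> rval p f = c.
Proof.
move=> h; have := @xgetPex _ 0 [set c | rv p f c] (ex_intro _ c h).
by move/rv_uniq; apply.
Qed.

Lemma rvalP (U : aopen X) (a : regfun U) p : aset U p -> rv p (regval a) (rval p (regval a)).
Proof.
move=> Up; have [c hc] : exists c, rv p (regval a) c.
  by apply/rv_reg/ordge_regP; exact: regfun_ord.
by rewrite (rval_eq hc).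
Qed.

Section Sky.
Variable p : point X.

(** The skyscraper at p has the sections k or 0 according to whether p belongs to
    the open set. *)
Definition sky_on (U : aopen X) : {pred k} := fun c => `[< ~ aset U p -> c = 0 >].

Lemma sky_onP (U : aopen X) c : reflect (~ aset U p -> c = 0) (c \in sky_on U).
Proof. exact: asboolP. Qed.

Lemma sky_on_zmod (U : aopen X) : zmod_closed (sky_on U).
Proof.
split=> [|c d /sky_onP hc /sky_onP hd]; apply/sky_onP => // nU.
by rewrite hc // hd // subrr.
Qed.

HB.instance Definition _ (U : aopen X) := GRing.isZmodClosed.Build k (sky_on U) (sky_on_zmod U).

Record ssec (U : aopen X) := SSec { scoef :> k; scoefP : scoef \in sky_on U }.

HB.instance Definition _ (U : aopen X) := [isSub for @scoef U].
HB.instance Definition _ (U : aopen X) := [Choice of ssec U by <:].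
HB.instance Definition _ (U : aopen X) := [SubChoice_isSubZmodule of ssec U by <:].

Lemma scoef_inj (U : aopen X) (s t : ssec U) : scoef s = scoef t -> s = t.
Proof. exact: val_inj. Qed.

Lemma scoef_out (U : aopen X) (s : ssec U) : ~ aset U p -> scoef s = 0.
Proof. by move/sky_onP: (scoefP s). Qed.

Lemma sscale_subproof (U : aopen X) (a : regfun U) (s : ssec U) :
  rval p (regval a) * scoef s \in sky_on U.
Proof. by apply/sky_onP => nU; rewrite scoef_out // mulr0. Qed.

Definition sscale (U : aopen X) (a : regfun U) (s : ssec U) : ssec U := SSec (sscale_subproof a s).

Fact sscaleA (U : aopen X) (a b : regfun U) (s : ssec U) : sscale a (sscale b s) = sscale (a * b) s.
Proof.
apply: scoef_inj => /=; have [Up|nU] := pselect (aset U p); last by rewrite scoef_out // !mulr0.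
by rewrite mulrA; congr (_ * _); apply/esym/rval_eq/rvM; exact: rvalP.
Qed.
Fact sscale1 (U : aopen X) : left_id 1 (@sscale U).
Proof. by move=> s; apply: scoef_inj => /=; rewrite (rval_eq (rv1 _)) mul1r. Qed.
Fact sscaleDr (U : aopen X) : right_distributive (@sscale U) +%R.
Proof. by move=> a s t; apply: scoef_inj; rewrite /= mulrDr. Qed.
Fact sscaleDl (U : aopen X) (s : ssec U) : {morph (@sscale U)^~ s : a b / a + b}.
Proof.
move=> a b; apply: scoef_inj => /=; have [Up|nU] := pselect (aset U p); last
  by rewrite scoef_out // !mulr0 addr0.
by rewrite -mulrDl; congr (_ * _); apply/rval_eq/rvD; exact: rvalP.
Qed.

HB.instance Definition _ (U : aopen X) :=
  GRing.Zmodule_isLmodule.Build (regfun U) (ssec U) (@sscaleA U) (@sscale1 U) (@sscaleDr U)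
    (@sscaleDl U).

Lemma scoefZ (U : aopen X) (a : regfun U) (s : ssec U) :
  scoef (a *: s) = rval p (regval a) * scoef s.
Proof. by []. Qed.
Lemma scoefD (U : aopen X) (s t : ssec U) : scoef (s + t) = scoef s + scoef t.
Proof. by []. Qed.

Definition scut (U : aopen X) c := if pselect (aset U p) then c else 0.

Lemma scut_subproof (U : aopen X) c : scut U c \in sky_on U.
Proof. by apply/sky_onP => nU; rewrite /scut; case: pselect. Qed.

Definition smk (U : aopen X) c : ssec U := SSec (scut_subproof U c).

Lemma smk_in (U : aopen X) c : aset U p -> scoef (smk U c) = c.
Proof. by rewrite /= /scut; case: pselect. Qed.

Definition sres (U V : aopen X) (sVU : V `<=` U) (s : ssec U) : ssec V := smk V (scoef s).

Lemma rval_const c : rval p (cst c) = c.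
Proof. by apply: rval_eq; exact: rv_const. Qed.

Lemma ssec_fg (U : aopen X) : exists (m : nat) (g : 'I_m -> ssec U),
    forall s : ssec U, exists c : 'I_m -> regfun U, s = \sum_(i < m) c i *: g i.
Proof.
exists 1%N, (fun _ => smk U 1) => s; exists (fun _ => regconst U (scoef s)).
rewrite big_ord1; apply: scoef_inj; rewrite scoefZ rval_const.
have [Up|nU] := pselect (aset U p); first by rewrite smk_in // mulr1.
by rewrite !scoef_out // mul0r.
Qed.

Lemma sky_unit (U V : aopen X) (f : regfun U) : distinguished V f -> aset U p -> ~ aset V p ->
  rval p (regval f) = 0.
Proof.
move=> dV Up nV; apply: contrapT => /eqP h; apply: nV; apply/dV; split => //.
exact: rv_unit_at (rvalP f Up).
Qed.

Definition sky : coh X.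
Proof.
refine (@Coh k X (fun U => ssec U : lmodType (regfun U)) sres _ _ _ ssec_fg _ _).
- move=> U V sVU a s t; apply: scoef_inj.
  have [Vp|nV] := pselect (aset V p); last by rewrite [LHS]scoef_out // [RHS]scoef_out.
  by rewrite smk_in // !scoefD !scoefZ !smk_in.
- move=> U sUU s; apply: scoef_inj.
  have [Vp|nV] := pselect (aset U p); last by rewrite [LHS]scoef_out // [RHS]scoef_out.
  by rewrite smk_in.
- move=> U V W sVU sWV sWU s; apply: scoef_inj.
  have [Wp|nW] := pselect (aset W p); last by rewrite [LHS]scoef_out // [RHS]scoef_out.
  by rewrite !smk_in //; exact: sWV.
- move=> U V sVU f dV s /(congr1 (@scoef V)) h.
  have [Vp|nV] := pselect (aset V p).
    by exists 0%N; rewrite expr0 scale1r; apply: scoef_inj; rewrite -[RHS]h smk_in.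
  have [Up|nU] := pselect (aset U p).
    by exists 1%N; rewrite expr1; apply: scoef_inj; rewrite scoefZ (sky_unit dV) // mul0r.
  by exists 0%N; rewrite expr0 scale1r; apply: scoef_inj; rewrite [LHS]scoef_out.
- move=> U V sVU f dV t; exists 0%N, (smk U (scoef t)).
  rewrite expr0 scale1r; apply: scoef_inj.
  have [Vp|nV] := pselect (aset V p); last by rewrite [LHS]scoef_out // [RHS]scoef_out.
  by rewrite !smk_in //; exact: sVU.
Defined.

Lemma sky_skyscraper : is_skyscraper p sky.
Proof.
move=> U; split=> [nU s|Up]; first by apply: scoef_inj; rewrite scoef_out.
exists (smk U 1) => s; exists (scoef s); split.
  by apply: scoef_inj; rewrite scoefZ rval_const smk_in // mulr1.
by move=> c ->; rewrite scoefZ rval_const smk_in // mulr1.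
Qed.

End Sky.

Section Step.
Variables (n : nat) (M M' : mdiv X n) (p : point X).
Hypothesis hup : up p (M p) (M' p).
Hypothesis hq : forall q, q <> p -> latsame q (M q) (M' q).

Lemma row_split (F : fieldType) r (s t e : 'rV[F]_r) (a ca cs cc : F) :
  a *: s + t - (ca * cs + cc) *: e =
  (a *: (s - cs *: e) + (t - cc *: e)) + ((a - ca) * cs) *: e.
Proof. by apply/rowP => j; rewrite !mxE; ring. Qed.

(** The cokernel of a lattice inclusion of length one is the skyscraper at p; the
    quotient map sends a row to its coefficient modulo M along e. *)
Lemma step_exact : exists (i : coh_hom (LL M) (LL M')) (pr : coh_hom (LL M') (sky p)),
  short_exact i pr.
Proof.
have [_ [e [ne te he]]] := hup.
have mon q (v : 'rV[K]_n) : lat q (M q) v -> lat q (M' q) v.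
  have [->|/eqP qp] := eqVneq q p; last by move=> h; apply/(hq qp).
  by move=> hv; apply/he; exists 0; rewrite ?ordge_0 // scale0r subr0.
have [i hi] : exists i : coh_hom (LL M) (LL M'), forall U (s : LL M U),
  lval (hmap i U s) = lval s *m 1%:M.
  by apply: matrix_hom => q; apply/hlatP => v /mon; rewrite mulmx1.
have uniq v c d : lat p (M p) (v - cst c *: e) -> lat p (M p) (v - cst d *: e) -> c = d.
  move=> hc hd; apply/eqP; rewrite -subr_eq0; apply: contra_notT ne => c0.
  rewrite -[e]scale1r -(mulVf (_ : cst (c - d) != 0)) ?fmorph_eq0 // -scalerA.
  apply: latZ; first by rewrite -fmorphV ordge_cst.
  have -> : cst (c - d) *: e = (v - cst d *: e) - (v - cst c *: e).
    by rewrite rmorphB scalerBl opprB [RHS]addrC addrA subrK.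
  exact: latB.
pose lam v := xget 0 [set c | lat p (M p) (v - cst c *: e)].
have lamE v c : lat p (M p) (v - cst c *: e) -> lam v = c.
  move=> h; have := @xgetPex _ 0 [set c | lat p (M p) (v - cst c *: e)] (ex_intro _ c h).
  by move=> /= h'; exact: uniq h' h.
have lamP v : lat p (M' p) v -> lat p (M p) (v - cst (lam v) *: e).
  move=> /he [b gb lb]; have [c hc] : exists c, rv p b c by apply/rv_reg/ordge_regP.
  have h : lat p (M p) (v - cst c *: e).
    have -> : v - cst c *: e = (v - b *: e) + ((b - cst c) / unif p) *: (unif p *: e).
      by rewrite scalerA divfK ?unif_neq0 // scalerBl addrA subrK.
    apply: latD => //; apply: latZ => //; move/rv_ordge1: hc => hc.
    by rewrite (ordge_shift _ _ (m := -1)) ?invr_eq0 ?unif_neq0 // valV ?unif_neq0 // val_unif.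
  by rewrite (lamE _ _ h).
pose f U (s : lsec M' U) : ssec p U := smk p U (lam (lval s)).
have fE U s : aset U p -> scoef (f U s) = lam (lval s) by exact: smk_in.
have f0 U s : ~ aset U p -> scoef (f U s) = 0 by exact: scoef_out.
have fL U (a : regfun U) (s t : lsec M' U) : aset U p ->
    lam (lval (a *: s + t)) = rval p (regval a) * lam (lval s) + lam (lval t).
  move=> Up; apply: lamE.
  have ra := rvalP a Up; set ca := rval _ _ in ra *.
  have lt := lamP _ (lsec_lat t Up); have ls := lamP _ (lsec_lat s Up).
  set cs := lam _ in ls *; set cc := lam _ in lt *.
  have -> : lval (a *: s + t) - cst (ca * cs + cc) *: e =
      (regval a *: (lval s - cst cs *: e) + (lval t - cst cc *: e)) + ((regval a - cst ca) * cst
        cs) *: e.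
    by rewrite lvalD lvalZ rmorphD rmorphM; exact: row_split.
  apply: latD; first by apply: latD => //; apply: latZ => //; exact: regfun_ord.
  have -> : ((regval a - cst ca) * cst cs) *: e = ((regval a - cst ca) / unif p * cst cs) *:
    (unif p *: e).
    by rewrite scalerA; congr (_ *: _); field; exact: unif_neq0.
  apply: latZ => //; rewrite ordgeM0 ?ordge_cst //.
  by rewrite (ordge_shift _ _ (m := -1)) ?invr_eq0 ?unif_neq0 // ?valV ?unif_neq0 // ?val_unif
    //; apply/rv_ordge1.
have lf U : linear (f U : LL M' U -> sky p U).
  move=> a s t; apply: scoef_inj; rewrite scoefD scoefZ.
  have [Up|nU] := pselect (aset U p).
    by apply: etrans (fE U _ Up) _; rewrite (fE U s Up) (fE U t Up); exact: fL.
  by apply: etrans (f0 U _ nU) _; rewrite (f0 U s nU) (f0 U t nU) mulr0 addr0.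
have hr (U V : aopen X) (sVU : V `<=` U) (s : LL M' U) :
    mklin (lf V) (res sVU s) = res sVU (mklin (lf U) s).
  apply: scoef_inj; rewrite !mklinE.
  have [Vp|nV] := pselect (aset V p); last by rewrite [LHS]scoef_out // [RHS]scoef_out.
  by rewrite !smk_in //; exact: sVU.
pose pr := @CohHom k X (LL M') (sky p) (fun U => mklin (lf U)) hr.
exists i, pr => U; split.
- by move=> s t /(congr1 (@lval k X n M' U)); rewrite !hi !mulmx1 => /lval_inj.
- move=> s.
  have [q0 hq0] := open_miss U.
  have [V [hV rV]] := lat_approx M q0 [:: p] (fun _ => cst (scoef s) *: e) 0.
  have [v hv] : exists v : lsec M' U, lval v = V.
    apply: lsec_ex => q Uq; have qq0 := hq0 _ Uq.
    have [e0|qp] := eqVneq q p; last first.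
      by apply: mon; apply: rV => //; rewrite mem_seq1.
    rewrite e0 in Uq qq0 *; apply/he; exists (cst (scoef s)); first exact: ordge_cst.
    by have := hV p; rewrite mem_seq1 eqxx; apply.
  exists v; apply: scoef_inj; rewrite mklinE.
  have [Up|nU] := pselect (aset U p); last by rewrite [LHS]scoef_out // [RHS]scoef_out.
  rewrite smk_in //; apply: lamE; rewrite hv.
  by have := hV p; rewrite mem_seq1 eqxx => /(_ isT (hq0 _ Up)).
- move=> m; rewrite mklinE; split.
    move=> /(congr1 (@scoef p U)) h.
    have hm : forall q, aset U q -> lat q (M q) (lval m).
      move=> q Uq; have [e0|/eqP qp] := eqVneq q p; last by apply/(hq qp); exact: lsec_lat.
      rewrite e0 in Uq *; rewrite smk_in // in h.
      by have := lamP _ (lsec_lat m Uq); rewrite h rmorph0 scale0r subr0.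
    have [b hb] := lsec_ex hm; exists b; apply: lval_inj; by rewrite hi hb mulmx1.
  move=> [b <-]; apply: scoef_inj.
  have [Up|nU] := pselect (aset U p); last by rewrite [LHS]scoef_out // [RHS]scoef_out.
  rewrite smk_in //; apply: lamE; rewrite hi mulmx1 rmorph0 scale0r subr0.
  exact: lsec_lat.
Qed.

End Step.

Lemma zero_rv m (A : 'M[K]_(m, 0)) (B : 'M[K]_(m, 0)) : A = B.
Proof. by apply/matrixP => i []. Qed.

Lemma zero_hom (E F : coh X) : exists h : coh_hom E F, forall (U : aopen X) (s : E U),
  hmap h U s = 0.
Proof.
have lf U : linear (fun _ : E U => 0 : F U) by move=> a s t; rewrite scaler0 addr0.
have hr (U V : aopen X) (sVU : V `<=` U) (s : E U) :
    mklin (lf V) (res sVU s) = res sVU (mklin (lf U) s) by rewrite !mklinE res0.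
by exists (@CohHom k X E F (fun U => mklin (lf U)) hr).
Qed.

Lemma id_hom (E : coh X) : exists h : coh_hom E E, forall (U : aopen X) (s : E U), hmap h U s = s.
Proof.
have lf U : linear (fun s : E U => s) by [].
have hr (U V : aopen X) (sVU : V `<=` U) (s : E U) :
    mklin (lf V) (res sVU s) = res sVU (mklin (lf U) s) by [].
by exists (@CohHom k X E E (fun U => mklin (lf U)) hr).
Qed.

Section DegreeAxioms.
Variable dg : coh X -> int.
Hypothesis dgP : is_degree dg.

Lemma dg_zero : dg (LL (mone X 0)) = 0.
Proof.
have [_ _ add] := dgP; set Z := LL _; have [z hz] := zero_hom Z Z.
have Z0 U (s t : Z U) : s = t by apply: lval_inj; exact: zero_rv.
have : dg Z = dg Z + dg Z.
  apply: (add Z Z Z z z) => U; split.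
  - by move=> s t _; exact: Z0.
  - by move=> s; exists s; exact: Z0.
  - by move=> m; split=> _; [exists m; exact: Z0|exact: Z0].
lia.
Qed.

Lemma dg_iso (E F : coh X) (h : coh_hom E F) : (forall U, injective (hmap h U)) ->
  (forall U t, exists s, hmap h U s = t) -> dg E = dg F.
Proof.
move=> hi hs; have [_ _ add] := dgP; set Z := LL (mone X 0).
have Z0 U (s t : Z U) : s = t by apply: lval_inj; exact: zero_rv.
have [z hz] := zero_hom F Z.
have -> : dg F = dg E + dg Z; last by rewrite dg_zero addr0.
apply: (add E F Z h z) => U; split.
- exact: hi.
- by move=> s; exists 0; exact: Z0.
- by move=> m; split=> _; [exact: hs|exact: Z0].
Qed.

Lemma dg_gups n (M M' : mdiv X n) N : gups M N M' -> dg (LL M') = dg (LL M) + N%:Z.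
Proof.
elim=> {M M' N} [M M' h|M M1 M' p N hup hq _ ->].
  have [i hi] : exists i : coh_hom (LL M) (LL M'), forall U (s : LL M U),
    lval (hmap i U s) = lval s *m 1%:M.
    by apply: matrix_hom => q; apply/hlatP => v /h; rewrite mulmx1.
  rewrite addr0; apply/esym; apply: (@dg_iso _ _ i).
    by move=> U s t /(congr1 (@lval k X n M' U)); rewrite !hi !mulmx1 => /lval_inj.
  move=> U t; have [s hs] : exists s : lsec M U, lval s = lval t.
    by apply: lsec_ex => p Up; apply/h; exact: lsec_lat.
  by exists s; apply: lval_inj; rewrite hi mulmx1.
have [_ sk add] := dgP; have [i [pr ex]] := step_exact hup hq.
rewrite (add _ _ _ _ _ ex) (sk p _ (sky_skyscraper p)); lia.
Qed.

Lemma structure_sheaf_LL : is_structure_sheaf (LL (mone X 1)).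
Proof.
have h U p : aset U p -> lat p (mone X 1 p) (1 : 'rV[K]_1).
  by move=> _; rewrite mone_eq /lat mulmx1; exact: mge_1.
exists (fun U => LSec (introT (lat_onP (mone X 1) U 1) (@h U))); split.
  by move=> U V sVU; exact: lval_inj.
move=> U s; have [a ha] : exists a : regfun U, regval a = lval s 0 0.
  apply: regfun_ex => p Up; have := lsec_lat s Up.
  by rewrite mone_eq /lat mulmx1; apply.
exists a; split.
  by apply: lval_inj; rewrite lvalZ /= ha; apply/rowP => j; rewrite ord1 !mxE mulr1.
move=> b /(congr1 (@lval k X 1 _ U)); rewrite lvalZ /= => eb; apply: regval_inj.
by rewrite ha eb !mxE mulr1.
Qed.

(** O ^ (n + 1) is an extension of O by O ^ n. *)
Lemma dg_one n : dg (LL (mone X n)) = 0.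
Proof.
elim: n => [|n IH]; first exact: dg_zero.
have [os _ add] := dgP.
have [i hi] : exists i : coh_hom (LL (mone X n)) (LL (mone X (1 + n))), forall U (s :
  LL (mone X n) U),
    lval (hmap i U s) = lval s *m row_mx 0 1%:M.
  apply: matrix_hom => p; rewrite /hlat !mone_eq invmx1 mul1mx mulmx1 => a b; rewrite mxE.
  by case: (fintype.split b) => j; [exact: mge_0|exact: mge_1].
have [pr hpr] : exists i : coh_hom (LL (mone X (1 + n))) (LL (mone X 1)), forall U (s :
  LL (mone X (1 + n)) U),
    lval (hmap i U s) = lval s *m col_mx 1%:M 0.
  apply: matrix_hom => p; rewrite /hlat !mone_eq invmx1 mul1mx mulmx1 => a b; rewrite mxE.
  by case: (fintype.split a) => j; [exact: mge_1|exact: mge_0].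
have := add _ _ _ i pr; rewrite IH (os _ structure_sheaf_LL) addr0; apply => U.
have reg m (v : 'rV[K]_m) (s : LL (mone X m) U) p : aset U p -> mge p 0 (lval s).
  by move=> Up; have := lsec_lat s Up; rewrite mone_eq /lat mulmx1.
split.
- move=> s t /(congr1 (@lval k X _ _ U)); rewrite !hi !mul_mx_row !mulmx1 !mulmx0.
  by move=> /eq_row_mx [_ /lval_inj].
- move=> s; have [t ht] : exists t : lsec (mone X (1 + n)) U, lval t = row_mx (lval s) 0.
    apply: lsec_ex => p Up; rewrite mone_eq /lat mulmx1 => a b; rewrite mxE.
    by case: (fintype.split b) => j; [exact: (reg _ (lval s))|exact: mge_0].
  by exists t; apply: lval_inj; rewrite hpr ht mul_row_col mulmx1 mul0mx addr0.
- move=> m; split.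
    move=> /(congr1 (@lval k X _ _ U));
      rewrite hpr lval0 -[lval m]hsubmxK mul_row_col mulmx1 mulmx0 addr0 => h.
    have [t ht] : exists t : lsec (mone X n) U, lval t = rsubmx (lval m : 'rV_(1 + n)).
      apply: lsec_ex => p Up; rewrite mone_eq /lat mulmx1 => a b; rewrite mxE.
      by apply: (reg _ (lval m)).
    exists t; apply: lval_inj; rewrite hi ht mul_mx_row mulmx0 mulmx1.
    by rewrite -[RHS](@hsubmxK _ _ 1 n) h.
  move=> [b <-]; apply: lval_inj; rewrite hpr hi -mulmxA mul_row_col mul0mx mulmx0 addr0 mulmx0 //.
Qed.

(** Additivity gives the degree the two properties used above: it increases by
    one in a step and vanishes on trivial bundles. *)
Theorem riemann_roch_dg n m (D : mdiv X n) (M : mdiv X m) a : h0 D M a -> h1zero D M ->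
  a%:Z = n%:Z * dg (LL M) - m%:Z * dg (LL D).
Proof.
apply: (riemann_roch (dl := fun n D => dg (LL D))); [exact: dg_gups|exact: dg_one].
Qed.

End DegreeAxioms.

End Skyscraper.

(** * Sections supported at a point *)

Section TorsionFree.
Variables (k : closedFieldType) (X : elliptic_curve k).
Context {ch : char0 k}.
Notation K := (ffield X).
Notation cst := (fconst X).
Implicit Types (p q : point X) (f g : K) (c : k).

Lemma end_scalar (E : coh X) (h : coh_hom E E) : hom_dim E E 1 ->
  exists c, forall (U : aopen X) (s : E U), hmap h U s = regconst U c *: s.
Proof.
move=> [f hf]; have [i hi] := id_hom E.
have [ci [hci uci]] := hf i; have [c1 [hc1 _]] := hf h.
have {}hci U (s : E U) : s = regconst U (ci 0 0) *: hmap (f ord0) U s.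
  by have := hci U s; rewrite hi big_ord1.
have {}hc1 U (s : E U) : hmap h U s = regconst U (c1 0 0) *: hmap (f ord0) U s.
  by have := hc1 U s; rewrite big_ord1.
have rM U a b : regconst U (a * b) = regconst U a * regconst U b.
  by apply: regval_inj; rewrite /= rmorphM.
have [c0|c0] := eqVneq (ci 0 0) 0.
  exists 0 => U s.
  have z (t : E U) : t = 0.
    rewrite [LHS]hci c0 (_ : regconst U 0 = 0) ?scale0r //.
    by apply: regval_inj; rewrite /= rmorph0.
  by rewrite [LHS]z [RHS]z.
exists (c1 0 0 / ci 0 0) => U s; rewrite hc1 [in RHS](hci U s) scalerA -rM divfK //.
Qed.

Lemma rval_pow1 (U : aopen X) (f : regfun U) p m : rv p (regval f) 1 ->
  rval p (regval (f ^+ m - 1)) = 0.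
Proof.
move=> rf; have -> : regval (f ^+ m - 1) = regval f ^+ m - 1 by rewrite -regvalX.
by apply: rval_eq; rewrite -(subrr 1) -{1}(expr1n k m); apply: rvB; [exact: rvX|exact: rv1].
Qed.

Variables (E : coh X) (n : nat) (D : mdiv X n.+1) (i : coh_hom E (LL D)).
Hypothesis i_surj : forall (U : aopen X) (v : LL D U), exists e : E U, hmap i U e = v.
Hypothesis i_tors : forall (U : aopen X) (e : E U), hmap i U e = 0 <-> exists2 b : regfun U,
  b != 0 & b *: e = 0.

(** Here s1 is a nonzero section over a neighbourhood W of p which is killed by a
    uniformizer u at p without other zeros on W. It spans a copy of the
    skyscraper at p in E, whose generator over an arbitrary open set is
    constructed below. *)
Section Point.
Variables (p : point X) (W : aopen X) (s1 : E W) (u : K).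
Hypotheses (Wp : aset W p) (u0 : u != 0) (vu : val p u = 1)
  (uW : forall p', aset W p' -> p' <> p -> val p' u = 0).
Hypothesis us1 : forall a : regfun W, regval a = u -> a *: s1 = 0.
Hypothesis s1_neq0 : s1 <> 0.

(** A function vanishing at p is a multiple of u. *)
Lemma kill_small (W1 : aopen X) (h : W1 `<=` W) (a : regfun W1) : aset W1 p ->
  rval p (regval a) = 0 -> a *: res h s1 = 0.
Proof.
move=> W1p ra.
have [b hb] : exists b : regfun W, regval b = u.
  apply: regfun_ex => p' Wp'; rewrite ordgeE //; have [->|/eqP np] := eqVneq p' p; first
    by rewrite vu.
  by rewrite uW.
have [d hd] : exists d : regfun W1, regval d = regval a / u.
  apply: regfun_ex => p' W1p'; have [->|/eqP np] := eqVneq p' p.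
    apply: (ordgeMe (m := 1) (n := -1)) => //.
      by apply/ordge1P; rewrite -ra; exact: rvalP.
    by rewrite ordgeE ?invr_eq0 // valV // vu.
  rewrite ordgeM0 //; first exact: regfun_ord.
  by rewrite ordgeE ?invr_eq0 // valV // uW //; exact: h.
have -> : a = d * regres h b by apply: regval_inj; rewrite regvalM hd /= hb divfK.
by rewrite -scalerA -resZ us1 // res0 scaler0.
Qed.

(** The extension of s1 by zero to Om. *)
Definition special (Om : aopen X) (s : E Om) :=
  (forall a : regfun Om, rval p (regval a) = 0 -> a *: s = 0) /\
  exists (W1 : aopen X) (h : W1 `<=` W) (h' : W1 `<=` Om), aset W1 p /\ res h' s = res h s1.

(** The functions vanishing at p are the sections of the line bundle O(- p). *)
Lemma max_ideal_fg (Om : aopen X) : aset Om p -> exists (m : nat) (g : 'I_m -> regfun Om),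
  (forall j, rval p (regval (g j)) = 0) /\
  forall a : regfun Om, rval p (regval a) = 0 -> exists c : 'I_m -> regfun Om, a = \sum_j c j * g j.
Proof.
move=> Op; have t0 : (unif p)^-1 != 0 by rewrite invr_eq0 unif_neq0.
pose I := mset (mone X 1) p (scalar_unit 1 t0).
have Ip : I p = (unif p)^-1%:M by rewrite mset_eq.
have Iq q : q <> p -> I q = 1%:M by move=> qp; rewrite mset_neq.
have small p' (v : 'rV[K]_1) : lat p' (I p') v <-> ordge p' (if p' == p then 1 else 0) (v 0 0).
  rewrite /lat; case: eqP => [->|np].
    rewrite Ip mul_mx_scalar; have e : ordge p 1 (v 0 0) = ordge p 0 ((unif p)^-1 * v 0 0).
      by rewrite mulrC (ordge_shift _ _ (m := -1)) // valV ?unif_neq0 // val_unif.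
    rewrite e; split=> [/(_ 0 0)|h a b]; first by rewrite mxE.
    by rewrite !ord1 mxE.
  by rewrite Iq // mulmx1; split=> [/(_ 0 0)//|h a b]; rewrite !ord1.
have [m [g hg]] := lsec_fg I Om.
have H j : exists a : regfun Om, regval a = lval (g j) 0 0.
  apply: regfun_ex => p' Op'; have /small := lsec_lat (g j) Op'.
  by apply: ordge_le; case: (_ == _).
exists m, (fun j => projT1 (cid (H j))); split.
  move=> j; case: cid => a /= ->; apply: rval_eq; apply/ordge1P.
  by have /small := lsec_lat (g j) Op; rewrite eqxx.
move=> a ra; have [s hs] : exists s : lsec I Om, lval s = (regval a)%:M.
  apply: lsec_ex => p' Op'; apply/small; rewrite mxE eqxx mulr1n; case: eqP => [->|_].
    by apply/ordge1P; rewrite -ra; exact: rvalP.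
  exact: regfun_ord.
have [c hc] := hg s; exists c; apply: regval_inj.
have := congr1 (fun v : lsec I Om => lval v 0 0) hc; rewrite hs mxE eqxx mulr1n => ->.
rewrite lval_sum summxE.
have sumE (J : finType) (F : J -> regfun Om) : regval (\sum_j F j) = \sum_j regval (F j).
  by elim/big_rec2: _ => // j y1 y2 _ <-.
rewrite sumE; apply: eq_bigr => j _; rewrite lvalZ mxE regvalM.
by case: cid => b /= ->.
Qed.

(** A power of a cutoff function times s1 extends to Om; a further power makes
    the extension vanish on the finitely many generators of the maximal ideal. *)
Lemma special_ex (Om : aopen X) : aset Om p -> exists s : E Om, special s.
Proof.
move=> Op; have [f [W1 [W1O W1W dW1 W1p rf]]] := nbhd Op Wp.
have fN N : rval p (regval (regres W1O f ^+ N - 1)) = 0.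
  exact: rval_pow1.
have fs N : regres W1O f ^+ N *: res W1W s1 = res W1W s1.
  have := kill_small W1W W1p (fN N); rewrite scalerBl scale1r => /eqP.
  by rewrite subr_eq0 => /eqP.
have [N0 [e he]] := sec_loc_im W1O dW1 (res W1W s1); rewrite fs in he.
have [m [g [rg hg]]] := max_ideal_fg Op.
have H j : exists N, f ^+ N *: (g j *: e) = 0.
  apply: (sec_loc_ker dW1); rewrite resZ -he; apply: kill_small => //; exact: rg.
pose N := (\sum_j projT1 (cid (H j)))%N.
have H' j : f ^+ N *: (g j *: e) = 0.
  have hj := projT2 (cid (H j)); set nj := projT1 _ in hj.
  have /subnK <- : (nj <= N)%N by rewrite /N (bigD1 j) //= leq_addr.
  by rewrite exprD -scalerA hj scaler0.
exists (f ^+ N *: e); split.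
  move=> a /hg [c ->]; rewrite scaler_suml big1 // => j _.
  by rewrite -scalerA [g j *: _]scalerA mulrC -[(_ * g j) *: e]scalerA H' scaler0.
exists W1, W1W, W1O; split => //; rewrite resZ -he.
have -> : regres W1O (f ^+ N) = regres W1O f ^+ N; last exact: fs.
by apply: regval_inj; rewrite regvalX /= regvalX.
Qed.

(** Two extensions agree near p, so their difference is killed by a power of a
    function with value 1 at p, and by functions vanishing at p. *)
Lemma special_uniq (Om : aopen X) (s t : E Om) : aset Om p -> special s -> special t -> s = t.
Proof.
move=> Op [ks [W1 [h1 [h1' [W1p e1]]]]] [kt [W2 [h2 [h2' [W2p e2]]]]].
pose V := openI W1 W2; have VW1 : V `<=` W1 := @openIl _ _ W1 W2.
have VW2 : V `<=` W2 := @openIr _ _ W1 W2.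
have Vp : aset V p by split.
have [f [W3 [W3O W3V dW3 W3p rf]]] := nbhd Op Vp.
have z : res W3O (s - t) = 0.
  have VO : V `<=` Om := fun q h => h1' q (VW1 q h).
  have VW : V `<=` W := fun q h => h1 q (VW1 q h).
  rewrite -(res_comp VO W3V) resD resN -(res_comp h1' VW1) e1 (res_comp h1 VW1 VW).
  by rewrite -(res_comp h2' VW2) e2 (res_comp h2 VW2 VW) subrr res0.
have [m hm] := sec_loc_ker dW3 z.
have k1 : (f ^+ m - 1) *: (s - t) = 0.
  have r0 : rval p (regval (f ^+ m - 1)) = 0 by exact: rval_pow1.
  by rewrite scalerBr ks // kt // subrr.
move: k1; rewrite scalerBl hm scale1r sub0r => /eqP; rewrite oppr_eq0 subr_eq0.
by move/eqP.
Qed.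

(** On V the functions that kill a s, for a vanishing at p, form an ideal: away
    from p cutoff functions belong to it, and at p the poles of a outside V are
    cleared by a function with value 1 at p. *)
Lemma special_res (Om V : aopen X) (h : V `<=` Om) (s : E Om) : aset V p -> special s ->
  special (res h s).
Proof.
move=> Vp [ks [W1 [h1 [h1' [W1p e1]]]]]; split; last first.
  have VW1 : openI V W1 `<=` W1 by exact: openIr.
  have VV : openI V W1 `<=` V by exact: openIl.
  have VW : openI V W1 `<=` W by move=> q /VW1; exact: h1.
  have VO : openI V W1 `<=` Om by move=> q /VV; exact: h.
  exists (openI V W1), VW, VV; split => //.
  by rewrite (res_comp h VV VO) -(res_comp h1' VW1 VO) e1 (res_comp h1 VW1 VW).
move=> a ra; pose I (b : regfun V) := b *: (a *: res h s) = 0.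
suff : I 1 by rewrite /I scale1r.
apply: nullstellensatz.
- by move=> b d hb hd; rewrite /I scalerDl hb hd addr0.
- by move=> b d hd; rewrite /I -scalerA hd scaler0.
move=> p' Vp'; have [e|/eqP np] := eqVneq p' p; last first.
  have [|b [b1 b0]] := @cutoff k X ch Om p' [:: p] (h _ Vp'); first by rewrite mem_seq1; apply/eqP.
  exists (regres h b), 1; split => //; last exact: oner_neq0.
  rewrite /I scalerA mulrC -scalerA -resZ ks ?res0 ?scaler0 //.
  by apply: rval_eq; apply: b0; rewrite ?mem_seq1 ?eqxx //; exact: (h _ Vp).
have [S hS] : exists S : seq (point X), forall q, ~ aset V q <-> q \in S := open_seq V.
(* clear the poles of a away from V *)
have [a0|a0] := eqVneq (regval a) 0.
  exists 1, 1; split; [|exact: oner_neq0|rewrite regval1; exact: rv1].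
  by rewrite /I (_ : a = 0) ?scale0r ?scaler0 //; exact: regval_inj.
have [S' hS'] := finite_list_zeros a0.
have [N hN] := val_bound S (regval a)^-1.
have [|b [b1 b0]] := @cutoff k X ch Om p S (h _ Vp); first by apply/negP => /hS; apply.
have [d hd] : exists d : regfun Om, regval d = regval b ^+ N * regval a.
  apply: regfun_ex => p'' Op''; have [Vp''|nV] := pselect (aset V p'').
    by rewrite ordgeM0 ?ordgeX //; exact: regfun_ord.
  have pS : p'' \in S by apply/hS.
  have o1 : ordge p'' 1 (regval b) by apply/ordge1P; exact: b0.
  apply: (@ordge_le _ _ p'' (N%:Z + val p'' (regval a))).
    have := hN p'' pS; rewrite valV //; lia.
  by apply: ordgeM; [exact: ordgeX1|exact: val_ordge].
exists (regres h (b ^+ N)), 1; split; [|exact: oner_neq0|]; last first.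
  by rewrite e /= regvalX -(expr1n k N); exact: rvX.
rewrite /I scalerA (_ : regres h (b ^+ N) * a = regres h d); last first.
  by apply: regval_inj; rewrite regvalM /= regvalX hd.
rewrite -resZ ks ?res0 //; apply: rval_eq; rewrite hd -(mulr0 (1 ^+ N)).
by apply: rvM; [exact: rvX|rewrite -ra; exact: rvalP].
Qed.

Lemma special_away (Om V : aopen X) (h : V `<=` Om) (s : E Om) : ~ aset V p -> special s ->
  res h s = 0.
Proof.
move=> nV [ks [W1 [h1 [h1' [W1p _]]]]]; have Op := h1' _ W1p; pose I (b :
  regfun V) := b *: res h s = 0.
suff : I 1 by rewrite /I scale1r.
apply: nullstellensatz.
- by move=> b d hb hd; rewrite /I scalerDl hb hd addr0.
- by move=> b d hd; rewrite /I -scalerA hd scaler0.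
move=> p' Vp'; have np : p' <> p by move=> e; apply: nV; rewrite -e.
have [|b [b1 b0]] := @cutoff k X ch Om p' [:: p] (h _ Vp'); first by rewrite mem_seq1; apply/eqP.
exists (regres h b), 1; split => //; last exact: oner_neq0.
by rewrite /I -resZ ks ?res0 //; apply: rval_eq; apply: b0; rewrite ?mem_seq1 ?eqxx.
Qed.

End Point.

End TorsionFree.

(** * Simple sheaves are bundles *)

Section TFree.
Variables (k : closedFieldType) (X : elliptic_curve k).
Context {ch : char0 k}.
Notation K := (ffield X).
Notation cst := (fconst X).
Implicit Types (p q : point X) (f g : K) (c : k).

(** A section with zero annihilator: the sheaf has positive rank. *)
Definition nontorsion (E : coh X) := exists (U : aopen X) (s : E U),
  forall b : regfun U, b *: s = 0 -> b = 0.

Definition torsion_free (E : coh X) := forall (U : aopen X) (b : regfun U) (s : E U),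
  b != 0 -> b *: s = 0 -> s = 0.

Section FromSpecial.
Variables (E : coh X) (n : nat) (D : mdiv X n.+1) (i : coh_hom E (LL D)).
Hypothesis i_surj : forall (U : aopen X) (v : LL D U), exists e : E U, hmap i U e = v.
Hypothesis i_tors : forall (U : aopen X) (e : E U), hmap i U e = 0 <-> exists2 b : regfun U,
  b != 0 & b *: e = 0.
Variables (p : point X) (W : aopen X) (s1 : E W) (u : K).
Hypotheses (Wp : aset W p) (u0 : u != 0) (vu : val p u = 1)
  (uW : forall p', aset W p' -> p' <> p -> val p' u = 0).
Hypothesis us1 : forall a : regfun W, regval a = u -> a *: s1 = 0.
Hypothesis s1_neq0 : s1 <> 0.

(** The composition of E onto its quotient bundle, a coordinate of the value at p
    in k, and the inclusion of the skyscraper spanned by s1, is an endomorphism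
    of E. It is nonzero and its image is torsion, so it is not a scalar. *)
Lemma not_end_scalar : ~ hom_dim E E 1.
Proof.
move=> hd.
have sp_ex (Om : aopen X) : exists s : E Om, (aset Om p -> special p s1 s) /\ (~ aset Om p ->
  s = 0).
  have [Op|nO] := pselect (aset Om p); last by exists 0; split.
  have [s hs] : exists s : E Om, special p s1 s by exact: (special_ex Wp u0 vu uW us1 Op).
  by exists s; split.
pose sg (Om : aopen X) := projT1 (cid (sp_ex Om)).
have sg_in (Om : aopen X) : aset Om p -> special p s1 (sg Om) by rewrite /sg; case: cid => s [].
have sg_out (Om : aopen X) : ~ aset Om p -> sg Om = 0 by rewrite /sg; case: cid => s [].
have sg_kill (Om : aopen X) (a : regfun Om) c : rv p (regval a) c ->
  a *: sg Om = regconst Om c *: sg Om.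
  move=> hc; have [Op|nO] := pselect (aset Om p); last by rewrite sg_out // !scaler0.
  apply/eqP; rewrite -subr_eq0 -scalerBl; apply/eqP; have [h _] := sg_in _ Op; apply: h.
  have -> : regval (a - regconst Om c) = regval a - cst c by [].
  by apply: rval_eq; rewrite -(subrr c); apply: rvB => //; exact: rv_const.
pose lam (Om : aopen X) (e : E Om) := rval p ((lval (hmap i Om e) *m D p) 0 0).
have lamP (Om : aopen X) (e : E Om) : aset Om p ->
  rv p ((lval (hmap i Om e) *m D p) 0 0) (lam Om e).
  move=> Op; have [c hc] : exists c, rv p ((lval (hmap i Om e) *m D p) 0 0) c.
    by apply/rv_reg/ordge_regP; apply: (lsec_lat (hmap i Om e) Op).
  by rewrite /lam (rval_eq hc).
pose phi (Om : aopen X) (e : E Om) : E Om := regconst Om (lam Om e) *: sg Om.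
have rcD (Om : aopen X) a b : regconst Om (a + b) = regconst Om a + regconst Om b.
  by apply: regval_inj; rewrite /= rmorphD.
have rcM (Om : aopen X) a b : regconst Om (a * b) = regconst Om a * regconst Om b.
  by apply: regval_inj; rewrite /= rmorphM.
have lphi (Om : aopen X) : linear (phi Om).
  move=> a e e'; have [Op|nO] := pselect (aset Om p); last first.
    by rewrite /phi !sg_out // !scaler0 addr0.
  have ra : rv p (regval a) (rval p (regval a)) by exact: rvalP.
  have -> : phi Om (a *: e + e') = regconst Om (rval p (regval a) * lam Om e + lam Om e') *: sg Om.
    rewrite /phi; congr (regconst _ _ *: _); apply: rval_eq.
    rewrite linearP lvalD lvalZ mulmxDl -scalemxAl [X in rv _ X _]mxE [X in rv _ (X + _) _]mxE.
    apply: rvD (lamP _ e' Op). exact: (rvM ra (lamP _ e Op)).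
  rewrite /phi rcD rcM scalerDl -scalerA; congr (_ + _).
  by rewrite scalerA mulrC -scalerA -(sg_kill _ _ _ ra) !scalerA mulrC.
have rphi (U V : aopen X) (h : V `<=` U) (e : E U) :
  mklin (lphi V) (res h e) = res h (mklin (lphi U) e).
  rewrite !mklinE /phi resZ; have [Vp|nV] := pselect (aset V p); last first.
    rewrite (sg_out _ nV) scaler0; have [Up|nU] := pselect (aset U p); last
      by rewrite sg_out // res0 scaler0.
    by rewrite (special_away h nV (sg_in _ Up)) scaler0.
  have Up := h _ Vp.
  have -> : res h (sg U) = sg V.
    apply: (special_uniq Vp _ (sg_in _ Vp)).
    exact: (special_res u0 vu h Vp (sg_in _ Up)).
  congr (_ *: _); apply: regval_inj => /=; congr (cst _).
  by rewrite /lam hmap_res.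
pose h := @CohHom k X E E (fun U => mklin (lphi U)) rphi.
have [c hc] := end_scalar h hd.
have hc' (U : aopen X) (e : E U) : phi U e = regconst U c *: e by rewrite -hc.
(* a section of the quotient bundle with first coordinate 1 at p *)
have [v Uv] : exists v : LL D W, lam W (projT1 (cid (i_surj v))) = 1.
  have [q hq] := open_miss W.
  have [V [hV rV]] := lat_approx D q [:: p] (fun _ => row (@ord0 n) (invmx (D p))) 1.
  have h1 : mge p 1 (V *m D p - row ord0 1%:M).
    rewrite -(mulVmx (mdiv_unit D p)) row_mul -mulmxBl; apply: hV; first by rewrite mem_seq1.
    exact: hq.
  have [v hv] : exists v : lsec D W, lval v = V.
    apply: lsec_ex => p' Wp'; have [->|np] := eqVneq p' p; last first.
      by apply: rV; [rewrite mem_seq1|exact: hq].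
    rewrite /lat -(subrK (row ord0 1%:M) (V *m D p)); apply: mgeD; first by apply: mge_le h1.
    by move=> a b; rewrite !mxE; case: (_ == _); [exact: ordge_1|exact: ordge_0].
  exists v; case: cid => e /= he; apply: rval_eq; rewrite he hv.
  by apply/rv_ordge1; have := h1 0 0; rewrite rmorph1 !mxE.
set e := projT1 _ in Uv; have ie : hmap i W e = v by rewrite /e; case: cid.
have phe : phi W e = sg W.
  by rewrite /phi Uv (_ : regconst W 1 = 1) ?scale1r //; apply: regval_inj; rewrite /= rmorph1.
have sgW : sg W = s1.
  have sps1 : special p s1 s1.
    split; last by exists W, (@subset_refl _ _), (@subset_refl _ _).
    move=> a ra; have h0 : a *: res (@subset_refl _ W) s1 = 0 by apply: (kill_small u0 vu uW us1).
    by rewrite res_id in h0.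
  exact: (special_uniq Wp (sg_in _ Wp) sps1).
have [b hb] : exists b : regfun W, regval b = u.
  apply: regfun_ex => p' Wp'; rewrite ordgeE //; have [->|/eqP np] := eqVneq p' p; first
    by rewrite vu.
  by rewrite uW.
(* if the endomorphism is the scalar c, then u c annihilates e *)
have z : (b * regconst W c) *: e = 0.
  by rewrite -scalerA -hc' phe sgW us1.
have c0 : c != 0.
  apply: contra_notN s1_neq0 => /eqP c0; rewrite -sgW -phe hc' c0.
  by rewrite (_ : regconst W 0 = 0) ?scale0r //; apply: regval_inj; rewrite /= rmorph0.
have : hmap i W e = 0.
  apply/i_tors; exists (b * regconst W c) => //.
  by rewrite regval_neq0 regvalM mulf_neq0 ?hb //= fmorph_eq0.
move=> e0; have := lamP W e Wp; rewrite e0 Uv lval0 mul0mx mxE => /(rv_uniq (rv0 _))/eqP.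
by rewrite eq_sym oner_eq0.
Qed.

End FromSpecial.

(** A nonzero torsion section has, at a point p of its support, a multiple killed
    by a uniformizer at p, to which the construction above applies. *)
Theorem end_torsion_free (E : coh X) : nontorsion E -> hom_dim E E 1 -> torsion_free E.
Proof.
move=> [U1 [t1 ht1]] hd U b s b0 bs; apply: contrapT => s0.
have [n [D [i [isurj itors]]]] : exists n (D : mdiv X n) (i : coh_hom E (LL D)),
  (forall (U : aopen X) (v : LL D U), exists e : E U, hmap i U e = v) /\
  (forall (U : aopen X) (e : E U), hmap i U e = 0 <-> exists2 b : regfun U, b != 0 & b *: e = 0).
  exact: coh_structure.
case: n => [|n] in D i isurj itors.
  have : hmap i U1 t1 = 0 by apply: lval_inj; exact: zero_rv.
  by move/itors => [d d0 /ht1 /eqP]; rewrite (negbTE d0).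
(* a point of the support of s *)
have [p [Up hp]] : exists p, aset U p /\ forall a : regfun U, a *: s = 0 -> rval p (regval a) = 0.
  apply: contrapT => hno; apply: s0; pose I (a : regfun U) := a *: s = 0.
  suff : I 1 by rewrite /I scale1r.
  apply: nullstellensatz.
  - by move=> a d ha hd'; rewrite /I scalerDl ha hd' addr0.
  - by move=> a d ha; rewrite /I -scalerA ha scaler0.
  move=> p Up; apply: contrapT => h; apply: hno; exists p; split => // a as0.
  apply: contrapT => /eqP ra; apply: h; exists a, (rval p (regval a)); split => //.
  exact: rvalP.
have [q hq] := open_miss U.
have [u [ru u0 vu]] : exists u, [/\ forall p', p' <> q -> ordge p' 0 u, u != 0 & val p u = 1].
  by apply: param; exact: hq.
have b0' : regval b != 0 by rewrite -regval_neq0.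
have [S1 hS1] := finite_list_zeros u0; have [S2 hS2] := finite_list_zeros b0'.
have [|f [f1 f0]] := @cutoff k X ch U p [seq x <- S1 ++ S2 | x != p] Up.
  by rewrite mem_filter eqxx.
have nz : regval f != 0 by apply: rv_neq0 f1; exact: oner_neq0.
have [W [WU dW]] := zero_list nz.
have Wp : aset W p by apply/dW; split => //; apply: rv_unit_at f1; exact: oner_neq0.
have Wz p' : aset W p' -> p' <> p -> p' \notin S1 /\ p' \notin S2.
  move=> Wp' /eqP np; suff : p' \notin S1 ++ S2 by rewrite mem_cat negb_or => /andP[].
  apply/negP => pS; have [Up' hu] := (dW p').1 Wp'.
  have r0 : rv p' (regval f) 0 by apply: f0; rewrite ?mem_filter ?np.
  have [_ v0] : regval f != 0 /\ val p' (regval f) = 0 by apply: unit_atE => //; exact: regfun_ord.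
  have : ordge p' 1 (regval f) by apply/ordge1P.
  by rewrite ordgeE // v0.
have uW p' : aset W p' -> p' <> p -> val p' u = 0 by move=> h1 h2; have [/hS1] := Wz p' h1 h2.
have bW p' : aset W p' -> p' <> p -> val p' (regval b) = 0 by move=> h1 h2;
  have [_ /hS2] := Wz p' h1 h2.
have [uw huw] : exists uw : regfun W, regval uw = u.
  by apply: regfun_ex => p' Wp'; apply: ru; apply: hq; exact: WU.
have sW : res WU s <> 0.
  move=> z; have [m hm] := sec_loc_ker dW z; have := hp _ hm.
  have -> : rval p (regval (f ^+ m)) = 1.
    by apply: rval_eq; rewrite regvalX -(expr1n k m); exact: rvX.
  by move/eqP; rewrite oner_eq0.
have [m hm] : exists m, uw ^+ m *: res WU s = 0.
  have vb : 0 <= val p (regval b) by rewrite -ordgeE //; exact: regfun_ord.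
  exists `|val p (regval b)|%N.
  have [w hw] : exists w : regfun W, regval w = u ^+ `|val p (regval b)|%N / regval b.
    apply: regfun_ex => p' Wp'; rewrite ordgeE ?mulf_neq0 ?expf_neq0 ?invr_eq0 //.
    rewrite valM ?expf_neq0 ?invr_eq0 // valX // valV // -mulr_natr natz.
    have [->|/eqP np] := eqVneq p' p; first by rewrite vu gez0_abs // mul1r subrr.
    have -> : val p' u = 0 by exact: uW. have -> : val p' (regval b) = 0 by exact: bW.
    by rewrite mul0r subr0.
  have -> : uw ^+ `|val p (regval b)|%N = w * regres WU b.
    by apply: regval_inj; rewrite regvalX regvalM hw huw /= divfK.
  by rewrite -scalerA -resZ bs res0 scaler0.
have [s1 [s10 us1]] : exists s1 : E W, s1 <> 0 /\ uw *: s1 = 0.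
  elim: m hm => [|m IHm]; first by rewrite expr0 scale1r => /sW.
  rewrite exprS -scalerA => h; have [/IHm //|ne] := pselect (uw ^+ m *: res WU s = 0).
  by exists (uw ^+ m *: res WU s).
apply: (not_end_scalar isurj itors Wp u0 vu uW _ s10 hd).
by move=> a ha; rewrite (_ : a = uw) //; apply: regval_inj; rewrite ha huw.
Qed.

Lemma inv_hom (E F : coh X) (i : coh_hom E F) : (forall U, injective (hmap i U)) ->
  (forall U t, exists s, hmap i U s = t) ->
  exists j : coh_hom F E, (forall U s, hmap j U (hmap i U s) = s) /\
    (forall U t, hmap i U (hmap j U t) = t).
Proof.
move=> inj surj; pose g U t := projT1 (cid (surj U t)).
have hg U t : hmap i U (g U t) = t by rewrite /g; case: cid.
have lg U : linear (g U : F U -> E U).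
  by move=> a s t; apply: inj; rewrite hg linearP !hg.
have rg (U V : aopen X) (h : V `<=` U) (e : F U) : mklin (lg V) (res h e) = res h (mklin (lg U) e).
  by apply: inj; rewrite !mklinE hg hmap_res hg.
exists (@CohHom k X F E (fun U => mklin (lg U)) rg); split=> U t /=; last exact: hg.
by apply: inj; exact: hg.
Qed.

Definition iso_LL (E : coh X) n (D : mdiv X n) (i : coh_hom E (LL D)) (j : coh_hom (LL D) E) :=
  (forall U s, hmap j U (hmap i U s) = s) /\ (forall U t, hmap i U (hmap j U t) = t).

Theorem torsion_free_iso (E : coh X) : torsion_free E -> exists n (D : mdiv X n)
  (i : coh_hom E (LL D)) (j : coh_hom (LL D) E), iso_LL i j.
Proof.
move=> tf; have [n [D [i [isurj itors]]]] : exists n (D : mdiv X n) (i : coh_hom E (LL D)),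
  (forall (U : aopen X) (v : LL D U), exists e : E U, hmap i U e = v) /\
  (forall (U : aopen X) (e : E U), hmap i U e = 0 <-> exists2 b : regfun U, b != 0 & b *: e = 0).
  exact: coh_structure.
have inj U : injective (hmap i U).
  move=> s t e; apply/eqP; rewrite -subr_eq0; apply/eqP.
  have /itors [b b0 hb] : hmap i U (s - t) = 0 by rewrite linearB e subrr.
  exact: tf hb.
by have [j hj] := inv_hom inj isurj; exists n, D, i, j.
Qed.

Lemma comp_hom (E F G : coh X) (f : coh_hom E F) (g : coh_hom F G) :
  exists h : coh_hom E G, forall (U : aopen X) (s : E U), hmap h U s = hmap g U (hmap f U s).
Proof.
have lh U : linear (fun s : E U => hmap g U (hmap f U s)) by move=> a s t; rewrite !linearP.
have rh (U V : aopen X) (h : V `<=` U) (e : E U) : mklin (lh V) (res h e) = res h (mklin (lh U) e).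
  by rewrite !mklinE !hmap_res.
by exists (@CohHom k X E G (fun U => mklin (lh U)) rh).
Qed.

Section HomDim.
Variables (E F : coh X) (n m : nat) (D : mdiv X n) (M : mdiv X m).
Variables (i : coh_hom E (LL D)) (i' : coh_hom (LL D) E) (j : coh_hom F (LL M)) (j' :
  coh_hom (LL M) F).
Hypotheses (hi : iso_LL i i') (hj : iso_LL j j').

Lemma hom_to_matrix (h : coh_hom E F) : exists A : 'M[K]_(n, m), hglob D M A /\
  forall (U : aopen X) (s : E U), lval (hmap j U (hmap h U s)) = lval (hmap i U s) *m A.
Proof.
have [h1 eh1] := comp_hom i' h; have [h2 eh2] := comp_hom h1 j.
have [A [hA gA]] := hom_matrix h2; exists A; split => // U s.
by rewrite -hA eh2 eh1 (proj1 hi).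
Qed.

Lemma matrix_to_hom (A : 'M[K]_(n, m)) : hglob D M A -> exists h : coh_hom E F,
  forall (U : aopen X) (s : E U), lval (hmap j U (hmap h U s)) = lval (hmap i U s) *m A.
Proof.
move=> gA; have [h0 eh0] := matrix_hom gA.
have [h1 eh1] := comp_hom i h0; have [h2 eh2] := comp_hom h1 j'.
by exists h2 => U s; rewrite eh2 eh1 (proj2 hj) eh0.
Qed.

Lemma hom_basis_h0 d (f : 'I_d -> coh_hom E F) : hom_basis f ->
  exists A : 'I_d -> 'M[K]_(n, m), (forall a (U : aopen X) (s : E U),
     lval (hmap j U (hmap (f a) U s)) = lval (hmap i U s) *m A a) /\ kbasis cst (hglob D M) A.
Proof.
move=> hf; pose A a := projT1 (cid (hom_to_matrix (f a))).
have gA a : hglob D M (A a) by rewrite /A; case: cid => B /= [].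
have hA a (U : aopen X) (s : E U) : lval (hmap j U (hmap (f a) U s)) = lval (hmap i U s) *m A a.
  by rewrite /A; case: cid => B /= [].
have sumE (c : 'rV[k]_d) (U : aopen X) (s : E U) :
    lval (hmap j U (\sum_(a < d) regconst U (c 0 a) *: hmap (f a) U s)) =
    lval (hmap i U s) *m (\sum_a cst (c 0 a) *: A a).
  rewrite linear_sum lval_sum mulmx_sumr; apply: eq_bigr => a _.
  by rewrite linearZ lvalZ hA -scalemxAr.
exists A; split => //; split => // B gB.
have [h hh] := matrix_to_hom gB; have [c [hc uc]] := hf h; exists c; split.
  apply: (@matrix_uniq k X ch _ _ D (off Infinity)) => s.
  by rewrite -(proj2 hi _ s) -hh hc sumE.
move=> c' ec'; apply: uc => U s.
have inj : injective (hmap j U) by exact: can_inj (proj1 hj U).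
by apply/inj/lval_inj; rewrite hh ec' sumE.
Qed.

Lemma hom_dim_h0 d : hom_dim E F d -> h0 D M d.
Proof. by move=> [f /hom_basis_h0 [A [_ hA]]]; exists A. Qed.

End HomDim.

End TFree.

(** * Extensions *)

Section YonedaSplit.
Variables (k : closedFieldType) (X : elliptic_curve k).
Context {ch : char0 k}.

Definition sec_bij (E F : coh X) (f : coh_hom E F) :=
  (forall U, injective (hmap f U)) /\ (forall U t, exists s, hmap f U s = t).

Lemma is_id_bij (E : coh X) (f : coh_hom E E) : is_id f -> sec_bij f.
Proof.
move=> h; have e U (s : E U) : hmap f U s = s.
  rewrite h (_ : regconst U 1 = 1) ?scale1r //; apply: regval_inj; rewrite /=; exact: rmorph1.
by split=> [U s t|U t]; [rewrite !e|exists t; rewrite e].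
Qed.

(** The map between the middle terms is bijective, by the five lemma, so
    splittings can be carried over in both directions. *)
Lemma ext_mor_split (A B A' B' : coh X) (e : extension A B) (e' : extension A' B')
    (a : coh_hom A A') (b : coh_hom B B') :
  sec_bij a -> sec_bij b -> ext_mor e e' a b -> (ext_split e <-> ext_split e').
Proof.
move=> [ainj asurj] [binj bsurj] [m [mi mp]].
have [a' [aK aK']] := inv_hom ainj asurj.
have minj U : injective (hmap m U).
  suff H x : hmap m U x = 0 -> x = 0.
    by move=> x y exy; apply/eqP; rewrite -subr_eq0; apply/eqP/H; rewrite linearB exy subrr.
  move=> mx; have [ei es ek] := e_exact e U; have [ei' es' ek'] := e_exact e' U.
  have /ek [y ey] : hmap (eprj e) U x = 0 by apply: ainj; rewrite -mp mx !linear0.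
  have y0 : y = 0 by apply/binj/ei'; rewrite -mi ey mx !linear0.
  by rewrite -ey y0 linear0.
have msurj U x' : exists x, hmap m U x = x'.
  have [ei es ek] := e_exact e U; have [ei' es' ek'] := e_exact e' U.
  have [t et] := asurj U (hmap (eprj e') U x'); have [x ex] := es t.
  have /ek' [b' hb'] : hmap (eprj e') U (x' - hmap m U x) = 0 by rewrite linearB mp ex et subrr.
  have [y ey] := bsurj U b'; exists (x + hmap (einj e) U y).
  by rewrite linearD mi ey hb' addrC subrK.
have [m' [mK mK']] := inv_hom minj msurj.
split=> [[s hs]|[s hs]].
  have [h1 e1] := comp_hom a' s; have [h2 e2] := comp_hom h1 m.
  by exists h2 => U x; rewrite e2 mp e1 hs aK'.
have [h1 e1] := comp_hom a s; have [h2 e2] := comp_hom h1 m'.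
by exists h2 => U x; apply: ainj; rewrite -mp e2 mK' e1 hs.
Qed.

Lemma yext_pos n (A B : coh X) : yext n A B -> n <> 0%N.
Proof. by case. Qed.

Lemma yext_mor_split n (A B A' B' : coh X) (y : yext n A B) (y' : yext n A' B')
    (a : coh_hom A A') (b : coh_hom B B') : yext_mor y y' a b -> n = 1%N ->
  sec_bij a -> sec_bij b -> (yext_zero y <-> yext_zero y').
Proof.
move=> h; case: h => [A1 B1 A1' B1' e e' a1 b1 h _ ha hb|n1 A1 C B1 A1' C' B1' e e' z z' a1 c b1
  _ _ [n0]].
  exact: ext_mor_split h.
by case: (yext_pos z n0).
Qed.

Lemma yext_equiv_split (A B : coh X) (y y' : yext 1 A B) : yext_equiv y y' ->
  (yext_zero y <-> yext_zero y').
Proof.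
apply: (@yext_equiv_ind k X 1 A B (fun y y' => yext_zero y <-> yext_zero y')) => {y y'}
  [u u' a b ha hb h|u|u u' _ IH|u u' u'' _ IH _ IH'] //.
- by apply: yext_mor_split h _ _ _ => //; exact: is_id_bij.
- by rewrite IH.
by rewrite IH IH'.
Qed.

Lemma ext_vanish_split (A B : coh X) (e : extension A B) : ext_vanish 1 A B -> ext_split e.
Proof. by move=> /(_ (Yone e)) [y' [/yext_equiv_split h /h]]. Qed.

End YonedaSplit.

Section ExtVanish.
Variables (k : closedFieldType) (X : elliptic_curve k).
Context {ch : char0 k}.
Notation K := (ffield X).
Notation cst := (fconst X).
Implicit Types (p q : point X) (f g : K) (c : k).

Variables (n m : nat) (D : mdiv X n) (M : mdiv X m) (S : seq (point X)) (A : point X ->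
  'M[K]_(n, m)).
Let A' p := if p \in S then A p else 0.

(** The extension of LL D by LL M whose class is given by the principal parts A:
    the lattice at p consists of the rows (w, v) with v in D p and w - v A p in
    M p. *)
Definition glue_fun p : 'M[K]_(m + n) := block_mx (M p) 0 (- (A' p *m M p)) (D p).

Lemma glue_subproof : (forall p, glue_fun p \in unitmx) /\ finite_set [set p | glue_fun p <> 1%:M].
Proof.
split=> [p|]; first by rewrite unitmxE det_lblock unitrM -!unitmxE !mdiv_unit.
have [T hT] := mdiv_supp D; have [T' hT'] := mdiv_supp M.
apply: (@sub_finite_set _ _ [set` T ++ T' ++ S]); last exact: finite_seq.
move=> p /= h; apply/negPn/negP => hp; apply: h; move: hp.
rewrite !mem_cat negb_or => /andP[/hT e]; rewrite negb_or => /andP[/hT' e' /negbTE e''].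
by rewrite /glue_fun /A' e e' e'' mul0mx oppr0 -scalar_mx_block.
Qed.

Definition glue : mdiv X (m + n) := Mdiv glue_subproof.1 glue_subproof.2.

Lemma glue_lat p (u : 'rV[K]_(m + n)) : lat p (glue p) u <->
  lat p (M p) (lsubmx u - rsubmx u *m A' p) /\ lat p (D p) (rsubmx u).
Proof.
rewrite /lat /glue /= /glue_fun -{1}(hsubmxK u) mul_row_block mulmx0 add0r mulmxN mulmxA -mulmxBl.
split=> [h|[h h'] a b].
  split=> a b; [have := h a (lshift n b)|have := h a (rshift m b)].
    by rewrite row_mxEl.
  by rewrite row_mxEr.
rewrite mxE; case: (fintype.split b) => c; [exact: h|exact: h'].
Qed.

Variables (E F : coh X) (i : coh_hom E (LL D)) (i' : coh_hom (LL D) E)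
  (j : coh_hom F (LL M)) (j' : coh_hom (LL M) F).
Hypotheses (hi : iso_LL i i') (hj : iso_LL j j').

Lemma iso_inj (G : coh X) l (N : mdiv X l) (u : coh_hom G (LL N)) u' : iso_LL u u' ->
  forall U, injective (hmap u U).
Proof. by move=> h U; exact: can_inj (h.1 U). Qed.

(** Sections of D lift because M has sections with prescribed principal parts
    over an affine open set. *)
Lemma glue_extension : exists e : extension E F, exists idh : coh_hom (LL glue) (emid e),
  (forall U, injective (hmap idh U)) /\
  (exists idh' : coh_hom (emid e) (LL glue), iso_LL idh' idh) /\
  forall U s, lval (hmap i U (hmap (eprj e) U (hmap idh U s))) = rsubmx (lval s).
Proof.
have [id hid] := id_hom (LL glue).
have isoid : iso_LL id id by split=> U s; rewrite !hid.
have [inj hinj] : exists h : coh_hom F (LL glue), forall (U : aopen X) (s : F U),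
    lval (hmap id U (hmap h U s)) = lval (hmap j U s) *m row_mx 1%:M 0.
  apply: (matrix_to_hom j isoid) => p; apply/hlatP => v hv.
  rewrite mul_mx_row mulmx1 mulmx0; apply/glue_lat.
  by rewrite row_mxKl row_mxKr mul0mx subr0; split => //; exact: lat_0.
have [prj hprj] : exists h : coh_hom (LL glue) E, forall (U : aopen X) (s : LL glue U),
    lval (hmap i U (hmap h U s)) = lval (hmap id U s) *m col_mx 0 1%:M.
  apply: (matrix_to_hom id hi) => p; apply/hlatP => v /glue_lat [_ hv].
  by rewrite -(hsubmxK v) mul_row_col mulmx0 add0r mulmx1.
have prjE U (s : LL glue U) : lval (hmap i U (hmap prj U s)) = rsubmx (lval s).
  by rewrite hprj hid -{1}(hsubmxK (lval s)) mul_row_col mulmx0 add0r mulmx1.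
have injE U (s : F U) : lval (hmap inj U s) = row_mx (lval (hmap j U s)) 0.
  by rewrite -[hmap inj U s]hid hinj mul_mx_row mulmx1 mulmx0.
have ex : short_exact inj prj.
  move=> U; split.
  - move=> s t e; apply/(iso_inj hj)/lval_inj.
    by have := congr1 (fun s : LL glue U => lsubmx (lval s)) e; rewrite !injE !row_mxKl.
  - move=> t; have [q hq] := open_miss U.
    have [V [hV rV]] := lat_approx M q S (fun p => lval (hmap i U t) *m A p) 0.
    have [s hs] : exists s : lsec glue U, lval s = row_mx V (lval (hmap i U t)).
      apply: lsec_ex => p Up; apply/glue_lat; rewrite row_mxKl row_mxKr; split;
        last exact: lsec_lat.
      rewrite /A'; case: ifP => pS; first by apply: hV => //; exact: hq.
      by rewrite mulmx0 subr0; apply: rV; [rewrite pS|exact: hq].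
    by exists s; apply/(iso_inj hi)/lval_inj; rewrite prjE hs row_mxKr.
  move=> s; split=> [e0|[t <-]].
    have rs0 : rsubmx (lval s) = 0 by rewrite -prjE e0 linear0 lval0.
    have [t ht] : exists t : lsec M U, lval t = lsubmx (lval s).
      apply: lsec_ex => p Up; have /glue_lat [h _] := lsec_lat s Up.
      by rewrite rs0 mul0mx subr0 in h.
    exists (hmap j' U t); apply: lval_inj.
    by rewrite injE (proj2 hj) ht -rs0 hsubmxK.
  by apply/(iso_inj hi)/lval_inj; rewrite prjE injE row_mxKr linear0 lval0.
exists (Extension ex), id; split; first exact: iso_inj isoid.
split; first by exists id.
by move=> U s /=; rewrite hid prjE.
Qed.

(** A splitting is given by a matrix (B, 1), and B has the principal parts A. *)
Lemma split_glue : ext_vanish 1 E F -> exists B, forall p, hlat p D M (B - A' p).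
Proof.
move=> ev; have [e [id [_ [[id' isoid] hp]]]] := glue_extension.
have [s hs] : ext_split e by exact: ext_vanish_split.
have [C [gC hC]] := hom_to_matrix id' hi s.
have C1 : rsubmx C = 1%:M.
  apply: (@matrix_uniq k X ch _ _ D (off Infinity)) => t.
  pose t' := hmap i' (off Infinity) t.
  have := hp _ (hmap id' _ (hmap s _ t')).
  rewrite (proj1 isoid) hs hC (proj2 hi) mulmx1 => e0.
  by rewrite mulmx_rsub -e0.
exists (lsubmx C) => p; apply/hlatP => v hv.
have /hlatP /(_ _ hv) /glue_lat [h _] := gC p; move: h.
by rewrite -mulmx_lsub -mulmx_rsub C1 mulmx1 mulmxBr.
Qed.

End ExtVanish.

Section RRExt.
Variables (k : closedFieldType) (X : elliptic_curve k).
Context {ch : char0 k}.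
Variables (n m : nat) (D : mdiv X n) (M : mdiv X m).
Variables (E F : coh X) (i : coh_hom E (LL D)) (i' : coh_hom (LL D) E)
  (j : coh_hom F (LL M)) (j' : coh_hom (LL M) F).
Hypotheses (hi : iso_LL i i') (hj : iso_LL j j').

Lemma ext_vanish_h1zero : ext_vanish 1 E F -> h1zero D M.
Proof. by move=> ev S A; exact: (split_glue S A hi hj ev). Qed.

Lemma dg_iso_LL (dg : coh X -> int) : is_degree dg -> dg E = dg (LL D).
Proof. by move=> dgP; apply: (dg_iso dgP (iso_inj hi)) => U t; exists (hmap i' U t);
  rewrite (hi.2). Qed.

End RRExt.

Theorem riemann_roch_ext (k : closedFieldType) (X : elliptic_curve k) (ch : char0 k)
  (n m : nat) (D : mdiv X n) (M : mdiv X m)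
  (E F : coh X) (i : coh_hom E (LL D)) (i' : coh_hom (LL D) E)
  (j : coh_hom F (LL M)) (j' : coh_hom (LL M) F) (dg : coh X -> int) d : is_degree dg ->
  iso_LL i i' -> iso_LL j j' -> ext_vanish 1 E F -> hom_dim E F d ->
  d%:Z = n%:Z * dg F - m%:Z * dg E.
Proof.
move=> dgP hi hj ev hd; rewrite (dg_iso_LL hi dgP) (dg_iso_LL hj dgP).
apply: (riemann_roch_dg dgP (hom_dim_h0 hi hj hd)). exact: ext_vanish_h1zero hi hj ev.
Qed.

(** * Ranks *)

Section Rank.
Variables (k : closedFieldType) (X : elliptic_curve k).
Context {ch : char0 k}.
Notation K := (ffield X).
Notation cst := (fconst X).
Implicit Types (p q : point X) (f g : K) (c : k).

Definition indep (E : coh X) (U : aopen X) r (s : 'I_r -> E U) := forall c : 'I_r -> regfun U,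
  \sum_(i < r) c i *: s i = 0 -> forall i, c i = 0.

Definition almost_spans (E : coh X) (U : aopen X) r (s : 'I_r -> E U) := forall t : E U,
  exists (a : regfun U) (c : 'I_r -> regfun U), a != 0 /\ a *: t = \sum_(i < r) c i *: s i.

Definition rank_on (U : aopen X) (E : coh X) r := exists s : 'I_r -> E U, indep s /\ almost_spans s.

Lemma regval_sum (U : aopen X) (J : finType) (G : J -> regfun U) :
  regval (\sum_j G j) = \sum_j regval (G j).
Proof. by elim/big_rec2: _ => // j y1 y2 _ <-. Qed.

Lemma regfun_mulf_neq0 (U : aopen X) (a b : regfun U) : a != 0 -> b != 0 -> a * b != 0.
Proof. by rewrite !regval_neq0 regvalM => a0 b0; rewrite mulf_neq0. Qed.

(** A relation over K between the coordinates, cleared of denominators, would be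
    a relation between the members of the independent family. *)
Lemma indep_le (E : coh X) (U : aopen X) r r' (s : 'I_r -> E U) (t : 'I_r' -> E U) :
  almost_spans s -> indep t -> (r' <= r)%N.
Proof.
move=> hs ht; have H j : exists ac : regfun U * ('I_r -> regfun U), ac.1 != 0 /\
    ac.1 *: t j = \sum_i ac.2 i *: s i.
  by have [a [c h]] := hs (t j); exists (a, c).
pose w j := projT1 (cid (H j)).
have w0 j : (w j).1 != 0 by rewrite /w; case: cid => ? /= [].
have wE j : (w j).1 *: t j = \sum_i (w j).2 i *: s i by rewrite /w; case: cid => ? /= [].
rewrite leqNgt; apply/negP => lt.
pose C : 'M[K]_(r', r) := \matrix_(j, i) regval ((w j).2 i).
have : kermx C != 0 by rewrite kermx_eq0 /row_free ltn_eqF // (leq_ltn_trans (rank_leq_col C)).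
move/rowV0Pn => [v /sub_kermxP vC v0].
have [b [b0 hb]] := denominator U v.
pose x j := projT1 (cid (hb j)).
have xE j : regval (x j) = regval b * v 0 j by rewrite /x; case: cid.
have z : \sum_j (x j * (w j).1) *: t j = 0.
  under eq_bigr do rewrite -scalerA wE scaler_sumr.
  rewrite exchange_big big1 //= => i _.
  under eq_bigr do rewrite scalerA.
  rewrite -scaler_suml (_ : \sum_j _ = 0) ?scale0r //.
  apply: regval_inj; rewrite regval_sum regval0.
  under eq_bigr do rewrite regvalM xE -mulrA.
  rewrite -mulr_sumr; have : (v *m C) 0 i = 0 by rewrite vC mxE.
  by rewrite mxE; under eq_bigr do rewrite [C _ _]mxE; move=> ->; rewrite mulr0.
move/negP: v0; apply; apply/eqP/rowP => j; rewrite mxE.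
have /eqP : x j * (w j).1 = 0 by exact: ht z j.
rewrite -[_ == 0]negbK; case: (eqVneq (x j) 0) => [xj0 _|xj0].
  have b0' : regval b != 0 by rewrite -regval_neq0.
  by have /eqP := xE j; rewrite xj0 regval0 eq_sym mulf_eq0 (negbTE b0') /= => /eqP.
by rewrite (regfun_mulf_neq0 xj0 (w0 j)).
Qed.

Lemma rank_on_uniq (E : coh X) (U : aopen X) r r' : rank_on U E r -> rank_on U E r' -> r = r'.
Proof.
by move=> [s [si ss]] [t [ti ts]]; apply/eqP; rewrite eqn_leq (indep_le ts si) (indep_le ss ti).
Qed.

Lemma coh_rankE (E : coh X) r : (forall U, rank_on U E r) -> coh_rank E = r.
Proof.
move=> h; have hr : is_rank E r.
  by have [s [h1 h2]] := h (off Infinity); exists (off Infinity), s.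
have : is_rank E (coh_rank E) by apply: (@xgetPex _ 0%N [set r | is_rank E r]); exists r.
by move=> [U [s [si ss]]]; apply: (rank_on_uniq (U := U)) (h U); exists s.
Qed.

Lemma rank_nontorsion (E : coh X) : coh_rank E <> 0%N -> nontorsion E.
Proof.
move=> r0; have [r [r1 [U [s [si _]]]]] : exists r, r <> 0%N /\ is_rank E r.
  exists (coh_rank E); split=> //; apply: (@xgetPex _ 0%N [set r | is_rank E r]).
  apply: contrapT => h; apply: r0; rewrite /coh_rank xgetPN // => r /= hr; by apply: h; exists r.
case: r r1 s si => // r _ s si; exists U, (s ord0) => b hb.
have := si (fun i => if i == ord0 then b else 0); rewrite (bigD1 ord0) //= hb add0r.
move=> /(_ _ ord0); rewrite eqxx; apply; rewrite big1 // => i /negbTE ->.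
by rewrite scale0r.
Qed.

Lemma iso_rank (E : coh X) n (D : mdiv X n) (i : coh_hom E (LL D)) (i' : coh_hom (LL D) E) (U :
  aopen X) :
  iso_LL i i' -> rank_on U E n.
Proof.
move=> hi; have [V [v [uV hv _]]] := frame_sec D U [::].
exists (fun a => hmap i' U (v a)); split.
  move=> c hc; have : hmap i U (\sum_a c a *: hmap i' U (v a)) = 0 by rewrite hc linear0.
  rewrite linear_sum => /(congr1 (@lval k X n D U)); rewrite lval_sum lval0.
  under eq_bigr do rewrite linearZ hi.2 lvalZ hv.
  pose x := \row_a regval (c a); have -> : \sum_a regval (c a) *: row a V = x *m V.
    by rewrite mulmx_sum_row; apply: eq_bigr => a _; rewrite mxE.
  move/(canRL (mulmxK uV)); rewrite mul0mx => x0 a; apply: regval_inj; rewrite regval0.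
  by have := congr1 (fun x : 'rV_n => x 0 a) x0; rewrite !mxE.
move=> t; pose x := lval (hmap i U t) *m invmx V.
have [b [b0 hb]] := denominator U x; pose y j := projT1 (cid (hb j)).
have yE j : regval (y j) = regval b * x 0 j by rewrite /y; case: cid.
exists b, y; split => //; apply: (iso_inj hi); apply: lval_inj.
rewrite linear_sum linearZ lval_sum lvalZ.
have -> : lval (hmap i U t) = x *m V by rewrite /x mulmxKV.
rewrite mulmx_sum_row scaler_sumr; apply: eq_bigr => j _.
by rewrite [hmap i U _]linearZ hi.2 lvalZ hv yE scalerA.
Qed.

(** As for vector spaces, with lifts of a basis of the quotient; the relations
    hold up to denominators. *)
Lemma rank_exact (B M A : coh X) (i : coh_hom B M) (q : coh_hom M A) (U : aopen X) b a :
  short_exact i q -> rank_on U B b -> rank_on U A a -> rank_on U M (b + a).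
Proof.
move=> /(_ U) [inj surj ker] [s [si ss]] [t [ti ts]].
pose l j := projT1 (cid (surj (t j))).
have lE j : hmap q U (l j) = t j by rewrite /l; case: cid.
have qi x : hmap q U (hmap i U x) = 0 by apply/ker; exists x.
exists (fun z => match fintype.split z with inl j => hmap i U (s j) | inr j => l j end).
have sumE (c : 'I_(b + a) -> regfun U) :
  \sum_z c z *: (match fintype.split z with inl j => hmap i U (s j) | inr j => l j end)
   = hmap i U (\sum_j c (lshift a j) *: s j) + \sum_j c (rshift b j) *: l j.
  rewrite big_split_ord linear_sum /=; congr (_ + _); apply: eq_bigr => j _.
    by rewrite linearZ -[lshift a j]/(unsplit (inl j)) unsplitK.
  by rewrite -[rshift b j]/(unsplit (inr j)) unsplitK.
split=> [c|x].
  rewrite sumE => h0; have cr j : c (rshift b j) = 0.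
    apply: (ti (fun j => c (rshift b j))); have := congr1 (hmap q U) h0.
    rewrite linearD qi add0r linear_sum linear0 => h1; rewrite -[RHS]h1; apply: eq_bigr => z _.
    by rewrite linearZ lE.
  have cl j : c (lshift a j) = 0.
    apply: (si (fun j => c (lshift a j))); apply: inj;
      rewrite linear0 -[RHS]h0 [X in _ = _ + X]big1 ?addr0 //.
    by move=> z _; rewrite cr scale0r.
  by move=> z; rewrite -(splitK z); case: (fintype.split z) => j /=; [exact: cl|exact: cr].
have [e [c [e0 hc]]] := ts (hmap q U x).
have /ker [y hy] : hmap q U (e *: x - \sum_j c j *: l j) = 0.
  have e1 : hmap q U (e *: x) = \sum_j c j *: t j by rewrite linearZ.
  rewrite linearB e1 linear_sum; under [X in _ - X]eq_bigr do rewrite linearZ lE.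
  by rewrite subrr.
have [e' [c' [e0' hc']]] := ss y.
exists (e' * e), (fun z => match fintype.split z with inl j => c' j | inr j => e' * c j end).
split; first exact: regfun_mulf_neq0.
rewrite (sumE (fun z => match fintype.split z with inl j => c' j | inr j => e' * c j end)).
under [X in hmap i U X]eq_bigr do rewrite -[lshift a _]/(unsplit (inl _)) unsplitK.
under [X in _ + X]eq_bigr do rewrite -[rshift b _]/(unsplit (inr _)) unsplitK -scalerA.
by rewrite -hc' linearZ hy -scaler_sumr -scalerDr subrK scalerA.
Qed.

End Rank.

(** * The exact sequence of a mutation *)

Section Pow.
Variables (k : closedFieldType) (X : elliptic_curve k).
Context {ch : char0 k}.
Notation K := (ffield X).
Implicit Types (p q : point X) (f g : K) (c : k).

Section PowDef.
Variables (E : coh X) (e : nat).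

Definition pres (U V : aopen X) (h : V `<=` U) (s : {ffun 'I_e -> E U}) : {ffun 'I_e -> E V} :=
  [ffun a => res h (s a)].

Lemma pow_fg (U : aopen X) : exists (n : nat) (g : 'I_n -> {ffun 'I_e -> E U}),
    forall s : {ffun 'I_e -> E U}, exists c : 'I_n -> regfun U, s = \sum_(i < n) c i *: g i.
Proof.
have [n [g hg]] := @sec_fg k X E U.
exists #|{: 'I_e * 'I_n}|, (fun z => [ffun a => if a == (enum_val z).1 then g (enum_val z).2
  else 0]) => s.
pose c a := projT1 (cid (hg (s a))); exists (fun z => c (enum_val z).1 (enum_val z).2).
rewrite (reindex (@enum_rank _)) /=; last exact/onW_bij/enum_rank_bij.
under eq_bigr do rewrite enum_rankK.
rewrite -(pair_bigA _ (fun i j => c i j *: [ffun a => if a == i then g j else 0 : E U])) /=.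
apply/ffunP => a; rewrite sum_ffunE (bigD1 a) //= sum_ffunE [X in _ + X]big1 ?addr0.
  have -> : s a = \sum_j c a j *: g j by rewrite /c; case: cid.
  by apply: eq_bigr => j _; rewrite !ffunE eqxx.
move=> i /negbTE ia; rewrite sum_ffunE big1 // => j _.
by rewrite !ffunE eq_sym ia scaler0.
Qed.

(** The direct sum of e copies of E, that is the tensor product of E with a space
    of homomorphisms of dimension e. *)
Definition pow : coh X.
Proof.
refine (@Coh k X (fun U => {ffun 'I_e -> E U} : lmodType (regfun U)) pres _ _ _ pow_fg _ _).
- move=> U V sVU a s t; apply/ffunP => x; rewrite !ffunE; exact: res_linear.
- by move=> U sUU s; apply/ffunP => x; rewrite !ffunE res_id.
- by move=> U V W h1 h2 h3 s; apply/ffunP => x; rewrite !ffunE; exact: res_comp.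
- move=> U V h f dV s hs.
  have H a : exists n, f ^+ n *: s a = 0.
    apply: (sec_loc_ker dV (sVU := h)).
    by have := congr1 (fun s : {ffun 'I_e -> E V} => s a) hs; rewrite !ffunE.
  pose n a := projT1 (cid (H a)); exists (\sum_a n a)%N; apply/ffunP => a; rewrite !ffunE.
  have hn : f ^+ n a *: s a = 0 by rewrite /n; case: cid.
  by rewrite (bigD1 a) //= addnC exprD -scalerA hn scaler0.
move=> U V h f dV t.
have H a : exists ns : nat * E U, regres h f ^+ ns.1 *: t a = res h ns.2.
  by have [n [s hs]] := sec_loc_im h dV (t a); exists (n, s).
pose w a := projT1 (cid (H a)); have hw a : regres h f ^+ (w a).1 *: t a = res h (w a).2.
  by rewrite /w; case: cid.
pose N := (\sum_a (w a).1)%N; exists N, [ffun a => f ^+ (N - (w a).1) *: (w a).2].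
apply/ffunP => a; rewrite !ffunE resZ -hw scalerA.
have le : ((w a).1 <= N)%N by rewrite /N (bigD1 a) //= leq_addr.
rewrite (_ : regres h (f ^+ _) = regres h f ^+ (N - (w a).1)) -?exprD ?subnK //.
by apply: regval_inj; rewrite regvalX /= regvalX.
Defined.

End PowDef.

Lemma pow_succ (E : coh X) e : exists (i : coh_hom (pow E e) (pow E e.+1)) (q :
  coh_hom (pow E e.+1) E),
  short_exact i q.
Proof.
pose fi U (s : pow E e U) : pow E e.+1 U := [ffun a => if unlift ord0 a is Some b then (s :
  {ffun _ -> _}) b else 0].
pose fq U (s : pow E e.+1 U) : E U := (s : {ffun _ -> _}) ord0.
have li U : linear (fi U).
  move=> a s t; apply/ffunP => x; rewrite !ffunE; case: unliftP => [b _|_]; first by rewrite !ffunE.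
  by rewrite scaler0 addr0.
have lq U : linear (fq U) by move=> a s t; rewrite /fq !ffunE.
have ri (U V : aopen X) (h : V `<=` U) (s : pow E e U) :
  mklin (li V) (res h s) = res h (mklin (li U) s).
  apply/ffunP => x; rewrite !mklinE !ffunE; case: unliftP => [b _|_]; first by rewrite !ffunE.
  by rewrite res0.
have rq (U V : aopen X) (h : V `<=` U) (s : pow E e.+1 U) :
  mklin (lq V) (res h s) = res h (mklin (lq U) s).
  by rewrite !mklinE /fq !ffunE.
exists (CohHom ri), (CohHom rq) => U; split.
- move=> s t /= /ffunP est; apply/ffunP => x; have := est (lift ord0 x).
  by rewrite !ffunE liftK.
- move=> t; exists ([ffun=> t] : {ffun 'I_e.+1 -> E U}); by rewrite /= /fq ffunE.
move=> s; rewrite /= /fq; split=> [s0|[b <-]]; last by rewrite ffunE unlift_none.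
exists ([ffun a => (s : {ffun _ -> _}) (lift ord0 a)] : {ffun 'I_e -> E U}).
by apply/ffunP => x; rewrite ffunE; case: unliftP => [b ->|->]; rewrite ?ffunE // s0.
Qed.

Lemma pow0_zero (E : coh X) U (s t : pow E 0 U) : s = t.
Proof. by apply/ffunP; case. Qed.

Lemma rank_pow (E : coh X) (U : aopen X) r e : rank_on U E r -> rank_on U (pow E e) (e * r).
Proof.
move=> hr; elim: e => [|e IH].
  exists (fun _ => 0); split=> [c _|t]; first by case.
  exists 1, (fun _ => 0); split; first by rewrite oner_eq0.
  exact: pow0_zero.
by have [i [q ex]] := pow_succ E e; rewrite mulSn addnC; exact: rank_exact ex IH hr.
Qed.

Lemma dg_pow (dg : coh X -> int) (E : coh X) e : is_degree dg -> dg (pow E e) = e%:Z * dg E.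
Proof.
move=> [_ _ add]; elim: e => [|e IH].
  have [z hz] := zero_hom (pow E 0) (pow E 0).
  have ex : short_exact z z.
    move=> U; split=> [s t _|s|m]; first exact: pow0_zero.
      by exists 0; exact: pow0_zero.
    by split=> _; [exists 0|]; exact: pow0_zero.
  by have := add _ _ _ _ _ ex; lia.
by have [i [q ex]] := pow_succ E e; rewrite (add _ _ _ _ _ ex) IH; lia.
Qed.

(** The basis f' for which the evaluation is surjective need not be the basis f
    whose evaluation has kernel G; expressing f' in terms of f shows that the
    evaluation of f is surjective as well. *)
Lemma mutation_exact (E F G : coh X) n (f : 'I_n -> coh_hom E F) n' (f' : 'I_n' -> coh_hom E F)
    (j : forall U : aopen X, {linear G U -> {ffun 'I_n -> E U}}) : hom_basis f ->
      ev_surjective f' ->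
   (forall (U V : aopen X) (sVU : V `<=` U) (g : G U) (i : 'I_n),
     j V (res sVU g) i = res sVU (j U g i)) ->
   (forall U : aopen X, injective (j U)) ->
   (forall (U : aopen X) (s : {ffun 'I_n -> E U}), ev_map f s = 0 <-> exists g : G U, j U g = s) ->
  exists (i : coh_hom G (pow E n)) (q : coh_hom (pow E n) F), short_exact i q.
Proof.
move=> bf sf rj ij kj.
have rj' (U V : aopen X) (h : V `<=` U) (g : G U) : (j V : {linear G V ->
  pow E n V}) (res h g) = res h (j U g : pow E n U).
  by apply/ffunP => x; rewrite ffunE; exact: rj.
have le U : linear (fun s : pow E n U => ev_map f s).
  move=> a s t; rewrite /ev_map scaler_sumr -big_split; apply: eq_bigr => i _.
  by rewrite !ffunE linearP.
have re (U V : aopen X) (h : V `<=` U) (s : pow E n U) :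
  mklin (le V) (res h s) = res h (mklin (le U) s).
  rewrite !mklinE /ev_map res_sum; apply: eq_bigr => i _.
  by rewrite ffunE hmap_res.
exists (@CohHom k X G (pow E n) (fun U => j U) rj'), (CohHom re) => U; split; first exact: ij.
  move=> t; have [s hs] := sf U t.
  have H b : exists c : 'rV[k]_n, forall s,
    hmap (f' b) U s = \sum_(i < n) regconst U (c 0 i) *: hmap (f i) U s.
    by have [c [hc _]] := bf (f' b); exists c => u; exact: hc.
  pose c b := projT1 (cid (H b)).
  have hc b u : hmap (f' b) U u = \sum_(i < n) regconst U (c b 0 i) *: hmap (f i) U u
    by rewrite /c; case: cid.
  exists [ffun i => \sum_b regconst U (c b 0 i) *: s b] => /=.
  rewrite -hs /ev_map; under [RHS]eq_bigr do rewrite hc.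
  rewrite exchange_big; apply: eq_bigr => i _; rewrite ffunE linear_sum.
  by apply: eq_bigr => b _; rewrite linearZ.
move=> s; exact: kj.
Qed.

End Pow.

(** * Twisting by multiples of the point at infinity *)

Section Twist.
Variables (k : closedFieldType) (X : elliptic_curve k).
Context {ch : char0 k}.
Notation K := (ffield X).
Notation cst := (fconst X).
Implicit Types (p q : point X) (f g : K) (c : k).

Definition twist_at (l : int) p : K := if p == Infinity then unif p ^ l else 1.

Lemma twist_neq0 l p : twist_at l p != 0.
Proof. by rewrite /twist_at; case: (p =P _) => _; rewrite ?oner_neq0 // expfz_neq0 // unif_neq0.
  Qed.

Lemma twist_subproof n (D : mdiv X n) l : (forall p, twist_at l p *: D p \in unitmx) /\
  finite_set [set p | twist_at l p *: D p <> 1%:M].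
Proof.
split=> [p|]; first by rewrite unitmxZ ?mdiv_unit // unitfE twist_neq0.
apply: (@sub_finite_set _ _ ([set Infinity] `|` [set q | D q <> 1%:M])).
  move=> p /=; rewrite /twist_at; case: eqP => [->|_]; first by left.
  by rewrite scale1r; right.
rewrite finite_setU; split; [exact: finite_set1|exact: mdiv_fin].
Qed.

Definition twist n (D : mdiv X n) l :
  mdiv X n := Mdiv (twist_subproof D l).1 (twist_subproof D l).2.

Lemma twist_lat n (D : mdiv X n) l p m (v : 'M[K]_(m, n)) :
  lat p (twist D l p) v <-> lat p (D p) (twist_at l p *: v).
Proof. by rewrite /lat /= -scalemxAr -scalemxAl. Qed.

(** The line bundle O(l * infinity). *)
Definition twisting l : mdiv X 1 := twist (mone X 1) l.

Lemma twisting_lat l p (v : 'rV[K]_1) : lat p (twisting l p) v <-> ordge p 0 (twist_at l p * v 0 0).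
Proof.
rewrite twist_lat /lat mone_eq mulmx1; split=> [/(_ 0 0)|h a b]; first by rewrite mxE.
by rewrite !ord1 mxE.
Qed.

Lemma twist_inv l p : twist_at l p * twist_at (- l) p = 1.
Proof.
rewrite /twist_at; case: eqP => _; last exact: mulr1.
by rewrite -invr_expz divff // expfz_neq0 // unif_neq0.
Qed.

(** At infinity the determinant changes by the factor unif ^ (l * n). *)
Lemma dg_twist (dg : coh X -> int) n (D : mdiv X n) l : is_degree dg ->
  dg (LL (twist D l)) = dg (LL D) + l * n%:Z.
Proof.
move=> dgP; have tE : twist_at l Infinity = unif (@Infinity k X) ^ l by rewrite /twist_at eqxx.
have away q : q <> Infinity -> latsame q (D q) (twist D l q).
  by move=> /eqP/negbTE h v; rewrite twist_lat /twist_at h scale1r.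
have vt : val Infinity (\det (twist D l Infinity)) = val Infinity (\det (D Infinity)) + l * n%:Z.
  have dD : \det (D Infinity) != 0 by rewrite -unitfE -unitmxE mdiv_unit.
  have tl0 : twist_at l (@Infinity k X) != 0 by exact: twist_neq0.
  rewrite /= detZ valM ?expf_neq0 // valX // tE valXz ?unif_neq0 // val_unif.
  by rewrite addrC mul1r -mulr_natr natz.
have [l0|l0] := leP 0 l.
  have [||a [ga va]] := @gups_point k X ch n Infinity D (twist D l); first exact: away.
    move=> v hv; apply/twist_lat; apply: latZ => //; rewrite tE.
    by rewrite ordgeE ?expfz_neq0 ?unif_neq0 // valXz ?unif_neq0 // val_unif mul1r.
  by rewrite (dg_gups dgP ga); move: va; rewrite vt; lia.
have [||a [ga va]] := @gups_point k X ch n Infinity (twist D l) D.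
- by move=> q /away h v; rewrite h.
- move=> v /twist_lat hv.
  have -> : v = twist_at (- l) Infinity *: (twist_at l Infinity *: v).
    by rewrite scalerA mulrC twist_inv scale1r.
  apply: latZ => //; rewrite /twist_at eqxx.
  rewrite ordgeE ?expfz_neq0 ?unif_neq0 // valXz ?unif_neq0 // val_unif mul1r; lia.
have e : dg (LL D) = dg (LL (twist D l)) + a%:Z by exact: dg_gups ga.
by rewrite e; move: va; rewrite vt; lia.
Qed.

(** A generator near infinity is a power of the uniformizer, on an open set
    without its other zeros. *)
Lemma line_bundle_twisting l : line_bundle (LL (twisting l)).
Proof.
move=> p; have [U [Up [x [x0 hx]]]] : exists U : aopen X, aset U p /\ exists x : K, x != 0 /\
    forall q, aset U q -> val q (twist_at l q * x) = 0.
  have [->|/eqP np] := eqVneq p Infinity; last first.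
    exists (off Infinity); split => //; exists 1; split=> [|q Uq]; first exact: oner_neq0.
    by rewrite /twist_at ifN ?mulr1 ?val1 //; apply/eqP.
  have t0 : unif (@Infinity k X) != 0 by exact: unif_neq0.
  have [S hS] := finite_list_zeros t0.
  have [q hq] : exists q : point X, Infinity <> q.
    by have [U Up] := open_ex (@Infinity k X); have [q hq] := open_miss U; exists q; exact: hq.
  exists (openD (off q) [seq p <- S | p != Infinity]); split.
    by split; [exact: hq|rewrite /= mem_filter eqxx].
  exists (unif (@Infinity k X) ^ (- l)); split; first by rewrite expfz_neq0.
  move=> q' [_ /= hq']; have [e|ne] := eqVneq q' Infinity.
    by have := twist_inv l Infinity; rewrite e {2}/twist_at eqxx => ->; rewrite val1.
  rewrite /twist_at (negbTE ne) mul1r valXz // hS ?mul0r //.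
  by apply/negP => h; apply: hq'; rewrite mem_filter ne.
have tx0 q : twist_at l q * x != 0 by rewrite mulf_neq0 ?twist_neq0.
have [e he] : exists e : lsec (twisting l) U, lval e = x%:M.
  by apply: lsec_ex => q Uq; apply/twisting_lat; rewrite mxE eqxx mulr1n ordgeE // hx.
exists U, e; split => // s.
have [a ha] : exists a : regfun U, regval a = lval s 0 0 / x.
  apply: regfun_ex => q Uq; have /twisting_lat h := lsec_lat s Uq.
  have -> : lval s 0 0 / x = (twist_at l q * lval s 0 0) * (twist_at l q * x)^-1.
    by rewrite -mulf_div divff ?twist_neq0 // mul1r.
  apply: (ordgeMe (m := 0) (n := 0)) => //.
  by rewrite ordgeE ?invr_eq0 // valV // hx.
exists a; split=> [|a' ea].
  apply: lval_inj; rewrite lvalZ he ha; apply/rowP => z; rewrite !ord1 !mxE eqxx mulr1n.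
  by rewrite divfK.
apply: regval_inj; rewrite ha ea lvalZ he !mxE eqxx mulr1n.
by rewrite mulfK.
Qed.

(** A section over U which generates the line bundle at p. *)
Lemma frame_at l (U : aopen X) p : aset U p -> exists a : LL (twisting l) U,
  lval a 0 0 != 0 /\ ordge p 0 (twist_at l p * lval a 0 0)^-1.
Proof.
move=> Up; have [V [v [uV hv hT]]] := frame_sec (twisting l) U [:: p].
have e : lval (v ord0) 0 0 = V 0 0 by rewrite hv mxE.
have V0 : V 0 0 != 0 by rewrite -det_mx11 -unitfE -unitmxE.
exists (v ord0); rewrite e; split => //.
have := hT p _ Up; rewrite mem_seq1 eqxx => /(_ isT).
rewrite (_ : twisting l p = (twist_at l p)%:M) ?mul_mx_scalar; last first.
  by rewrite -[LHS]/(twist_at l p *: mone X 1 p) mone_eq scalemx1.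
rewrite {1}[V]mx11_scalar scale_scalar_mx invmx_scalar.
by move=> /(_ 0 0); rewrite mxE eqxx mulr1n.
Qed.

Definition pairing_ideal l (U : aopen X) (f : regfun U) :=
  exists n (a : 'I_n -> LL (twisting l) U) (m : 'I_n -> LL (twisting (- l)) U),
    \sum_i lval (m i) 0 0 * lval (a i) 0 0 = regval f.

(** The products of sections of O(l * infinity) and of its inverse generate the
    unit ideal, since at each point there are local generators among the
    sections over U. *)
Lemma partition_of_unity l (U : aopen X) : exists n (a : 'I_n -> LL (twisting l) U) (m : 'I_n ->
  LL (twisting (- l)) U),
  \sum_i lval (m i) 0 0 * lval (a i) 0 0 = 1.
Proof.
have : @pairing_ideal l U 1; last by rewrite /pairing_ideal regval1.
apply: nullstellensatz.
- move=> f g [n [a [m hf]]] [n' [a' [m' hg]]].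
  exists (n + n')%N, (fun z => match fintype.split z with inl j => a j | inr j => a' j end),
    (fun z => match fintype.split z with inl j => m j | inr j => m' j end).
  rewrite big_split_ord regvalD -hf -hg /=; congr (_ + _); apply: eq_bigr => j _.
    by rewrite -[lshift _ j]/(unsplit (inl j)) unsplitK.
  by rewrite -[rshift _ j]/(unsplit (inr j)) unsplitK.
- move=> f g [n [a [m hg]]]; exists n, a, (fun i => f *: m i).
  rewrite regvalM -hg mulr_sumr; apply: eq_bigr => i _.
  by rewrite lvalZ mxE mulrA.
move=> p Up; have [a [a0 ha]] := frame_at l Up; have [m [m0 hm]] := frame_at (- l) Up.
have prod q : (twist_at (- l) q * lval m 0 0) * (twist_at l q * lval a 0 0) = lval m 0 0 * lval
  a 0 0.
  by rewrite mulrACA [_ * twist_at l q]mulrC twist_inv mul1r.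
have [f hf] : exists f : regfun U, regval f = lval m 0 0 * lval a 0 0.
  apply: regfun_ex => q Uq; rewrite -(prod q); apply: (ordgeMe (m := 0) (n := 0)) => //.
    by apply/twisting_lat; exact: lsec_lat.
  by apply/twisting_lat; exact: lsec_lat.
have f0 : regval f != 0 by rewrite hf mulf_neq0.
have vf : val p (regval f) = 0.
  apply/eqP; rewrite eq_le -ordgeE // (regfun_ord f Up) andbT.
  have : ordge p 0 (regval f)^-1.
    by rewrite hf -(prod p) invfM; apply: (ordgeMe (m := 0) (n := 0)).
  by rewrite ordgeE ?invr_eq0 // valV // oppr_ge0.
have hr : rv p (regval f) (rval p (regval f)) by exact: rvalP.
exists f, (rval p (regval f)); split => //.
  by exists 1%N, (fun _ => a), (fun _ => m); rewrite big_ord1 hf.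
apply/negP => /eqP r0; have : ordge p 1 (regval f) by apply/ordge1P; rewrite -r0.
by rewrite ordgeE // vf.
Qed.

Section Tensor.
Variables (E : coh X) (n : nat) (D : mdiv X n) (i : coh_hom E (LL D)) (i' :
  coh_hom (LL D) E) (l : int).
Hypothesis hi : iso_LL i i'.

Lemma tensor_lat (U : aopen X) (a : LL (twisting l) U) (s : E U) :
  lval a 0 0 *: lval (hmap i U s) \in lat_on (twist D l) U.
Proof.
apply/lat_onP => p Up; apply/twist_lat; rewrite scalerA; apply: latZ; last exact: lsec_lat.
by apply/twisting_lat; exact: lsec_lat.
Qed.

Definition tensor_map (U : aopen X) (a : LL (twisting l) U) (s : E U) : LL (twist D l) U :=
  LSec (tensor_lat a s).

Lemma contract_lat (U : aopen X) (m : LL (twisting (- l)) U) (t : LL (twist D l) U) :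
  lval m 0 0 *: lval t \in lat_on D U.
Proof.
apply/lat_onP => p Up; have /twist_lat h := lsec_lat t Up; have /twisting_lat h' := lsec_lat m Up.
have -> : lval m 0 0 *: lval t = (twist_at (- l) p * lval m 0 0) *: (twist_at l p *: lval t).
  by rewrite scalerA mulrAC [_ * twist_at l p]mulrC twist_inv mul1r.
exact: latZ.
Qed.

Definition contract (U : aopen X) (m : LL (twisting (- l)) U) (t : LL (twist D l) U) : E U :=
  hmap i' U (LSec (contract_lat m t) : LL D U).

(** Write 1 as a sum of products m i * a i with sections a i of the line bundle and
    m i of its inverse. Then t is the sum of the tensors of a i with m i t, which
    determines the map induced by c and shows that it exists. *)
Theorem tensor_twist : is_tensor (LL (twisting l)) E (LL (twist D l)).
Proof.
exists tensor_map; split.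
- move=> U; split=> [s a x y|x a s t]; apply: lval_inj => /=.
    by rewrite !mxE scalerDl scalerA.
  by rewrite linearP lvalD lvalZ scalerDr !scalerA mulrC.
- by move=> U V h a s; apply: lval_inj; rewrite /= hmap_res.
move=> U N c [cl cr].
have [r [a [m am]]] := partition_of_unity l U.
have cD x y s : c (x + y) s = c x s + c y s by have := cl s 1 x y; rewrite !scale1r.
have c0 s : c 0 s = 0 by apply: (addrI (c 0 s)); rewrite -cD !addr0.
have cZ e x s : c (e *: x) s = e *: c x s by have := cl s e x 0; rewrite c0 !addr0.
have crD x s t : c x (s + t) = c x s + c x t by have := cr x 1 s t; rewrite !scale1r.
have cr0 x : c x 0 = 0 by apply: (addrI (c x 0)); rewrite -crD !addr0.
have crZ e x s : c x (e *: s) = e *: c x s by have := cr x e s 0; rewrite cr0 !addr0.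
have csum s (J : finType) (G : J -> LL (twisting l) U) : c (\sum_j G j) s = \sum_j c (G j) s.
  by elim/big_rec2: _ => // j y1 y2 _ <-.
pose phi t := \sum_j c (a j) (contract (m j) t).
exists phi; split.
  split=> [e x y|x s].
    rewrite /phi scaler_sumr -big_split; apply: eq_bigr => j _ /=.
    rewrite -crZ -crD; congr c; rewrite -linearP; congr (hmap _ _ _); apply: lval_inj => /=.
    by rewrite scalerDr !scalerA mulrC.
  have H j : exists f : regfun U, regval f = lval (m j) 0 0 * lval x 0 0.
    apply: regfun_ex => q Uq.
    have -> : lval (m j) 0 0 * lval x 0 0 = (twist_at (- l) q * lval (m j) 0 0) * (twist_at l q
      * lval x 0 0).
      by rewrite mulrACA [_ * twist_at l q]mulrC twist_inv mul1r.
    by apply: (ordgeMe (m := 0) (n := 0)) => //; apply/twisting_lat; exact: lsec_lat.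
  pose w j := projT1 (cid (H j)).
  have hw j : regval (w j) = lval (m j) 0 0 * lval x 0 0 by rewrite /w; case: cid.
  have xE : x = \sum_j w j *: a j.
    apply: lval_inj; rewrite lval_sum; apply/rowP => z; rewrite !ord1 summxE.
    under eq_bigr do rewrite lvalZ mxE hw mulrAC.
    by rewrite -mulr_suml am mul1r.
  rewrite /phi [in RHS]xE csum; apply: eq_bigr => j _; rewrite cZ -crZ; congr c.
  rewrite -[s in RHS](hi.1 U) -linearZ; congr (hmap _ _ _); apply: lval_inj => /=.
  by rewrite ?lvalZ scalerA hw.
move=> psi [lpsi hpsi]; apply/funext => t.
have pD x y : psi (x + y) = psi x + psi y by have := lpsi 1 x y; rewrite !scale1r.
have p0 : psi 0 = 0 by apply: (addrI (psi 0)); rewrite -pD !addr0.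
have tE : t = \sum_j tensor_map (a j) (contract (m j) t).
  apply: lval_inj; rewrite lval_sum.
  have e j : lval (tensor_map (a j) (contract (m j) t)) = (lval (m j) 0 0 * lval (a j) 0 0) *:
    lval t.
    by rewrite /= /contract hi.2 /= scalerA mulrC.
  by under eq_bigr do rewrite e; rewrite -scaler_suml am scale1r.
rewrite [in RHS]tE /phi; under eq_bigr do rewrite -hpsi.
by elim/big_rec2: _ => // j y1 y2 _ ->; rewrite pD.
Qed.

End Tensor.
End Twist.

(** * The equation d x y - x ^ 2 - y ^ 2 = d - 2 *)

Section Recurrence.
Variable d : nat.

Lemma int_two_sided (P : int -> Prop) : P 0 -> (forall i, P i -> P (i + 1)) -> (forall i, P i ->
  P (i - 1)) ->
  forall i, P i.
Proof.
move=> P0 Pu Pd; elim/int_ind => // n IH; first by rewrite -addn1 PoszD; exact: Pu.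
by rewrite -addn1 PoszD opprD; exact: Pd.
Qed.

Definition recurrent (r : int -> int) := forall i, r (i - 2) = d%:Z * r (i - 1) - r i.

Lemma recurrent_eq (r s : int -> int) j : recurrent r -> recurrent s ->
  r j = s j -> r (j + 1) = s (j + 1) -> forall i, r i = s i.
Proof.
move=> hr hs e0 e1 i.
suff : forall n, r (j + n) = s (j + n) /\ r (j + n + 1) = s (j + n + 1).
  by move=> /(_ (i - j)) [+ _]; rewrite addrC subrK.
apply: int_two_sided => [|n [ha hb]|n [ha hb]]; first by rewrite addr0.
  have := hr (j + n + 2); have := hs (j + n + 2).
  rewrite (_ : j + n + 2 - 2 = j + n); last by ring.
  rewrite (_ : j + n + 2 - 1 = j + n + 1); last by ring.
  rewrite (_ : j + (n + 1) = j + n + 1); last by ring.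
  rewrite (_ : j + n + 1 + 1 = j + n + 2); last by ring.
  by rewrite ha hb; lia.
have := hr (j + n + 1); have := hs (j + n + 1).
rewrite (_ : j + n + 1 - 2 = j + (n - 1)); last by ring.
rewrite (_ : j + n + 1 - 1 = j + n); last by ring.
rewrite (_ : j + (n - 1) + 1 = j + n); last by ring.
by rewrite ha hb; lia.
Qed.

Lemma recurrent_shift (r : int -> int) m : recurrent r -> recurrent (fun i => r (i + m)).
Proof. by move=> hr i; have := hr (i + m); rewrite !(addrAC i m). Qed.

End Recurrence.

Section Orbit.
Variable d : nat.
Hypothesis d2 : (2 < d)%N.
Let M : 'M[int]_2 := mx2 0 1 (-1) d%:Z.

Lemma mx2_col2 (a b c e x y : int) : mx2 a b c e *m col2 x y = col2 (a * x + b * y) (c * x + e * y).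
Proof.
apply/matrixP => i j; rewrite ord1 !mxE !big_ord_recl big_ord0 !mxE /= addr0.
by case: i => [[|[|]]].
Qed.

Lemma mxM_col2 (x y : int) : M *m col2 x y = col2 y (d%:Z * y - x).
Proof. by rewrite mx2_col2; congr col2; ring. Qed.

Lemma mxM_unit : M \is a GRing.unit.
Proof.
apply/unitrP; exists (mx2 d%:Z (-1) 1 0).
by split; apply/matrixP => i j; rewrite !mxE !big_ord_recl big_ord0 !mxE /=;
  case: i => [[|[|]]] // ?; case: j => [[|[|]]] // ? /=; ring.
Qed.

Lemma mxM_colV (x y : int) : M ^ (-1) *m col2 y (d%:Z * y - x) = col2 x y.
Proof. by rewrite -mxM_col2 mulmxA mulmxE -[M in _ * M]expr1z -exprzDr ?mxM_unit // expr0z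
  mul1mx. Qed.

Lemma orbit_step (n : int) (v : 'cV[int]_2) : M ^ (n + 1) *m v = M *m (M ^ n *m v).
Proof. by rewrite mulmxA mulmxE -[M in M * _]expr1z -exprzDr ?mxM_unit // addrC. Qed.

Lemma orbit_stepV (n : int) (v : 'cV[int]_2) : M ^ (n - 1) *m v = M ^ (-1) *m (M ^ n *m v).
Proof. by rewrite mulmxA mulmxE -exprzDr ?mxM_unit // addrC. Qed.

Definition norm_form (x y : int) := d%:Z * x * y - x ^+ 2 - y ^+ 2.

(** Vieta jumping: y and d x - y are the roots of T ^ 2 - d x T + x ^ 2 + d - 2, a
    polynomial which is not positive at T = x; so x lies between the roots. *)
Lemma descent (x y : int) : 0 < x -> x < y -> norm_form x y = d%:Z - 2 ->
  [/\ 0 < d%:Z * x - y, d%:Z * x - y <= x & norm_form (d%:Z * x - y) x = d%:Z - 2].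
Proof.
rewrite /norm_form => x0 xy hQ; set z := d%:Z * x - y.
have yz : y * z = x ^+ 2 + (d%:Z - 2) by rewrite -hQ /z; ring.
have z0 : 0 < z.
  have : 0 < y * z by rewrite yz addr_gt0 ?exprn_gt0 //; lia.
  by rewrite pmulr_rgt0 //; lia.
split=> //; last by rewrite -hQ /z; ring.
have : (z - x) * (y - x) = (d%:Z - 2) * (1 - x ^+ 2).
  have -> : (z - x) * (y - x) = y * z - x * (y + z) + x ^+ 2 by ring.
  by rewrite yz /z; ring.
move=> e; rewrite leNgt; apply/negP => xz.
have : 0 < (z - x) * (y - x) by rewrite mulr_gt0 // subr_gt0.
rewrite e ltNge => /negP; apply.
by rewrite mulr_ge0_le0 ?subr_le0 ?exprn_ege1 //; lia.
Qed.

(** The matrix maps (x, y) to (y, d y - x). Descending on the larger entry, by the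
    matrix or its inverse, ends in a pair with equal entries, which is (1, 1). *)
Lemma orbit (x y : int) : 0 < x -> 0 < y -> norm_form x y = d%:Z - 2 ->
  exists n : int, col2 x y = M ^ n *m col2 1 1.
Proof.
have [N hN] : exists N : nat, x + y <= N%:Z by exists (absz (x + y)); lia.
elim: N x y hN => [|N IH] x y hN x0 y0 hQ; first by lia.
have sym a b : norm_form a b = norm_form b a by rewrite /norm_form; ring.
have [xy|yx|exy] := ltgtP x y.
- have [z0 zx hz] := descent x0 xy hQ.
  have [|n hn] := IH (d%:Z * x - y) x _ z0 x0 hz; first by lia.
  by exists (n + 1); rewrite orbit_step -hn mxM_col2; congr col2; ring.
- rewrite sym in hQ; have [z0 zx hz] := descent y0 yx hQ; rewrite sym in hz.
  have [|n hn] := IH y (d%:Z * y - x) _ y0 z0 hz; first by lia.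
  by exists (n - 1); rewrite orbit_stepV -hn mxM_colV.
exists 0; rewrite expr0z mul1mx exy.
suff -> : y = 1 by [].
have /eqP : (d%:Z - 2) * ((y - 1) * (y + 1)) = 0.
  rewrite (_ : _ * _ = norm_form y y - (d%:Z - 2)); last by rewrite /norm_form; ring.
  by rewrite -{1}exy hQ subrr.
by rewrite !mulf_eq0 => /orP[|/orP[]] /eqP; lia.
Qed.

(** Consecutive pairs of the sequence are moved by the same matrix. *)
Lemma recurrent_unit (r : int -> int) : recurrent d r -> (forall i, 0 < r i) ->
  norm_form (r (-1)) (r 0) = d%:Z - 2 -> exists j, r j = 1 /\ r (j + 1) = 1.
Proof.
move=> hr r0 hQ; have [n hn] := orbit (r0 _) (r0 _) hQ.
have H : forall j, col2 (r (j - 1)) (r j) = M ^ (j + n) *m col2 1 1.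
  apply: int_two_sided => [|j IH|j IH]; first by rewrite !add0r.
    rewrite (_ : j + 1 + n = j + n + 1); last by ring.
    rewrite orbit_step -IH mxM_col2; congr col2; first by congr r; ring.
    have := hr (j + 1); rewrite (_ : j + 1 - 2 = j - 1); last by ring.
    by rewrite addrK => ->; ring.
  rewrite (_ : j - 1 + n = j + n - 1); last by ring.
  have e : r j = d%:Z * r (j - 1) - r (j - 2) by rewrite hr; ring.
  rewrite orbit_stepV -IH e mxM_colV.
  by rewrite (_ : j - 1 - 1 = j - 2); last by ring.
exists (- n - 1); have := H (- n); rewrite addNr expr0z mul1mx subrK.
by move/matrixP => h; have := h 0 0; have := h 1 0; rewrite !mxE.
Qed.

End Orbit.

(** * The limit slope *)

Import numFieldNormedType.Exports.

(** Solutions of u (n + 2) = D u (n + 1) - u n, where lam > 1 > mu > 0 are the roots of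
    T ^ 2 - D T + 1. *)
Section DominantSolution.
Variables (R : realType) (lam mu D : R).
Hypotheses (lm : lam * mu = 1) (lD : lam + mu = D) (gap : 1 <= lam - mu) (mu0 : 0 < mu).

Let lam0 : 0 < lam.
Proof. by apply: (lt_le_trans mu0); rewrite -subr_ge0; apply: le_trans gap; exact: ler01. Qed.

Definition recurrentR (u : nat -> R) := forall n, u n.+2 = D * u n.+1 - u n.

Lemma recurrentR_diff u : recurrentR u -> forall n,
  u n.+1 - mu * u n = lam ^+ n * (u 1%N - mu * u 0%N).
Proof.
move=> hu; elim=> [|n IH]; first by rewrite expr0 mul1r.
rewrite exprS -mulrA -IH hu -lD mulrBr mulrA lm mul1r; ring.
Qed.

Lemma recurrentR_bound u : recurrentR u -> 0 <= u 0%N -> exists2 C, 0 < C & forall n,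
  u n <= C * lam ^+ n.
Proof.
move=> hu u0; pose Y := u 1%N - mu * u 0%N; pose C := u 0%N + `|Y| + 1.
have Y0 : 0 <= `|Y| by exact: normr_ge0.
have C0 : 0 < C by rewrite /C; lra.
exists C => //; elim=> [|n IH]; first by rewrite expr0 mulr1 /C; lra.
have := recurrentR_diff hu n; rewrite -/Y => e.
have -> : u n.+1 = mu * u n + lam ^+ n * Y by rewrite -e; ring.
have l0 : 0 < lam ^+ n by exact: exprn_gt0.
have h1 : mu * u n <= mu * (C * lam ^+ n) by rewrite ler_pM2l.
have h2 : lam ^+ n * Y <= lam ^+ n * ((lam - mu) * C).
  rewrite ler_pM2l //; apply: (le_trans (ler_norm _)).
  apply: (@le_trans _ _ C); first by rewrite /C; lra.
  by rewrite ler_peMl // ltW.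
apply: (le_trans (lerD h1 h2)); rewrite exprS le_eqVlt; apply/orP; left; apply/eqP; ring.
Qed.

(** The sequence e - th * r is a solution and is o(r), hence o(lam ^ n), since r is
    O(lam ^ n). So its component along lam ^ n, which is measured by the
    difference in the statement, is zero. *)
Lemma dominant_vanish (r e : nat -> R) (th : R) : recurrentR r -> recurrentR e -> (forall n,
  0 < r n) ->
  (fun n => e n / r n) @ \oo --> th -> e 1%N - th * r 1%N = mu * (e 0%N - th * r 0%N).
Proof.
move=> hr he r0 cv; pose z n := e n - th * r n.
have hz : recurrentR z by move=> n; rewrite /z hr he; ring.
have [C C0 hC] := recurrentR_bound hr (ltW (r0 0%N)).
pose Z := z 1%N - mu * z 0%N.
suff Z0 : Z = 0 by move/eqP: Z0; rewrite /Z subr_eq0 => /eqP.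
apply/eqP/negPn/negP => nZ.
have aZ : 0 < `|Z| by rewrite normr_gt0.
have D0 : 0 < D by rewrite -lD addr_gt0.
(* with this bound the estimate at the end reads |Z| <= |Z| / 2 *)
pose ep := `|Z| / (2 * (C * D)).
have CD0 : 0 < C * D by exact: mulr_gt0.
have ep0 : 0 < ep by rewrite divr_gt0 // mulr_gt0.
have [N _ hN] := (cvgrPdist_lt _ _).1 cv ep ep0.
have small n : (N <= n)%N -> `|z n| <= ep * (C * lam ^+ n).
  move=> Nn; have := hN n Nn => /= h.
  have -> : z n = - ((th - e n / r n) * r n).
    by rewrite /z mulrBl divfK ?gt_eqF // opprB.
  by rewrite normrN normrM (gtr0_norm (r0 n)) ler_pM ?hC ?(ltW h) ?(ltW (r0 n)).
have := recurrentR_diff hz N; rewrite -/Z => eZ.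
have l0 : 0 < lam ^+ N by exact: exprn_gt0.
have : `|Z| * lam ^+ N <= `|Z| / 2 * lam ^+ N.
  rewrite -[X in _ * X <= _](gtr0_norm l0) -normrM mulrC -eZ.
  apply: (le_trans (ler_normB _ _)).
  have h1 := small _ (leqnSn N); have h2 := small _ (leqnn N).
  have h3 : `|mu * z N| <= mu * (ep * (C * lam ^+ N)).
    by rewrite normrM (gtr0_norm mu0) ler_pM2l.
  apply: (le_trans (lerD h1 h3)); rewrite exprS.
  have -> : ep * (C * (lam * lam ^+ N)) + mu * (ep * (C * lam ^+ N)) = ep * (C * D) * lam ^+ N.
    by rewrite -lD; ring.
  by rewrite (_ : ep * (C * D) = `|Z| / 2) // /ep; field; rewrite !gt_eqF.
by rewrite ler_pM2r //; lra.
Qed.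

End DominantSolution.

Section Irrational.
Variables (R : realType) (d : nat).
Hypothesis d2 : (2 < d)%N.

Let S : R := Num.sqrt (d%:R ^+ 2 - 4).

Lemma sqrt_sq : S ^+ 2 = d%:R ^+ 2 - 4.
Proof.
have h : (3 : R) <= d%:R by rewrite (ler_nat R 3 d).
by rewrite sqr_sqrtr //; nra.
Qed.

(** d ^ 2 - 4 lies strictly between the squares of d - 1 and d. *)
Lemma rat_sq_absurd (z : rat) : z ^+ 2 = d%:R ^+ 2 - 4 -> False.
Proof.
move=> hz; have zE : z * (denq z)%:~R = (numq z)%:~R by rewrite numqE.
have e : numq z ^+ 2 = (d%:Z ^+ 2 - 4) * denq z ^+ 2.
  apply: (@intr_inj rat); rewrite rmorphXn rmorphM rmorphXn rmorphB rmorphXn /= -zE exprMn hz.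
  by rewrite -pmulrn.
pose n := absz (numq z); pose m := absz (denq z).
have e' : (n ^ 2 = (d ^ 2 - 4) * m ^ 2)%N.
  have := congr1 absz e; rewrite abszX abszM abszX -/n -/m => ->; congr (_ * _)%N.
  have h4 : (4 <= d ^ 2)%N by rewrite -[4%N]/(2 ^ 2)%N leq_exp2r // ltnW.
  by rewrite (_ : d%:Z ^+ 2 - 4 = ((d ^ 2 - 4)%N)%:Z) // -subzn // -mulnn PoszM expr2.
have cop : coprime (n ^ 2) m by rewrite coprimeXl // coprime_num_den.
have m1 : m = 1%N.
  have /gcdn_idPr : (m %| n ^ 2)%N by rewrite e' expnS mulnCA dvdn_mulr.
  by move: cop; rewrite /coprime => /eqP ->.
rewrite m1 exp1n muln1 -!mulnn in e'.
have [dn|nd] := leqP d n; first by have := leq_mul dn dn; rewrite e'; nia.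
have nd' : (n <= d.-1)%N by lia.
have := leq_mul nd' nd'; rewrite e'; case: d d2 => // c c2 /=; nia.
Qed.

Lemma sqrt_indep (a b : rat) : ratr a + ratr b * S = 0 -> a = 0 /\ b = 0.
Proof.
have [-> |b0] := eqVneq b 0.
  by rewrite rmorph0 mul0r addr0 => /eqP; rewrite fmorph_eq0 => /eqP.
move=> h; exfalso; apply: (@rat_sq_absurd (- a / b)).
have rb0 : ratr b != 0 :> R by rewrite fmorph_eq0.
have SE : S = ratr (- a / b).
  rewrite fmorph_div rmorphN; apply: (mulIf rb0); rewrite divfK // mulrC.
  by apply/eqP; rewrite -subr_eq0 opprK addrC h.
apply: (fmorph_inj (@ratr R)); rewrite [LHS]rmorphXn /= -SE sqrt_sq rmorphB /= [ratr (_ ^+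
  2)]rmorphXn /=.
by rewrite !ratr_nat.
Qed.

(** The vanishing of the dominant component is a relation over Q(S), where S is
    the square root of d ^ 2 - 4. As S is irrational it amounts to two rational
    relations, and the unknown rational part q of the limit is eliminated
    between them. *)
Lemma limit_relation (r e : nat -> int) (q : rat) :
  (forall n, r n.+2 = d%:Z * r n.+1 - r n) -> (forall n, e n.+2 = d%:Z * e n.+1 - e n) ->
  (forall n, 0 < r n) ->
  (fun n => (e n)%:~R / (r n)%:~R) @ \oo --> (ratr q - d%:R / (2 * (d%:R - 2)) * S : R) ->
  (r 1%N * e 0%N - r 0%N * e 1%N) * (d%:Z - 2) = d%:Z * norm_form d (r 1%N) (r 0%N).
Proof.
move=> hr he r0 cv.
have d3 : (3 : R) <= d%:R by rewrite (ler_nat R 3 d).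
have S2 := sqrt_sq.
have S1 : 1 <= S by rewrite -(@ler_pXn2r _ 2) ?nnegrE ?sqrtr_ge0 // expr1n S2; nra.
have Sd : S < d%:R by rewrite -(@ltr_pXn2r _ 2) ?nnegrE ?sqrtr_ge0 ?ler0n // S2; lra.
pose lam := (d%:R + S) / 2; pose mu := (d%:R - S) / 2.
have e1 : lam * mu = 1.
  have -> : lam * mu = (d%:R ^+ 2 - S ^+ 2) / 4 by rewrite /lam /mu; field.
  by rewrite S2; field.
have e2 : lam + mu = d%:R by rewrite /lam /mu; field.
have e3 : 1 <= lam - mu by rewrite (_ : lam - mu = S) // /lam /mu; field.
have e4 : 0 < mu by rewrite /mu; lra.
have rec (u : nat -> int) : (forall n, u n.+2 = d%:Z * u n.+1 - u n) -> recurrentR (d%:R :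
  R) (fun n => (u n)%:~R).
  by move=> hu n; rewrite hu rmorphB rmorphM.
have r0R n : 0 < (r n)%:~R :> R by rewrite ltr0z.
have key := dominant_vanish e1 e2 e3 e4 (rec _ hr) (rec _ he) r0R cv.
(* the two coordinates of the relation over the basis 1, S, with denominators cleared *)
pose DD : rat := d%:R; pose x0 : rat := (r 0%N)%:~R; pose x1 : rat := (r 1%N)%:~R.
pose y0 : rat := (e 0%N)%:~R; pose y1 : rat := (e 1%N)%:~R; pose c2 := 2 * DD - 4.
pose A := 2 * c2 * y1 - 2 * c2 * q * x1 - c2 * DD * (y0 - q * x0) + DD * (DD * DD - 4) * x0.
pose B := 2 * DD * x1 - DD * DD * x0 + c2 * (y0 - q * x0).
have [A0 B0] : A = 0 /\ B = 0.
  apply: sqrt_indep.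
  rewrite /A /B /c2 !(rmorphB, rmorphD, rmorphM) /= !ratr_nat !ratr_int.
  move/eqP: key; rewrite -subr_eq0 => /eqP key.
  have d20 : (d%:R - 2 : R) != 0 by rewrite gt_eqF //; lra.
  apply: (mulfI (x := (4 * (d%:R - 2))^-1)); first by rewrite invr_eq0 mulf_neq0 // pnatr_eq0.
  rewrite mulr0 -[RHS]key /mu.
  have SS : S * S = d%:R ^+ 2 - 4 by rewrite -S2 expr2.
  rewrite rmorph1 (_ : d%:R * d%:R - (1 + (1 + (1 + 1))) = S * S); last by rewrite SS expr2.
  by field.
apply: (@intr_inj rat); rewrite /norm_form !(rmorphB, rmorphD, rmorphM, rmorphXn) /=.
rewrite -/x0 -/x1 -/y0 -/y1 -[d%:~R]/DD.
apply: (mulfI (x := 4)) => //.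
apply/eqP; rewrite -subr_eq0; apply/eqP.
have -> : 0 = B * (2 * x1 - DD * x0) - A * x0 by rewrite A0 B0 !mul0r subrr.
rewrite /A /B /c2; ring.
Qed.
End Irrational.

(** * Helices *)

Section Helix.
Variables (k : closedFieldType) (X : elliptic_curve k).
Context {ch : char0 k}.
Variables (R : realType) (d : nat).
Hypothesis d2 : (2 < d)%N.

(** Without a degree function all slopes are zero by definition, and so is their
    limit. *)
Lemma is_degree_slope (E : int -> coh X) (th : R) : th != 0 -> negative_limit_slope E th ->
  is_degree (@coh_degree k X).
Proof.
move=> th0; rewrite /negative_limit_slope.
have [h|nh] := pselect (exists dg : coh X -> int, is_degree dg).
  by move=> _; rewrite /coh_degree; case: pselect => // h'; case: cid.
have e : @coh_degree k X = fun=> 0 by rewrite /coh_degree; case: pselect.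
have -> : (fun n : nat => slope R (E (- n%:Z))) = (fun=> 0).
  by apply/funext => n; rewrite /slope e mul0r.
move=> cv; exfalso; move/negP: th0; apply; apply/eqP.
by apply: (cvg_unique _ cv (cvg_cst 0)).
Qed.

Lemma irrational_neq0 (q : rat) :
  ratr q - d%:R / (2 * (d%:R - 2)) * Num.sqrt (d%:R ^+ 2 - 4) != 0 :> R.
Proof.
apply/eqP => h.
have [_ b0] : q = 0 /\ - (d%:R / (2 * (d%:R - 2))) = 0 :> rat.
  apply: (sqrt_indep (R := R) d2); rewrite rmorphN fmorph_div rmorphM rmorphB /= !ratr_nat mulNr.
  exact: h.
move/eqP: b0; rewrite oppr_eq0 mulf_eq0 invr_eq0 mulf_eq0 !pnatr_eq0 /= subr_eq0 eqr_nat.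
by case: d d2 => [|[|[|]]].
Qed.

Lemma common_annihilator (E : coh X) (U : aopen X) n (v : 'I_n -> E U) :
  (forall a, exists2 b : regfun U, b != 0 & b *: v a = 0) ->
  exists2 b : regfun U, b != 0 & forall a, b *: v a = 0.
Proof.
move=> h; suff H (s : seq 'I_n) : exists2 b : regfun U, b != 0 & forall a, a \in s -> b *: v a = 0.
  by have [b b0 hb] := H (enum 'I_n); exists b => // a; apply: hb; rewrite mem_enum.
elim: s => [|a s [b b0 hb]]; first by exists 1 => //; rewrite oner_neq0.
have [b' b0' hb'] := h a; exists (b * b'); first exact: regfun_mulf_neq0.
move=> a'; rewrite in_cons => /orP[/eqP ->|/hb e]; first by rewrite -scalerA hb' scaler0.
by rewrite mulrC -scalerA e scaler0.
Qed.

(** G embeds in a power of E. *)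
Lemma nontorsion_up (E F G : coh X) : is_left_mutation E F G -> nontorsion G -> nontorsion E.
Proof.
move=> [n [f [j [_ _ ij _]]]] [U [s hs]]; apply: contrapT => nE.
have [b b0 hb] : exists2 b : regfun U, b != 0 & forall a, b *: (j U s) a = 0.
  apply: common_annihilator => a; apply: contrapT => h; apply: nE; exists U, (j U s a) => b hb.
  by apply: contrapT => /eqP b0; apply: h; exists b.
have /hs /eqP : b *: s = 0; last by rewrite (negbTE b0).
by apply: ij; rewrite linear0 linearZ; apply/ffunP => a; rewrite !ffunE.
Qed.

(** A sheaf of rank zero has slope zero by definition, so far to the left all terms
    have positive rank; mutations carry this to the right. *)
Lemma helix_nontorsion (E : int -> coh X) (th : R) : th != 0 -> negative_limit_slope E th ->
  two_periodic_elliptic_helix E -> forall i, nontorsion (E i).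
Proof.
move=> th0 cv [_ _ mut].
have ath : 0 < `|th| by rewrite normr_gt0.
have [N _ hN] := (cvgrPdist_lt _ _).1 cv _ ath.
have low (n : nat) : (N <= n)%N -> nontorsion (E (- n%:Z)).
  move=> Nn; apply: rank_nontorsion => r0; have := hN n Nn => /=.
  by rewrite /slope r0 invr0 mulr0 subr0 ltxx.
have up i : nontorsion (E i) -> nontorsion (E (i + 1)).
  have [_ hm] := mut (i + 2).
  rewrite (_ : i + 2 - 1 = i + 1) in hm; last by ring.
  rewrite (_ : i + 2 - 2 = i) in hm; last by ring.
  exact: nontorsion_up hm.
move=> i; pose n := (N + absz i)%N.
suff H (m : nat) : nontorsion (E (- n%:Z + m%:Z)).
  by have := H (absz (i + n%:Z)); rewrite (_ : - n%:Z + _ = i) // /n; lia.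
elim: m => [|m IH]; first by rewrite addr0; apply: low; rewrite leq_addr.
by rewrite -addn1 PoszD addrA; exact: up.
Qed.

Definition rk (E : int -> coh X) i : int := (coh_rank (E i))%:Z.
Definition dgr (E : int -> coh X) i : int := coh_degree (E i).

(** All terms are bundles. The mutation sequences give the recurrences, and
    Riemann-Roch applies to consecutive terms as Ext ^ 1 vanishes. *)
Theorem helix_data (E : int -> coh X) (th : R) : th != 0 -> negative_limit_slope E th ->
  two_periodic_elliptic_helix E -> (forall i : int, hom_dim (E i) (E (i + 1)) d) ->
  [/\ forall i, 0 < rk E i, recurrent d (rk E), recurrent d (dgr E),
      forall i, rk E i * dgr E (i + 1) - rk E (i + 1) * dgr E i = d%:Z &
      forall i, exists n (D : mdiv X n) (f : coh_hom (E i) (LL D)) (g : coh_hom (LL D) (E i)),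
        iso_LL f g].
Proof.
move=> th0 cv hE hd; have nt := helix_nontorsion th0 cv hE.
have dgP := is_degree_slope th0 cv; case: hE => exc ext mut.
have iso i : exists n (D : mdiv X n) (f : coh_hom (E i) (LL D)) (g : coh_hom (LL D) (E i)),
  iso_LL f g.
  by apply/torsion_free_iso/end_torsion_free => //; case: (exc i).
have rkE i n (D : mdiv X n) (f : coh_hom (E i) (LL D)) (g : coh_hom (LL D) (E i)) :
  iso_LL f g -> rk E i = n%:Z.
  by move=> h; rewrite /rk (coh_rankE (r := n)) // => U; exact: iso_rank h.
have hd' i : hom_dim (E (i - 1)) (E i) d by have := hd (i - 1); rewrite subrK.
have exact_i i : exists (f : coh_hom (E (i - 2)) (pow (E (i - 1)) d)) (q :
  coh_hom (pow (E (i - 1)) d) (E i)),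
    short_exact f q.
  have [[_ [n' [f' [_ sf']]]] [n [f [j [bf rj ij kj]]]]] := mut i.
  have [n1 [D1 [f1 [g1 h1]]]] := iso (i - 1); have [n2 [D2 [f2 [g2 h2]]]] := iso i.
  have nd : n = d.
    apply: kdim_uniq (hom_dim_h0 h1 h2 (hd' i)); apply: (hom_dim_h0 h1 h2).
    by exists f.
  rewrite nd in f j bf rj ij kj; exact: (mutation_exact bf sf' rj ij kj).
split=> //.
- move=> i; have [n [D [f [g h]]]] := iso i; rewrite (rkE _ _ _ _ _ h).
  case: n D f g h => // D f g h; have [U [s hs]] := nt i.
  have s0 : s = 0 by apply: (iso_inj h); apply: lval_inj; exact: zero_rv.
  have : (1 : regfun U) = 0 by apply: hs; rewrite s0 scaler0.
  by move/eqP; rewrite oner_eq0.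
- move=> i; have [f [q ex]] := exact_i i.
  have [n0 [D0 [f0 [g0 h0]]]] := iso (i - 2).
  have [n1 [D1 [f1 [g1 h1]]]] := iso (i - 1); have [n2 [D2 [f2 [g2 h2]]]] := iso i.
  rewrite (rkE _ _ _ _ _ h0) (rkE _ _ _ _ _ h1) (rkE _ _ _ _ _ h2).
  have e : (n0 + n2 = d * n1)%N.
    apply: (@rank_on_uniq k X ch _ (off Infinity));
      first exact: rank_exact ex (iso_rank _ h0) (iso_rank _ h2).
    exact: rank_pow (iso_rank _ h1).
  by rewrite -PoszM -e PoszD addrK.
- move=> i; have [f [q ex]] := exact_i i.
  have [_ _ add] := dgP; have := add _ _ _ _ _ ex; rewrite /dgr (dg_pow _ _ dgP) => ->.
  by rewrite addrK.
move=> i; have [n1 [D1 [f1 [g1 h1]]]] := iso i; have [n2 [D2 [f2 [g2 h2]]]] := iso (i + 1).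
rewrite (rkE _ _ _ _ _ h1) (rkE _ _ _ _ _ h2).
symmetry; apply: (riemann_roch_ext dgP h1 h2 _ (hd i)).
by apply: ext; rewrite ltrDl.
Qed.

(** The limit slope and the determinant relation together give the quadratic
    equation for consecutive ranks. *)
Lemma helix_unit_index (E : int -> coh X) (q : rat) :
  negative_limit_slope E (ratr q - d%:R / (2 * (d%:R - 2)) * Num.sqrt (d%:R ^+ 2 - 4) : R) ->
  two_periodic_elliptic_helix E -> (forall i : int, hom_dim (E i) (E (i + 1)) d) ->
  exists j, rk E j = 1 /\ rk E (j + 1) = 1.
Proof.
move=> cv hE hd; have [r0 rr re det _] := helix_data (irrational_neq0 q) cv hE hd.
apply: (recurrent_unit d2 rr r0).
have rev (u : int -> int) : recurrent d u -> forall n : nat,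
  u (- n.+2%:Z) = d%:Z * u (- n.+1%:Z) - u (- n%:Z).
  move=> hu n; have h := hu (- n%:Z).
  by rewrite -addn2 -[n.+1]addn1 !PoszD !opprD.
have := limit_relation d2 (rev _ rr) (rev _ re) (fun n => r0 _) cv.
have := det (-1); rewrite addNr oppr0 => ->.
have dd : d%:Z != 0 by rewrite eqz_nat -lt0n ltnW // ltnW.
by move=> e; apply: (mulfI dd); rewrite -e.
Qed.

Lemma twisted_helix (E : int -> coh X) (m l : int) (dgP : is_degree (@coh_degree k X)) :
  (forall i, exists n (D : mdiv X n) (f : coh_hom (E i) (LL D)) (g : coh_hom (LL D) (E i)),
    iso_LL f g) ->
  exists T : int -> coh X, forall i, [/\ is_tensor (LL (twisting X l)) (E (i + m)) (T i),
    rk T i = rk E (i + m) & dgr T i = dgr E (i + m) + l * rk E (i + m)].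
Proof.
move=> iso.
have H i : exists T : coh X, [/\ is_tensor (LL (twisting X l)) (E (i + m)) T,
    (coh_rank T)%:Z = rk E (i + m) & coh_degree T = dgr E (i + m) + l * rk E (i + m)].
  have [n [D [f [g h]]]] := iso (i + m).
  have rkn : rk E (i + m) = n%:Z by rewrite /rk (coh_rankE (r := n)) // => U; exact: iso_rank h.
  exists (LL (twist D l)); split; first exact: tensor_twist h.
    rewrite rkn (coh_rankE (r := n)) // => U.
    have [id hid] := id_hom (LL (twist D l)).
    by apply: (@iso_rank k X ch _ _ _ id id); split=> V s; rewrite !hid.
  by rewrite rkn (dg_twist _ _ dgP) /dgr (dg_iso_LL h dgP).
by exists (fun i => projT1 (cid (H i))) => i; rewrite /rk /dgr; case: cid.
Qed.

End Helix.

Theorem proposition6p6 (k : closedFieldType) (hk : [pchar k] =i pred0)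
    (X : elliptic_curve k) (R : realType) (d : nat) (hd : (2 < d)%N) :
  (forall rm1 r0 dm1 d0 : int,
     0 < rm1 -> 0 < r0 ->
     gcdz rm1 dm1 = 1 -> gcdz r0 d0 = 1 ->
     d%:Z * rm1 * r0 - rm1 ^+ 2 - r0 ^+ 2 = d%:Z - 2 ->
     d%:Z = \det (mx2 rm1 dm1 r0 d0) ->
     exists n : int, col2 rm1 r0 = mx2 0 1 (-1) d%:Z ^ n *m col2 1 1)
  /\
  (forall E F : int -> coh X,
     two_periodic_elliptic_helix E -> two_periodic_elliptic_helix F ->
     (forall i : int, hom_dim (E i) (E (i + 1)) d) ->
     (forall i : int, hom_dim (F i) (F (i + 1)) d) ->
     (exists q : rat, negative_limit_slope E
        (ratr q - d%:R / (2 * (d%:R - 2)) * Num.sqrt (d%:R ^+ 2 - 4) : R)) ->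
     (exists q : rat, negative_limit_slope F
        (ratr q - d%:R / (2 * (d%:R - 2)) * Num.sqrt (d%:R ^+ 2 - 4) : R)) ->
     same_numerical_class E F).
Proof.
have ch : char0 k := hk.
split=> [rm1 r0 dm1 d0 hrm1 hr0 _ _ hQ _|E F hE hF hdE hdF [qE cE] [qF cF]].
  exact: orbit.
have [posE recE degE detE isoE] := helix_data hd (irrational_neq0 R hd qE) cE hE hdE.
have [posF recF degF detF _] := helix_data hd (irrational_neq0 R hd qF) cF hF hdF.
have [a [a0 a1]] := helix_unit_index hd cE hE hdE.
have [b [b0 b1]] := helix_unit_index hd cF hF hdF.
have dgP := is_degree_slope (irrational_neq0 R hd qE) cE.
(* the shift makes the ranks agree, the twist the degrees at one position *)
pose l := dgr F b - dgr E a.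
have [T hT] := twisted_helix (a - b) l dgP isoE.
exists (a - b), (LL (twisting X l)), T; split.
- exact: line_bundle_twisting.
- by move=> i; have [] := hT i.
have rkT : forall i, rk T i = rk F i.
  move=> i; have [_ -> _] := hT i; move: i.
  apply: (@recurrent_eq d (fun i => rk E (i + (a - b))) (rk F) b) => //.
  - exact: (recurrent_shift (a - b) recE).
  - by rewrite addrC subrK a0 b0.
  - by rewrite (_ : b + 1 + (a - b) = a + 1) ?a1 ?b1 //; ring.
have dgT : forall i, dgr T i = dgr F i.
  move=> i; have [_ _ ->] := hT i; move: i.
  apply: (@recurrent_eq d (fun i => dgr E (i + (a - b)) + l * rk E (i + (a - b))) _ b) => //.
  - move=> i; have := recurrent_shift (a - b) degE i; have := recurrent_shift (a - b) recE i.
    by move=> -> ->; ring.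
  - by rewrite [b + _]addrC subrK a0 /l; ring.
  rewrite (_ : b + 1 + (a - b) = a + 1); last by ring.
  by have := detE a; have := detF b; rewrite a0 a1 b0 b1 /l; lia.
move=> i; split; last exact: dgT.
by have := rkT i; rewrite /rk => -[].
Qed.
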